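(* Let $k\ge 1$, $l_0,l_1,\dots,l_k$ and $m_1,\dots,m_k$ be non-negative integers with $l_0>0$, $l_i\ge m_i$ for all $1\le i\le k$, and $l'>m'>0$, where $l'=\sum_{i=1}^k l_i$ and $m'=\sum_{i=1}^k m_i$. For a meromorphic function $f$ put $$P[f]=f^{l_0}(f^{l_1})^{(m_1)}(f^{l_2})^{(m_2)}\cdots (f^{l_k})^{(m_k)}.$$ Let $f$ be a transcendental meromorphic function on $\mathbb{C}$. Then for any small function $\omega\not\equiv 0,\infty$ of $f$, the function $P[f]-\omega$ has infinitely many zeros.
   Context: A meromorphic function $\omega$ is a small function of $f$ if $T(r,\omega)=o(T(r,f))$ as $r\to\infty$, possibly outside a set of $r$ of finite linear measure, where $T$ is the Nevanlinna characteristic. *)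

(* Defs.v *)
From HB Require Import structures.
From mathcomp Require Import all_boot all_order all_algebra.
From mathcomp Require Import all_classical all_reals all_analysis.
From mathcomp Require Import complex.
Import Order.TTheory GRing.Theory Num.Theory.
Import numFieldNormedType.Exports.

Set Implicit Arguments.
Unset Strict Implicit.
Unset Printing Implicit Defensive.

Local Open Scope classical_set_scope.
Local Open Scope ring_scope.

Section Nevanlinna.
Variable R : realType.

(* The complex plane, viewed as a numFieldType (hence a normed space over
   itself, with its usual topology). *)
Definition CC : numFieldType := R[i].

Definition modC (z : CC) : R :=
  Num.sqrt (complex.Re z ^+ 2 + complex.Im z ^+ 2).

Definition logp (x : R) : R := if x <= 1 then 0 else ln x.

Definition is_pole (f : CC -> CC) (a : CC) : Prop :=
  (fun w => modC (f w)) @ a^' --> +oo.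

(* Meromorphic on C: the poles form a locally finite set, and f is
   complex-differentiable at every point that is not a pole (values of f at
   poles are irrelevant). *)
Definition meromorphic (f : CC -> CC) : Prop :=
  (forall a, ~ is_pole f a -> derivable f a 1) /\
  (forall a : CC, exists2 r : R, 0 < r &
     finite_set [set z | is_pole f z /\ modC (z - a) < r]).

Definition pole_bounded (f : CC -> CC) (a : CC) (n : nat) : Prop :=
  exists M : R, \forall w \near a^', modC ((w - a) ^+ n * f w) <= M.

Definition pole_mult (f : CC -> CC) (a : CC) : nat :=
  if `[< is_pole f a >] then
    xget 0%N [set n | pole_bounded f a n /\
                      forall p, pole_bounded f a p -> (n <= p)%N]
  else 0%N.

Definition npoles (f : CC -> CC) (t : R) : nat :=
  let A := [set z | is_pole f z /\ modC z <= t] in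
  \big[addn/0%N]_(a \in A) pole_mult f a.

Definition Ncount (f : CC -> CC) (r : R) : R :=
  Rintegral lebesgue_measure `]0, r]
      (fun t => ((npoles f t)%:R - (npoles f 0)%:R) / t)
  + (npoles f 0)%:R * ln r.

Definition mprox (f : CC -> CC) (r : R) : R :=
  (2 * pi)^-1 *
  Rintegral lebesgue_measure `[0, 2 * pi]
      (fun t => logp (modC (f (Complex (r * cos t) (r * sin t))))).

Definition Tchar (f : CC -> CC) (r : R) : R := mprox f r + Ncount f r.

Definition rational_fun (f : CC -> CC) : Prop :=
  exists p q : {poly R[i]}, q != 0 /\
    forall z : CC, ~ is_pole f z -> q.[z] != 0 -> f z = p.[z] / q.[z].

Definition transcendental (f : CC -> CC) : Prop :=
  meromorphic f /\ ~ rational_fun f.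

Definition small_function (omega f : CC -> CC) : Prop :=
  meromorphic omega /\
  exists E : set R, measurable E /\ (lebesgue_measure E < +oo)%E /\
    forall eps : R, 0 < eps -> exists r0 : R,
      forall r : R, r0 < r -> ~ E r -> Tchar omega r <= eps * Tchar f r.

(* omega is not identically zero (being meromorphic, it is never
   identically infinite) *)
Definition not_ident_zero (omega : CC -> CC) : Prop :=
  exists z : CC, ~ is_pole omega z /\ omega z != 0.

Definition Pdiff (k : nat) (l0 : nat) (l m : 'I_k -> nat) (f : CC -> CC)
  : CC -> CC :=
  fun z => f z ^+ l0 * \prod_(i < k) derive1n (m i) (fun w : CC => f w ^+ l i) z.

(* a is a zero of the meromorphic function g: g(w) -> 0 as w -> a, w <> a
   (this also handles removable singularities of g) *)
Definition zeros (g : CC -> CC) : set CC := [set a | g w @[w --> a^'] --> 0].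

End Nevanlinna.

(* Main.v *)
(* Write P for the differential monomial, d for its degree, m' for the total number of
   derivatives, h = P / omega - 1, and suppose that P - omega has only finitely many
   zeros. From 1 / (h + 1) = 1 - (h / h') (h' / (h + 1)), the first main theorem and the lemma
   on the logarithmic derivative one gets
     d T(r, f) <= Nbar(r, f) + (m' + 1) Nbar(r, 1 / f) + o(T(r, f)),
   which is absurd unless d = m' + 2. In that case equality forces almost all zeros and poles
   of f to be simple, phi = h' / (h f) is a small function, and comparing Laurent coefficients
   at the simple poles shows that f satisfies a Riccati equation f' = A f^2 + B f + C with
   small coefficients. Then h = Q(f) for a polynomial Q of degree n = 2 m' + 2 over the field
   of small functions, and h' = n A f h becomes an identity between polynomials. The
   invariant of Q built from its Hessian is constant, so Q is, up to scaling, a numerical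
   solution of Q' (a X^2 + b X + c) = n a X Q. Such a Q has exactly two roots, of
   multiplicities p and q, and |Q_n|^2 |c / a|^n = (p / q)^(q - p) <= 1, whereas the explicit
   coefficients of the differential monomial make the left-hand side greater than 1. *)

Require Import Defs.
From HB Require Import structures.
From mathcomp Require Import all_boot all_order all_algebra.
From mathcomp Require Import all_classical all_reals all_analysis.
From mathcomp Require Import complex.
From mathcomp Require Import ring lra zify.
Import Order.TTheory GRing.Theory Num.Theory.
Import numFieldNormedType.Exports.

Set Implicit Arguments.
Unset Strict Implicit.
Unset Printing Implicit Defensive.

Local Open Scope classical_set_scope.
Local Open Scope ring_scope.

(** * Complex analysis on discs *)

(** Since l0 >= 1 and l' >= m' + 1, the degree d is at least m' + 2. Truncated counting functions
    are at most T, so the inequality settles everything but l0 = 1, l' = m' + 1. What remains is to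
    exploit the equality it forces there. At a simple pole, h' = phi f h fixes the first two Laurent
    coefficients of f in terms of phi and omega, which makes f' - A f^2 - B f regular at that pole.
    Small functions form a differential field over which f is transcendental, so identities at f
    become identities between polynomials.

    The final clash is between two evaluations of |Q_n| |c / a|^(m' + 1). The roots of Q give at
    most 1. The coefficient of X in the equation gives (m' + 1) koo / k0, where koo and k0 are
    products of rising and of falling factorials; hence koo >= k0, and m' > 0 makes the value exceed
    1.

    Meromorphic functions are elements of a differential field, obtained by fixing their values at
    isolated singularities. Orders, and evaluation at regular points, take the place of Laurent
    series. *)

Section ComplexBasics.
Variable R : realType.
Local Notation C := (CC R).
Implicit Types (z w : C) (x y r : R).

Lemma normCE z : `|z| = (modC z)%:C%C :> C.
Proof. exact: normc_def. Qed.

Lemma modC_def z : modC z = complex.Re `|z|.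
Proof. by rewrite normCE. Qed.

Lemma modC_ge0 z : 0 <= modC z.
Proof. exact: sqrtr_ge0. Qed.

Lemma modCM z w : modC (z * w) = modC z * modC w.
Proof. by rewrite !modC_def normrM !normCE -rmorphM. Qed.

Lemma modC0 : modC (0 : C) = 0.
Proof. by rewrite modC_def normr0. Qed.

Lemma modC1 : modC (1 : C) = 1.
Proof. by rewrite modC_def normr1. Qed.

Lemma modCV z : modC z^-1 = (modC z)^-1.
Proof. by rewrite !modC_def normfV normCE -fmorphV. Qed.

Lemma modCX z n : modC (z ^+ n) = modC z ^+ n.
Proof. by elim: n => [|n ih]; rewrite ?expr0 ?modC1// !exprS modCM ih. Qed.

Lemma modCN z : modC (- z) = modC z.
Proof. by rewrite !modC_def normrN. Qed.

Lemma modCD z w : modC (z + w) <= modC z + modC w.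
Proof.
have : `|z + w| <= `|z| + `|w| :> C by exact: ler_normD.
by rewrite !normCE -rmorphD lecR.
Qed.

Lemma modCB z w : modC (z - w) = modC (w - z).
Proof. by rewrite -modCN opprB. Qed.

Lemma modC_eq0 z : (modC z == 0) = (z == 0).
Proof.
apply/eqP/eqP => [h|->]; last exact: modC0.
by apply/eqP; rewrite -normr_eq0 normCE h.
Qed.

Lemma modC_gt0 z : (0 < modC z) = (z != 0).
Proof. by rewrite lt_neqAle modC_ge0 andbT eq_sym modC_eq0. Qed.

Lemma modC_triB z w : modC z - modC w <= modC (z - w).
Proof. by have := modCD (z - w) w; rewrite subrK; lra. Qed.

Lemma modC_tri z w v : modC (z - w) <= modC (z - v) + modC (v - w).
Proof. by have := modCD (z - v) (v - w); rewrite addrA subrK. Qed.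

Lemma ReM_le z : `|complex.Re z| <= modC z.
Proof.
rewrite /modC -[X in X <= _]sqrtr_sqr.
by rewrite ler_sqrt ?addr_ge0 ?sqr_ge0// lerDl sqr_ge0.
Qed.

Lemma ImM_le z : `|complex.Im z| <= modC z.
Proof.
rewrite /modC -[X in X <= _]sqrtr_sqr.
by rewrite ler_sqrt ?addr_ge0 ?sqr_ge0// lerDr sqr_ge0.
Qed.

Lemma modC_le_ReIm z : modC z <= `|complex.Re z| + `|complex.Im z|.
Proof.
have h : 0 <= `|complex.Re z| + `|complex.Im z| by rewrite addr_ge0.
rewrite -(@ler_pXn2r _ 2)// ?nnegrE ?modC_ge0//.
rewrite /modC sqr_sqrtr ?addr_ge0 ?sqr_ge0// sqrrD !real_normK ?num_real// lerD2r.
by rewrite lerDl mulrn_wge0 ?mulr_ge0.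
Qed.

Lemma modC_sqr z : modC z ^+ 2 = complex.Re z ^+ 2 + complex.Im z ^+ 2.
Proof. by rewrite /modC sqr_sqrtr// addr_ge0// sqr_ge0. Qed.

Definition toC (x : R) : C := Complex x 0.

Lemma modC_toC x : modC (toC x) = `|x|.
Proof. by rewrite /modC /= expr0n addr0 sqrtr_sqr. Qed.

Lemma modC_nat n : modC (n%:R : C) = n%:R.
Proof.
have -> : (n%:R : C) = toC n%:R by rewrite /toC; exact: (esym (rmorph_nat (real_complex R) n)).
by rewrite modC_toC ger0_norm.
Qed.

(** In the order of [R[i]] a positive radius has imaginary part zero, so complex balls can be
    re-indexed by real radii. All later estimates are made in [R]. *)
Lemma nbhsC z (P : set C) :
  nbhs z P <-> exists2 d : R, 0 < d & forall w, modC (w - z) < d -> P w.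
Proof.
split.
  move/nbhs_ballP => [e e0 he]; rewrite /= in e0.
  move: e e0 he => [a b]; rewrite ltcE /= => /andP[/eqP -> a0] he.
  exists a => // w hw; apply: he; rewrite /ball /= distrC normCE.
  by rewrite (ltcR (modC (w - z)) a).
move=> [d d0 h]; apply/nbhs_ballP; exists (toC d).
  by rewrite /= (ltcR 0 d).
move=> w; rewrite /ball /= distrC normCE => hw; apply: h.
by move: hw; rewrite (ltcR (modC (w - z)) d).
Qed.

Lemma dnbhsC z (P : set C) :
  (\forall w \near z^', P w) <->
  exists2 d : R, 0 < d & forall w, modC (w - z) < d -> w != z -> P w.
Proof.
rewrite /dnbhs /within /=; exact: nbhsC.
Qed.

Lemma ccontP (f : C -> C) z : {for z, continuous f} <->
  forall e : R, 0 < e -> exists2 d : R, 0 < d &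
    forall w, modC (w - z) < d -> modC (f w - f z) < e.
Proof.
split=> [h e e0|h].
  have : nbhs (f z) [set w | modC (w - f z) < e] by apply/nbhsC; exists e.
  by move/h => /nbhsC.
move=> A /nbhsC[e e0 he]; have [d d0 hd] := h e e0.
by apply/nbhsC; exists d => // w /hd /he.
Qed.

Lemma rcontP (u : C -> R) z : {for z, continuous u} <->
  forall e : R, 0 < e -> exists2 d : R, 0 < d &
    forall w, modC (w - z) < d -> `|u w - u z| < e.
Proof.
split=> [h e e0|h].
  have : nbhs (u z) [set w | `|w - u z| < e].
    by apply/nbhs_ballP; exists e => // y; rewrite /ball/= distrC.
  by move/h => /nbhsC.
move=> A /nbhs_ballP[e e0 he]; have [d d0 hd] := h e e0.
apply/nbhsC; exists d => // w /hd hw; apply: he.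
by rewrite /ball/= distrC.
Qed.

Lemma pcontP (v : R -> C) t : {for t, continuous v} <->
  forall e : R, 0 < e -> exists2 d : R, 0 < d &
    forall s, `|s - t| < d -> modC (v s - v t) < e.
Proof.
split=> [h e e0|h].
  have : nbhs (v t) [set w | modC (w - v t) < e] by apply/nbhsC; exists e.
  move/h => /nbhs_ballP[d d0 hd]; exists d => // s hs; apply: hd.
  by rewrite /ball/= distrC.
move=> A /nbhsC[e e0 he]; have [d d0 hd] := h e e0.
apply/nbhs_ballP; exists d => // s; rewrite /ball/= distrC => /hd; exact: he.
Qed.

Lemma cont_Re : continuous (@complex.Re R : C -> R).
Proof.
move=> z; apply/rcontP => e e0; exists e => // w; apply: le_lt_trans.
by have := ReM_le (w - z); case: w z => [? ?] [? ?].
Qed.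

Lemma cont_Im : continuous (@complex.Im R : C -> R).
Proof.
move=> z; apply/rcontP => e e0; exists e => // w; apply: le_lt_trans.
by have := ImM_le (w - z); case: w z => [? ?] [? ?].
Qed.

Lemma cont_modC : continuous (@modC R : C -> R).
Proof.
move=> z; apply/rcontP => e e0; exists e => // w; apply: le_lt_trans.
have := modC_triB w z; have := modC_triB z w; rewrite (modCB z w) => h1 h2.
by rewrite ler_norml; apply/andP; split; lra.
Qed.

Lemma cont_Complex (T : topologicalType) (a b : T -> R) (t : T) :
  {for t, continuous a} -> {for t, continuous b} ->
  {for t, continuous (fun s => Complex (a s) (b s) : C)}.
Proof.
move=> ca cb A /nbhsC[e e0 he].
have e2 : 0 < e / 2 by rewrite divr_gt0.
have na : nbhs (a t) [set x | `|x - a t| < e / 2].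
  by apply/nbhs_ballP; exists (e / 2) => // y; rewrite /ball/= distrC.
have nb : nbhs (b t) [set x | `|x - b t| < e / 2].
  by apply/nbhs_ballP; exists (e / 2) => // y; rewrite /ball/= distrC.
have na2 : nbhs t [set s | `|a s - a t| < e / 2] by exact: ca _ na.
have nb2 : nbhs t [set s | `|b s - b t| < e / 2] by exact: cb _ nb.
change (nbhs t [set s | A (Complex (a s) (b s))]).
near=> s; apply: he.
have h1 : `|a s - a t| < e / 2 by near: s; exact: na2.
have h2 : `|b s - b t| < e / 2 by near: s; exact: nb2.
apply: le_lt_trans (modC_le_ReIm _) _ => /=.
by rewrite [e]splitr ltrD.
Unshelve. all: by end_near. Qed.

Lemma cont_toC (T : topologicalType) (a : T -> R) (t : T) :
  {for t, continuous a} -> {for t, continuous (fun s => toC (a s))}.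
Proof. by move=> ca; apply: cont_Complex => //; exact: cst_continuous. Qed.

Lemma complex_eta z : z = Complex (complex.Re z) (complex.Im z) :> C.
Proof. by case: z. Qed.

Lemma ReD z w : complex.Re (z + w) = complex.Re z + complex.Re w.
Proof. by case: z w => [? ?] []. Qed.
Lemma ImD z w : complex.Im (z + w) = complex.Im z + complex.Im w.
Proof. by case: z w => [? ?] []. Qed.
Lemma ReN z : complex.Re (- z) = - complex.Re z.
Proof. by case: z. Qed.
Lemma ImN z : complex.Im (- z) = - complex.Im z.
Proof. by case: z. Qed.
Lemma ReMul z w : complex.Re (z * w) =
  complex.Re z * complex.Re w - complex.Im z * complex.Im w.
Proof. by case: z w => [? ?] []. Qed.
Lemma ImMul z w : complex.Im (z * w) =
  complex.Re z * complex.Im w + complex.Im z * complex.Re w.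
Proof. by case: z w => [? ?] []. Qed.

Lemma Ceq z w : complex.Re z = complex.Re w -> complex.Im z = complex.Im w -> z = w.
Proof. by case: z w => [? ?] [? ?] /= -> ->. Qed.

End ComplexBasics.

(** The difference quotient is multiplied out: the point [w = z] needs no exclusion, and composition
    and integration can use the estimate without dividing. *)
Lemma is_derive1P (K : numFieldType) (f : K -> K) (z d : K) :
  is_derive z 1 f d <-> forall e : K, 0 < e -> exists2 del : K, 0 < del &
    forall w, `|w - z| < del -> `|f w - f z - d * (w - z)| <= e * `|w - z|.
Proof.
split.
  move=> [hd hv] e e0; rewrite -hv /derive.
  have /cvgrPdist_le /(_ _ e0) := hd.
  rewrite /dnbhs /within /= => /nbhs_ballP[del /= del0 hdel]; exists del => // w wz.
  have [->|wz0] := eqVneq w z; first by rewrite !subrr mulr0 subr0 normr0 mulr0.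
  have wz0' : w - z != 0 by rewrite subr_eq0.
  have := hdel (w - z); rewrite /ball /= sub0r normrN => /(_ wz wz0').
  rewrite distrC [_ *: 1]mulr1 subrK -[_ *: _]/(_ * _) => h.
  rewrite -ler_pdivrMr ?normr_gt0// -normf_div; apply: le_trans h.
  by rewrite mulrBl mulfK// mulrC.
move=> h.
have hc : (fun k : K => k^-1 *: (f (k *: 1 + z) - f z)) @ 0^' --> d.
  apply/cvgrPdist_le => e e0; have [del del0 hdel] := h e e0.
  rewrite /dnbhs /within /=; apply/nbhs_ballP; exists del => // k.
  rewrite /ball /= sub0r normrN => kd k0.
  have := hdel (k + z); rewrite addrK => /(_ kd) hk.
  rewrite distrC [_ *: 1]mulr1 -[_ *: _]/(_ * _).
  rewrite -(ler_pM2r (_ : 0 < `|k|)) ?normr_gt0// -normrM.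
  by rewrite mulrBl mulrAC mulVf// mul1r.
split; first by apply/cvg_ex; exists d.
exact: cvg_lim hc.
Qed.

(** * Complex derivatives as first-order estimates *)

Section ComplexDerivative.
Variable R : realType.
Local Notation C := (CC R).
Implicit Types (f g : C -> C) (z w d : C).

Definition cder f z d := is_derive z 1 f d.

Lemma cderP f z d : cder f z d <->
  forall e : R, 0 < e -> exists2 del : R, 0 < del &
   forall w, modC (w - z) < del ->
     modC (f w - f z - d * (w - z)) <= e * modC (w - z).
Proof.
rewrite /cder is_derive1P; split=> h e e0.
  have [|del del0 hdel] := h (toC e); first by rewrite (ltcR 0 e).
  move: del del0 hdel => [a b]; rewrite ltcE /= => /andP[/eqP -> a0] hdel.
  exists a => // w hw; have := hdel w; rewrite !normCE (ltcR (modC (w - z)) a).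
  by move=> /(_ hw); rewrite -[toC e]/(e%:C)%C -rmorphM lecR.
move: e e0 => [a b]; rewrite ltcE /= => /andP[/eqP -> a0].
have [del del0 hdel] := h _ a0; exists (toC del); first by rewrite (ltcR 0 del).
move=> w; rewrite !normCE (ltcR (modC (w - z)) del) => /hdel.
by rewrite -[Complex a 0]/(a%:C)%C -rmorphM lecR.
Qed.

(** [C] is a normed space over itself, so the derivative of a path with real parameter is spelled
    out as an estimate, parallel to [cderP]. *)
Definition pder (V : R -> C) (t : R) (d : C) :=
  forall e : R, 0 < e -> exists2 del : R, 0 < del &
   forall s, `|s - t| < del ->
     modC (V s - V t - d * toC (s - t)) <= e * `|s - t|.

Lemma pder_Re V t d : pder V t d ->
  is_derive t 1 (fun s => complex.Re (V s)) (complex.Re d).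
Proof.
move=> h; apply/is_derive1P => e /h[del del0 hd]; exists del => // s /hd.
apply: le_trans; apply: le_trans (ReM_le _).
by rewrite !(ReD, ReN, ReMul) /= mulr0 subr0.
Qed.

Lemma pder_Im V t d : pder V t d ->
  is_derive t 1 (fun s => complex.Im (V s)) (complex.Im d).
Proof.
move=> h; apply/is_derive1P => e /h[del del0 hd]; exists del => // s /hd.
apply: le_trans; apply: le_trans (ImM_le _).
by rewrite !(ImD, ImN, ImMul) /= mulr0 add0r.
Qed.

Lemma pder_cont V t d : pder V t d -> {for t, continuous V}.
Proof.
move=> h; apply/pcontP => e e0; have [del del0 hd] := h 1 ltr01.
have M0 : 0 < modC d + 1 by have := modC_ge0 d; lra.
exists (Num.min del (e / (modC d + 1))); first by rewrite lt_min del0 divr_gt0.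
move=> s; rewrite lt_min => /andP[/hd h1 h2].
rewrite -[V s - V t](subrK (d * toC (s - t))).
apply: le_lt_trans (modCD _ _) _; rewrite modCM modC_toC.
move: h2; rewrite ltr_pdivlMr// mulrC => h2.
lra.
Qed.

Lemma cder_cont f z d : cder f z d -> {for z, continuous f}.
Proof.
move=> /cderP h; apply/ccontP => e e0; have [del del0 hd] := h 1 ltr01.
have M0 : 0 < modC d + 1 by have := modC_ge0 d; lra.
exists (Num.min del (e / (modC d + 1))); first by rewrite lt_min del0 divr_gt0.
move=> s; rewrite lt_min => /andP[/hd h1 h2].
rewrite -[f s - f z](subrK (d * (s - z))).
apply: le_lt_trans (modCD _ _) _; rewrite modCM.
move: h2; rewrite ltr_pdivlMr// mulrC => h2.
lra.
Qed.

Lemma pder_comp f V t d e : cder f (V t) d -> pder V t e ->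
  pder (f \o V) t (d * e).
Proof.
move=> /cderP hf hV eps eps0.
have M0 : 0 < modC e + 1 by have := modC_ge0 e; lra.
have N0 : 0 < modC d + 1 by have := modC_ge0 d; lra.
have e1 : 0 < eps / 2 / (modC e + 1) by rewrite !divr_gt0.
have e2 : 0 < eps / 2 / (modC d + 1) by rewrite !divr_gt0.
have [d1 d10 h1] := hf _ e1.
have [d2 d20 h2] := hV _ e2.
have [d3 d30 h3] := hV _ ltr01.
have [d4 d40 h4] := (pcontP V t).1 (pder_cont hV) _ d10.
exists (Num.min (Num.min d2 d3) d4); first by rewrite !lt_min d20 d30 d40.
move=> s; rewrite !lt_min => /andP[/andP[/h2 a2 /h3 a3] /h4 a4] /=.
have := h1 _ a4; set D := V s - V t => a1.
have D1 : modC D <= (modC e + 1) * `|s - t|.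
  rewrite -[D](subrK (e * toC (s - t))); apply: le_trans (modCD _ _) _.
  by rewrite modCM modC_toC mulrDl addrC mul1r lerD2l; move: a3; rewrite mul1r.
have -> : f (V s) - f (V t) - d * e * toC (s - t) =
  (f (V s) - f (V t) - d * D) + d * (D - e * toC (s - t)) by ring.
apply: le_trans (modCD _ _) _; rewrite modCM.
have b1 : modC (f (V s) - f (V t) - d * D) <= eps / 2 * `|s - t|.
  apply: le_trans a1 _; apply: le_trans (ler_wpM2l (ltW e1) D1) _.
  by rewrite mulrA divfK ?gt_eqF.
have b2 : modC d * modC (D - e * toC (s - t)) <= eps / 2 * `|s - t|.
  apply: (@le_trans _ _ ((modC d + 1) * (eps / 2 / (modC d + 1) * `|s - t|))).
    by apply: ler_pM => //; rewrite ?modC_ge0//; lra.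
  by rewrite mulrA mulrCA divff ?gt_eqF// mulr1.
lra.
Qed.

Lemma pder_affine (a b : C) (t : R) : pder (fun s => a + b * toC s) t b.
Proof.
move=> e e0; exists 1 => // s _.
have -> : toC (s - t) = toC s - toC t by rewrite /toC; apply: Ceq; rewrite /= ?subrr.
have -> : a + b * toC s - (a + b * toC t) - b * (toC s - toC t) = 0 by ring.
by rewrite modC0 mulr_ge0// ltW.
Qed.

Lemma cder_affine_comp f z d (a b : C) :
  cder f (a + b * z) d -> cder (fun w => f (a + b * w)) z (d * b).
Proof.
move=> /cderP h; apply/cderP => e e0.
have M0 : 0 < modC b + 1 by have := modC_ge0 b; lra.
have [|del del0 hd] := h (e / (modC b + 1)); first by rewrite divr_gt0.
exists (del / (modC b + 1)); first by rewrite divr_gt0.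
move=> w; rewrite ltr_pdivlMr// => hw.
have hbw : a + b * w - (a + b * z) = b * (w - z) by ring.
have bw : modC (b * (w - z)) <= (modC b + 1) * modC (w - z).
  by rewrite modCM ler_wpM2r ?modC_ge0//; lra.
have := hd (a + b * w); rewrite hbw => h1.
rewrite -mulrA; apply: le_trans (h1 _) _; first by rewrite (le_lt_trans bw)// mulrC.
apply: le_trans (ler_wpM2l _ bw) _; first by rewrite ltW// divr_gt0.
by rewrite mulrA divfK ?gt_eqF.
Qed.

Lemma cder_uniq f z d d' : cder f z d -> cder f z d' -> d = d'.
Proof. by move=> [_ <-] [_ <-]. Qed.

Lemma cder_derive1 f z d : cder f z d -> derive1 f z = d.
Proof. by move=> [_ <-]; rewrite derive1E. Qed.

Lemma derivable_cder f z : derivable f z 1 -> cder f z (derive1 f z).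
Proof. by move=> h; split; [exact: h|rewrite derive1E]. Qed.

Lemma cder_near f g z d : (\forall w \near z, f w = g w) -> cder f z d -> cder g z d.
Proof.
move=> /nbhsC[r r0 hr] /cderP h; apply/cderP => e /h[del del0 hd].
exists (Num.min r del); first by rewrite lt_min r0.
move=> w; rewrite lt_min => /andP[/hr <- /hd]; rewrite -(hr z)//.
by rewrite subrr modC0.
Qed.

Lemma cderD f g z a b : cder f z a -> cder g z b -> cder (fun w => f w + g w) z (a + b).
Proof. exact: is_deriveD. Qed.

Lemma cderN f z a : cder f z a -> cder (fun w => - f w) z (- a).
Proof. exact: is_deriveN. Qed.

Lemma cderB f g z a b : cder f z a -> cder g z b -> cder (fun w => f w - g w) z (a - b).
Proof. exact: is_deriveB. Qed.

Lemma cderM f g z a b : cder f z a -> cder g z b ->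
  cder (fun w => f w * g w) z (a * g z + f z * b).
Proof.
by move=> ha hb; apply: is_derive_eq (is_deriveM ha hb) _; rewrite addrC mulrC.
Qed.

Lemma cder_cst c z : cder (fun=> c) z 0.
Proof. exact: is_derive_cst. Qed.

Lemma cder_id z : cder (fun w => w) z 1.
Proof. exact: is_derive_id. Qed.

Lemma cderV f z a : f z != 0 -> cder f z a -> cder (fun w => (f w)^-1) z (- (f z)^-2 * a).
Proof.
move=> fz [ha <-]; split; first exact: derivableV.
by rewrite deriveV.
Qed.

Lemma cderX f z a n : cder f z a -> cder (fun w => f w ^+ n) z (n%:R * f z ^+ n.-1 * a).
Proof.
move=> h; elim: n => [|n ih].
  by rewrite mul0r mul0r; exact: cder_cst.
have := cderM h ih; rewrite /cder => h2.
rewrite (_ : (fun w => f w ^+ n.+1) = (fun w => f w * f w ^+ n)); last first.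
  by apply/funext => w; rewrite exprS.
apply: is_derive_eq h2 _.
case: n {ih} => [|n] /=; first by rewrite !expr0 !mul0r mulr0; ring.
by rewrite !exprS -(addn1 n.+1) -(addn1 n) !natrD; ring.
Qed.

End ComplexDerivative.

(** * Integrals of complex functions over real segments *)

Section SegmentIntegrals.
Variable R : realType.
Local Notation C := (CC R).
Local Notation mu := (@lebesgue_measure R).
Implicit Types (v : R -> C) (u : R -> R) (a b t : R).

Definition contI a b (T : topologicalType) (v : R -> T) :=
  forall t, a <= t <= b -> {for t, continuous v}.

Definition rint a b u := Rintegral mu `[a, b] u.
Definition cint a b v : C :=
  Complex (rint a b (fun t => complex.Re (v t))) (rint a b (fun t => complex.Im (v t))).

Lemma contI_within a b u : contI a b u -> {within `[a, b], continuous u}.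
Proof.
by move=> h; apply: continuous_in_subspaceT => t; rewrite inE/= in_itv/= => /h.
Qed.

Lemma contI_integrable a b u : contI a b u -> mu.-integrable `[a, b] (EFin \o u).
Proof.
move=> h; apply: continuous_compact_integrable; first exact: segment_compact.
exact: contI_within.
Qed.

Lemma rintD a b u u' : contI a b u -> contI a b u' ->
  rint a b (fun t => u t + u' t) = rint a b u + rint a b u'.
Proof. by move=> h1 h2; rewrite /rint RintegralD//; exact: contI_integrable. Qed.

Lemma rintZ a b k u : contI a b u -> rint a b (fun t => k * u t) = k * rint a b u.
Proof. by move=> h1; rewrite /rint RintegralZl//; exact: contI_integrable. Qed.

Lemma rintB a b u u' : contI a b u -> contI a b u' ->
  rint a b (fun t => u t - u' t) = rint a b u - rint a b u'.
Proof. by move=> h1 h2; rewrite /rint RintegralB//; exact: contI_integrable. Qed.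

Lemma rint_cst a b k : a <= b -> rint a b (fun=> k) = k * (b - a).
Proof.
move=> ab; rewrite /rint Rintegral_cst//= lebesgue_measure_itv /= lte_fin.
move: ab; rewrite le_eqVlt => /predU1P[->|->] //=.
by rewrite ltxx /= subrr.
Qed.

Lemma rint_le a b u u' : contI a b u -> contI a b u' ->
  (forall t, a <= t <= b -> u t <= u' t) -> rint a b u <= rint a b u'.
Proof.
move=> h1 h2 h; apply: le_Rintegral; rewrite //; try exact: contI_integrable.
Qed.

Lemma eq_rint a b u u' : (forall t, a <= t <= b -> u t = u' t) ->
  rint a b u = rint a b u'.
Proof. by move=> h; apply: eq_Rintegral => t; rewrite inE/= in_itv/= => /h. Qed.

Lemma rint_split a c b u : a <= c -> c <= b -> contI a b u ->
  rint a b u = rint a c u + rint c b u.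
Proof.
move=> ac cb h; have ih := contI_integrable h.
have := @Rintegral_itvB _ u (BLeft a) (BRight b) c ih.
rewrite !bnd_simp => /(_ ac cb) h1.
apply/eqP; rewrite addrC -subr_eq h1 Rintegral_itv_obnd_cbnd//.
by apply: integrableS ih => //; apply: subset_itv; rewrite bnd_simp.
Qed.

Lemma rint_FTC a b (U u : R -> R) : a <= b -> contI a b u ->
  (forall t, a <= t <= b -> is_derive t 1 U (u t)) -> rint a b u = U b - U a.
Proof.
rewrite le_eqVlt => /predU1P[<- _ _|ab h hd].
  by rewrite /rint set_itv1 Rintegral_set1 subrr.
have cU : contI a b U.
  move=> t tab; apply: differentiable_continuous; apply/derivable1_diffP.
  by case: (hd t tab).
rewrite /rint /Rintegral (@continuous_FTC2 _ u U)//.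
- exact: contI_within.
- have := contI_within cU; rewrite continuous_within_itvP// => -[_ ha hb].
  split=> // t; rewrite in_itv/= => /andP[t1 t2].
  by case: (hd t) => //; rewrite !ltW.
- move=> t; rewrite in_itv/= => /andP[t1 t2]; rewrite derive1E.
  by case: (hd t) => //; rewrite !ltW.
Qed.

Lemma contI_Re a b v : contI a b v -> contI a b (fun t => complex.Re (v t)).
Proof. by move=> h t /h ht; apply: continuous_comp => //; exact: cont_Re. Qed.

Lemma contI_Im a b v : contI a b v -> contI a b (fun t => complex.Im (v t)).
Proof. by move=> h t /h ht; apply: continuous_comp => //; exact: cont_Im. Qed.

Lemma cintD a b v v' : contI a b v -> contI a b v' ->
  cint a b (fun t => v t + v' t) = cint a b v + cint a b v'.
Proof.
move=> h1 h2; apply: Ceq; rewrite ?ReD ?ImD /= -rintD; try exact: contI_Re; try exact: contI_Im.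
  by apply: eq_rint => t _; rewrite ReD.
by apply: eq_rint => t _; rewrite ImD.
Qed.

Lemma cintZ a b c v : contI a b v -> cint a b (fun t => c * v t) = c * cint a b v.
Proof.
move=> h; have hR := contI_Re h; have hI := contI_Im h.
have hZ (k : R) u : contI a b u -> contI a b (fun t => k * u t).
  by move=> hu t /hu ht; apply: continuousM => //; exact: cst_continuous.
apply: Ceq; rewrite ?ReMul ?ImMul /= -!rintZ//.
  by rewrite -rintB; [|exact: hZ..]; apply: eq_rint => t _; rewrite ReMul.
by rewrite -rintD; [|exact: hZ..]; apply: eq_rint => t _; rewrite ImMul.
Qed.

Lemma eq_cint a b v v' : (forall t, a <= t <= b -> v t = v' t) -> cint a b v = cint a b v'.
Proof. by move=> h; apply: Ceq; apply: eq_rint => t /h ->. Qed.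

Lemma cint_cst a b c : a <= b -> cint a b (fun=> c) = c * toC (b - a).
Proof.
by move=> ab; apply: Ceq; rewrite ?ReMul ?ImMul /= rint_cst// mulr0 ?subr0 ?add0r.
Qed.

Lemma cint_split a c b v : a <= c -> c <= b -> contI a b v ->
  cint a b v = cint a c v + cint c b v.
Proof.
move=> ac cb h; apply: Ceq; rewrite ?ReD ?ImD /=; apply: rint_split => //.
  exact: contI_Re.
exact: contI_Im.
Qed.

Lemma rint_norm_le a b u M : a <= b -> contI a b u ->
  (forall t, a <= t <= b -> `|u t| <= M) -> `|rint a b u| <= M * (b - a).
Proof.
move=> ab h hM; rewrite ler_norml -mulNr -!rint_cst//.
by apply/andP; split; apply: rint_le => //; try (by move=> ? _; exact: cst_continuous);
  move=> t /hM; rewrite ler_norml => /andP[].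
Qed.

(** The factor 2 is the price of bounding real and imaginary parts separately; it propagates to
    [rectI_le] and [cmean_le_pt]. *)
Lemma cint_le a b v M : a <= b -> contI a b v ->
  (forall t, a <= t <= b -> modC (v t) <= M) -> modC (cint a b v) <= 2 * M * (b - a).
Proof.
move=> ab h hM; apply: le_trans (modC_le_ReIm _) _ => /=.
have h1 : `|rint a b (fun t => complex.Re (v t))| <= M * (b - a).
  apply: rint_norm_le => //; first exact: contI_Re.
  by move=> t /hM; apply: le_trans; exact: ReM_le.
have h2 : `|rint a b (fun t => complex.Im (v t))| <= M * (b - a).
  apply: rint_norm_le => //; first exact: contI_Im.
  by move=> t /hM; apply: le_trans; exact: ImM_le.
lra.
Qed.

Lemma cint_FTC a b (V v : R -> C) : a <= b -> contI a b v ->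
  (forall t, a <= t <= b -> pder V t (v t)) -> cint a b v = V b - V a.
Proof.
move=> ab h hd; apply: Ceq; rewrite ?(ReD, ImD, ReN, ImN) /=.
  apply: (@rint_FTC _ _ (fun t => complex.Re (V t))) => //; first exact: contI_Re.
  by move=> t /hd; exact: pder_Re.
apply: (@rint_FTC _ _ (fun t => complex.Im (V t))) => //; first exact: contI_Im.
by move=> t /hd; exact: pder_Im.
Qed.

End SegmentIntegrals.

(** * Compactness of rectangles by bisection *)

Section Bisection.
Variable R : realType.

Lemma nested_point (a b : nat -> R) :
  (forall n m, a n <= b m) -> exists x, forall n, a n <= x <= b n.
Proof.
move=> h; have hs : has_sup (range a).
  by split; [exists (a 0%N); exists 0%N | exists (b 0%N) => _ [n _ <-]].
exists (sup (range a)) => n; apply/andP; split.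
  by apply: sup_upper_bound => //; exists n.
by apply: ge_sup; [exists (a 0%N); exists 0%N | move=> _ [m _ <-]].
Qed.

Lemma pow2_small (L d : R) : 0 <= L -> 0 < d -> exists n, L / 2 ^+ n < d.
Proof.
move=> L0 d0; exists (Num.truncn (L / d)).+1.
rewrite ltr_pdivrMr ?exprn_gt0// -ltr_pdivrMl//.
apply: lt_trans (_ : (Num.truncn (L / d)).+1%:R < _).
  by rewrite mulrC; apply: truncnS_gt.
by rewrite -natrX ltr_nat ltn_expl.
Qed.

(** Selects a quarter on which [P] fails. After three successes the fourth is taken unchecked:
    failure there follows from the subdivision hypothesis of [rect_ind]. *)
Definition halves (P : R -> R -> R -> R -> Prop) (q : (R * R) * (R * R)) :=
  let: ((a, b), (c, d)) := q in
  let p := (a + b) / 2 in let s := (c + d) / 2 in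
  if `[< P a p c s >] then
    if `[< P p b c s >] then
      if `[< P a p s d >] then ((p, b), (s, d)) else ((a, p), (s, d))
    else ((p, b), (c, s))
  else ((a, p), (c, s)).

(** A failing rectangle would produce nested failing quarters shrinking to a point, against the
    local hypothesis at that point. This single induction principle supplies every compactness
    argument below; segments are covered as rectangles with [c = d]. *)
Lemma rect_ind (P : R -> R -> R -> R -> Prop) a b c d : a <= b -> c <= d ->
  (forall a b c d, a <= b -> c <= d ->
     P a ((a + b) / 2) c ((c + d) / 2) -> P ((a + b) / 2) b c ((c + d) / 2) ->
     P a ((a + b) / 2) ((c + d) / 2) d -> P ((a + b) / 2) b ((c + d) / 2) d ->
     P a b c d) ->
  (forall x y, a <= x <= b -> c <= y <= d -> exists2 del : R, 0 < del &
     forall a' b' c' d', a <= a' -> a' <= x -> x <= b' -> b' <= b ->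
       c <= c' -> c' <= y -> y <= d' -> d' <= d -> b' - a' < del -> d' - c' < del ->
       P a' b' c' d') ->
  P a b c d.
Proof.
move=> ab cd hsub hloc; apply: contrapT => nP.
pose q n := iter n (halves P) ((a, b), (c, d)).
pose A n := (q n).1.1; pose B n := (q n).1.2.
pose C n := (q n).2.1; pose D n := (q n).2.2.
have step n : [/\ A n <= B n, C n <= D n, ~ P (A n) (B n) (C n) (D n) &
   [/\ A n <= A n.+1, B n.+1 <= B n, C n <= C n.+1, D n.+1 <= D n &
       (B n.+1 - A n.+1 = (B n - A n) / 2) /\ (D n.+1 - C n.+1 = (D n - C n) / 2)]].
  suff st : [/\ A n <= B n, C n <= D n & ~ P (A n) (B n) (C n) (D n)] /\ 
    ([/\ A n <= B n, C n <= D n & ~ P (A n) (B n) (C n) (D n)] ->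
    [/\ [/\ A n.+1 <= B n.+1, C n.+1 <= D n.+1 & ~ P (A n.+1) (B n.+1) (C n.+1) (D n.+1)] &
   [/\ A n <= A n.+1, B n.+1 <= B n, C n <= C n.+1, D n.+1 <= D n &
       (B n.+1 - A n.+1 = (B n - A n) / 2) /\ (D n.+1 - C n.+1 = (D n - C n) / 2)]]).
    by case: st => -[? ? ?] /(_ (And3 _ _ _))[].
  have H k : [/\ A k <= B k, C k <= D k & ~ P (A k) (B k) (C k) (D k)] ->
    [/\ [/\ A k.+1 <= B k.+1, C k.+1 <= D k.+1 & ~ P (A k.+1) (B k.+1) (C k.+1) (D k.+1)] &
   [/\ A k <= A k.+1, B k.+1 <= B k, C k <= C k.+1, D k.+1 <= D k &
       (B k.+1 - A k.+1 = (B k - A k) / 2) /\ (D k.+1 - C k.+1 = (D k - C k) / 2)]].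
    rewrite /A /B /C /D /q /= -/(q k); case: (q k) => [[a1 b1] [c1 d1]] /= [h1 h2 h3].
    case: asboolP => [p1|p1]; last by repeat split => //=; clear -h1 h2; lra.
    case: asboolP => [p2|p2]; last by repeat split => //=; clear -h1 h2; lra.
    case: asboolP => [p3|p3]; last by repeat split => //=; clear -h1 h2; lra.
    repeat split => //=; try (clear -h1 h2; lra).
    by move=> p4; apply: h3; exact: hsub.
  split; last exact: H.
  by elim: n => [|k /H[]//].
have mA : {homo A : n m / (n <= m)%N >-> n <= m}.
  by apply: homo_leq => [//|x y z|n]; [exact: le_trans | case: (step n) => _ _ _ []].
have mB n m : (n <= m)%N -> B m <= B n.
  apply: (@homo_leq R B (fun x y => y <= x)) => [//|x y z h1 h2|k].
    exact: le_trans h2 h1.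
  by case: (step k) => _ _ _ [].
have mC : {homo C : n m / (n <= m)%N >-> n <= m}.
  by apply: homo_leq => [//|x y z|n]; [exact: le_trans | case: (step n) => _ _ _ []].
have mD n m : (n <= m)%N -> D m <= D n.
  apply: (@homo_leq R D (fun x y => y <= x)) => [//|x y z h1 h2|k].
    exact: le_trans h2 h1.
  by case: (step k) => _ _ _ [].
have AB n m : A n <= B m.
  apply: le_trans (mA _ _ (leq_maxl n m)) _; apply: le_trans (mB _ _ (leq_maxr n m)).
  by case: (step (maxn n m)).
have CD n m : C n <= D m.
  apply: le_trans (mC _ _ (leq_maxl n m)) _; apply: le_trans (mD _ _ (leq_maxr n m)).
  by case: (step (maxn n m)).
have [x hx] := nested_point AB.
have [y hy] := nested_point CD.
have wAB n : B n - A n = (b - a) / 2 ^+ n.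
  elim: n => [|n ih]; first by rewrite expr0 divr1.
  by case: (step n) => _ _ _ [_ _ _ _ [-> _]]; rewrite ih exprS invfM mulrA mulrAC.
have wCD n : D n - C n = (d - c) / 2 ^+ n.
  elim: n => [|n ih]; first by rewrite expr0 divr1.
  by case: (step n) => _ _ _ [_ _ _ _ [_ ->]]; rewrite ih exprS invfM mulrA mulrAC.
have [del del0 hdel] := hloc x y (hx 0%N) (hy 0%N).
have [n1 hn1] := @pow2_small (b - a) del ltac:(lra) del0.
have [n2 hn2] := @pow2_small (d - c) del ltac:(lra) del0.
pose n := maxn n1 n2.
have small (L : R) k : 0 <= L -> (k <= n)%N -> L / 2 ^+ n <= L / 2 ^+ k.
  move=> L0 kn; rewrite ler_wpM2l// lef_pV2 ?posrE ?exprn_gt0//.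
  by rewrite ler_eXn2l// ltr1n.
case: (step n) => _ _ + _; apply.
have /andP[? ?] := hx n; have /andP[? ?] := hy n.
apply: hdel => //; first exact: (mA 0%N n).
- exact: (mB 0%N n).
- exact: (mC 0%N n).
- exact: (mD 0%N n).
- by rewrite wAB; apply: le_lt_trans hn1; apply: small; [lra|exact: leq_maxl].
- by rewrite wCD; apply: le_lt_trans hn2; apply: small; [lra|exact: leq_maxr].
Qed.

End Bisection.

(** * Goursat's theorem on rectangles *)

Section Goursat.
Variable R : realType.

Local Lemma le_of_eq (x y : R) : x = y -> x <= y.
Proof. by move=> ->. Qed.

Local Notation C := (CC R).
Implicit Types (f g : C -> C) (a b c d x y : R).

Definition Ci : C := Complex 0 1.

Definition rectI f a b c d : C :=
  cint a b (fun x => f (Complex x c)) + Ci * cint c d (fun y => f (Complex b y))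
  - cint a b (fun x => f (Complex x d)) - Ci * cint c d (fun y => f (Complex a y)).

Definition contR f a b c d := forall x y, a <= x <= b -> c <= y <= d ->
  {for (Complex x y : C), continuous f}.

Lemma contR_h f a b c d y : c <= y <= d -> contR f a b c d ->
  contI a b (fun x => f (Complex x y)).
Proof.
move=> yc h x xab; apply: (@continuous_comp _ _ _ (fun x => Complex x y : C) f); last exact: h.
by apply: cont_Complex; [exact: cvg_id|exact: cst_continuous].
Qed.

Lemma contR_v f a b c d x : a <= x <= b -> contR f a b c d ->
  contI c d (fun y => f (Complex x y)).
Proof.
move=> yc h y xab; apply: (@continuous_comp _ _ _ (fun y => Complex x y : C) f); last exact: h.
by apply: cont_Complex; [exact: cst_continuous|exact: cvg_id].
Qed.

Lemma contRW f a b c d a' b' c' d' : a <= a' -> b' <= b -> c <= c' -> d' <= d ->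
  contR f a b c d -> contR f a' b' c' d'.
Proof. by move=> ? ? ? ? h x y /andP[? ?] /andP[? ?]; apply: h; lra. Qed.

Lemma rectI_split f a b c d p q : a <= p <= b -> c <= q <= d -> contR f a b c d ->
  rectI f a b c d = rectI f a p c q + rectI f p b c q + rectI f a p q d + rectI f p b q d.
Proof.
move=> /andP[ap pb] /andP[cq qd] h.
rewrite /rectI (@cint_split _ a p b (fun x => f (Complex x c)))//; last first.
  by apply: contR_h h; lra.
rewrite (@cint_split _ a p b (fun x => f (Complex x d)))//; last by apply: contR_h h; lra.
rewrite (@cint_split _ c q d (fun y => f (Complex b y)))//; last by apply: contR_v h; lra.
rewrite (@cint_split _ c q d (fun y => f (Complex a y)))//; last by apply: contR_v h; lra.
ring.
Qed.

Lemma rectID f g a b c d : a <= b -> c <= d -> contR f a b c d -> contR g a b c d ->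
  rectI (fun z => f z + g z) a b c d = rectI f a b c d + rectI g a b c d.
Proof.
move=> ab cd hf hg.
have lexx' : [/\ a <= a <= b, a <= b <= b, c <= c <= d & c <= d <= d] by rewrite !lexx ab cd.
case: lexx' => l1 l2 l3 l4.
have hh y : c <= y <= d -> cint a b (fun x => f (Complex x y) + g (Complex x y)) =
    cint a b (fun x => f (Complex x y)) + cint a b (fun x => g (Complex x y)).
  by move=> hy; apply: cintD; [exact: (contR_h hy hf)|exact: (contR_h hy hg)].
have hv x : a <= x <= b -> cint c d (fun y => f (Complex x y) + g (Complex x y)) =
    cint c d (fun y => f (Complex x y)) + cint c d (fun y => g (Complex x y)).
  by move=> hx; apply: cintD; [exact: (contR_v hx hf)|exact: (contR_v hx hg)].
rewrite /rectI (hh c l3) (hh d l4) (hv a l1) (hv b l2).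
ring.
Qed.

Lemma modC_Ci : modC Ci = 1.
Proof. by rewrite /modC /= expr0n expr1n add0r sqrtr1. Qed.

Lemma rectI_le f a b c d M : a <= b -> c <= d -> contR f a b c d ->
  (forall x y, a <= x <= b -> c <= y <= d -> modC (f (Complex x y)) <= M) ->
  modC (rectI f a b c d) <= 4 * M * ((b - a) + (d - c)).
Proof.
move=> ab cd h hM; rewrite /rectI.
have lexx' : [/\ a <= a <= b, a <= b <= b, c <= c <= d & c <= d <= d] by rewrite !lexx ab cd.
case: lexx' => l1 l2 l3 l4.
set A := cint a b _; set B := cint c d _; set A' := cint a b _; set B' := cint c d _.
have hA : modC A <= 2 * M * (b - a).
  by apply: cint_le => //; [exact: (contR_h l3 h) | move=> x hx; apply: hM].
have hA' : modC A' <= 2 * M * (b - a).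
  by apply: cint_le => //; [exact: (contR_h l4 h) | move=> x hx; apply: hM].
have hB : modC B <= 2 * M * (d - c).
  by apply: cint_le => //; [exact: (contR_v l2 h) | move=> x hx; apply: hM].
have hB' : modC B' <= 2 * M * (d - c).
  by apply: cint_le => //; [exact: (contR_v l1 h) | move=> x hx; apply: hM].
have h1 := modCD (A + Ci * B - A') (- (Ci * B')).
have h2 := modCD (A + Ci * B) (- A').
have h3 := modCD A (Ci * B).
by move: h1 h2 h3; rewrite !modCN !modCM modC_Ci !mul1r => h1 h2 h3; lra.
Qed.

Lemma pder_h c x : pder (fun x => Complex x c : C) x 1.
Proof.
move=> e e0; exists 1 => // s _.
have -> : (Complex s c : C) - Complex x c - 1 * toC (s - x) = 0.
  by apply: Ceq; rewrite /=; ring.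
by rewrite modC0 mulr_ge0// ltW.
Qed.

Lemma pder_v x y : pder (fun y => Complex x y : C) y Ci.
Proof.
move=> e e0; exists 1 => // s _.
have -> : (Complex x s : C) - Complex x y - Ci * toC (s - y) = 0.
  by apply: Ceq; rewrite /=; ring.
by rewrite modC0 mulr_ge0// ltW.
Qed.

Lemma rectI_prim (F f : C -> C) a b c d : a <= b -> c <= d -> contR f a b c d ->
  (forall z, cder F z (f z)) -> rectI f a b c d = 0.
Proof.
move=> ab cd h hF.
have lexx' : [/\ a <= a <= b, a <= b <= b, c <= c <= d & c <= d <= d] by rewrite !lexx ab cd.
case: lexx' => l1 l2 l3 l4.
have Hh y : c <= y <= d -> cint a b (fun x => f (Complex x y)) =
    F (Complex b y) - F (Complex a y).
  move=> hy; apply: (@cint_FTC _ _ _ (fun x => F (Complex x y))) => //.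
    exact: (contR_h hy h).
  move=> x _; rewrite -[f _]mulr1.
  exact: (pder_comp (V := fun x => Complex x y) (hF _) (pder_h y x)).
have Hv x : a <= x <= b -> Ci * cint c d (fun y => f (Complex x y)) =
    F (Complex x d) - F (Complex x c).
  move=> hx; rewrite -cintZ; last exact: (contR_v hx h).
  apply: (@cint_FTC _ _ _ (fun y => F (Complex x y))) => //.
    by move=> t ht; apply: continuousM; [exact: cst_continuous|exact: (contR_v hx h)].
  move=> y _; rewrite mulrC.
  exact: (pder_comp (V := fun y => Complex x y) (hF _) (pder_v x y)).
by rewrite /rectI !Hh// !Hv//; ring.
Qed.

Lemma rectI_affine (p q z0 : C) a b c d : a <= b -> c <= d ->
  rectI (fun w => p + q * (w - z0)) a b c d = 0.
Proof.
move=> ab cd; apply: (@rectI_prim (fun w => p * w + q / 2 * (w - z0) ^+ 2) _ _ _ _ _ ab cd).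
  move=> x y _ _; apply: (@cder_cont _ _ _ (0 + (0 * (Complex x y - z0) + q * (1 - 0)))).
  apply: cderD; first exact: cder_cst.
  apply: (@cderM _ (fun=> q) (fun w => w - z0)); first exact: cder_cst.
  by apply: cderB; [exact: cder_id|exact: cder_cst].
move=> z.
have h1 : cder (fun w : C => w - z0) z (1 - 0).
  by apply: cderB; [exact: cder_id|exact: cder_cst].
have h2 := cderM (cder_cst (q / 2) z) (cderX 2 h1).
have h3 := cderD (cderM (cder_cst p z) (cder_id z)) h2.
rewrite /cder; apply: is_derive_eq h3 _ => /=.
by rewrite expr1; field.
Qed.

(** The bound [E * (half-perimeter)^2] is additive under subdivision, since each quarter has half
    the half-perimeter. Near a point [f] is its affine part, whose integral vanishes, plus an error
    proportional to the distance, so the bound holds for small rectangles. *)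
Theorem goursat f a b c d : a <= b -> c <= d ->
  (forall x y, a <= x <= b -> c <= y <= d -> exists l, cder f (Complex x y) l) ->
  rectI f a b c d = 0.
Proof.
move=> ab cd hf.
have hc : contR f a b c d by move=> x y hx hy; have [l /cder_cont] := hf x y hx hy.
apply/eqP; rewrite -modC_eq0; apply/eqP/le_anti; rewrite modC_ge0 andbT.
apply/ler_addgt0Pl => e e0; rewrite addr0.
pose s := (b - a) + (d - c).
have s0 : 0 <= s by rewrite /s; lra.
pose E := e / (s ^+ 2 + 1).
have s21 : 0 < s ^+ 2 + 1 by rewrite ltr_wpDl ?sqr_ge0.
have E0 : 0 < E by rewrite divr_gt0.
have : a <= a -> b <= b -> c <= c -> d <= d ->
   modC (rectI f a b c d) <= E * ((b - a) + (d - c)) ^+ 2.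
  (* Inclusion in the original rectangle is part of [P], since it is what makes [f] continuous on
     the smaller ones. *)
  pose P a' b' c' d' := a <= a' -> b' <= b -> c <= c' -> d' <= d ->
    modC (rectI f a' b' c' d') <= E * ((b' - a') + (d' - c')) ^+ 2.
  apply: (@rect_ind _ P) => //.
  - move=> a' b' c' d' ab' cd' p1 p2 p3 p4 A1 A2 A3 A4.
    rewrite (@rectI_split _ _ _ _ _ ((a' + b') / 2) ((c' + d') / 2)); try lra; last first.
      exact: contRW hc.
    have h1 : modC (rectI f a' ((a' + b') / 2) c' ((c' + d') / 2)) <=
      E * ((b' - a') + (d' - c')) ^+ 2 / 4.
      by apply: le_trans (p1 _ _ _ _) _; [lra..|apply: le_of_eq; field].
    have h2 : modC (rectI f ((a' + b') / 2) b' c' ((c' + d') / 2)) <=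
      E * ((b' - a') + (d' - c')) ^+ 2 / 4.
      by clear h1; apply: le_trans (p2 _ _ _ _) _; [lra..|apply: le_of_eq; field].
    have h3 : modC (rectI f a' ((a' + b') / 2) ((c' + d') / 2) d') <=
      E * ((b' - a') + (d' - c')) ^+ 2 / 4.
      by clear h1 h2; apply: le_trans (p3 _ _ _ _) _; [lra..|apply: le_of_eq; field].
    have h4 : modC (rectI f ((a' + b') / 2) b' ((c' + d') / 2) d') <=
      E * ((b' - a') + (d' - c')) ^+ 2 / 4.
      by clear h1 h2 h3; apply: le_trans (p4 _ _ _ _) _; [lra..|apply: le_of_eq; field].
    set I1 := rectI _ _ _ _ _; set I2 := rectI _ _ _ _ _; set I3 := rectI _ _ _ _ _; set I4 := rectI _ _ _ _ _.
    have t1 := modCD (I1 + I2 + I3) I4; have t2 := modCD (I1 + I2) I3; have t3 := modCD I1 I2.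
    move: h1 h2 h3 h4; rewrite -/I1 -/I2 -/I3 -/I4 => h1 h2 h3 h4.
    by clearbody I1 I2 I3 I4; move: h1 h2 h3 h4 t1 t2 t3; move: (E * _) => S; clear; lra.
  - move=> x y hx hy; have [l /cderP hl] := hf x y hx hy.
    (* The quarter cancels the factor 4 of [rectI_le]. *)
    have E4 : 0 < E / 4 by rewrite divr_gt0.
    have [del del0 hdel] := hl _ E4.
    exists (del / 2); first by rewrite divr_gt0.
    move=> a' b' c' d' A1 A2 A3 A4 A5 A6 A7 A8 A9 A10 _ _ _ _.
    pose z : C := Complex x y; pose g w := f w - (f z + l * (w - z)).
    have ab' : a' <= b' by lra.
    have cd' : c' <= d' by lra.
    have hcf : contR f a' b' c' d' by apply: contRW hc; clear -A1 A2 A3 A4 A5 A6 A7 A8 A9; lra.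
    have hca : contR (fun w => f z + l * (w - z)) a' b' c' d'.
      move=> x' y' _ _; apply: (@cder_cont _ _ _ (0 + (0 * (Complex x' y' - z) + l * (1 - 0)))).
      apply: cderD; first exact: cder_cst.
      apply: (@cderM _ (fun=> l) (fun w => w - z)); first exact: cder_cst.
      by apply: cderB; [exact: cder_id|exact: cder_cst].
    have hcg : contR g a' b' c' d'.
      by move=> x' y' hx' hy'; apply: continuousB; [exact: hcf|exact: hca].
    have -> : f = (fun w => g w + (f z + l * (w - z))).
      by apply/funext => w; rewrite /g subrK.
    rewrite rectID// rectI_affine// addr0.
    pose s' := (b' - a') + (d' - c').
    have := @rectI_le g a' b' c' d' (E / 4 * s') ab' cd' hcg.
    rewrite (_ : 4 * (E / 4 * s') * (b' - a' + (d' - c')) = E * s' ^+ 2); last first.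
      by rewrite -/s' expr2; field.
    apply=> x' y' /andP[X1 X2] /andP[Y1 Y2].
    have wz : modC (Complex x' y' - z) <= s'.
      apply: le_trans (modC_le_ReIm _) _ => /=.
      by clear -A2 A3 A6 A7 X1 X2 Y1 Y2; rewrite /s' lerD// ler_norml; apply/andP; split; lra.
    have := hdel (Complex x' y'); rewrite -/z => hh.
    rewrite /g opprD addrA; apply: le_trans (hh _) _.
      by apply: le_lt_trans wz _; rewrite /s'; lra.
    by rewrite ler_wpM2l// ltW.
move=> /(_ (lexx _) (lexx _) (lexx _) (lexx _)) h; apply: le_trans h _.
by rewrite -/s /E mulrAC ler_pdivrMr// ler_wpM2l ?ltW//; lra.
Qed.

End Goursat.

(** * The chain rule and the complex exponential *)

Section ComplexExp.
Variable R : realType.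
Local Notation C := (CC R).

Lemma cder_comp (f g : C -> C) z d e : cder f (g z) d -> cder g z e ->
  cder (f \o g) z (d * e).
Proof.
move=> /cderP hf hg0; have /cderP hg := hg0; apply/cderP => eps eps0.
have M0 : 0 < modC e + 1 by have := modC_ge0 e; lra.
have N0 : 0 < modC d + 1 by have := modC_ge0 d; lra.
have e1 : 0 < eps / 2 / (modC e + 1) by rewrite !divr_gt0.
have e2 : 0 < eps / 2 / (modC d + 1) by rewrite !divr_gt0.
have [d1 d10 h1] := hf _ e1.
have [d2 d20 h2] := hg _ e2.
have [d3 d30 h3] := hg _ ltr01.
have [d4 d40 h4] := (ccontP g z).1 (cder_cont hg0) _ d10.
exists (Num.min (Num.min d2 d3) d4); first by rewrite !lt_min d20 d30 d40.
move=> s; rewrite !lt_min => /andP[/andP[/h2 a2 /h3 a3] /h4 a4] /=.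
have := h1 _ a4; set D := g s - g z => a1.
have D1 : modC D <= (modC e + 1) * modC (s - z).
  rewrite -[D](subrK (e * (s - z))); apply: le_trans (modCD _ _) _.
  by rewrite modCM mulrDl addrC mul1r lerD2l; move: a3; rewrite mul1r.
have -> : f (g s) - f (g z) - d * e * (s - z) =
  (f (g s) - f (g z) - d * D) + d * (D - e * (s - z)) by ring.
apply: le_trans (modCD _ _) _; rewrite modCM.
have b1 : modC (f (g s) - f (g z) - d * D) <= eps / 2 * modC (s - z).
  apply: le_trans a1 _; apply: le_trans (ler_wpM2l (ltW e1) D1) _.
  by rewrite mulrA divfK ?gt_eqF.
have b2 : modC d * modC (D - e * (s - z)) <= eps / 2 * modC (s - z).
  apply: (@le_trans _ _ ((modC d + 1) * (eps / 2 / (modC d + 1) * modC (s - z)))).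
    by apply: ler_pM => //; rewrite ?modC_ge0//; lra.
  by rewrite mulrA mulrCA divff ?gt_eqF// mulr1.
lra.
Qed.

Definition expi (t : R) : C := Complex (cos t) (sin t).

Lemma modC_expi t : modC (expi t) = 1.
Proof. by rewrite /modC /= cos2Dsin2 sqrtr1. Qed.

Lemma expiD s t : expi (s + t) = expi s * expi t.
Proof. by apply: Ceq; rewrite ?ReMul ?ImMul /= ?cosD ?sinD; ring. Qed.

Lemma expi2pi t : expi (t + pi *+ 2) = expi t.
Proof. by rewrite /expi cosD2pi sinD2pi. Qed.

Definition cexp (s : C) : C := toC (expR (complex.Re s)) * expi (complex.Im s).

Lemma toCM x y : toC (x * y) = toC x * toC y :> C.
Proof. by apply: Ceq; rewrite /=; ring. Qed.

Lemma toCD x y : toC (x + y) = toC x + toC y :> C.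
Proof. by apply: Ceq; rewrite /=; ring. Qed.

Lemma toCV x : toC x^-1 = (toC x)^-1 :> C.
Proof. exact: (fmorphV (real_complex R)). Qed.

Lemma toCN x : toC (- x) = - toC x :> C.
Proof. by apply: Ceq; rewrite /=; ring. Qed.

Lemma cexpD (s t : C) : cexp (s + t) = cexp s * cexp t.
Proof. by rewrite /cexp ReD ImD expRD toCM expiD; ring. Qed.

Lemma modC_cexp s : modC (cexp s) = expR (complex.Re s).
Proof. by rewrite /cexp modCM modC_expi mulr1 modC_toC ger0_norm// ltW// expR_gt0. Qed.

(** Only the origin requires an estimate; the addition theorem [cexpD] carries the derivative to
    every other point. *)
Lemma cder_cexp0 : cder cexp 0 1.
Proof.
have /is_derive1P hx := is_derive_expR (0 : R).
have /is_derive1P hs := is_derive_sin (0 : R).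
have /is_derive1P hc := is_derive_cos (0 : R).
have hcont : {for (0 : R), continuous (@expR R)} by exact: continuous_expR.
apply/cderP => e e0.
(* Six errors of size [e1 * modC w] are summed at the end. *)
pose e1 := Num.min 1 (e / 7).
have e10 : 0 < e1 by rewrite lt_min ltr01 divr_gt0.
have e11 : e1 <= 1 by rewrite ge_min lexx.
have e17 : e1 <= e / 7 by rewrite ge_min lexx orbT.
have [d1 d10 h1] := hx _ e10.
have [d2 d20 h2] := hs _ e10.
have [d3 d30 h3] := hc _ e10.
have : \forall x \near (0 : R), `|expR 0 - expR x| <= e1.
  by have /cvgrPdist_le := hcont; apply.
move=> /nbhs_ballP[d4 /= d40 h4].
exists (Num.min (Num.min d1 d2) (Num.min d3 d4)).
  by rewrite !lt_min d10 d20 d30 d40.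
move=> w; rewrite !subr0 !lt_min => /andP[/andP[w1 w2] /andP[w3 w4]].
set x := complex.Re w; set y := complex.Im w.
have rx := ReM_le w; have ry := ImM_le w; rewrite -/x -/y in rx ry.
have H1 : `|expR x - 1 - x| <= e1 * `|x|.
  by have := h1 x; rewrite !subr0 expR0 mul1r; apply; exact: le_lt_trans rx w1.
have H2 : `|sin y - y| <= e1 * `|y|.
  by have := h2 y; rewrite !subr0 sin0 cos0 mul1r subr0; apply; exact: le_lt_trans ry w2.
have H3 : `|cos y - 1| <= e1 * `|y|.
  have := h3 y; rewrite !subr0 sin0 cos0 oppr0 mul0r subr0; apply; exact: le_lt_trans ry w3.
have H4 : `|expR x - 1| <= e1.
  have := h4 x; rewrite /ball /= sub0r normrN expR0 distrC; apply; exact: le_lt_trans rx w4.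
set Z := cexp w - cexp 0 - _; have -> : Z =
  toC (expR x - 1 - x) + toC (expR x) * (toC (cos y - 1) + Ci R * toC (sin y - y))
  + toC (expR x - 1) * (Ci R * toC y).
  rewrite /Z mul1r /cexp -/x -/y /expi; apply: Ceq; rewrite !(ReD, ImD, ReN, ImN, ReMul, ImMul) /=.
    by rewrite expR0 cos0 sin0 -/x; ring.
  by rewrite expR0 cos0 sin0 -/y; ring.
apply: le_trans (modCD _ _) _; rewrite !modCM modC_Ci mul1r !modC_toC.
have b1 : modC (toC (expR x - 1 - x) + toC (expR x) * (toC (cos y - 1) + Ci R * toC (sin y - y)))
   <= e1 * `|x| + 2 * (e1 * `|y| + e1 * `|y|).
  apply: le_trans (modCD _ _) _; rewrite modC_toC; apply: lerD; first exact: H1.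
  rewrite modCM.
  have ex2 : modC (toC (expR x)) <= 2.
    by clear -H4 e11; rewrite modC_toC; have := H4; rewrite !ler_norml => /andP[? ?]; apply/andP; split; lra.
  apply: ler_pM; rewrite ?modC_ge0//.
  by apply: le_trans (modCD _ _) _; rewrite modCM modC_Ci mul1r !modC_toC lerD.
have b2 : `|expR x - 1| * `|y| <= e1 * `|y| by rewrite ler_wpM2r.
have b3 : e1 * `|x| <= e1 * modC w by rewrite ler_wpM2l// ltW.
have b4 : e1 * `|y| <= e1 * modC w by rewrite ler_wpM2l// ltW.
have b5 : e1 * modC w <= e / 7 * modC w by rewrite ler_wpM2r ?modC_ge0.
have p5 : 0 <= e1 * modC w by rewrite mulr_ge0 ?modC_ge0// ltW.
clear -b1 b2 b3 b4 b5 p5; lra.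
Qed.

Lemma cder_cexp s : cder cexp s (cexp s).
Proof.
have h : cder (fun w => cexp s * cexp (- s + 1 * w)) s (cexp s).
  have h0 : cder cexp (- s + 1 * s) 1 by rewrite mul1r addNr; exact: cder_cexp0.
  have := cderM (cder_cst (cexp s) s) (cder_affine_comp h0).
  by rewrite /cder => h1; apply: is_derive_eq h1 _; ring.
apply: cder_near h; apply/nbhsC; exists 1 => // w _.
by rewrite -cexpD mul1r addrA subrr add0r.
Qed.

End ComplexExp.

(** * Means over circles *)

Section CircleMeans.
Variable R : realType.
Local Notation C := (CC R).
Implicit Types (f g : C -> C) (r : R) (u : C -> R).

Definition pt r t : C := toC r * expi t.
(** This is the contour integral of [f w / w] divided by 2 pi i, which is why Cauchy's kernel takes
    the form [w / (w - z)] below. *)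
Definition cmean r f : C := toC ((2 * pi)^-1) * cint 0 (2 * pi) (fun t => f (pt r t)).
Definition rmean r u : R := (2 * pi)^-1 * rint 0 (2 * pi) (fun t => u (pt r t)).

Definition circ_cont r (T : topologicalType) (f : C -> T) :=
  forall z, modC z = r -> {for z, continuous f}.

Lemma modC_pt r t : 0 <= r -> modC (pt r t) = r.
Proof. by move=> r0; rewrite modCM modC_expi mulr1 modC_toC ger0_norm. Qed.

Lemma twopi_gt0 : 0 < 2 * pi :> R.
Proof. by rewrite mulr_gt0// pi_gt0. Qed.

Lemma continuous_pt r : continuous (pt r).
Proof.
move=> t; apply: (@continuousM _ _ (fun=> toC r) (@expi R)); first exact: cst_continuous.
by apply: cont_Complex; [exact: continuous_cos|exact: continuous_sin].
Qed.

Lemma circ_contI r (T : topologicalType) (f : C -> T) (a b : R) :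
  0 <= r -> circ_cont r f -> contI a b (fun t => f (pt r t)).
Proof.
move=> r0 h t _; apply: (@continuous_comp _ _ _ (pt r) f); first exact: continuous_pt.
by apply: h; rewrite modC_pt.
Qed.

Lemma cmeanD r f g : 0 <= r -> circ_cont r f -> circ_cont r g ->
  cmean r (fun z => f z + g z) = cmean r f + cmean r g.
Proof. by move=> r0 hf hg; rewrite /cmean cintD ?mulrDr//; exact: circ_contI. Qed.

Lemma cmeanZ r c f : 0 <= r -> circ_cont r f ->
  cmean r (fun z => c * f z) = c * cmean r f.
Proof. by move=> r0 hf; rewrite /cmean (cintZ _ (circ_contI r0 hf)) mulrCA. Qed.

Lemma eq_cmean r f g : 0 <= r -> (forall z, modC z = r -> f z = g z) ->
  cmean r f = cmean r g.
Proof. by move=> r0 h; congr (_ * _); apply: eq_cint => t _; rewrite h// modC_pt. Qed.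

Lemma cmean_cst r c : cmean r (fun=> c) = c.
Proof.
have := twopi_gt0 => h; rewrite /cmean (cint_cst _ (ltW h)) subr0 mulrC -mulrA -toCM.
by rewrite divff ?gt_eqF// mulr1.
Qed.

Lemma rmeanD r u v : 0 <= r -> circ_cont r u -> circ_cont r v ->
  rmean r (fun z => u z + v z) = rmean r u + rmean r v.
Proof. by move=> r0 hf hg; rewrite /rmean rintD ?mulrDr//; exact: circ_contI. Qed.

Lemma rmeanZ r k u : 0 <= r -> circ_cont r u ->
  rmean r (fun z => k * u z) = k * rmean r u.
Proof. by move=> r0 hf; rewrite /rmean (rintZ _ (circ_contI r0 hf)) mulrCA. Qed.

Lemma eq_rmean r u v : 0 <= r -> (forall z, modC z = r -> u z = v z) ->
  rmean r u = rmean r v.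
Proof. by move=> r0 h; congr (_ * _); apply: eq_rint => t _; rewrite h// modC_pt. Qed.

Lemma rmean_cst r k : rmean r (fun=> k) = k.
Proof.
have := twopi_gt0 => h; rewrite /rmean (rint_cst _ (ltW h)) subr0 mulrCA.
by rewrite mulVf ?gt_eqF// mulr1.
Qed.

Lemma rmean_le r u v : 0 <= r -> circ_cont r u -> circ_cont r v ->
  (forall z, modC z = r -> u z <= v z) -> rmean r u <= rmean r v.
Proof.
move=> r0 hf hg h; have h' : 0 <= (2 * pi)^-1 :> R by rewrite invr_ge0 ltW// twopi_gt0.
rewrite /rmean (ler_wpM2l h')//; apply: rint_le.
- exact: circ_contI.
- exact: circ_contI.
- by move=> t _; apply: h; rewrite modC_pt.
Qed.

Lemma Re_cmean r f : 0 <= r -> circ_cont r f ->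
  complex.Re (cmean r f) = rmean r (fun z => complex.Re (f z)).
Proof. by move=> r0 _; rewrite /cmean ReMul /= mul0r subr0. Qed.

Lemma cmean_conj r f : 0 <= r -> circ_cont r f ->
  cmean r (fun z => conjc (f z)) = conjc (cmean r f).
Proof.
move=> r0 hf; have hI := contI_Im (circ_contI (a := 0) (b := 2 * pi) r0 hf).
rewrite /cmean; apply: Ceq; rewrite !(ReMul, ImMul) /= !mul0r ?subr0 ?addr0.
  rewrite ?subr0; congr (_ * _); apply: eq_rint => t _; by case: (f _).
rewrite -mulrN; congr (_ * _); rewrite -mulN1r -rintZ//; apply: eq_rint => t _.
by case: (f _) => ? ? /=; rewrite mulN1r.
Qed.

(** The exponential maps the rectangle [[ln r1, ln r2] x [0, 2 pi]] onto the annulus. In Goursat's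
    theorem for [f \o cexp] the horizontal sides cancel by periodicity, and the vertical sides are
    the two means. *)
Lemma cmean_annulus r1 r2 f : 0 < r1 -> r1 <= r2 ->
  (forall z, r1 <= modC z <= r2 -> exists l, cder f z l) -> cmean r1 f = cmean r2 f.
Proof.
move=> r10 r12 hf; have r20 : 0 < r2 by exact: lt_le_trans r12.
have l12 : ln r1 <= ln r2 by rewrite ler_ln ?posrE.
have tp := @twopi_gt0.
have := @goursat R (f \o @cexp R) (ln r1) (ln r2) 0 (2 * pi) l12 (ltW tp).
have hpt r t : 0 < r -> cexp (Complex (ln r) t) = pt r t.
  by move=> r0; rewrite /cexp /= lnK.
move=> /(_ _)/wrap[].
  move=> x y /andP[x1 x2] _; have [|l hl] := hf (cexp (Complex x y)).
    rewrite modC_cexp /= -[r1]lnK ?posrE// -[X in _ <= _ <= X]lnK ?posrE//.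
    by rewrite !ler_expR x1.
  by exists (l * cexp (Complex x y)); apply: cder_comp hl _; exact: cder_cexp.
rewrite /rectI.
have -> : cint (ln r1) (ln r2) (fun x => (f \o @cexp R) (Complex x 0)) =
   cint (ln r1) (ln r2) (fun x => (f \o @cexp R) (Complex x (2 * pi))).
  have E : expi (2 * pi) = expi 0 :> C.
    by rewrite -[RHS]expi2pi add0r mulr_natl.
  by apply: eq_cint => t _; rewrite [LHS]/= [RHS]/= /cexp E.
set I := cint (ln r1) _ _; set A := cint _ _ _; set B := cint _ _ _.
have -> : I + Ci R * A - I - Ci R * B = Ci R * (A - B) by ring.
rewrite {}/A {}/B.
move/eqP; rewrite mulf_eq0 -modC_eq0 modC_Ci oner_eq0 subr_eq0 => /eqP h.
rewrite /cmean; congr (_ * _).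
have e r : 0 < r -> cint 0 (2 * pi) (fun y => (f \o @cexp R) (Complex (ln r) y)) =
  cint 0 (2 * pi) (fun t => f (pt r t)).
  by move=> r0; apply: eq_cint => t _ /=; rewrite hpt.
exact: (etrans (esym (e r1 r10)) (etrans (esym h) (e r2 r20))).
Qed.

End CircleMeans.

(** * Mean value property and Cauchy's formula *)

Section CauchyFormula.
Variable R : realType.
Local Notation C := (CC R).
Implicit Types (f g : C -> C) (r : R) (z w : C).

Definition hol_on (r : R) f := forall z, modC z < r -> exists l, cder f z l.

Lemma hol_on_cont r f z : hol_on r f -> modC z < r -> {for z, continuous f}.
Proof. by move=> h /h[l /cder_cont]. Qed.

(** Uniformity in the angle is obtained from [rect_ind] on the degenerate rectangle [[0, 2 pi] x
    {0}]. *)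
Lemma cmean_continuous f r0 (e : R) : 0 <= r0 -> 0 < e -> circ_cont r0 f ->
  exists2 d : R, 0 < d & forall r, 0 <= r -> circ_cont r f -> `|r - r0| < d ->
    modC (cmean r f - cmean r0 f) <= e.
Proof.
move=> r00 e0 hf; have e2 : 0 < e / 2 by rewrite divr_gt0.
have tp := @twopi_gt0 R.
pose P (a b c d : R) := exists2 d : R, 0 < d & forall r t, `|r - r0| < d -> a <= t <= b ->
  modC (f (pt r t) - f (pt r0 t)) <= e / 2.
have : P 0 (2 * pi) 0 0.
  apply: rect_ind => //; first exact: ltW.
  - move=> a b c d ab cd [d1 d10 h1] [d2 d20 h2] _ _.
    exists (Num.min d1 d2); first by rewrite lt_min d10.
    move=> r t; rewrite lt_min => /andP[r1 r2] /andP[ta tb].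
    have [tm|tm] := leP t ((a + b) / 2); first by apply: h1 => //; rewrite ta.
    by apply: h2 => //; rewrite (ltW tm).
  - move=> x y hx hy; have e4 : 0 < e / 4 by rewrite divr_gt0.
    have [d1 d10 h1] := (ccontP f (pt r0 x)).1 (hf _ (modC_pt x r00)) _ e4.
    have d12 : 0 < d1 / 2 by rewrite divr_gt0.
    have [d2 d20 h2] := (pcontP (@expi R) x).1
       (cont_Complex (@continuous_cos R x) (@continuous_sin R x)) _
       (divr_gt0 d12 (ltr_wpDl r00 ltr01)).
    exists (Num.min d2 (d1 / 2)); first by rewrite lt_min d20.
    move=> a b c d a0 ax xb b2 c0 cy yd d0; rewrite !lt_min => /andP[ba _] _.
    exists (d1 / 2) => // r t hr /andP[ta tb].
    have tx : modC (expi t - expi x) < d1 / 2 / (r0 + 1).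
      by apply: h2; rewrite ltr_norml; apply/andP; split; lra.
    have k1 : modC (pt r0 t - pt r0 x) < d1 / 2.
      rewrite /pt -mulrBr modCM modC_toC ger0_norm//.
      move: tx; rewrite ltr_pdivlMr ?ltr_wpDl// => tx; apply: le_lt_trans tx.
      by rewrite mulrC ler_wpM2l ?modC_ge0//; lra.
    have k2 : modC (pt r t - pt r0 t) < d1 / 2.
      by rewrite /pt -mulrBl modCM modC_expi mulr1 -toCN -toCD modC_toC.
    have k3 : modC (f (pt r t) - f (pt r0 x)) < e / 4.
      by apply: h1; apply: le_lt_trans (modC_tri _ _ (pt r0 t)) _; lra.
    have k4 : modC (f (pt r0 x) - f (pt r0 t)) < e / 4.
      by rewrite modCB; apply: h1; lra.
    by apply: le_trans (modC_tri _ _ (f (pt r0 x))) _; lra.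
move=> [d d0 hd]; exists d => // r r0' hr rd.
rewrite /cmean -mulrBr.
have c1 : contI 0 (2 * pi) (fun t => f (pt r t)) by exact: circ_contI.
have c2 : contI 0 (2 * pi) (fun t => - 1 * f (pt r0 t)).
  move=> t ht; apply: continuousM; first exact: cst_continuous.
  exact: (circ_contI r00 hf ht).
have -> : cint 0 (2 * pi) (fun t => f (pt r t)) - cint 0 (2 * pi) (fun t => f (pt r0 t)) =
   cint 0 (2 * pi) (fun t => f (pt r t) + -1 * f (pt r0 t)).
  by rewrite (cintD c1 c2) (cintZ _ (circ_contI r00 hf)) mulN1r.
have h' : 0 <= (2 * pi)^-1 :> R by rewrite invr_ge0 ltW.
rewrite modCM modC_toC (ger0_norm h') ler_pdivrMl//.
have c3 : contI 0 (2 * pi) (fun t => f (pt r t) + -1 * f (pt r0 t)).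
  by move=> t ht; apply: continuousD; [exact: c1|exact: c2].
apply: le_trans (@cint_le _ _ _ _ (e / 2) (ltW tp) c3 _) _.
  by move=> t ht; rewrite mulN1r; exact: hd.
by rewrite subr0; lra.
Qed.

(** A point [z0] of mere continuity is allowed, because Cauchy's formula applies this to a
    difference quotient. The mean is constant on either side of the circle through [z0] and
    continuous across it, and tends to [f 0] as the radius shrinks. *)
Lemma mean_value f r R0 z0 : 0 <= r -> r < R0 ->
  (forall z, modC z < R0 -> {for z, continuous f}) ->
  (forall z, modC z < R0 -> z != z0 -> exists l, cder f z l) ->
  cmean r f = f 0.
Proof.
move=> r0 rR hc hd.
have cc s : s < R0 -> circ_cont s f by move=> sR z zs; apply: hc; rewrite zs.
have m0 : cmean 0 f = f 0.
  rewrite -[RHS](cmean_cst 0); apply: eq_cmean => // z /eqP; rewrite modC_eq0 => /eqP ->.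
  by [].
pose p := modC z0.
have ann s t : 0 < s -> s <= t -> t < R0 -> (t < p \/ p < s) -> cmean s f = cmean t f.
  move=> s0 st tR h; apply: cmean_annulus => // z /andP[zs zt].
  apply: hd; first exact: le_lt_trans tR.
  by apply/eqP => zz; move: h zs zt; rewrite zz -/p; lra.
have close (a b : C) : (forall e : R, 0 < e -> modC (a - b) <= e) -> a = b.
  move=> h; apply/eqP; rewrite -subr_eq0 -modC_eq0; apply/eqP/le_anti.
  by rewrite modC_ge0 andbT; apply/ler_addgt0Pl => e e0; rewrite addr0 h.
have lt_p s : 0 < s -> s < p -> s < R0 -> cmean s f = f 0.
  move=> s0 sp sR; rewrite -m0; apply: close => e e0.
  have [d d00 hdd] := @cmean_continuous f 0 e (lexx _) e0 (cc 0 (lt_trans s0 sR)).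
  pose q := Num.min s (d / 2).
  have q0 : 0 < q by rewrite lt_min s0 divr_gt0.
  have qs : q <= s by rewrite ge_min lexx.
  have qd : q <= d / 2 by rewrite ge_min lexx orbT.
  rewrite -(ann q s)//; last by left.
  apply: hdd; [exact: ltW | apply: cc; lra | ].
  by rewrite subr0 gtr0_norm//; lra.
have eq_p : p < R0 -> cmean p f = f 0.
  move=> pR; have [<-//|pn0] := eqVneq 0 p.
  have p0 : 0 < p by rewrite lt_neqAle pn0 modC_ge0.
  apply: close => e e0.
  have [d d00 hdd] := @cmean_continuous f p e (modC_ge0 _) e0 (cc p pR).
  pose q := Num.max (p / 2) (p - d / 2).
  have q1 : p / 2 <= q by rewrite le_max lexx.
  have q2 : p - d / 2 <= q by rewrite le_max lexx orbT.
  have q3 : q < p by rewrite gt_max; apply/andP; split; lra.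
  rewrite -(lt_p q); [|lra..]; rewrite modCB.
  apply: hdd; [lra| by apply: cc; lra|].
  by rewrite ltr_norml; apply/andP; split; lra.
have [rp|pr|rp] := ltgtP r p.
- move: r0; rewrite le_eqVlt => /predU1P[<-//|r0]; exact: lt_p.
- have pR : p < R0 by lra.
  rewrite -(eq_p pR); apply: close => e e0.
  have [d d00 hdd] := @cmean_continuous f p e (modC_ge0 _) e0 (cc p pR).
  pose q := Num.min r (p + d / 2).
  have q1 : q <= r by rewrite ge_min lexx.
  have q2 : q <= p + d / 2 by rewrite ge_min lexx orbT.
  have q3 : p < q by rewrite lt_min; apply/andP; split; lra.
  have q0 : 0 < q by apply: le_lt_trans q3; exact: modC_ge0.
  rewrite -(ann q r)//; last by right.
  apply: hdd; [lra| by apply: cc; lra|].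
  by rewrite ltr_norml; apply/andP; split; lra.
- by rewrite rp; apply: eq_p; rewrite -rp.
Qed.

Lemma mean_hol f r R0 : 0 <= r -> r < R0 -> hol_on R0 f -> cmean r f = f 0.
Proof.
move=> r0 rR h; apply: (@mean_value f r R0 0) => // z zR; last by move=> _; exact: h.
exact: hol_on_cont h zR.
Qed.

Lemma modC_conj z : modC (conjc z : C) = modC z.
Proof. by rewrite /modC; case: z => a b /=; rewrite sqrrN. Qed.

Lemma conjCM z w : conjc (z * w : C) = conjc z * conjc w :> C.
Proof. by case: z w => [a b] [a' b']; apply: Ceq; rewrite /=; ring. Qed.

Lemma conjCB z w : conjc (z - w : C) = conjc z - conjc w :> C.
Proof. by case: z w => [a b] [a' b']; apply: Ceq; rewrite /=; ring. Qed.

Lemma conj_circ w r : modC w = r -> w * conjc w = toC (r ^+ 2).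
Proof.
move=> <-; rewrite modC_sqr; case: w => a b; apply: Ceq; rewrite /=; ring.
Qed.

Lemma kernel_den z w r : modC z < r -> modC w = r -> w - z != 0.
Proof. by move=> zr wr; rewrite subr_eq0; apply/eqP => wz; move: zr; rewrite -wz wr ltxx. Qed.

Lemma cont_cderE f z : (exists l, cder f z l) -> {for z, continuous f}.
Proof. by move=> [l /cder_cont]. Qed.

Lemma cder_kernel z w : w - z != 0 -> cder (fun w => (w - z)^-1) w (- (w - z)^-2 * (1 - 0)).
Proof.
by move=> h; apply: cderV => //; apply: cderB; [exact: cder_id|exact: cder_cst].
Qed.

(* On |w| = r the kernel is the conjugate of a function of w holomorphic in a larger disc. *)
Lemma kernel_conj z w r : 0 < r -> modC z < r -> modC w = r ->
  w / (w - z) = conjc ((1 - conjc z / toC (r ^+ 2) * w)^-1 : C).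
Proof.
move=> r0 zr wr; have h := conj_circ wr; have wz := kernel_den zr wr.
have w0 : w != 0 by rewrite -modC_gt0 wr.
have cw0 : conjc w != 0 :> C by rewrite -modC_gt0 modC_conj wr.
have q0 : toC (r ^+ 2) != 0 by rewrite -h mulf_neq0.
have -> : conjc ((1 - conjc z / toC (r ^+ 2) * w)^-1 : C) =
    (1 - z / conjc (toC (r ^+ 2)) * conjc w)^-1 :> C.
  by rewrite conjc_inv conjCB conjCM conjCM conjc_inv conjcK conjc1.
have -> : conjc (toC (r ^+ 2)) = toC (r ^+ 2) :> C by apply: Ceq => //=; rewrite oppr0.
rewrite -h; have -> : 1 - z / (w * conjc w) * conjc w = (w - z) / w :> C.
  by field; rewrite w0 cw0.
by rewrite invf_div.
Qed.

Lemma dual_kernel_hol z r f R1 : 0 < r -> modC z < r -> r < R1 -> hol_on R1 f ->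
  exists2 R0, r < R0 & hol_on R0 (fun w => f w * (1 - conjc z / toC (r ^+ 2) * w)^-1).
Proof.
(* For [z != 0] the dual kernel has its pole at modulus [r ^+ 2 / modC z]; [R2] lies strictly
   between [r] and this value. *)
move=> r0 zr rR hf; pose R2 := 2 * r ^+ 2 / (r + modC z).
have rz : 0 < r + modC z by have := modC_ge0 z; lra.
have rR2 : r < R2.
  rewrite /R2 ltr_pdivlMr// mulrDr expr2 mulr_natl mulr2n ltrD2l.
  by rewrite ltr_pM2l.
exists (Num.min R1 R2); first by rewrite lt_min rR.
move=> w; rewrite lt_min => /andP[wR1 wR2].
have [l hl] := hf w wR1.
have hd : cder (fun w : C => 1 - conjc z / toC (r ^+ 2) * w) w
  (0 - (0 * w + conjc z / toC (r ^+ 2) * 1)).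
  apply: cderB; first exact: cder_cst.
  by apply: cderM; [exact: cder_cst|exact: cder_id].
have nz : 1 - conjc z / toC (r ^+ 2) * w != 0.
  rewrite subr_eq0; apply/eqP => /(congr1 (@modC R)).
  rewrite modC1 !modCM modCV modC_conj modC_toC ger0_norm ?sqr_ge0// => h.
  suff : modC z / r ^+ 2 * modC w < 1 by rewrite -h ltxx.
  rewrite mulrAC ltr_pdivrMr ?exprn_gt0// mul1r.
  have [->|z0] := eqVneq (modC z) 0; first by rewrite mul0r exprn_gt0.
  have z00 : 0 < modC z by rewrite lt_neqAle eq_sym z0 modC_ge0.
  apply: lt_le_trans (_ : modC z * R2 <= _); first by rewrite ltr_pM2l.
  rewrite /R2 mulrA ler_pdivrMr//.
  have h2 : 0 <= r ^+ 2 * (r - modC z) by rewrite mulr_ge0 ?sqr_ge0// subr_ge0 ltW.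
  by clear -h2; lra.
by eexists; apply: cderM; [exact: hl|apply: cderV; [exact: nz|exact: hd]].
Qed.

Lemma circ_cont_kernel z r : modC z < r -> circ_cont r (fun w => w / (w - z)).
Proof.
move=> zr w wr; apply: cont_cderE; eexists; apply: cderM; first exact: cder_id.
by apply: cder_kernel; exact: kernel_den wr.
Qed.

Lemma circ_contM r f g : circ_cont r f -> circ_cont r g -> circ_cont r (fun w => f w * g w).
Proof. by move=> hf hg w wr; apply: continuousM; [exact: hf|exact: hg]. Qed.

Lemma hol_circ_cont r R0 f : r < R0 -> hol_on R0 f -> circ_cont r f.
Proof. by move=> rR h z zr; apply: hol_on_cont h _; rewrite zr. Qed.

(** On the circle the integrand is the conjugate of a holomorphic function, so its mean is the
    conjugate of the value at 0. With [f = 1] this normalises the kernel; for general [f] it is the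
    second half of Schwarz's formula. *)
Lemma cmean_conj_kernel f z r R0 : 0 < r -> r < R0 -> modC z < r -> hol_on R0 f ->
  cmean r (fun w => conjc (f w) * (w / (w - z))) = conjc (f 0).
Proof.
move=> r0 rR zr hf; have [R2 rR2 hol] := dual_kernel_hol r0 zr rR hf.
have -> : cmean r (fun w => conjc (f w) * (w / (w - z))) =
   cmean r (fun w => conjc (f w * (1 - conjc z / toC (r ^+ 2) * w)^-1 : C)).
  apply: eq_cmean; first exact: ltW.
  by move=> w wr; rewrite (kernel_conj r0 zr wr) conjCM.
rewrite cmean_conj; [|exact: ltW|exact: hol_circ_cont hol].
by rewrite (mean_hol (ltW r0) rR2 hol) mulr0 subr0 invr1 mulr1.
Qed.

Lemma cmean_kernel z r : 0 < r -> modC z < r -> cmean r (fun w => w / (w - z)) = 1.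
Proof.
move=> r0 zr; have h1 : hol_on (r + 1) (fun=> 1) by move=> w _; exists 0; exact: cder_cst.
have E : conjc (1 : C) = 1 :> C by exact: conjc1.
have rr : r < r + 1 by lra.
rewrite -[RHS]E -(cmean_conj_kernel r0 rr zr h1).
by apply: eq_cmean => [|w _]; [exact: ltW|rewrite E mul1r].
Qed.

(** The mean value property for [w * (f w - f z) / (w - z)], which extends continuously to [z] and
    vanishes at 0. *)
Lemma cauchy_formula f z r R0 : 0 < r -> r < R0 -> modC z < r -> hol_on R0 f ->
  f z = cmean r (fun w => f w * (w / (w - z))).
Proof.
move=> r0 rR zr hf; have [l hl] := hf z (lt_trans zr rR).
pose G w := if w == z then l * z else (f w - f z) / (w - z) * w.
have G0 : G 0 = 0.
  rewrite /G; case: eqP => [<-|_]; by rewrite mulr0.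
have Gd w : modC w < R0 -> w != z -> exists l, cder G w l.
  move=> wR wz; have [l' hl'] := hf w wR.
  have wz0 : w - z != 0 by rewrite subr_eq0.
  have hk := cderM (cderM (cderB hl' (cder_cst (f z) w)) (cder_kernel wz0)) (cder_id w).
  eexists; apply: cder_near hk; apply/nbhsC; exists (modC (w - z)).
    by rewrite modC_gt0.
  by move=> v hv; rewrite /G; case: eqP => // vz; move: hv; rewrite vz modCB ltxx.
have Gc w : modC w < R0 -> {for w, continuous G}.
  move=> wR; have [->|wz] := eqVneq w z; last by apply: cont_cderE; exact: Gd.
  pose Q w := if w == z then l else (f w - f z) / (w - z).
  have GQ : G = fun w => Q w * w.
    by apply/funext => v; rewrite /G /Q; have [->|//] := eqVneq v z.
  rewrite GQ; apply: continuousM; last exact: cvg_id.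
  apply/ccontP => e e0; have e2 : 0 < e / 2 by rewrite divr_gt0.
  have /cderP /(_ _ e2) [d d0 hd] := hl; exists d => // v /hd hv.
  rewrite /Q eqxx; case: eqVneq => [_|vz]; first by rewrite subrr modC0.
  have vz0 : v - z != 0 by rewrite subr_eq0.
  have -> : (f v - f z) / (v - z) - l = (f v - f z - l * (v - z)) / (v - z).
    by field.
  apply: le_lt_trans (_ : e / 2 < _); last by lra.
  by rewrite modCM modCV ler_pdivrMr ?modC_gt0.
have := @mean_value G r R0 z (ltW r0) rR Gc Gd; rewrite G0.
have ck := circ_cont_kernel zr; have cf := hol_circ_cont rR hf.
have -> : cmean r G = cmean r (fun w => f w * (w / (w - z)) + (- f z) * (w / (w - z))).
  apply: eq_cmean => [|w wr]; first exact: ltW.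
  have wz0 := kernel_den zr wr.
  rewrite /G; case: eqP => [wz|_]; first by rewrite wz subrr eqxx in wz0.
  by field.
have r0' := ltW r0.
have cz : circ_cont r (fun=> - f z : C) by move=> w _; exact: cst_continuous.
rewrite (cmeanD r0'); first 1 last.
- exact: circ_contM cf ck.
- exact: circ_contM cz ck.
rewrite (cmeanZ _ r0' ck) cmean_kernel// mulr1 => /eqP.
by rewrite subr_eq0 => /eqP.
Qed.

End CauchyFormula.

(** * Cauchy-type integrals, derivatives and primitives *)

Section CauchyTransform.
Variable R : realType.
Local Notation C := (CC R).
Implicit Types (f g : C -> C) (r : R) (z w : C).

Lemma contI_bounded (a b : R) (u : R -> R) : a <= b -> contI a b u ->
  exists M, forall t, a <= t <= b -> u t <= M.
Proof.
move=> ab hu; have [t _ ht] := EVT_max ab (contI_within hu).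
by exists (u t) => s hs; apply: ht; rewrite in_itv.
Qed.

Lemma circ_bounded r (u : C -> R) : 0 <= r -> circ_cont r u ->
  exists M, forall t, 0 <= t <= 2 * pi -> u (pt r t) <= M.
Proof.
move=> r0 hu; have tp := ltW (@twopi_gt0 R).
exact: contI_bounded tp (circ_contI (a := 0) (b := 2 * pi) r0 hu).
Qed.

Lemma circ_cont_modC r f : circ_cont r f -> circ_cont r (fun z => modC (f z)).
Proof. by move=> h z /h hz; apply: continuous_comp hz _; exact: cont_modC. Qed.

Lemma cmean_le_pt r f M : 0 <= r -> circ_cont r f ->
  (forall t, 0 <= t <= 2 * pi -> modC (f (pt r t)) <= M) -> modC (cmean r f) <= 2 * M.
Proof.
move=> r0 hf hM; have h := @twopi_gt0 R.
have h' : 0 <= (2 * pi)^-1 :> R by rewrite invr_ge0 ltW.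
rewrite /cmean modCM modC_toC (ger0_norm h') ler_pdivrMl//.
apply: le_trans (cint_le _ _ hM) _; first exact: ltW.
- exact: circ_contI.
- by rewrite subr0 mulrC.
Qed.

Lemma cmeanB r f g : 0 <= r -> circ_cont r f -> circ_cont r g ->
  cmean r (fun z => f z - g z) = cmean r f - cmean r g.
Proof.
move=> r0 hf hg.
have cg : circ_cont r (fun z => -1 * g z).
  by move=> z zr; apply: continuousM; [exact: cst_continuous|exact: hg].
have := cmeanD r0 hf cg; rewrite (cmeanZ _ r0 hg) mulN1r => <-.
by apply: eq_cmean => // z _; rewrite mulN1r.
Qed.

(* A quadratic remainder estimate, uniform in the circle variable, passes to the mean. *)
Lemma cmean_quad r g (k k' : C -> C -> C) (rho M : R) : 0 <= r -> circ_cont r g ->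
  (forall z, modC z <= rho -> circ_cont r (k z)) ->
  (forall z, modC z <= rho -> circ_cont r (k' z)) ->
  (forall a c w, modC a <= rho -> modC c <= rho -> modC w = r ->
     modC (k c w - k a w - (c - a) * k' a w) <= M * modC (c - a) ^+ 2) ->
  exists2 K, 0 <= K & forall a c, modC a <= rho -> modC c <= rho ->
    modC (cmean r (fun w => g w * k c w) - cmean r (fun w => g w * k a w)
          - (c - a) * cmean r (fun w => g w * k' a w)) <= K * modC (c - a) ^+ 2.
Proof.
move=> r0 hg hk hk' hq; have [B hB] := circ_bounded r0 (circ_cont_modC hg).
exists (2 * (Num.max B 0 * Num.max M 0)); first by rewrite !mulr_ge0// le_max lexx orbT.
move=> a c ar cr.
have c1 := circ_contM hg (hk c cr); have c2 := circ_contM hg (hk a ar).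
have c3 := circ_contM hg (hk' a ar).
have c4 : circ_cont r (fun w => (c - a) * (g w * k' a w)).
  by move=> w wr; apply: continuousM; [exact: cst_continuous|exact: c3].
have c5 : circ_cont r (fun w => g w * k c w - g w * k a w).
  by move=> w wr; apply: continuousB; [exact: c1|exact: c2].
rewrite -(cmeanZ _ r0 c3) -(cmeanB r0 c1 c2) -(cmeanB r0 c5 c4) -mulrA.
apply: (cmean_le_pt r0).
  by move=> w wr; apply: continuousB; [exact: c5|exact: c4].
move=> t ht; set w := pt r t.
have -> : g w * k c w - g w * k a w - (c - a) * (g w * k' a w) =
  g w * (k c w - k a w - (c - a) * k' a w) by ring.
rewrite modCM -mulrA; apply: ler_pM; rewrite ?modC_ge0//.
  by rewrite le_max hB.
apply: le_trans (hq _ _ _ ar cr (modC_pt t r0)) _.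
by rewrite ler_wpM2r ?sqr_ge0// le_max lexx.
Qed.

Lemma cder_quad f z d (rho K : R) : modC z < rho -> 
  (forall c, modC c <= rho -> modC (f c - f z - (c - z) * d) <= K * modC (c - z) ^+ 2) ->
  cder f z d.
Proof.
move=> zr hK; apply/cderP => e e0.
have K0 : 0 < `|K| + 1 by have := normr_ge0 K; lra.
exists (Num.min (rho - modC z) (e / (`|K| + 1))).
  by rewrite lt_min subr_gt0 zr divr_gt0.
move=> w; rewrite lt_min => /andP[h1 h2].
rewrite [d * _]mulrC; apply: le_trans (hK _ _) _.
  by have := modC_triB w z; lra.
rewrite expr2 mulrA ler_wpM2r ?modC_ge0//.
move: h2; rewrite ltr_pdivlMr// => h2; apply: le_trans (ltW h2).
rewrite mulrC ler_wpM2l ?modC_ge0//.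
by have := ler_norm K; lra.
Qed.

Lemma dist_circ z w r rho : modC z <= rho -> modC w = r -> r - rho <= modC (w - z).
Proof. by move=> h1 h2; have := modC_triB w z; lra. Qed.

Lemma circ_cont_kerX z r n : modC z < r -> circ_cont r (fun w => (w - z)^-1 ^+ n).
Proof.
move=> zr w wr; apply: cont_cderE; eexists; apply: cderX.
by apply: cder_kernel; exact: kernel_den wr.
Qed.

Definition ctr (n : nat) r g z : C := cmean r (fun w => g w * (w - z)^-1 ^+ n).

Lemma ctr1_quad r g rho : 0 < r -> circ_cont r g -> rho < r ->
  exists2 K, 0 <= K & forall a c, modC a <= rho -> modC c <= rho ->
  modC (ctr 1 r g c - ctr 1 r g a - (c - a) * ctr 2 r g a) <= K * modC (c - a) ^+ 2.
Proof.
move=> r0 hg rr; pose D := r - rho; have D0 : 0 < D by rewrite /D; lra.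
apply: (@cmean_quad r g (fun z w => (w - z)^-1 ^+ 1) (fun z w => (w - z)^-1 ^+ 2)
  rho (D^-1 ^+ 3) (ltW r0) hg).
- by move=> z zr; apply: circ_cont_kerX; lra.
- by move=> z zr; apply: circ_cont_kerX; lra.
move=> a c w ar cr wr.
have wa := dist_circ ar wr; have wc := dist_circ cr wr.
have wa0 : w - a != 0 by rewrite -modC_gt0; rewrite -/D in wa; lra.
have wc0 : w - c != 0 by rewrite -modC_gt0; rewrite -/D in wc; lra.
have -> : (w - c)^-1 ^+ 1 - (w - a)^-1 ^+ 1 - (c - a) * (w - a)^-1 ^+ 2 =
  ((w - c)^-1 * (w - a)^-1 ^+ 2) * (c - a) ^+ 2 by field; rewrite wa0 wc0.
rewrite modCM [modC (_ ^+ 2)]modCX modCM modCX ler_wpM2r ?sqr_ge0// !modCV [leRHS]exprS.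
have ia : (modC (w - a))^-1 <= D^-1 by rewrite lef_pV2 ?posrE ?modC_gt0.
have ic : (modC (w - c))^-1 <= D^-1 by rewrite lef_pV2 ?posrE ?modC_gt0.
apply: ler_pM => //; rewrite ?exprn_ge0 ?invr_ge0 ?modC_ge0//.
by rewrite ler_pXn2r ?nnegrE ?invr_ge0 ?modC_ge0// ltW.
Qed.

Lemma cder_ctr1 r g z : 0 < r -> circ_cont r g -> modC z < r ->
  cder (ctr 1 r g) z (ctr 2 r g z).
Proof.
move=> r0 hg zr; pose rho := (modC z + r) / 2.
have [|K K0 hK] := @ctr1_quad r g rho r0 hg; first by rewrite /rho; lra.
apply: (@cder_quad _ _ _ rho K); first by rewrite /rho; lra.
by move=> c cr; apply: hK => //; rewrite /rho; lra.
Qed.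

Lemma cder_ctr2 r g z : 0 < r -> circ_cont r g -> modC z < r ->
  cder (ctr 2 r g) z (cmean r (fun w => g w * (2 * (w - z)^-1 ^+ 3))).
Proof.
move=> r0 hg zr; pose rho := (modC z + r) / 2.
pose D := r - rho; have D0 : 0 < D by rewrite /D /rho; lra.
have [|||||K K0 hK] := @cmean_quad r g (fun z w => (w - z)^-1 ^+ 2)
  (fun z w => 2 * (w - z)^-1 ^+ 3) rho (6 * r * D^-1 ^+ 5).
- exact: ltW.
- exact: hg.
- by move=> a ar; apply: circ_cont_kerX; move: ar; rewrite /rho; lra.
- move=> a ar w wr; apply: continuousM; first exact: cst_continuous.
  by apply: circ_cont_kerX wr; move: ar; rewrite /rho; lra.
- move=> a c w ar cr wr.
  have wa := dist_circ ar wr; have wc := dist_circ cr wr.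
  have wa0 : w - a != 0 by rewrite -modC_gt0; rewrite -/D in wa; lra.
  have wc0 : w - c != 0 by rewrite -modC_gt0; rewrite -/D in wc; lra.
  have -> : (w - c)^-1 ^+ 2 - (w - a)^-1 ^+ 2 - (c - a) * (2 * (w - a)^-1 ^+ 3) =
    ((w - a) + 2 * (w - c)) * ((w - c)^-1 ^+ 2 * (w - a)^-1 ^+ 3) * (c - a) ^+ 2.
    by field; rewrite wa0 wc0.
  rewrite modCM [modC ((c - a) ^+ 2)]modCX modCM [modC (_ * (_ ^+ 3))]modCM !modCX.
  rewrite ler_wpM2r ?sqr_ge0// !modCV.
  have ia : (modC (w - a))^-1 <= D^-1 by rewrite lef_pV2 ?posrE ?modC_gt0.
  have ic : (modC (w - c))^-1 <= D^-1 by rewrite lef_pV2 ?posrE ?modC_gt0.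
  have rr : rho < r by rewrite /rho; lra.
  apply: ler_pM => //; rewrite ?mulr_ge0 ?exprn_ge0 ?invr_ge0 ?modC_ge0//.
    apply: le_trans (modCD _ _) _; rewrite modCM modC_nat.
    have := modCD w (- a); have := modCD w (- c); rewrite !modCN wr.
    by clear -ar cr rr r0; lra.
  rewrite -[5%N]/(2 + 3)%N exprD.
  by apply: ler_pM; rewrite ?exprn_ge0 ?invr_ge0 ?modC_ge0// ler_pXn2r ?nnegrE ?invr_ge0 ?modC_ge0// ltW.
apply: (@cder_quad _ _ _ rho K); first by rewrite /rho; lra.
by move=> c cr; apply: hK => //; rewrite /rho; lra.
Qed.

Lemma cauchy_ctr f z r R0 : 0 < r -> r < R0 -> modC z < r -> hol_on R0 f ->
  f z = ctr 1 r (fun w => f w * w) z.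
Proof.
move=> r0 rR zr hf; rewrite (cauchy_formula r0 rR zr hf).
by apply: eq_cmean => [|w _]; [exact: ltW|rewrite expr1 mulrA].
Qed.

Lemma circ_cont_id r : circ_cont r (fun w : C => w).
Proof. by move=> w _; exact: cvg_id. Qed.

Lemma nbhs_disc z r : modC z < r -> \forall w \near z, modC w < r.
Proof.
move=> zr; apply/nbhsC; exists (r - modC z); first by rewrite subr_gt0.
by move=> w; have := modC_triB w z; lra.
Qed.

Lemma hol_deriv_ctr f z r R0 : 0 < r -> r < R0 -> modC z < r -> hol_on R0 f ->
  cder f z (ctr 2 r (fun w => f w * w) z).
Proof.
move=> r0 rR zr hf.
have cg : circ_cont r (fun w => f w * w).
  exact: circ_contM (hol_circ_cont rR hf) (circ_cont_id (r:=r)).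
apply: cder_near (cder_ctr1 r0 cg zr).
apply: filterS (nbhs_disc zr) => w wr.
by rewrite -(cauchy_ctr r0 rR wr hf).
Qed.

Lemma hol_on_pick (f : C -> C) z R0 : modC z < R0 -> exists2 r, 0 < r & modC z < r /\ r < R0.
Proof. by move=> h; have := modC_ge0 z => ?; exists ((modC z + R0) / 2); [|split]; lra. Qed.

(** By Cauchy's formula the derivative is the Cauchy-type integral [ctr 2], which can be
    differentiated under the integral once more. *)
Lemma hol_derive1 f R0 : hol_on R0 f -> hol_on R0 (derive1 f).
Proof.
move=> hf z zR; have [r r0 [zr rR]] := hol_on_pick f zR.
have cg : circ_cont r (fun w => f w * w).
  exact: circ_contM (hol_circ_cont rR hf) (circ_cont_id (r:=r)).
eexists; apply: cder_near (cder_ctr2 r0 cg zr).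
apply: filterS (nbhs_disc zr) => w wr.
by rewrite (cder_derive1 (hol_deriv_ctr r0 rR wr hf)).
Qed.

Lemma hol_quad f R0 rho : hol_on R0 f -> rho < R0 -> 
  exists2 K, 0 <= K & forall a c, modC a <= rho -> modC c <= rho ->
    modC (f c - f a - (c - a) * derive1 f a) <= K * modC (c - a) ^+ 2.
Proof.
move=> hf rR.
have [rho0|rho0] := ltP rho 0.
  by exists 0 => // a c ar; have := modC_ge0 a; lra.
pose r := (rho + R0) / 2.
have r0 : 0 < r by rewrite /r; lra.
have rr : rho < r by rewrite /r; lra.
have rR' : r < R0 by rewrite /r; lra.
have cg : circ_cont r (fun w => f w * w).
  exact: circ_contM (hol_circ_cont rR' hf) (circ_cont_id (r:=r)).
have [K K0 hK] := ctr1_quad r0 cg rr; exists K => // a c ar cr.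
have ar' : modC a < r by lra.
have cr' : modC c < r by lra.
rewrite (cauchy_ctr r0 rR' ar' hf) (cauchy_ctr r0 rR' cr' hf).
by rewrite (cder_derive1 (hol_deriv_ctr r0 rR' ar' hf)); exact: hK.
Qed.

(** The primitive is the integral of [K t z = z * f (t z)] over [0 <= t <= 1]. The z-derivative of
    [K] equals the t-derivative of [t * f (t z)], so it integrates to [f z]. *)
Lemma hol_primitive f R0 : hol_on R0 f ->
  exists F, forall z, modC z < R0 -> cder F z (f z).
Proof.
move=> hf; pose K t (w : C) := w * f (toC t * w).
exists (fun z => cint 0 1 (fun t => K t z)) => z zR.
pose K' t := f (toC t * z) + z * (toC t * derive1 f (toC t * z)).
have [r r0 [zr rR]] := hol_on_pick f zR.
have [Q Q0 hQ] := hol_quad hf rR.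
have tz t (w : C) : 0 <= t <= 1 -> modC (toC t * w) <= modC w.
  move=> /andP[t0 t1]; rewrite modCM modC_toC ger0_norm//.
  by rewrite ler_piMl// modC_ge0.
have contt (w : C) t : {for t, continuous (fun t => toC t * w)}.
  apply: continuousM; last exact: cst_continuous.
  by apply: cont_toC; exact: cvg_id.
have cK w : modC w < R0 -> contI 0 1 (fun t => K t w).
  move=> wR t ht; apply: continuousM; first exact: cst_continuous.
  apply: (@continuous_comp _ _ _ (fun t => toC t * w) f); first exact: contt.
  by apply: hol_on_cont hf _; apply: le_lt_trans (tz _ _ ht) _.
have cK' : contI 0 1 K'.
  move=> t ht; have tzR : modC (toC t * z) < R0 by apply: le_lt_trans (tz _ _ ht) _.
  apply: continuousD.
    apply: (@continuous_comp _ _ _ (fun t => toC t * z) f); first exact: contt.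
    exact: hol_on_cont hf _.
  apply: continuousM; first exact: cst_continuous.
  apply: continuousM; first by apply: cont_toC; exact: cvg_id.
  apply: (@continuous_comp _ _ _ (fun t => toC t * z) (derive1 f)); first exact: contt.
  exact: hol_on_cont (hol_derive1 hf) _.
have IK' : cint 0 1 K' = f z.
  rewrite (@cint_FTC _ _ _ (fun t => toC t * f (0 + z * toC t)))//.
    rewrite (_ : toC 1 = 1)// (_ : toC 0 = 0)//.
    by rewrite mul1r mulr1 add0r mul0r subr0.
  move=> t ht; have tzR : modC (toC t * z) < R0 by apply: le_lt_trans (tz _ _ ht) _.
  have hd : cder f (0 + z * toC t) (derive1 f (toC t * z)).
    have [l hl] := hf _ tzR.
    by rewrite add0r mulrC (cder_derive1 hl).
  have := pder_comp (V := fun t => 0 + z * toC t) hd (pder_affine 0 z t) => hp.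
  have hg : cder (fun w => w * f (0 + z * w)) (toC t)
      (1 * f (0 + z * toC t) + toC t * (derive1 f (toC t * z) * z)).
    by apply: cderM; [exact: cder_id | exact: (cder_affine_comp (a := 0) hd)].
  have ha := pder_affine 0 1 t.
  have hb : pder (fun s => toC s : C) t 1.
    move=> e e0; have [d d0 hh] := ha e e0; exists d => // s /hh.
    by rewrite !add0r !mul1r.
  have := pder_comp (V := fun s => toC s : C) hg hb.
  rewrite mulr1 mul1r (_ : _ + _ = K' t)//.
  by rewrite /K' add0r [z * toC t]mulrC; ring.
have cD : contI 0 1 (fun t => modC (derive1 f (toC t * z))).
  move=> t ht; apply: (@continuous_comp _ _ _ (fun t => derive1 f (toC t * z)) (@modC R)).
    apply: (@continuous_comp _ _ _ (fun t => toC t * z) (derive1 f)); first exact: contt.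
    by apply: hol_on_cont (hol_derive1 hf) _; apply: le_lt_trans (tz _ _ ht) _.
  exact: cont_modC.
have [B hB] := contI_bounded ler01 cD.
rewrite -IK'; apply: (@cder_quad _ _ _ r (2 * (r * Q + Num.max B 0))) => // c cr.
have cR : modC c < R0 by lra.
have k1 : contI 0 1 (fun t => - 1 * K t z).
  by move=> t ht; apply: continuousM; [exact: cst_continuous|exact: (cK z zR)].
have k2 : contI 0 1 (fun t => - (c - z) * K' t).
  by move=> t ht; apply: continuousM; [exact: cst_continuous|exact: cK'].
have k3 : contI 0 1 (fun t => K t c + - 1 * K t z).
  by move=> t ht; apply: continuousD; [exact: (cK c cR)|exact: k1].
have k4 : contI 0 1 (fun t => K t c + - 1 * K t z + - (c - z) * K' t).
  by move=> t ht; apply: continuousD; [exact: k3|exact: k2].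
have -> : cint 0 1 (fun t => K t c) - cint 0 1 (fun t => K t z) - (c - z) * cint 0 1 K' =
  cint 0 1 (fun t => K t c + - 1 * K t z + - (c - z) * K' t).
  by rewrite (cintD k3 k2) (cintD (cK c cR) k1) (cintZ _ (cK z zR)) (cintZ _ cK') mulN1r mulNr.
apply: le_trans (@cint_le _ _ _ _ ((r * Q + Num.max B 0) * modC (c - z) ^+ 2) ler01 k4 _) _.
  move=> t ht.
  have -> : K t c + -1 * K t z + - (c - z) * K' t =
    c * (f (toC t * c) - f (toC t * z) - (toC t * c - toC t * z) * derive1 f (toC t * z))
     + (c - z) ^+ 2 * (toC t * derive1 f (toC t * z)) by rewrite /K /K'; ring.
  have /andP[t0 t1] := ht.
  apply: le_trans (modCD _ _) _; rewrite [leRHS]mulrDl; apply: lerD.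
    rewrite modCM -mulrA; apply: ler_pM; rewrite ?modC_ge0//.
    apply: le_trans (hQ _ _ _ _) _.
    - by apply: le_trans (tz _ _ ht) _; exact: ltW.
    - by apply: le_trans (tz _ _ ht) _.
    rewrite -mulrBr ler_wpM2l// ler_pXn2r ?nnegrE ?modC_ge0//; exact: tz.
  rewrite modCM modCX mulrC ler_wpM2r ?sqr_ge0// modCM modC_toC ger0_norm//.
  apply: (@le_trans _ _ (modC (derive1 f (toC t * z)))); first by rewrite ler_piMl ?modC_ge0.
  by rewrite le_max hB.
by rewrite subr0 mulr1 mulrA.
Qed.

End CauchyTransform.

(** * Taylor expansion, orders and removable singularities *)

Section LocalTheory.
Variable R : realType.
Local Notation C := (CC R).
Implicit Types (f g : C -> C) (r : R) (a z w : C).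

Definition tcoef r f n : C := cmean r (fun w => f w * w^-1 ^+ n).
(** The Taylor remainder after [n] terms divided by [z ^+ n]. Being a Cauchy-type integral it is
    holomorphic even at 0. *)
Definition ttail r f n z : C := ctr 1 r (fun w => f w * w^-1 ^+ n * w) z.

Lemma circ_cont_invX r n : 0 < r -> circ_cont r (fun w : C => w^-1 ^+ n).
Proof.
move=> r0 w wr; apply: cont_cderE; eexists; apply: cderX; apply: cderV; last exact: cder_id.
by rewrite -modC_gt0 wr.
Qed.

Lemma circ_cont_tail r R0 f n : 0 < r -> r < R0 -> hol_on R0 f ->
  circ_cont r (fun w => f w * w^-1 ^+ n * w).
Proof.
move=> r0 rR hf; apply: circ_contM; last exact: circ_cont_id.
apply: circ_contM; [exact: hol_circ_cont hf|exact: circ_cont_invX].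
Qed.

Lemma ttailS r R0 f n z : 0 < r -> r < R0 -> modC z < r -> hol_on R0 f ->
  ttail r f n z = tcoef r f n + z * ttail r f n.+1 z.
Proof.
move=> r0 rR zr hf; have r0' := ltW r0.
have c1 : circ_cont r (fun w => f w * w^-1 ^+ n).
  by apply: circ_contM; [exact: hol_circ_cont hf|exact: circ_cont_invX].
have c2 : circ_cont r (fun w => f w * w^-1 ^+ n.+1 * w * (w - z)^-1 ^+ 1).
  apply: circ_contM; first exact: circ_cont_tail hf.
  exact: circ_cont_kerX.
have c3 : circ_cont r (fun w => z * (f w * w^-1 ^+ n.+1 * w * (w - z)^-1 ^+ 1)).
  by move=> w wr; apply: continuousM; [exact: cst_continuous|exact: c2].
rewrite /ttail /tcoef /ctr -(cmeanZ _ r0' c2) -(cmeanD r0' c1 c3).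
apply: eq_cmean => // w wr; have wz := kernel_den zr wr.
have w0 : w != 0 by rewrite -modC_gt0 wr.
by rewrite [w^-1 ^+ n.+1]exprS !expr1; field; rewrite wz w0.
Qed.

Lemma ttail0 r R0 f z : 0 < r -> r < R0 -> modC z < r -> hol_on R0 f ->
  f z = ttail r f 0 z.
Proof.
move=> r0 rR zr hf; rewrite (cauchy_ctr r0 rR zr hf) /ttail /ctr.
by apply: eq_cmean; [exact: ltW|move=> w _; rewrite expr0 mulr1].
Qed.

Lemma taylor_vanish r R0 f n z : 0 < r -> r < R0 -> modC z < r -> hol_on R0 f ->
  (forall j, (j < n)%N -> tcoef r f j = 0) -> f z = z ^+ n * ttail r f n z.
Proof.
move=> r0 rR zr hf; elim: n => [_|n ih h]; first by rewrite expr0 mul1r -(ttail0 r0 rR zr).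
rewrite ih; last by move=> j jn; apply: h; rewrite ltnS ltnW.
by rewrite (ttailS n r0 rR zr hf) h// add0r exprS; ring.
Qed.

Lemma ttail_le r R0 f : 0 < r -> r < R0 -> hol_on R0 f ->
  exists2 M, 0 <= M & forall n z, modC z <= r / 2 -> modC (ttail r f n z) <= M * r^-1 ^+ n.
Proof.
move=> r0 rR hf; have cf := hol_circ_cont rR hf.
have [B hB] := circ_bounded (ltW r0) (circ_cont_modC cf).
exists (2 * (Num.max B 0 * 2)); first by rewrite !mulr_ge0// le_max lexx orbT.
move=> n z zr; rewrite -mulrA; apply: (cmean_le_pt (ltW r0)).
  by apply: circ_contM; [exact: circ_cont_tail hf|apply: circ_cont_kerX; lra].
move=> t ht; have := hB t ht; have := modC_pt t (ltW r0); move: (pt r t) => w wr hBw.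
have d : r / 2 <= modC (w - z) by have := dist_circ zr wr; lra.
have d0 : 0 < modC (w - z) by lra.
rewrite expr1 !modCM modCX !modCV wr.
have -> : modC (f w) * r^-1 ^+ n * r / modC (w - z) =
  modC (f w) * (r / modC (w - z)) * r^-1 ^+ n by field; rewrite gt_eqF ?gt_eqF.
have rn : 0 <= r^-1 ^+ n by rewrite exprn_ge0// invr_ge0 ltW.
rewrite (ler_wpM2r rn)//; apply: ler_pM; rewrite ?modC_ge0//.
- by rewrite divr_ge0 ?modC_ge0// ltW.
- by rewrite le_max hBw.
- by rewrite ler_pdivrMr//; lra.
Qed.

(** If all Taylor coefficients vanish, [f] equals [z ^+ n] times its remainder for every [n], and is
    therefore [O(2^-n)] on a small disc. Otherwise the first nonzero coefficient gives the order,
    and the remainder gives the cofactor. *)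
Lemma hol_on_order f R0 : 0 < R0 -> hol_on R0 f ->
  (exists2 r, 0 < r & forall z, modC z < r -> f z = 0) \/
  (exists n g, [/\ (exists2 r, 0 < r & hol_on r g), g 0 != 0 &
     exists2 r, 0 < r & forall z, modC z < r -> f z = z ^+ n * g z]).
Proof.
move=> R00 hf; pose r := R0 / 2.
have r0 : 0 < r by rewrite /r; lra.
have rR : r < R0 by rewrite /r; lra.
have [h|/existsNP h] := pselect (forall n, tcoef r f n = 0).
  left; exists (r / 4); first by lra.
  move=> z zr; have [M M0 hM] := ttail_le r0 rR hf.
  have le n : modC (f z) <= M / 2 ^+ n.
    rewrite (@taylor_vanish r R0 f n z)//; [|lra].
    rewrite modCM modCX; apply: le_trans (ler_wpM2l _ (hM n z _)) _; [|lra|].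
      by rewrite exprn_ge0// modC_ge0.
    rewrite mulrCA -exprMn ler_wpM2l// -exprVn; apply: lerXn2r; rewrite ?nnegrE//.
    - by rewrite divr_ge0 ?modC_ge0// ltW.
    - by rewrite ler_pdivrMr//; lra.
  apply/eqP; rewrite -modC_eq0; apply/negPn/negP => fz.
  have fz0 : 0 < modC (f z) by rewrite lt_neqAle eq_sym fz modC_ge0.
  have [n hn] := pow2_small M0 fz0.
  by have := le n; rewrite leNgt hn.
right; have ex : exists n, tcoef r f n != 0 by case: h => n /eqP hn; exists n.
pose n := ex_minn ex; have hn : tcoef r f n != 0 by rewrite /n; case: ex_minnP.
have hlt j : (j < n)%N -> tcoef r f j = 0.
  rewrite /n; case: ex_minnP => m _ hm jm; apply/eqP/negPn/negP => /hm.
  by rewrite leqNgt jm.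
exists n, (ttail r f n); split.
- exists r => // z zr; eexists; apply: cder_ctr1; [by []| |by []].
  exact: circ_cont_tail hf.
- rewrite (@ttailS r R0 f n 0)//; last by rewrite modC0.
  by rewrite mul0r addr0.
- by exists r => // z zr; exact: taylor_vanish rR zr hf hlt.
Qed.

(** Riemann's argument: [z ^+ 2 * f z] has value and derivative zero at 0, so its first two Taylor
    coefficients vanish, and its remainder after two terms extends [f]. *)
Lemma removable0 f R0 (M : R) : 0 < R0 ->
  (forall z, modC z < R0 -> z != 0 -> (exists l, cder f z l) /\ modC (f z) <= M) ->
  exists2 g, (exists2 r, 0 < r & hol_on r g) &
    exists2 r, 0 < r & forall z, modC z < r -> z != 0 -> f z = g z.
Proof.
move=> R00 h; pose k z := if z == 0 then 0 else z ^+ 2 * f z.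
have k0 : cder k 0 0.
  apply: (@cder_quad _ _ _ _ (R0 / 2) M); first by rewrite modC0; lra.
  move=> c cr; rewrite /k eqxx !subr0 mulr0 subr0; case: eqVneq => [->|c0].
    by rewrite modC0 expr0n mulr0.
  have [|_ hM] := h c _ c0; first by lra.
  by rewrite modCM modCX mulrC ler_wpM2r// sqr_ge0.
have hk : hol_on R0 k.
  move=> z zR; have [->|z0] := eqVneq z 0; first by exists 0.
  have [[l hl] _] := h z zR z0.
  have h1 := cderM (cderX 2 (cder_id z)) hl; eexists; apply: cder_near h1.
  apply/nbhsC; exists (modC z); first by rewrite modC_gt0.
  move=> w wz; rewrite /k; case: eqVneq => // w0; move: wz.
  by rewrite w0 sub0r modCN ltxx.
pose r := R0 / 2.
have r0 : 0 < r by rewrite /r; lra.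
have rR : r < R0 by rewrite /r; lra.
have zr : modC (0 : C) < r by rewrite modC0.
have c0 : tcoef r k 0 = 0.
  have := @ttailS r R0 k 0 0 r0 rR zr hk; rewrite -(ttail0 r0 rR zr hk) mul0r addr0.
  by rewrite /k eqxx.
have c1 : tcoef r k 1 = 0.
  have hd : cder (fun z => z * ttail r k 1 z) 0 (1 * ttail r k 1 0 + 0 * ctr 2 r (fun w => k w * w^-1 ^+ 1 * w) 0).
    apply: cderM; first exact: cder_id.
    by apply: cder_ctr1; [by []|exact: circ_cont_tail hk|by []].
  have hd2 : cder k 0 (1 * ttail r k 1 0 + 0 * ctr 2 r (fun w => k w * w^-1 ^+ 1 * w) 0).
    apply: cder_near hd; apply: filterS (nbhs_disc zr) => w wr.
    have -> : k w = w ^+ 1 * ttail r k 1 w.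
      by apply: taylor_vanish rR wr hk _ => // -[].
    by rewrite expr1.
  have t1 : ttail r k 1 0 = 0.
    by have := cder_uniq k0 hd2; rewrite mul0r addr0 mul1r.
  by have := @ttailS r R0 k 1 0 r0 rR zr hk; rewrite t1 mul0r addr0.
exists (ttail r k 2).
  exists r => // z zr'; eexists; apply: cder_ctr1; [by []| |by []].
  exact: circ_cont_tail hk.
exists r => // z zr' z0.
have : k z = z ^+ 2 * ttail r k 2 z.
  by apply: taylor_vanish rR zr' hk _ => // -[_|[_|//]].
rewrite /k (negbTE z0) => /mulfI -> //.
by rewrite expf_neq0.
Qed.

Definition hol_at f a := exists2 r, 0 < r & forall z, modC (z - a) < r -> exists l, cder f z l.

Lemma hol_at_near f a : hol_at f a <-> \forall z \near a, exists l, cder f z l.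
Proof. by split => [h|/nbhsC h //]; apply/nbhsC. Qed.

Lemma hol_at_shift f a : hol_at f a ->
  exists2 r, 0 < r & hol_on r (fun z => f (a + 1 * z)).
Proof.
move=> [r r0 h]; exists r => // z zr.
have [|l hl] := h (a + 1 * z); first by rewrite mul1r [a + z]addrC addrK.
by exists (l * 1); exact: cder_affine_comp hl.
Qed.

Lemma hol_at_unshift g a r : 0 < r -> hol_on r g -> hol_at (fun z => g (- a + 1 * z)) a.
Proof.
move=> r0 h; exists r => // z zr.
have [|l hl] := h (- a + 1 * z); first by rewrite mul1r addrC.
by exists (l * 1); exact: cder_affine_comp hl.
Qed.

Lemma near_shift a r (P : C -> Prop) : 0 < r -> (forall z, modC z < r -> P (a + 1 * z)) ->
  \forall z \near a, P z.
Proof.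
move=> r0 h; apply/nbhsC; exists r => // z zr.
by have := h (z - a) zr; rewrite mul1r subrKC.
Qed.

Lemma hol_at_order f a : hol_at f a ->
  (\forall z \near a, f z = 0) \/
  (exists n g, [/\ hol_at g a, g a != 0 & \forall z \near a, f z = (z - a) ^+ n * g z]).
Proof.
move=> /hol_at_shift[r r0 /(hol_on_order r0)[[s s0 h]|]].
  by left; exact: near_shift s0 h.
move=> [n [g [[s s0 hg] g0 [s' s'0 hf]]]]; right.
exists n, (fun z => g (- a + 1 * z)); split.
- exact: hol_at_unshift hg.
- by rewrite mul1r addNr.
- apply: near_shift s'0 _ => z /hf ->.
  by rewrite !mul1r addrA addNr add0r addrAC subrr add0r.
Qed.

Lemma hol_at_removable f a (M : R) :
  (\forall z \near a^', (exists l, cder f z l) /\ modC (f z) <= M) ->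
  exists2 g, hol_at g a & \forall z \near a^', f z = g z.
Proof.
move=> /dnbhsC[r r0 h].
have [|g [s s0 hg] [s' s'0 hgf]] := @removable0 (fun z => f (a + 1 * z)) r M r0.
  move=> z zr z0; have [||[l hl] hM] := h (a + 1 * z).
  - by rewrite mul1r [a + z]addrC addrK.
  - by rewrite mul1r -subr_eq0 [a + z]addrC addrK.
  by split => //; exists (l * 1); exact: cder_affine_comp hl.
exists (fun z => g (- a + 1 * z)); first exact: hol_at_unshift hg.
apply/dnbhsC; exists s' => // z zs za.
have := hgf (z - a) zs; rewrite subr_eq0 => /(_ za).
by rewrite !mul1r subrKC addrC.
Qed.

Lemma hol_at_derive1 f a : hol_at f a -> hol_at (derive1 f) a.
Proof.
move=> hf; have [r r0 /hol_derive1 h] := hol_at_shift hf.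
have [s s0 hs] := hf.
exists (Num.min r s); first by rewrite lt_min r0.
move=> z; rewrite lt_min => /andP[zr zs].
have [l hl] := h (- a + 1 * z) ltac:(by rewrite mul1r addrC).
exists (l * 1); have hc := cder_affine_comp hl; apply: cder_near hc.
have zs' : \forall w \near z, modC (w - a) < s.
  apply/nbhsC; exists (s - modC (z - a)); first by rewrite subr_gt0.
  by move=> w ww; have := modC_tri w a z; lra.
apply: filterS zs' => w /hs[l' hl'].
have h1 : cder f (a + 1 * (- a + 1 * w)) l' by rewrite !mul1r addrA subrr add0r.
by rewrite (cder_derive1 (cder_affine_comp h1)) mulr1 (cder_derive1 hl').
Qed.

Lemma hol_atD f g a : hol_at f a -> hol_at g a -> hol_at (fun z => f z + g z) a.
Proof.
rewrite !hol_at_near => hf hg; apply: filterS (filterI hf hg) => z [[l hl] [l' hl']].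
by eexists; exact: cderD hl hl'.
Qed.

Lemma hol_atM f g a : hol_at f a -> hol_at g a -> hol_at (fun z => f z * g z) a.
Proof.
rewrite !hol_at_near => hf hg; apply: filterS (filterI hf hg) => z [[l hl] [l' hl']].
by eexists; exact: cderM hl hl'.
Qed.

Lemma hol_at_cst c a : hol_at (fun=> c) a.
Proof. by exists 1 => // z _; exists 0; exact: cder_cst. Qed.

Lemma hol_at_id a : hol_at (fun z => z) a.
Proof. by exists 1 => // z _; exists 1; exact: cder_id. Qed.

Lemma hol_atX f n a : hol_at f a -> hol_at (fun z => f z ^+ n) a.
Proof.
by rewrite !hol_at_near; apply: filterS => z [l hl]; eexists; exact: cderX hl.
Qed.

Lemma hol_at_cont f a : hol_at f a -> {for a, continuous f}.
Proof. by move=> [r r0 h]; apply: cont_cderE; apply: h; rewrite subrr modC0. Qed.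

Lemma cont_neq0 f a : {for a, continuous f} -> f a != 0 -> \forall z \near a, f z != 0.
Proof.
move=> /ccontP h fa; have [|d d0 hd] := h (modC (f a)); first by rewrite modC_gt0.
apply/nbhsC; exists d => // z /hd; apply: contraTneq => ->.
by rewrite sub0r modCN ltxx.
Qed.

Lemma hol_atV f a : hol_at f a -> f a != 0 -> hol_at (fun z => (f z)^-1) a.
Proof.
move=> hf fa; have h0 := cont_neq0 (hol_at_cont hf) fa.
move: hf; rewrite !hol_at_near => hf; apply: filterS (filterI hf h0) => z [[l hl] fz].
by eexists; exact: cderV fz hl.
Qed.

Lemma hol_at_eq f g a : (\forall z \near a, f z = g z) -> hol_at f a -> hol_at g a.
Proof.
rewrite !hol_at_near => h1 h2.
have h3 : \forall z \near a, \forall w \near z, f w = g w.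
  move/nbhsC: h1 => [r r0 h1]; apply/nbhsC; exists (r / 2); first by lra.
  move=> z zr; apply/nbhsC; exists (r / 2); first by lra.
  by move=> w wr; apply: h1; have := modC_tri w a z; lra.
by apply: filterS (filterI h2 h3) => z [[l hl] hz]; exists l; exact: cder_near hl.
Qed.

End LocalTheory.

(** * The field of meromorphic functions *)

Section MeromorphicGerms.
Variable R : realType.
Local Notation C := (CC R).
Implicit Types (f g : C -> C) (a z w : C) (k n : int).

Lemma cder_eq f z d d' : cder f z d -> d = d' -> cder f z d'.
Proof. by move=> ? <-. Qed.

Lemma cder_subz a z : cder (fun w => w - a) z 1.
Proof.
by have := cderB (cder_id z) (cder_cst a z); rewrite subr0.
Qed.

Lemma cder_exprz a z k : z != a -> cder (fun w => (w - a) ^ k) z (k%:~R * (z - a) ^ (k - 1)).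
Proof.
rewrite -subr_eq0 => za; case: k => [n|n].
  have h := cderX n (cder_subz a z); apply: cder_eq h _.
  rewrite mulr1 -pmulrn; case: n => [|n]; first by rewrite !mul0r.
  by have -> : n.+1%:Z - 1 = n%:Z by rewrite -addn1 PoszD addrK.
have h := cderV (f := fun w => (w - a) ^+ n.+1) _ (cderX n.+1 (cder_subz a z)).
have nz : (z - a) ^+ n.+1 != 0 by rewrite expf_neq0.
apply: cder_eq (h nz) _.
rewrite mulr1 NegzE mulrNz -pmulrn /= mulNr mulNr; congr (- _).
rewrite mulrCA; congr (_ * _).
rewrite -opprD -(PoszD n.+1 1) -exprnN addn1.
have -> : ((z - a) ^+ n.+1) ^- 2 * (z - a) ^+ n = ((z - a) ^+ n.+2)^-1; last by [].
by rewrite !exprS; field; rewrite za expf_neq0.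
Qed.

(** Only values in punctured neighbourhoods matter. Unlike [meromorphic], this is stable under
    pointwise sums and under pointwise inverse with [0^-1 = 0], whatever the values at singular
    points. *)
Definition merom f := forall a, exists n : nat, exists2 g, hol_at g a &
  \forall z \near a^', (z - a) ^+ n * f z = g z.

(** [g a] may vanish: a form bounds the order at [a] from below, and [k] is the exact order when
    [g a != 0]. *)
Definition form f a k g := hol_at g a /\ \forall z \near a^', f z = (z - a) ^ k * g z.

Lemma near_dnbhs a (P : C -> Prop) : (\forall z \near a, P z) -> \forall z \near a^', P z.
Proof. by move=> /nbhsC[d d0 h]; apply/dnbhsC; exists d => // z zd _; exact: h. Qed.

Lemma near_neq a : \forall z \near a^', z != a.
Proof. by apply/dnbhsC; exists 1. Qed.

Lemma dnbhs_dnbhs a (P : C -> Prop) : (\forall z \near a^', P z) ->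
  \forall z \near a^', \forall w \near z, P w.
Proof.
move=> /dnbhsC[d d0 h]; apply/dnbhsC; exists d => // z zd za.
apply/nbhsC; exists (Num.min (d - modC (z - a)) (modC (z - a))).
  by rewrite lt_min subr_gt0 zd modC_gt0 subr_eq0.
move=> w; rewrite lt_min => /andP[w1 w2]; apply: h.
  by have := modC_tri w a z; lra.
by apply/eqP => wa; move: w2; rewrite wa modCB ltxx.
Qed.

Lemma dnbhs_ex a (P : C -> Prop) : (\forall z \near a^', P z) -> exists2 z, P z & z != a.
Proof.
move=> /dnbhsC[d d0 h].
have e : a + toC (d / 2) - a = toC (d / 2) by rewrite addrC addKr.
have m : modC (a + toC (d / 2) - a) = d / 2 by rewrite e modC_toC gtr0_norm// divr_gt0.
have n : a + toC (d / 2) != a by rewrite -subr_eq0 -modC_gt0 m divr_gt0.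
by exists (a + toC (d / 2)) => //; apply: h => //; rewrite m; lra.
Qed.

Lemma form_merom f : (forall a, exists k g, form f a k g) -> merom f.
Proof.
move=> h a; have [k [g [hg hf]]] := h a; case: k hf => [k|k] hf.
  exists 0%N; exists (fun z => (z - a) ^+ k * g z).
    apply: hol_atM => //; apply: hol_atX; apply: hol_atD; [exact: hol_at_id|exact: hol_at_cst].
  by apply: filterS hf => z ->; rewrite expr0 mul1r.
exists k.+1; exists g => //; apply: filterS (filterI hf (near_neq a)) => z [-> za].
rewrite NegzE mulrA -exprnN divff ?mul1r// expf_neq0// subr_eq0//.
Qed.

Lemma merom_form f a : merom f -> exists k g, form f a k g.
Proof.
move=> /(_ a)[n [g hg h]]; exists (- n%:Z), g; split => //.
apply: filterS (filterI h (near_neq a)) => z [<- za].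
by rewrite mulrA -exprnN mulVf ?mul1r// expf_neq0// subr_eq0.
Qed.

Lemma form_dich f a k g : form f a k g ->
  (\forall z \near a^', f z = 0) \/ exists k g, form f a k g /\ g a != 0.
Proof.
move=> [hg hf]; case: (hol_at_order hg) => [h0|[n [g' [hg' ga h']]]].
  by left; apply: filterS (filterI hf (near_dnbhs h0)) => z [-> ->]; rewrite mulr0.
right; exists (k + n%:Z), g'; split => //; split => //.
apply: filterS (filterI (filterI hf (near_dnbhs h')) (near_neq a)) => z [[-> ->] za].
by rewrite expfzDr ?subr_eq0// mulrA.
Qed.

Lemma form_shift f a k n g : n <= k -> form f a k g ->
  form f a n (fun z => (z - a) ^ (k - n) * g z).
Proof.
move=> nk [hg hf]; split.
  have -> : (fun z => (z - a) ^ (k - n) * g z) = (fun z => (z - a) ^+ `|k - n|%N * g z).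
    by apply/funext => z; rewrite -[in LHS](gez0_abs (_ : 0 <= k - n)) ?subr_ge0.
  apply: hol_atM => //; apply: hol_atX; apply: hol_atD; [exact: hol_at_id|exact: hol_at_cst].
apply: filterS (filterI hf (near_neq a)) => z [-> za].
by rewrite mulrA -expfzDr ?subr_eq0// subrKC.
Qed.

Lemma cont_eq_dnbhs f g a : {for a, continuous f} -> {for a, continuous g} ->
  (\forall z \near a^', f z = g z) -> f a = g a.
Proof.
move=> /ccontP cf /ccontP cg h.
apply/eqP; rewrite -subr_eq0 -modC_eq0; apply/negPn/negP => n0.
have e0 : 0 < modC (f a - g a) / 2 by rewrite divr_gt0// lt_neqAle eq_sym n0 modC_ge0.
have [d1 d10 h1] := cf _ e0; have [d2 d20 h2] := cg _ e0.
have b1 : \forall z \near a^', modC (z - a) < d1 by apply/dnbhsC; exists d1.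
have b2 : \forall z \near a^', modC (z - a) < d2 by apply/dnbhsC; exists d2.
have [z [[e /h1 k1] /h2 k2] _] := dnbhs_ex (filterI (filterI h b1) b2).
have t := modC_tri (f a) (g a) (f z).
rewrite modCB in k1; rewrite -e in k2.
by clear -k1 k2 t; lra.
Qed.

Lemma form_le f a k n g g' : form f a k g -> g a != 0 -> form f a n g' -> n <= k.
Proof.
move=> [hg hf] ga [hg' hf']; rewrite leNgt; apply/negP => kn.
have h : g a = (fun z => (z - a) ^+ `|n - k|%N * g' z) a.
  apply: (@cont_eq_dnbhs g (fun z => (z - a) ^+ `|n - k|%N * g' z) a).
  - exact: hol_at_cont.
  - apply: hol_at_cont; apply: hol_atM => //; apply: hol_atX; apply: hol_atD.
      exact: hol_at_id.
    exact: hol_at_cst.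
  apply: filterS (filterI (filterI hf hf') (near_neq a)) => z [[-> e] za].
  have za0 : z - a != 0 by rewrite subr_eq0.
  apply: (mulfI (_ : (z - a) ^ k != 0)); first by rewrite expfz_neq0.
  rewrite e mulrA -[_ ^+ _]/((z - a) ^ (`|n - k|%N : int)) gez0_abs ?subr_ge0 1?ltW//.
  by rewrite -expfzDr// subrKC.
have /negbTE nk : `|n - k|%N != 0%N by rewrite absz_eq0 subr_eq0 gt_eqF.
by move: ga; rewrite h subrr expr0n nk mulr0n mul0r eqxx.
Qed.

(** The limit at [a], or 0 when there is none. Passing to [nv f] repairs removable singularities and
    makes the values at poles canonical. *)
Definition nv f a : C := xget 0 [set L : C | f z @[z --> a^'] --> L].

Lemma nv_near f g a : (\forall z \near a^', f z = g z) -> nv f a = nv g a.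
Proof.
move=> h; rewrite /nv; congr (xget _ _); apply/seteqP; split => L /= hL.
  by apply: cvg_trans hL; apply: near_eq_cvg; apply: filterS h => z ->.
by apply: cvg_trans hL; apply: near_eq_cvg; apply: filterS h => z ->.
Qed.

Lemma nv_cont f a : {for a, continuous f} -> nv f a = f a.
Proof.
move=> h; rewrite /nv; have hL : f z @[z --> a^'] --> f a.
  by apply: cvg_trans h; apply: cvg_app; exact: cvg_within.
apply: xget_unique => // L hL2; exact: (cvg_unique _ hL2 hL).
Qed.

Lemma form_near_hol f a k g : form f a k g -> \forall z \near a^', exists l, cder f z l.
Proof.
move=> [hg hf].
have h1 := near_dnbhs ((hol_at_near g a).1 hg).
have h2 := dnbhs_dnbhs hf.
apply: filterS (filterI (filterI h1 h2) (near_neq a)) => z [[[l hl] hz] za].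
eexists; apply: (cder_near _ (cderM (cder_exprz k za) hl)).
by apply: filterS hz => w ->.
Qed.

Lemma merom_near_hol f a : merom f -> \forall z \near a^', exists l, cder f z l.
Proof. by move=> /(merom_form a)[k [g /form_near_hol]]. Qed.

Lemma merom_nv f a : merom f -> \forall z \near a^', nv f z = f z.
Proof.
by move=> /(merom_near_hol a); apply: filterS => z /cont_cderE /nv_cont.
Qed.

Lemma form_eq f f' a k g : (\forall z \near a^', f z = f' z) -> form f a k g -> form f' a k g.
Proof. by move=> h [hg hf]; split => //; apply: filterS (filterI h hf) => z [<- ->]. Qed.

Lemma merom_eq f g : (forall a, \forall z \near a^', f z = g z) -> merom f -> merom g.
Proof.
move=> h hf; apply: form_merom => a; have [k [u hu]] := merom_form a hf.
by exists k, u; exact: form_eq (h a) hu.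
Qed.

Lemma formD f f' a k g g' : form f a k g -> form f' a k g' ->
  form (fun z => f z + f' z) a k (fun z => g z + g' z).
Proof.
move=> [h1 h2] [h3 h4]; split; first exact: hol_atD.
by apply: filterS (filterI h2 h4) => z [-> ->]; rewrite mulrDr.
Qed.

Lemma formM f f' a k n g g' : form f a k g -> form f' a n g' ->
  form (fun z => f z * f' z) a (k + n) (fun z => g z * g' z).
Proof.
move=> [h1 h2] [h3 h4]; split; first exact: hol_atM.
apply: filterS (filterI (filterI h2 h4) (near_neq a)) => z [[-> ->] za].
by rewrite expfzDr ?subr_eq0//; ring.
Qed.

Lemma formV f a k g : form f a k g -> g a != 0 ->
  form (fun z => (f z)^-1) a (- k) (fun z => (g z)^-1).
Proof.
move=> [h1 h2] ga; split; first exact: hol_atV.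
by apply: filterS h2 => z ->; rewrite invfM invr_expz.
Qed.

Lemma form_der f a k g : form f a k g ->
  form (derive1 f) a (k - 1) (fun z => k%:~R * g z + (z - a) * derive1 g z).
Proof.
move=> [h1 h2]; split.
  apply: hol_atD; first by apply: hol_atM => //; exact: hol_at_cst.
  apply: hol_atM; last exact: hol_at_derive1.
  by apply: hol_atD; [exact: hol_at_id|exact: hol_at_cst].
have h1' := near_dnbhs ((hol_at_near g a).1 h1).
apply: filterS (filterI (filterI h1' (dnbhs_dnbhs h2)) (near_neq a)) => z [[[l hl] hz] za].
have za0 : z - a != 0 by rewrite subr_eq0.
have hc := cderM (cder_exprz k za) hl.
have hf : cder f z (k%:~R * (z - a) ^ (k - 1) * g z + (z - a) ^ k * l).
  by apply: cder_near hc; apply: filterS hz => w ->.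
rewrite (cder_derive1 hf) (cder_derive1 hl) mulrDr mulrA.
rewrite -{3}[k](subrK 1) [in X in _ + X = _]expfzDr// expr1z.
by rewrite [_ * k%:~R]mulrC -!mulrA.
Qed.

Lemma form_cst c a : form (fun=> c) a 0 (fun=> c).
Proof. by split; [exact: hol_at_cst|apply/dnbhsC; exists 1 => // z _ _; rewrite mul1r]. Qed.

Lemma merom_cst c : merom (fun=> c).
Proof. by apply: form_merom => a; exists 0, (fun=> c); exact: form_cst. Qed.

Lemma merom_hol f : (forall a, hol_at f a) -> merom f.
Proof.
move=> h; apply: form_merom => a; exists 0, f; split => //.
by apply/dnbhsC; exists 1 => // z _ _; rewrite mul1r.
Qed.

Lemma form_common f f' a : merom f -> merom f' ->
  exists k g g', form f a k g /\ form f' a k g'.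
Proof.
move=> /(merom_form a)[k [g h]] /(merom_form a)[n [g' h']].
exists (Order.min k n); do 2 eexists; split.
  by apply: form_shift h; rewrite ge_min lexx.
by apply: form_shift h'; rewrite ge_min lexx orbT.
Qed.

Lemma meromD f g : merom f -> merom g -> merom (fun z => f z + g z).
Proof.
move=> hf hg; apply: form_merom => a; have [k [u [v [h1 h2]]]] := form_common a hf hg.
by exists k; eexists; exact: formD h1 h2.
Qed.

Lemma meromM f g : merom f -> merom g -> merom (fun z => f z * g z).
Proof.
move=> /[swap] /[swap] hf hg; apply: form_merom => a.
have [k [u h1]] := merom_form a hf; have [n [v h2]] := merom_form a hg.
by exists (k + n); eexists; exact: formM h1 h2.
Qed.

Lemma meromV f : merom f -> merom (fun z => (f z)^-1).
Proof.
move=> hf; apply: form_merom => a; have [k [u h1]] := merom_form a hf.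
case: (form_dich h1) => [h0|[k' [g' [h2 g0]]]].
  exists 0, (fun=> 0); apply: form_eq (form_cst 0 a).
  by apply: filterS h0 => z ->; rewrite invr0.
by exists (- k'); eexists; exact: formV h2 g0.
Qed.

Lemma merom_der f : merom f -> merom (derive1 f).
Proof.
move=> hf; apply: form_merom => a; have [k [u h1]] := merom_form a hf.
by exists (k - 1); eexists; exact: form_der h1.
Qed.

(* The set of points where a meromorphic function vanishes to infinite order
   is clopen; connectedness of the plane is obtained by bisecting rectangles,
   the four quarters of which share their centre. *)
Lemma merom_identity f a (b : C) : merom f ->
  (\forall z \near a^', f z = 0) -> \forall z \near b^', f z = 0.
Proof.
move=> hf ha; pose Z (c : C) : Prop := \forall z \near c^', f z = 0.
have loc (c : C) : (\forall w \near c, Z w) \/ (\forall w \near c, ~ Z w).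
  have [k [u h1]] := merom_form c hf; case: (form_dich h1) => [h0|[k' [g' [[h2 h3] g0]]]].
    left; have /dnbhsC[d d0 hd] := dnbhs_dnbhs h0.
    apply/nbhsC; exists d; first exact: d0.
    move=> w wd; have [->|wc] := eqVneq w c; first exact: h0.
    by apply: near_dnbhs; apply: hd wd wc.
  right; have h4 := near_dnbhs (cont_neq0 (hol_at_cont h2) g0).
  have h5 : \forall z \near c^', f z != 0.
    apply: filterS (filterI (filterI h3 h4) (near_neq c)) => z [[-> gz] zc].
    by rewrite mulf_neq0// expfz_neq0// subr_eq0.
  have /dnbhsC[d d0 hd] := dnbhs_dnbhs h5.
  apply/nbhsC; exists d; first exact: d0.
  move=> w wd hw; have h6 : \forall z \near w^', f z != 0.
    have [->|wc] := eqVneq w c; first exact: h5.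
    by apply: near_dnbhs; apply: hd wd wc.
  by have [z [/eqP zz /negP]] := dnbhs_ex (filterI hw h6).
pose P (x1 x2 y1 y2 : R) :=
  (forall x y, x1 <= x <= x2 -> y1 <= y <= y2 -> Z (Complex x y)) \/
  (forall x y, x1 <= x <= x2 -> y1 <= y <= y2 -> ~ Z (Complex x y)).
pose ra := complex.Re a; pose rb := complex.Re b; pose ia := complex.Im a; pose ib := complex.Im b.
have : P (Num.min ra rb) (Num.max ra rb) (Num.min ia ib) (Num.max ia ib).
  apply: rect_ind; try by rewrite ge_min le_max lexx.
  - move=> x1 x2 y1 y2 hx hy p1 p2 p3 p4.
    set p := (x1 + x2) / 2 in p1 p2 p3 p4; set q := (y1 + y2) / 2 in p1 p2 p3 p4.
    have hp : x1 <= p <= x2 by rewrite /p; lra.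
    have hq : y1 <= q <= y2 by rewrite /q; lra.
    have /andP[P1 P2] := hp; have /andP[Q1 Q2] := hq.
    have mid (x1' x2' y1' y2' : R) : x1' <= p -> p <= x2' -> y1' <= q -> q <= y2' ->
      P x1' x2' y1' y2' -> forall x y, x1' <= x <= x2' -> y1' <= y <= y2' ->
      (Z (Complex x y) <-> Z (Complex p q)).
      move=> A1 A2 A3 A4 [h|h] x y hx' hy'.
        by split => _; apply: h; rewrite ?A1 ?A3.
      by split => hz; exfalso; [apply: (h x y) hz|apply: (h p q) hz => //; rewrite ?A1 ?A3].
    have all x y : x1 <= x <= x2 -> y1 <= y <= y2 -> (Z (Complex x y) <-> Z (Complex p q)).
      move=> /andP[X1 X2] /andP[Y1 Y2].
      have [xp|/ltW xp] := leP x p; have [yq|/ltW yq] := leP y q.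
      - by apply: mid p1 _ _ _ _ => //; lra.
      - by apply: mid p3 _ _ _ _ => //; lra.
      - by apply: mid p2 _ _ _ _ => //; lra.
      - by apply: mid p4 _ _ _ _ => //; lra.
    have [zz|zz] := pselect (Z (Complex p q)); [left|right] => x y hx' hy'.
      by apply/all.
    by move=> /all -/(_ hx' hy').
  - move=> x y hx hy.
    have small (Q : C -> Prop) : (\forall w \near (Complex x y : C), Q w) ->
      exists2 del : R, 0 < del & forall x1 x2 y1 y2, x1 <= x -> x <= x2 -> y1 <= y -> y <= y2 ->
        x2 - x1 < del -> y2 - y1 < del -> forall x' y', x1 <= x' <= x2 -> y1 <= y' <= y2 ->
        Q (Complex x' y').
      move=> /nbhsC[d d0 hd]; exists (d / 2); first by lra.
      move=> x1 x2 y1 y2 A1 A2 A3 A4 A5 A6 x' y' /andP[X1 X2] /andP[Y1 Y2]; apply: hd.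
      apply: le_lt_trans (modC_le_ReIm _) _ => /=.
      have t1 : `|x' - x| < d / 2.
        by clear -A1 A2 A5 X1 X2; rewrite ltr_norml; apply/andP; split; lra.
      have t2 : `|y' - y| < d / 2.
        by clear -A3 A4 A6 Y1 Y2; rewrite ltr_norml; apply/andP; split; lra.
      by clear -t1 t2; lra.
    case: (loc (Complex x y)) => /small[d d0 hd]; (exists d; first exact: d0); move=> x1 x2 y1 y2 _ A1 A2 _ _ A3 A4 _ A5 A6;
      [left|right]; exact: hd.
have ina : Num.min ra rb <= ra <= Num.max ra rb /\ Num.min ia ib <= ia <= Num.max ia ib.
  by rewrite !ge_min !le_max !lexx.
have inb : Num.min ra rb <= rb <= Num.max ra rb /\ Num.min ia ib <= ib <= Num.max ia ib.
  by rewrite !ge_min !le_max !lexx !orbT.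
case: ina inb => a1 a2 [b1 b2] [h|h].
  by have := h _ _ b1 b2; rewrite -complex_eta.
by exfalso; apply: (h _ _ a1 a2); rewrite -complex_eta.
Qed.

End MeromorphicGerms.

(** * Field structure and derivation *)

Section MeromorphicField.
Variable R : realType.
Local Notation C := (CC R).

(** The normalisation [nv f = f] picks one representative per class, so that agreement near every
    point is Leibniz equality and the ring laws can hold literally. *)
Record mer := Mer { mfun :> C -> C; mer_merom : merom mfun; mer_nv : nv mfun = mfun }.

Lemma mer_ext (F G : mer) : mfun F = mfun G -> F = G.
Proof.
case: F G => [f f1 f2] [g g1 g2] /= fg; subst g.
by rewrite (Prop_irrelevance f1 g1) (Prop_irrelevance f2 g2).
Qed.

Lemma mer_near (F G : mer) : (forall a, \forall z \near a^', F z = G z) -> F = G.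
Proof.
move=> h; apply: mer_ext; rewrite -(mer_nv F) -(mer_nv G); apply/funext => a.
exact: nv_near.
Qed.

HB.instance Definition _ := gen_eqMixin mer.
HB.instance Definition _ := gen_choiceMixin mer.

Lemma nv_merom (f : C -> C) : merom f -> merom (nv f) /\ nv (nv f) = nv f.
Proof.
move=> hf; have h a : \forall z \near a^', nv f z = f z by exact: merom_nv.
split; first by apply: merom_eq hf => a; apply: filterS (h a) => z ->.
by apply/funext => a; exact: nv_near.
Qed.

Definition mk (f : C -> C) (hf : merom f) : mer := Mer (nv_merom hf).1 (nv_merom hf).2.

Lemma mkE f (hf : merom f) a : \forall z \near a^', mk hf z = f z.
Proof. exact: merom_nv. Qed.

Lemma mk_pt f (hf : merom f) a : {for a, continuous f} -> mk hf a = f a.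
Proof. exact: nv_cont. Qed.

Definition cstm (c : C) : mer := mk (merom_cst c).
Definition addm (F G : mer) : mer := mk (meromD (mer_merom F) (mer_merom G)).
Definition mulm (F G : mer) : mer := mk (meromM (mer_merom F) (mer_merom G)).
Definition oppm (F : mer) : mer := mulm (cstm (-1)) F.
Definition invm (F : mer) : mer := mk (meromV (mer_merom F)).
Definition derm (F : mer) : mer := mk (merom_der (mer_merom F)).

Lemma addmE F G a : \forall z \near a^', addm F G z = F z + G z.
Proof. exact: mkE. Qed.
Lemma mulmE F G a : \forall z \near a^', mulm F G z = F z * G z.
Proof. exact: mkE. Qed.
Lemma cstmE c a : \forall z \near a^', cstm c z = c.
Proof. exact: mkE. Qed.
Lemma invmE F a : \forall z \near a^', invm F z = (F z)^-1.
Proof. exact: mkE. Qed.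
Lemma dermE F a : \forall z \near a^', derm F z = derive1 F z.
Proof. exact: mkE. Qed.
Lemma oppmE F a : \forall z \near a^', oppm F z = - F z.
Proof.
apply: filterS (filterI (mulmE (cstm (-1)) F a) (cstmE (-1) a)) => z [-> ->].
exact: mulN1r.
Qed.

Lemma addmA : associative addm.
Proof.
move=> F G H; apply: mer_near => a.
apply: filterS (filterI (filterI (addmE F (addm G H) a) (addmE G H a))
  (filterI (addmE (addm F G) H a) (addmE F G a))) => z [[-> ->] [-> ->]].
exact: addrA.
Qed.

Lemma addmC : commutative addm.
Proof.
move=> F G; apply: mer_near => a.
apply: filterS (filterI (addmE F G a) (addmE G F a)) => z [-> ->]; exact: addrC.
Qed.

Lemma add0m : left_id (cstm 0) addm.
Proof.
move=> F; apply: mer_near => a.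
apply: filterS (filterI (addmE (cstm 0) F a) (cstmE 0 a)) => z [-> ->]; exact: add0r.
Qed.

Lemma addNm : left_inverse (cstm 0) oppm addm.
Proof.
move=> F; apply: mer_near => a.
apply: filterS (filterI (filterI (addmE (oppm F) F a) (cstmE 0 a)) (oppmE F a)) => z [[-> ->] ->].
exact: addNr.
Qed.

HB.instance Definition _ := GRing.isZmodule.Build mer addmA addmC add0m addNm.

Lemma mulmA : associative mulm.
Proof.
move=> F G H; apply: mer_near => a.
apply: filterS (filterI (filterI (mulmE F (mulm G H) a) (mulmE G H a))
  (filterI (mulmE (mulm F G) H a) (mulmE F G a))) => z [[-> ->] [-> ->]].
exact: mulrA.
Qed.

Lemma mulmC : commutative mulm.
Proof.
move=> F G; apply: mer_near => a.
apply: filterS (filterI (mulmE F G a) (mulmE G F a)) => z [-> ->]; exact: mulrC.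
Qed.

Lemma mul1m : left_id (cstm 1) mulm.
Proof.
move=> F; apply: mer_near => a.
apply: filterS (filterI (mulmE (cstm 1) F a) (cstmE 1 a)) => z [-> ->]; exact: mul1r.
Qed.

Lemma mulmDl : left_distributive mulm addm.
Proof.
move=> F G H; apply: mer_near => a.
apply: filterS (filterI (filterI (mulmE (addm F G) H a) (addmE F G a))
  (filterI (addmE (mulm F H) (mulm G H) a) (filterI (mulmE F H a) (mulmE G H a))))
  => z [[-> ->] [-> [-> ->]]].
exact: mulrDl.
Qed.

Lemma cst1m_neq0 : cstm 1 != cstm 0.
Proof.
apply/eqP => h; have [z [h1 h2] _] := dnbhs_ex (filterI (cstmE 1 0) (cstmE 0 0)).
by move: h1; rewrite h h2 => /eqP; rewrite eq_sym oner_eq0.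
Qed.

HB.instance Definition _ :=
  GRing.Zmodule_isComNzRing.Build mer mulmA mulmC mul1m mulmDl cst1m_neq0.

(** Here the identity theorem enters: a function vanishing near one point vanishes near all. This is
    what makes the ring a field. *)
Lemma mer_neq0 (F : mer) a : F != 0 -> \forall z \near a^', F z != 0.
Proof.
move=> F0; have [k [g h]] := merom_form a (mer_merom F).
case: (form_dich h) => [h0|[k' [g' [[h1 h2] g0]]]].
  exfalso; move/eqP: F0; apply; apply: mer_near => b.
  have hb := merom_identity b (mer_merom F) h0.
  by apply: filterS (filterI hb (cstmE 0 b)) => z [-> ->].
have h4 := near_dnbhs (cont_neq0 (hol_at_cont h1) g0).
apply: filterS (filterI (filterI h2 h4) (near_neq a)) => z [[-> gz] zc].
by rewrite mulf_neq0// expfz_neq0// subr_eq0.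
Qed.

Lemma mulVm (F : mer) : F != 0 -> mulm (invm F) F = 1.
Proof.
move=> F0; apply: mer_near => a.
apply: filterS (filterI (filterI (mulmE (invm F) F a) (invmE F a))
  (filterI (cstmE 1 a) (mer_neq0 a F0))) => z [[-> ->] [-> Fz]].
exact: mulVf.
Qed.

Lemma invm0 : invm 0 = 0.
Proof.
apply: mer_near => a; apply: filterS (filterI (invmE 0 a) (cstmE 0 a)) => z [-> h].
by rewrite h invr0.
Qed.

HB.instance Definition _ := GRing.ComNzRing_isField.Build mer mulVm invm0.

Lemma merD (F G : mer) a : \forall z \near a^', (F + G) z = F z + G z.
Proof. exact: addmE. Qed.
Lemma merM (F G : mer) a : \forall z \near a^', (F * G) z = F z * G z.
Proof. exact: mulmE. Qed.
Lemma merN (F : mer) a : \forall z \near a^', (- F) z = - F z.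
Proof. exact: oppmE. Qed.
Lemma merV (F : mer) a : \forall z \near a^', F^-1 z = (F z)^-1.
Proof. exact: invmE. Qed.
Lemma mer0 a : \forall z \near a^', (0 : mer) z = 0.
Proof. exact: cstmE. Qed.
Lemma mer1 a : \forall z \near a^', (1 : mer) z = 1.
Proof. exact: cstmE. Qed.

Lemma cstm_pt c a : cstm c a = c.
Proof. by apply: mk_pt; exact: cst_continuous. Qed.

Lemma cstmD c d : cstm (c + d) = cstm c + cstm d.
Proof.
apply: mer_near => a; apply: filterS (merD (cstm c) (cstm d) a) => z ->.
by rewrite !cstm_pt.
Qed.

Lemma cstmM c d : cstm (c * d) = cstm c * cstm d.
Proof.
apply: mer_near => a; apply: filterS (merM (cstm c) (cstm d) a) => z ->.
by rewrite !cstm_pt.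
Qed.

Lemma cstm_nat n : cstm n%:R = n%:R.
Proof. by elim: n => [|n ih]; rewrite // -addn1 !natrD cstmD ih. Qed.

Lemma mer_near_hol (F : mer) a : \forall z \near a^', exists l, cder F z l.
Proof. exact: merom_near_hol (mer_merom F). Qed.

Lemma mer_near_cder (F : mer) a : \forall z \near a^', cder F z (derm F z).
Proof.
apply: filterS (filterI (mer_near_hol F a) (dermE F a)) => z [[l hl] ->].
by rewrite (cder_derive1 hl).
Qed.

Lemma derm_eq (F : mer) (G : mer) :
  (forall a, \forall z \near a^', cder F z (G z)) -> derm F = G.
Proof.
move=> h; apply: mer_near => a.
by apply: filterS (filterI (h a) (mer_near_cder F a)) => z [h1 h2]; exact: cder_uniq h2 h1.
Qed.

Lemma dermD (F G : mer) : derm (F + G) = derm F + derm G.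
Proof.
apply: derm_eq => a.
have h := dnbhs_dnbhs (merD F G a).
apply: filterS (filterI (filterI (mer_near_cder F a) (mer_near_cder G a))
  (filterI h (merD (derm F) (derm G) a))) => z [[h1 h2] [h3 ->]].
by apply: cder_near (cderD h1 h2); apply: filterS h3 => w ->.
Qed.

Lemma dermM (F G : mer) : derm (F * G) = derm F * G + F * derm G.
Proof.
apply: derm_eq => a.
have h := dnbhs_dnbhs (merM F G a).
apply: filterS (filterI (filterI (filterI (mer_near_cder F a) (mer_near_cder G a))
  (filterI h (merD (derm F * G) (F * derm G) a))) (filterI (merM (derm F) G a) (merM F (derm G) a)))
  => z [[[h1 h2] [h3 ->]] [-> ->]].
by apply: cder_near (cderM h1 h2); apply: filterS h3 => w ->.
Qed.

Lemma derm_cst c : derm (cstm c) = 0.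
Proof.
apply: derm_eq => a; apply: filterS (mer0 a) => z ->.
by apply: cder_near (cder_cst c z); apply/nbhsC; exists 1 => // w _; rewrite cstm_pt.
Qed.

Lemma derm0 : derm 0 = 0. Proof. exact: derm_cst. Qed.
Lemma derm1 : derm 1 = 0. Proof. exact: derm_cst. Qed.
Lemma derm_nat n : derm n%:R = 0. Proof. by rewrite -cstm_nat derm_cst. Qed.

Lemma dermN (F : mer) : derm (- F) = - derm F.
Proof. by apply/eqP; rewrite -addr_eq0 -dermD addNr derm0. Qed.

Lemma dermB (F G : mer) : derm (F - G) = derm F - derm G.
Proof. by rewrite dermD dermN. Qed.

Lemma dermX (F : mer) n : derm (F ^+ n) = n%:R * F ^+ n.-1 * derm F.
Proof.
elim: n => [|n ih]; first by rewrite expr0 derm1 !mul0r.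
rewrite exprS dermM ih; case: n {ih} => [|n] /=; first by rewrite !expr0; ring.
by rewrite exprS -(addn1 n.+1) -(addn1 n) !natrD; ring.
Qed.

Lemma dermV (F : mer) : F != 0 -> derm F^-1 = - (derm F / F ^+ 2).
Proof.
move=> F0; have := dermM F F^-1; rewrite divff// derm1 => h.
apply: (mulfI F0); move/eqP: h; rewrite eq_sym addrC addr_eq0 => /eqP ->.
by field.
Qed.

Lemma merom_id : merom (fun z : C => z).
Proof. by apply: merom_hol => a; exact: hol_at_id. Qed.

Definition idm : mer := mk merom_id.

Lemma idm_pt a : idm a = a.
Proof. by apply: mk_pt; exact: cvg_id. Qed.

Lemma derm_id : derm idm = 1.
Proof.
apply: derm_eq => a; apply: filterS (mer1 a) => z ->.
by apply: cder_near (cder_id z); apply/nbhsC; exists 1 => // w _; rewrite idm_pt.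
Qed.

End MeromorphicField.

(** * Orders at a point and values at regular points *)

Section Orders.
Variable R : realType.
Local Notation C := (CC R).
Local Notation M := (mer R).
Implicit Types (F G : M) (a z : C) (k n : int).

Definition vge a k F := exists g, form F a k g.

(** The order of 0 is the default 0 instead of infinity. The predicate [vge] expresses lower bounds
    on the order that remain correct for 0. *)
Definition ord a F : int := xget 0 [set k | exists g, form F a k g /\ g a != 0].

Lemma ordP F a : F != 0 -> exists2 g, form F a (ord a F) g & g a != 0.
Proof.
move=> F0.
have [k [g [h g0]]] : exists k g, form F a k g /\ g a != 0.
  have [k [g h]] := merom_form a (mer_merom F); case: (form_dich h) => // h0.
  have [z [z0]] := dnbhs_ex (filterI h0 (mer_neq0 a F0)).
  by rewrite z0 eqxx.
rewrite /ord; case: xgetP => [n _ [g' [h1 h2]]|hn]; first by exists g'.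
by exfalso; apply: (hn k); exists g.
Qed.

Lemma form_neq0 F a k g : form F a k g -> g a != 0 -> F != 0.
Proof.
move=> [h1 h2] g0; apply/eqP => F0.
have h4 := near_dnbhs (cont_neq0 (hol_at_cont h1) g0).
have [z [[[zE z0] gz] zc] _] := dnbhs_ex (filterI (filterI (filterI h2 (mer0 a)) h4) (near_neq a)).
move: zE; rewrite F0 z0 => /esym/eqP; rewrite mulf_eq0 (negbTE gz) orbF.
by apply/negP; rewrite expfz_neq0// subr_eq0.
Qed.

Lemma ordE F a k g : form F a k g -> g a != 0 -> ord a F = k.
Proof.
move=> h g0; have [g' h' g'0] := ordP a (form_neq0 h g0).
by apply/le_anti; rewrite (form_le h g0 h') (form_le h' g'0 h).
Qed.

Lemma vgeP F a k : F != 0 -> (vge a k F <-> k <= ord a F).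
Proof.
move=> F0; have [g h g0] := ordP a F0; split => [[g' h']|kn].
  exact: form_le h g0 h'.
by eexists; exact: form_shift kn h.
Qed.

Lemma vge0 a k : vge a k 0.
Proof.
exists (fun=> 0); split; first exact: hol_at_cst.
by apply: filterS (mer0 a) => z ->; rewrite mulr0.
Qed.

Lemma vgeW a k n F : n <= k -> vge a k F -> vge a n F.
Proof. by move=> nk [g h]; eexists; exact: form_shift nk h. Qed.

Lemma vgeD a k F G : vge a k F -> vge a k G -> vge a k (F + G).
Proof.
move=> [g h] [g' h']; eexists; apply: form_eq (formD h h').
by apply: filterS (merD F G a) => z ->.
Qed.

Lemma vgeM a k n F G : vge a k F -> vge a n G -> vge a (k + n) (F * G).
Proof.
move=> [g h] [g' h']; eexists; apply: form_eq (formM h h').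
by apply: filterS (merM F G a) => z ->.
Qed.

Lemma vge_cst a c : vge a 0 (cstm c).
Proof.
exists (fun=> c); apply: form_eq (form_cst c a).
by apply: filterS (cstmE c a) => z ->.
Qed.

Lemma vge1_0 a : vge a 0 1. Proof. exact: vge_cst. Qed.

Lemma vge_nat a (n : nat) : vge a 0 n%:R.
Proof. by rewrite -cstm_nat; exact: vge_cst. Qed.

Lemma cstmN1 : (-1 : M) = cstm (-1).
Proof. by apply/eqP; rewrite eq_sym -addr_eq0 -(cstmD (-1) 1) addNr. Qed.

Lemma vgeN a k F : vge a k F -> vge a k (- F).
Proof. by move=> h; rewrite -mulN1r -[k]add0r; apply: vgeM => //; rewrite cstmN1; exact: vge_cst. Qed.

Lemma vgeB a k F G : vge a k F -> vge a k G -> vge a k (F - G).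
Proof. by move=> h h'; apply: vgeD => //; exact: vgeN. Qed.

Lemma vgeX a k F (n : nat) : vge a k F -> vge a (k *+ n) (F ^+ n).
Proof.
move=> h; elim: n => [|n ih]; first by rewrite mulr0n expr0; exact: vge1_0.
by rewrite mulrS exprS; exact: vgeM.
Qed.

Lemma vge_der a k F : vge a k F -> vge a (k - 1) (derm F).
Proof.
move=> [g h]; eexists; apply: form_eq (form_der h).
by apply: filterS (dermE F a) => z ->.
Qed.

Lemma vge_der0 a F : vge a 0 F -> vge a 0 (derm F).
Proof.
move=> [g [h1 h2]]; exists (derive1 g); split; first exact: hol_at_derive1.
have h1' := near_dnbhs ((hol_at_near g a).1 h1).
apply: filterS (filterI (filterI h1' (dnbhs_dnbhs h2)) (dermE F a)) => z [[[l hl] hz] ->].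
have hc : cder F z l.
  by apply: cder_near hl; apply: filterS hz => w ->; rewrite mul1r.
by rewrite (cder_derive1 hc) (cder_derive1 hl) mul1r.
Qed.

Lemma ord_cst a c : c != 0 -> ord a (cstm c) = 0.
Proof.
move=> c0; apply: (@ordE _ _ _ (fun=> c)) => //; apply: form_eq (form_cst c a).
by apply: filterS (cstmE c a) => z ->.
Qed.

Lemma ord1 a : ord a 1 = 0. Proof. by apply: ord_cst; rewrite oner_eq0. Qed.

Lemma ordM a F G : F != 0 -> G != 0 -> ord a (F * G) = ord a F + ord a G.
Proof.
move=> F0 G0; have [g h g0] := ordP a F0; have [g' h' g'0] := ordP a G0.
apply: (@ordE _ _ _ (fun z => g z * g' z)); last by rewrite mulf_neq0.
by apply: form_eq (formM h h'); apply: filterS (merM F G a) => z ->.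
Qed.

Lemma ordV a F : F != 0 -> ord a F^-1 = - ord a F.
Proof.
move=> F0; have := ordM a F0 (invr_neq0 F0); rewrite divff// ord1 => /esym/eqP.
by rewrite addrC addr_eq0 => /eqP.
Qed.

Lemma ordX a F (n : nat) : F != 0 -> ord a (F ^+ n) = ord a F *+ n.
Proof.
move=> F0; elim: n => [|n ih]; first by rewrite expr0 ord1.
by rewrite exprS ordM ?expf_neq0// ih mulrS.
Qed.

Lemma ord_der a F : F != 0 -> ord a F != 0 ->
  derm F != 0 /\ ord a (derm F) = ord a F - 1.
Proof.
move=> F0 k0; have [g h g0] := ordP a F0; have h' := form_der h.
have h2 : form (derm F) a (ord a F - 1)
    (fun z => (ord a F)%:~R * g z + (z - a) * derive1 g z).
  by apply: form_eq h'; apply: filterS (dermE F a) => z ->.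
have nz : (ord a F)%:~R * g a + (a - a) * derive1 g a != 0.
  by rewrite subrr mul0r addr0 mulf_neq0// intr_eq0.
by split; [exact: form_neq0 h2 nz | exact: ordE h2 nz].
Qed.

Lemma vge_hol a F : vge a 0 F -> hol_at F a.
Proof.
move=> [g [h1 h2]].
have hz : \forall z \near a, F z = g z.
  move/dnbhsC: h2 => [d d0 hd]; apply/nbhsC; exists d => // z zd.
  have [->|za] := eqVneq z a; last by rewrite hd// mul1r.
  rewrite -(mer_nv F) -(nv_cont (hol_at_cont h1)); apply: nv_near.
  by apply/dnbhsC; exists d => // w wd wa; rewrite hd// mul1r.
by apply: hol_at_eq h1; apply: filterS hz => z ->.
Qed.

Lemma vge_cont a F : vge a 0 F -> {for a, continuous F}.
Proof. by move/vge_hol/hol_at_cont. Qed.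

Lemma hol_vge a F : hol_at F a -> vge a 0 F.
Proof. by move=> h; exists F; split => //; apply/dnbhsC; exists 1 => // z _ _; rewrite mul1r. Qed.

Lemma evD a F G : vge a 0 F -> vge a 0 G -> (F + G) a = F a + G a.
Proof.
move=> hF hG; apply: (@cont_eq_dnbhs _ (F + G : M) (fun z => F z + G z) a).
- by apply: vge_cont; exact: vgeD.
- by apply: continuousD; exact: vge_cont.
- exact: merD.
Qed.

Lemma evM a F G : vge a 0 F -> vge a 0 G -> (F * G) a = F a * G a.
Proof.
move=> hF hG; apply: (@cont_eq_dnbhs _ (F * G : M) (fun z => F z * G z) a).
- by apply: vge_cont; rewrite -[0]addr0; exact: vgeM.
- by apply: continuousM; exact: vge_cont.
- exact: merM.
Qed.

Lemma ev_nat a (n : nat) : (n%:R : M) a = n%:R.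
Proof. by rewrite -cstm_nat cstm_pt. Qed.

Lemma evN a F : vge a 0 F -> (- F) a = - F a.
Proof.
by move=> h; rewrite -mulN1r cstmN1 evM ?cstm_pt ?mulN1r//; exact: vge_cst.
Qed.

Lemma evB a F G : vge a 0 F -> vge a 0 G -> (F - G) a = F a - G a.
Proof. by move=> h h'; rewrite evD ?evN//; exact: vgeN. Qed.

Lemma evX a F (n : nat) : vge a 0 F -> (F ^+ n) a = F a ^+ n.
Proof.
move=> h; elim: n => [|n ih]; first by rewrite !expr0 (ev_nat a 1).
by rewrite !exprS evM// ?ih//; have := vgeX n h; rewrite mul0rn.
Qed.

Lemma ev_der a F : vge a 0 F -> cder F a (derm F a).
Proof.
move=> h; have hF := vge_hol h; have [r r0 hr] := hF.
have [|l hl] := hr a; first by rewrite subrr modC0.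
suff -> : derm F a = derive1 F a by rewrite (cder_derive1 hl).
apply: (@cont_eq_dnbhs _ (derm F) (derive1 F) a).
- by apply: vge_cont; exact: vge_der0.
- exact: hol_at_cont (hol_at_derive1 hF).
- exact: dermE.
Qed.

Lemma vge1P a F : vge a 0 F -> (vge a 1 F <-> F a = 0).
Proof.
move=> h; split.
  move=> [g [h1 h2]].
  have -> : F a = (a - a) * g a; last by rewrite subrr mul0r.
  apply: (@cont_eq_dnbhs _ F (fun z => (z - a) * g z) a); first exact: vge_cont.
    apply: hol_at_cont; apply: hol_atM => //.
    by apply: hol_atD; [exact: hol_at_id|exact: hol_at_cst].
  by apply: filterS h2 => z ->; rewrite expr1z.
move=> Fa; have [->|F0] := eqVneq F 0; first exact: vge0.
apply/vgeP => //; have /(vgeP a 0 F0) := h.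
rewrite le_eqVlt => /predU1P[k0|//].
have [g [h1 h2] g0] := ordP a F0; exfalso; move/negP: g0; apply; apply/eqP.
rewrite -Fa; apply/esym; apply: (@cont_eq_dnbhs _ F g a); first exact: vge_cont.
  exact: hol_at_cont.
by apply: filterS h2 => z ->; rewrite -k0 mul1r.
Qed.

Definition tm a : M := idm R - cstm a.

Lemma vge_id a : vge a 0 (idm R).
Proof. by apply: hol_vge; apply: hol_at_eq (hol_at_id a); apply/nbhsC; exists 1 => // z _; rewrite idm_pt. Qed.

Lemma tm_pt a z : tm a z = z - a.
Proof. by rewrite /tm evB ?idm_pt ?cstm_pt//; [exact: vge_id|exact: vge_cst]. Qed.

Lemma derm_tm a : derm (tm a) = 1.
Proof. by rewrite /tm dermB derm_cst derm_id subr0. Qed.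

Lemma tm_form a : form (tm a) a 1 (fun=> 1).
Proof.
split; first exact: hol_at_cst.
by apply/dnbhsC; exists 1 => // z _ _; rewrite tm_pt expr1z mulr1.
Qed.

Lemma tm_neq0 a : tm a != 0.
Proof. by apply: form_neq0 (tm_form a) _; rewrite oner_eq0. Qed.

Lemma ord_tm a : ord a (tm a) = 1.
Proof. by apply: ordE (tm_form a) _; rewrite oner_eq0. Qed.

Lemma vge_tm a z : vge z 0 (tm a).
Proof. by apply: vgeB; [exact: vge_id|exact: vge_cst]. Qed.

Lemma ord_eq0 a F : F != 0 -> vge a 0 F -> F a != 0 -> ord a F = 0.
Proof.
move=> F0 h Fa; apply/le_anti; rewrite ((vgeP a 0 F0).1 h) andbT leNgt.
by apply/negP => k0; move/negP: Fa; apply; apply/eqP; apply/vge1P => //; apply/vgeP.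
Qed.

Lemma ord_tm_ne a z : z != a -> ord z (tm a) = 0.
Proof.
move=> za; apply: ord_eq0; [exact: tm_neq0|exact: vge_tm|].
by rewrite tm_pt subr_eq0.
Qed.

Lemma vge_divt a k F : vge a k F -> vge a (k - 1) (F / tm a).
Proof.
move=> h; apply: vgeM => //; apply/vgeP; first by rewrite invr_neq0// tm_neq0.
by rewrite ordV ?tm_neq0// ord_tm.
Qed.

Lemma vge2 a F : vge a 0 F -> F a = 0 -> derm F a = 0 -> vge a 2 F.
Proof.
move=> h0 Fa dFa; have h1 : vge a 1 F by apply/vge1P.
have h := vge_divt h1; rewrite subrr in h.
have E : F = tm a * (F / tm a) by rewrite mulrCA divff ?tm_neq0// mulr1.
have dE : derm F = F / tm a + tm a * derm (F / tm a).
  by rewrite {1}E dermM derm_tm mul1r.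
have v : (F / tm a) a = 0.
  move: dFa; rewrite dE evD; [|exact: h|].
    rewrite (evM (vge_tm a a) (vge_der0 h)) tm_pt subrr mul0r addr0 //.
  rewrite -[0]addr0; apply: vgeM; [exact: vge_tm|exact: vge_der0].
rewrite E -[2]/(1 + 1); apply: vgeM; last exact/vge1P.
by apply/vgeP; [exact: tm_neq0|rewrite ord_tm].
Qed.

(** At a regular point [z] the function [F - F z] has positive order. Were it nonzero, [ord_der]
    would make its derivative nonzero. *)
Lemma derm0_cst F : derm F = 0 -> exists c, F = cstm c.
Proof.
move=> dF; have [z hz _] := dnbhs_ex (dnbhs_dnbhs (mer_near_hol F 0)).
have hF : vge z 0 F by apply: hol_vge; apply/hol_at_near.
exists (F z); apply/eqP; rewrite -subr_eq0; apply/negPn/negP => G0.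
have hG : vge z 0 (F - cstm (F z)) by apply: vgeB => //; exact: vge_cst.
have h1 : vge z 1 (F - cstm (F z)).
  by apply/vge1P => //; rewrite evB ?cstm_pt ?subrr//; exact: vge_cst.
have k1 := (vgeP z 1 G0).1 h1.
have k0 : ord z (F - cstm (F z)) != 0.
  by apply/eqP => e; rewrite e in k1.
have [] := ord_der G0 k0.
by rewrite dermB dF derm_cst subrr eqxx.
Qed.

Lemma ord_near0 a F : F != 0 -> \forall z \near a^', ord z F = 0.
Proof.
move=> F0; have h1 := dnbhs_dnbhs (mer_near_hol F a).
apply: filterS (filterI h1 (mer_neq0 a F0)) => z [hz Fz].
by apply: ord_eq0 => //; apply: hol_vge; apply/hol_at_near.
Qed.

(** Near any point the order is 0 except possibly at the point itself, and finiteness passes to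
    unions of quarters, so [rect_ind] applies. *)
Lemma fin_ord F (r : R) : F != 0 -> finite_set [set z : C | modC z <= r /\ ord z F != 0].
Proof.
move=> F0; have [r0|r0] := ltP r 0.
  apply: (sub_finite_set (B := set0)) => // z [zr _].
  by have := modC_ge0 z; lra.
pose P (x1 x2 y1 y2 : R) := finite_set [set z : C |
  (x1 <= complex.Re z <= x2 /\ y1 <= complex.Im z <= y2) /\ ord z F != 0].
have : P (- r) r (- r) r.
  apply: rect_ind; [lra|lra| |].
  - move=> x1 x2 y1 y2 hx hy p1 p2 p3 p4.
    have fu : finite_set (
      ([set z : C | (x1 <= complex.Re z <= (x1 + x2) / 2 /\ y1 <= complex.Im z <= (y1 + y2) / 2) /\ ord z F != 0] `|`
      [set z : C | ((x1 + x2) / 2 <= complex.Re z <= x2 /\ y1 <= complex.Im z <= (y1 + y2) / 2) /\ ord z F != 0]) `|`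
      ([set z : C | (x1 <= complex.Re z <= (x1 + x2) / 2 /\ (y1 + y2) / 2 <= complex.Im z <= y2) /\ ord z F != 0] `|`
      [set z : C | ((x1 + x2) / 2 <= complex.Re z <= x2 /\ (y1 + y2) / 2 <= complex.Im z <= y2) /\ ord z F != 0])).
      by rewrite !finite_setU.
    apply: sub_finite_set fu => z [[/andP[A1 A2] /andP[A3 A4]] A5].
    have [xp|/ltW xp] := leP (complex.Re z) ((x1 + x2) / 2);
    have [yq|/ltW yq] := leP (complex.Im z) ((y1 + y2) / 2).
    + by left; left; rewrite /= A1 A3.
    + by right; left; rewrite /= A1 A4 yq.
    + by left; right; rewrite /= A2 A3 xp.
    + by right; right; rewrite /= A2 A4 xp yq.
  - move=> x y hx hy; have /dnbhsC[d d0 hd] := ord_near0 (Complex x y) F0.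
    exists (d / 2); first by lra.
    move=> x1 x2 y1 y2 _ A1 A2 _ _ A3 A4 _ A5 A6.
    apply: (sub_finite_set (B := [set (Complex x y : C)])); last exact: finite_set1.
    move=> z [[/andP[X1 X2] /andP[Y1 Y2]] A7] /=; apply/eqP/negPn/negP => zn.
    move/negP: A7; apply; apply/eqP; apply: hd => //.
    apply: le_lt_trans (modC_le_ReIm _) _; rewrite ReD ImD ReN ImN /=.
    have t1 : `|complex.Re z - x| < d / 2.
      by clear -A1 A2 A5 X1 X2; rewrite ltr_norml; apply/andP; split; lra.
    have t2 : `|complex.Im z - y| < d / 2.
      by clear -A3 A4 A6 Y1 Y2; rewrite ltr_norml; apply/andP; split; lra.
    by clear -t1 t2; lra.
apply: sub_finite_set => z [zr zo] /=; split => //.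
have := ReM_le z; have := ImM_le z; rewrite !ler_norml => /andP[? ?] /andP[? ?].
by split; apply/andP; split; lra.
Qed.

End Orders.

(** * Nevanlinna theory *)

Section LogMeans.
Variable R : realType.
Local Notation C := (CC R).
Implicit Types (f g L : C -> C) (r : R) (z w a : C) (u : C -> R).

Lemma cder0_disc (h : C -> C) R0 z : (forall z, modC z < R0 -> cder h z 0) ->
  modC z < R0 -> h z = h 0.
Proof.
move=> hd zR.
have hp t : 0 <= t <= 1 -> pder (fun t => h (0 + z * toC t)) t 0.
  move=> /andP[t0 t1]; rewrite -[X in pder _ _ X](mul0r z).
  apply: (pder_comp (V := fun t => 0 + z * toC t)); last exact: pder_affine.
  apply: hd; rewrite add0r modCM modC_toC ger0_norm//; apply: le_lt_trans zR.
  by rewrite ler_piMr ?modC_ge0.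
have c0 : contI 0 1 (fun _ : R => 0 : C) by move=> t _; exact: cst_continuous.
have := @cint_FTC R 0 1 (fun t => h (0 + z * toC t)) (fun=> 0) ler01 c0 hp.
rewrite cint_cst// mul0r => /esym/eqP.
rewrite subr_eq0 => /eqP.
by rewrite (_ : toC 1 = 1)// (_ : toC 0 = 0)// mulr1 mulr0 !add0r.
Qed.

(** A primitive [F] of [g' / g] is a logarithm up to a constant, because [g * cexp (- F)] has
    derivative zero. Adding a real constant adjusts the real part, the part that carries
    [ln (modC (g z))]. *)
Lemma hol_log g R0 : 0 < R0 -> hol_on R0 g -> (forall z, modC z < R0 -> g z != 0) ->
  exists L, (forall z, modC z < R0 -> cder L z (derive1 g z / g z)) /\
            (forall z, modC z < R0 -> complex.Re (L z) = ln (modC (g z))).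
Proof.
move=> R00 hg gn.
have hq : hol_on R0 (fun z => derive1 g z / g z).
  move=> z zR; have [l hl] := hol_derive1 hg zR; have [l' hl'] := hg z zR.
  by eexists; exact: cderM hl (cderV (gn z zR) hl').
have [F hF] := hol_primitive hq.
have hc z : modC z < R0 -> g z * cexp (- F z) = g 0 * cexp (- F 0).
  move=> zR; apply: (@cder0_disc (fun z => g z * cexp (- F z)) R0) => // w wR.
  have [l hl] := hg w wR.
  have h1 := cderM hl (cder_comp (cder_cexp _) (cderN (hF w wR))).
  apply: cder_eq h1 _; rewrite (cder_derive1 hl); have := gn w wR => gw.
  by rewrite /=; field.
pose c := g 0 * cexp (- F 0).
have c0 : c != 0.
  rewrite mulf_neq0 ?gn ?modC0// -modC_gt0 modC_cexp expR_gt0//.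
exists (fun z => F z + toC (ln (modC c))); split => z zR.
  by apply: cder_eq (cderD (hF z zR) (cder_cst _ z)) _; rewrite addr0.
have e : modC (g z) = modC c * expR (complex.Re (F z)).
  have := congr1 (@modC R) (hc z zR); rewrite modCM modC_cexp ReN expRN -/c => <-.
  by rewrite mulfVK// gt_eqF// expR_gt0.
by rewrite ReD /= e lnM ?posrE ?modC_gt0 ?expR_gt0// expRK addrC.
Qed.

Lemma circ_cont_ln r g : circ_cont r g -> (forall z, modC z = r -> g z != 0) ->
  circ_cont r (fun z => ln (modC (g z))).
Proof.
move=> hg g0 z zr; apply: (@continuous_comp _ _ _ (fun z => modC (g z)) (@ln R)).
  exact: (circ_cont_modC hg zr).
by apply: continuous_ln; rewrite modC_gt0 g0.
Qed.

Lemma mean_log g r R0 : 0 <= r -> r < R0 -> hol_on R0 g ->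
  (forall z, modC z < R0 -> g z != 0) -> rmean r (fun z => ln (modC (g z))) = ln (modC (g 0)).
Proof.
move=> r0 rR hg gn; have R00 : 0 < R0 by lra.
have [L [hL hl]] := hol_log R00 hg gn.
have LR : hol_on R0 L by move=> z zR; eexists; exact: hL.
rewrite -hl ?modC0// -(mean_hol r0 rR LR) (Re_cmean r0 (hol_circ_cont rR LR)).
by apply: eq_rmean => // z zr; rewrite hl// zr.
Qed.

(** Cauchy's formula for [L] plus the mean of the conjugate of [L] against the same kernel: the sum
    involves only the real part of [L] on the circle. *)
Lemma schwarz L r R0 z : 0 < r -> r < R0 -> modC z < r -> hol_on R0 L ->
  L z + conjc (L 0) = cmean r (fun w => toC (2 * complex.Re (L w)) * (w / (w - z))).
Proof.
move=> r0 rR zr hL; have r0' := ltW r0.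
rewrite -(cmean_conj_kernel r0 rR zr hL) {1}(cauchy_formula r0 rR zr hL).
have ck := circ_cont_kernel zr; have cL := hol_circ_cont rR hL.
have cc : circ_cont r (fun w => conjc (L w) : C).
  move=> w wr; have h := cL w wr.
  rewrite (_ : (fun w => _) = (fun w => Complex (complex.Re (L w)) (- complex.Im (L w)) : C)).
    apply: cont_Complex; first by apply: continuous_comp => //; exact: cont_Re.
    by apply: continuousN; apply: continuous_comp => //; exact: cont_Im.
  by apply/funext => v; case: (L v).
rewrite -(cmeanD r0' (circ_contM cL ck) (circ_contM cc ck)).
apply: eq_cmean => // w _; rewrite -mulrDl; congr (_ * _).
by case: (L w) => x y; apply: Ceq; rewrite /=; ring.
Qed.

Lemma circ_cont_toC r u : circ_cont r u -> circ_cont r (fun w => toC (u w) : C).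
Proof. by move=> h w /h hw; exact: cont_toC. Qed.

Lemma circ_cont_Re r f : circ_cont r f -> circ_cont r (fun w => complex.Re (f w)).
Proof. by move=> h w /h hw; apply: continuous_comp hw _; exact: cont_Re. Qed.

Lemma circ_contMr r u (v : C -> R) : circ_cont r u -> circ_cont r v -> circ_cont r (fun w => u w * v w).
Proof. by move=> hf hg w wr; apply: continuousM; [exact: hf|exact: hg]. Qed.

Lemma circ_cont_cst r (T : topologicalType) (c : T) : circ_cont r (fun _ : C => c).
Proof. by move=> w _; exact: cst_continuous. Qed.

Lemma circ_cont_abs r u : circ_cont r u -> circ_cont r (fun w => `|u w|).
Proof. by move=> h w /h hw; apply: continuous_comp hw _; exact: norm_continuous. Qed.

Lemma rmean_norm r u : 0 <= r -> circ_cont r u ->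
  `|rmean r u| <= rmean r (fun w => `|u w|).
Proof.
move=> r0 hu; have ha := circ_cont_abs hu; rewrite ler_norml; apply/andP; split.
  rewrite -mulN1r -(rmeanZ _ r0 ha); apply: rmean_le => //.
    by apply: circ_contMr => //; exact: circ_cont_cst.
  by move=> z _; rewrite mulN1r; have := ler_norm (- u z); rewrite normrN; lra.
by apply: rmean_le => // z _; exact: ler_norm.
Qed.

Lemma cmean_le_rmean r f : 0 <= r -> circ_cont r f ->
  modC (cmean r f) <= 2 * rmean r (fun w => modC (f w)).
Proof.
move=> r0 hf; have hm := circ_cont_modC hf.
have hI : circ_cont r (fun w => complex.Im (f w)).
  by move=> w wr; apply: continuous_comp; [exact: hf|exact: cont_Im].
have hR := circ_cont_Re hf.
have ReI : complex.Im (cmean r f) = rmean r (fun w => complex.Im (f w)).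
  by rewrite /cmean ImMul /= mul0r addr0.
apply: le_trans (modC_le_ReIm _) _; rewrite (Re_cmean r0 hf) ReI.
have h1 := rmean_norm r0 hR; have h2 := rmean_norm r0 hI.
have h3 : rmean r (fun w => `|complex.Re (f w)|) <= rmean r (fun w => modC (f w)).
  by apply: rmean_le => //; [exact: circ_cont_abs|move=> z _; exact: ReM_le].
have h4 : rmean r (fun w => `|complex.Im (f w)|) <= rmean r (fun w => modC (f w)).
  by apply: rmean_le => //; [exact: circ_cont_abs|move=> z _; exact: ImM_le].
by clear -h1 h2 h3 h4; lra.
Qed.

(** Schwarz's formula for a logarithm of [g], differentiated in [z], has kernel
    [2 * w / (w - z) ^+ 2]. A further factor 2 comes from [cmean_le_rmean]. *)
Lemma logderiv_le g r R0 z : 0 < r -> r < R0 -> modC z < r -> hol_on R0 g ->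
  (forall z, modC z < R0 -> g z != 0) ->
  modC (derive1 g z / g z) <=
    4 * r / (r - modC z) ^+ 2 * rmean r (fun w => `|ln (modC (g w))|).
Proof.
move=> r0 rR zr hg gn; have R00 : 0 < R0 by lra.
have r0' := ltW r0; have zR := lt_trans zr rR.
have [L [hL hl]] := hol_log R00 hg gn.
have LR : hol_on R0 L by move=> w wR; eexists; exact: hL.
have cL := hol_circ_cont rR LR.
pose U w : C := toC (2 * complex.Re (L w)) * w.
have cu : circ_cont r (fun w => 2 * complex.Re (L w)).
  by apply: circ_contMr; [exact: circ_cont_cst|exact: circ_cont_Re].
have cU : circ_cont r U.
  by apply: circ_contM; [exact: circ_cont_toC|exact: circ_cont_id].
have hd : cder L z (ctr 2 r U z).
  have h1 := cderB (cder_ctr1 r0 cU zr) (cder_cst (conjc (L 0) : C) z).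
  apply: (cder_eq _ (subr0 _)); apply: cder_near h1.
  apply: filterS (nbhs_disc zr) => w wr.
  rewrite (_ : ctr 1 r U w = L w + conjc (L 0)) ?addrK//.
  rewrite (schwarz r0 rR wr LR); apply: eq_cmean => // v _.
  by rewrite expr1 /U mulrA.
rewrite (cder_uniq (hL z zR) hd).
have cK : circ_cont r (fun w => U w * (w - z)^-1 ^+ 2).
  by apply: circ_contM; [exact: cU|exact: circ_cont_kerX].
apply: le_trans (cmean_le_rmean r0' cK) _.
have d0 : 0 < r - modC z by lra.
have cg : circ_cont r (fun w => `|ln (modC (g w))|).
  apply: circ_cont_abs; apply: circ_cont_ln; first exact: hol_circ_cont hg.
  by move=> w wr; apply: gn; rewrite wr.
have cg2 : circ_cont r (fun w => 2 * r / (r - modC z) ^+ 2 * `|ln (modC (g w))|).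
  by apply: circ_contMr; [exact: circ_cont_cst|exact: cg].
apply: le_trans (_ : 2 * rmean r (fun w => 2 * r / (r - modC z) ^+ 2 * `|ln (modC (g w))|) <= _).
  rewrite ler_wpM2l//; apply: (rmean_le r0' (circ_cont_modC cK) cg2).
  move=> w wr; rewrite modCM modCX modCV /U modCM modC_toC wr -hl ?wr// normrM normr_nat.
  have d1 : r - modC z <= modC (w - z) by have := modC_triB w z; rewrite wr.
  have -> : 2 * r / (r - modC z) ^+ 2 * `|complex.Re (L w)| =
     2 * `|complex.Re (L w)| * r * (r - modC z)^-1 ^+ 2 by rewrite exprVn; ring.
  rewrite ler_wpM2l ?mulr_ge0//; apply: lerXn2r; rewrite ?nnegrE ?invr_ge0 ?modC_ge0//.
    exact: ltW.
  by rewrite lef_pV2 ?posrE//; lra.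
by rewrite (rmeanZ _ r0' cg) !mulrA -natrM.
Qed.

Definition pker z w : R := complex.Re ((w + z) / (w - z)).

Lemma pker_ge0 z w r : modC z < r -> modC w = r -> 0 <= pker z w.
Proof.
move=> zr wr; have wz := kernel_den zr wr.
have -> : pker z w = (modC w ^+ 2 - modC z ^+ 2) / modC (w - z) ^+ 2.
  have d0 : modC (w - z) ^+ 2 != 0 by rewrite expf_neq0// modC_eq0.
  have ci : (w - z)^-1 = conjc (w - z : C) / toC (modC (w - z) ^+ 2) :> C.
    rewrite -(conj_circ (w := w - z) erefl) invfM mulrCA divff ?mulr1//.
    by rewrite -modC_gt0 modC_conj modC_gt0.
  rewrite /pker ci -toCV mulrA ReMul /= mulr0 subr0; congr (_ / _).
  rewrite !modC_sqr; case: w z {wr zr wz d0 ci} => [x y] [x' y'] /=; ring.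
rewrite divr_ge0 ?sqr_ge0// subr_ge0 wr.
by apply: lerXn2r; rewrite ?nnegrE ?modC_ge0 ?(le_trans (modC_ge0 z))// ltW.
Qed.

(** The Herglotz integral: holomorphic in [z], with the Poisson integral of [u] as real part. *)
Definition poisson r u z : C := cmean r (fun w => toC (u w) * ((w + z) / (w - z))).

Lemma circ_cont_pk r z : modC z < r -> circ_cont r (fun w => (w + z) / (w - z)).
Proof.
move=> zr w wr; apply: cont_cderE; eexists; apply: cderM.
  by apply: cderD; [exact: cder_id|exact: cder_cst].
by apply: cder_kernel; exact: kernel_den wr.
Qed.

Lemma poissonE r u z : 0 < r -> circ_cont r u -> modC z < r ->
  poisson r u z = ctr 1 r (fun w => toC (2 * u w) * w) z - cmean r (fun w => toC (u w)).
Proof.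
move=> r0 hu zr; have r0' := ltW r0.
have c1 : circ_cont r (fun w => toC (2 * u w) * w * (w - z)^-1 ^+ 1).
  apply: circ_contM; last exact: circ_cont_kerX.
  apply: circ_contM; last exact: circ_cont_id.
  by apply: circ_cont_toC; apply: circ_contMr; [exact: circ_cont_cst|exact: hu].
rewrite /ctr -(cmeanB r0' c1 (circ_cont_toC hu)); apply: eq_cmean => // w wr.
have wz := kernel_den zr wr; rewrite toCM expr1 (_ : toC 2 = 2); last first.
  exact: (rmorph_nat (real_complex R) 2).
by field.
Qed.

Lemma poisson_hol r u : 0 < r -> circ_cont r u -> hol_on r (poisson r u).
Proof.
move=> r0 hu z zr; pose U w : C := toC (2 * u w) * w.
have cU : circ_cont r U.
  apply: circ_contM; last exact: circ_cont_id.
  by apply: circ_cont_toC; apply: circ_contMr; [exact: circ_cont_cst|exact: hu].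
eexists; apply: cder_near (cderB (cder_ctr1 r0 cU zr) (cder_cst (cmean r (fun w => toC (u w))) z)).
by apply: filterS (nbhs_disc zr) => w wr; rewrite (poissonE r0 hu wr).
Qed.

Lemma poisson0 r u : 0 < r -> circ_cont r u -> complex.Re (poisson r u 0) = rmean r u.
Proof.
move=> r0 hu; have r0' := ltW r0.
have cc : circ_cont r (fun w => toC (u w) * ((w + 0) / (w - 0))).
  by apply: circ_contM; [exact: circ_cont_toC|apply: circ_cont_pk; rewrite modC0].
rewrite /poisson (Re_cmean r0' cc); apply: eq_rmean => // w wr.
have w0 : w != 0 by rewrite -modC_gt0 wr.
by rewrite addr0 subr0 divff// mulr1.
Qed.

(** For zero-free [g], [ln (modC (g z))] is the Poisson integral of its boundary values. The kernel
    is non-negative, so a majorant on the circle gives one inside. *)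
Lemma poisson_le g r R0 u z : 0 < r -> r < R0 -> modC z < r -> hol_on R0 g ->
  (forall z, modC z < R0 -> g z != 0) -> circ_cont r u ->
  (forall w, modC w = r -> ln (modC (g w)) <= u w) ->
  ln (modC (g z)) <= complex.Re (poisson r u z).
Proof.
move=> r0 rR zr hg gn hu hle; have R00 : 0 < R0 by lra.
have r0' := ltW r0; have zR := lt_trans zr rR.
have [L [hL hl]] := hol_log R00 hg gn.
have LR : hol_on R0 L by move=> w wR; eexists; exact: hL.
have cL := circ_cont_Re (hol_circ_cont rR LR).
have ck := circ_cont_pk zr.
have ckR : circ_cont r (fun w => pker z w) by exact: circ_cont_Re.
have E : complex.Re (L z) = complex.Re (poisson r (fun w => complex.Re (L w)) z).
  rewrite (poissonE r0 cL zr).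
  have -> : ctr 1 r (fun w => toC (2 * complex.Re (L w)) * w) z = L z + conjc (L 0).
    by rewrite (schwarz r0 rR zr LR); apply: eq_cmean => // w _; rewrite expr1 mulrA.
  rewrite ReD ReN ReD (Re_cmean r0' (circ_cont_toC cL)) /=.
  rewrite -(Re_cmean r0' (hol_circ_cont rR LR)) (mean_hol r0' rR LR).
  by case: (L 0) => x y /=; rewrite addrK.
have RP v : circ_cont r v -> complex.Re (poisson r v z) = rmean r (fun w => v w * pker z w).
  move=> hv; rewrite /poisson (Re_cmean r0' (circ_contM (circ_cont_toC hv) ck)).
  by apply: eq_rmean => // w _; rewrite ReMul /= mul0r subr0.
rewrite -hl// E (RP _ cL) (RP _ hu).
apply: (rmean_le r0' (circ_contMr cL ckR) (circ_contMr hu ckR)) => w wr.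
rewrite ler_wpM2r ?(pker_ge0 zr wr)// hl ?wr//; exact: hle.
Qed.

End LogMeans.

(** * Integrated counting functions of divisors *)

Section DivisorSums.
Variable R : realType.
Local Notation C := (CC R).
Implicit Types (d : C -> R) (r : R) (a z : C).

(** The contribution of one point to the integrated counting function: the integral of [1 / t] from
    [modC a] to [r], and at the origin the [ln r] that [Ncount] adds separately. In this way [Nc] is
    a finite sum, linear in the divisor. *)
Definition lw r a : R := if a == 0 then ln r else ln r - ln (modC a).

Definition Nc r d : R := \sum_(a \in [set a : C | modC a <= r]) d a * lw r a.

Definition locfin d := forall r, finite_set [set a : C | modC a <= r /\ d a != 0].

Lemma locfin2 d d' r : locfin d -> locfin d' ->
  exists s : seq C, [/\ uniq s, forall a, a \in s -> modC a <= r &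
    forall a, modC a <= r -> a \notin s -> d a = 0 /\ d' a = 0].
Proof.
move=> h h'; pose A := [set a : C | modC a <= r /\ d a != 0] `|` [set a : C | modC a <= r /\ d' a != 0].
have fA : finite_set A by rewrite finite_setU; split; [exact: h|exact: h'].
move/finite_seqP: fA => [s As]; exists (undup s); split; first exact: undup_uniq.
  move=> a; rewrite mem_undup => sa.
  by have : [set` s] a by []; rewrite -As => -[[]|[]].
move=> a ar; rewrite mem_undup => /negP ha.
have nA : ~ A a by rewrite As.
by split; apply/eqP/negPn/negP => da; apply: nA; [left|right].
Qed.

Lemma NcE r d (s : seq C) : uniq s -> (forall a, a \in s -> modC a <= r) ->
  (forall a, modC a <= r -> a \notin s -> d a = 0) ->
  Nc r d = \sum_(a <- s) d a * lw r a.
Proof.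
move=> us hs h; rewrite /Nc (@fsbigE _ _ _ _ _ s)//.
  rewrite big_seq_cond [RHS]big_seq_cond; apply: eq_bigl => a.
  by case: (boolP (a \in s)) => //= /hs ha; rewrite mem_set.
by move=> a ar /h ->//; rewrite mul0r.
Qed.

Lemma NcD r d d' : locfin d -> locfin d' -> Nc r (fun a => d a + d' a) = Nc r d + Nc r d'.
Proof.
move=> h h'; have [s [us hs hz]] := locfin2 r h h'.
rewrite (@NcE _ (fun a => d a + d' a) s)//; last first.
  by move=> a ar /(hz a ar)[-> ->]; rewrite addr0.
rewrite (@NcE _ d s)//; last by move=> a ar /(hz a ar)[].
rewrite (@NcE _ d' s)//; last by move=> a ar /(hz a ar)[].
by rewrite -big_split; apply: eq_bigr => a _; rewrite mulrDl.
Qed.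

Lemma NcZ r (k : R) d : Nc r (fun a => k * d a) = k * Nc r d.
Proof. by rewrite /Nc mulr_fsumr; apply: eq_fsbigr => a _; rewrite mulrA. Qed.

Lemma lw_ge0 r a : 1 <= r -> modC a <= r -> 0 <= lw r a.
Proof.
move=> r1 ar; rewrite /lw; case: eqP => [_|/eqP a0]; first exact: ln_ge0.
by rewrite subr_ge0 ler_ln ?posrE ?modC_gt0//; lra.
Qed.

Lemma Nc_le r d d' : 1 <= r -> locfin d -> locfin d' ->
  (forall a, modC a <= r -> d a <= d' a) -> Nc r d <= Nc r d'.
Proof.
move=> r1 h h' hle; have [s [us hs hz]] := locfin2 r h h'.
rewrite (@NcE _ d s)//; last by move=> a ar /(hz a ar)[].
rewrite (@NcE _ d' s)//; last by move=> a ar /(hz a ar)[].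
by rewrite big_seq [leRHS]big_seq; apply: ler_sum => a /hs ha; rewrite ler_wpM2r ?lw_ge0 ?hle.
Qed.

Lemma Nc_ge0 r d : 1 <= r -> (forall a, 0 <= d a) -> 0 <= Nc r d.
Proof. by move=> r1 h; apply: fsumr_ge0 => a ar; rewrite mulr_ge0 ?lw_ge0. Qed.

Lemma locfin_bound d d' : (forall a, d' a = 0 -> d a = 0) -> locfin d' -> locfin d.
Proof.
move=> h hd r; apply: sub_finite_set (hd r) => a [ar da]; split => //.
by apply: contraNneq da => /h ->.
Qed.

Lemma locfinD d d' : locfin d -> locfin d' -> locfin (fun a => d a + d' a).
Proof.
move=> h h' r; have fU : finite_set ([set a : C | modC a <= r /\ d a != 0] `|`
   [set a : C | modC a <= r /\ d' a != 0]) by rewrite finite_setU.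
apply: sub_finite_set fU => a [ar da] /=.
have [d0|d0] := eqVneq (d a) 0; last by left.
by right; split => //; move: da; rewrite d0 add0r.
Qed.

Lemma locfinZ (k : R) d : locfin d -> locfin (fun a => k * d a).
Proof. by apply: locfin_bound => a ->; rewrite mulr0. Qed.

(** Points of modulus at most [rho] have weight at least [ln (r / rho)] at radius [r]; this bounds
    an unintegrated count by the integrated one. *)
Lemma Nc_count r rho d (s : seq C) : 1 <= rho -> rho < r -> locfin d -> (forall a, 0 <= d a) ->
  uniq s -> (forall a, a \in s -> modC a <= rho) ->
  (\sum_(a <- s) d a) * ln (r / rho) <= Nc r d.
Proof.
move=> r1 rr h h0 us hs; have [s' [us' hs' hz]] := locfin2 r h h.
have r0 : 0 < r by lra.
have rho0 : 0 < rho by lra.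
have lr : 0 <= ln (r / rho) by rewrite ln_ge0// ler_pdivlMr// mul1r ltW.
pose t := undup (s ++ s').
have ht a : a \in t -> modC a <= r.
  by rewrite mem_undup mem_cat => /orP[/hs|/hs'//] => ha; lra.
rewrite (@NcE r _ t); first 1 last.
- exact: undup_uniq.
- exact: ht.
- by move=> a ar; rewrite mem_undup mem_cat negb_or => /andP[_ /(hz a ar)[]].
have pt : perm_eq s [seq a <- t | a \in s].
  apply: uniq_perm => //; first by rewrite filter_uniq ?undup_uniq.
  by move=> a; rewrite mem_filter mem_undup mem_cat; case: (a \in s).
rewrite (perm_big _ pt) /= big_filter mulr_suml big_mkcond /=.
rewrite big_seq [leRHS]big_seq; apply: ler_sum => a ta; have ar := ht a ta.
case: ifP => as_; last by rewrite mulr_ge0// lw_ge0//; lra.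
rewrite ler_wpM2l// /lw ln_div ?posrE//; case: eqP => [_|/eqP a0].
  by rewrite lerBlDr lerDl ln_ge0.
by rewrite lerD2l lerN2 ler_ln ?posrE ?modC_gt0// hs.
Qed.

End DivisorSums.

(** * Pole and zero divisors *)

Section Poles.
Variable R : realType.
Local Notation C := (CC R).
Local Notation M := (mer R).
Implicit Types (F G : M) (a z : C) (r : R).

Definition poln a F : nat := absz (Num.min 0 (ord a F)).
Definition pol F a : R := (poln a F)%:R.
Definition zer F a : R := (poln a F^-1)%:R.
Definition ordR F a : R := (ord a F)%:~R.

Lemma ord0E a : ord a (0 : M) = 0.
Proof.
rewrite /ord; case: xgetP => // k _ [g [h g0]].
by have := form_neq0 h g0; rewrite eqxx.
Qed.

Lemma ordVE a F : ord a F^-1 = - ord a F.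
Proof. by have [->|F0] := eqVneq F 0; [rewrite invr0 ord0E oppr0|exact: ordV]. Qed.

Lemma ordR_split F a : ordR F a = zer F a - pol F a.
Proof.
rewrite /ordR /zer /pol /poln ordVE; case: (ord a F) => n.
  have -> : Num.min 0 (Posz n) = 0 by apply/min_idPl.
  have -> : Num.min 0 (- Posz n) = - Posz n by apply/min_idPr; rewrite oppr_le0.
  by rewrite abszN !absz_nat subr0 pmulrn.
rewrite NegzE opprK.
have -> : Num.min 0 (Posz n.+1) = 0 by apply/min_idPl.
have -> : Num.min 0 (- Posz n.+1) = - Posz n.+1 by apply/min_idPr; rewrite oppr_le0.
by rewrite abszN !absz_nat sub0r mulrNz -pmulrn.
Qed.

Lemma locfin_ord F : F != 0 -> locfin (ordR F).
Proof.
move=> F0 r; apply: sub_finite_set (fin_ord r F0) => a [ar h]; split => //.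
by apply: contraNneq h; rewrite /ordR => ->.
Qed.

Lemma locfin_pol F : locfin (pol F).
Proof.
have [->|F0] := eqVneq F 0.
  move=> r; apply: (sub_finite_set (B := set0)) => // a [_].
  by rewrite /pol /poln ord0E minxx absz0 eqxx.
apply: locfin_bound (locfin_ord F0) => a; rewrite /ordR /pol /poln => /eqP.
by rewrite intr_eq0 => /eqP ->; rewrite minxx absz0.
Qed.

Lemma locfin_zer F : locfin (zer F). Proof. exact: (locfin_pol F^-1). Qed.

Lemma pol_ge0 F a : 0 <= pol F a. Proof. exact: ler0n. Qed.

Lemma polnP a F k : F != 0 -> (vge a (- k%:Z) F <-> (poln a F <= k)%N).
Proof.
move=> F0; rewrite vgeP// /poln -lez_nat; case: (ord a F) => n.
  have -> : Num.min 0 (Posz n) = 0 by apply/min_idPl.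
  by rewrite absz0 lez_nat leq0n; split => // _; apply: le_trans (_ : 0 <= _); rewrite ?oppr_le0.
rewrite NegzE; have -> : Num.min 0 (- Posz n.+1) = - Posz n.+1 by apply/min_idPr; rewrite oppr_le0.
by rewrite abszN absz_nat lerN2.
Qed.

Lemma vge_poln a F : vge a (- (poln a F)%:Z) F.
Proof. by have [->|F0] := eqVneq F 0; [exact: vge0|apply/polnP]. Qed.

Lemma poln_le a F k : vge a (- k%:Z) F -> (poln a F <= k)%N.
Proof.
have [->|F0] := eqVneq F 0; first by rewrite /poln ord0E minxx absz0.
by move/polnP; apply.
Qed.

Lemma poln0 a F : (poln a F == 0%N) <-> vge a 0 F.
Proof.
split => [/eqP h|h]; first by have := vge_poln a F; rewrite h oppr0.
by rewrite -leqn0; apply: poln_le; rewrite oppr0.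
Qed.

Lemma polnD a F G : (poln a (F + G)%R <= maxn (poln a F) (poln a G))%N.
Proof.
apply: poln_le; apply: vgeD; apply: vgeW (vge_poln a _); rewrite lerN2 lez_nat.
  exact: leq_maxl.
exact: leq_maxr.
Qed.

Lemma polnM a F G : (poln a (F * G)%R <= poln a F + poln a G)%N.
Proof.
by apply: poln_le; rewrite PoszD opprD; apply: vgeM; exact: vge_poln.
Qed.

Lemma poln_der a F : (poln a (derm F) <= poln a F + (0 < poln a F))%N.
Proof.
apply: poln_le; case: (posnP (poln a F)) => [h|h].
  by rewrite h oppr0; apply: vge_der0; apply/poln0; rewrite h.
by rewrite PoszD opprD; apply: vge_der; exact: vge_poln.
Qed.

End Poles.

(** * Splitting off finitely many zeros and poles *)

Section Factorization.
Variable R : realType.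
Local Notation C := (CC R).
Local Notation M := (mer R).
Implicit Types (F G : M) (a z : C) (r : R) (s : seq C).

Definition gen r F := forall z, modC z = r -> ord z F = 0.

Lemma ord0_vge z F : ord z F = 0 -> vge z 0 F.
Proof. by have [->|F0 h] := eqVneq F 0; [move=> _; exact: vge0|apply/vgeP; rewrite ?h]. Qed.

Lemma ord0_neq0 z F : F != 0 -> ord z F = 0 -> F z != 0.
Proof.
move=> F0 h; apply/eqP => /vge1P -/(_ (ord0_vge h)) /vgeP -/(_ F0).
by rewrite h.
Qed.

Lemma evV z F : F != 0 -> ord z F = 0 -> F^-1 z = (F z)^-1.
Proof.
move=> F0 h; have h' : ord z F^-1 = 0 by rewrite ordV// h.
have := evM (ord0_vge h') (ord0_vge h); rewrite mulVf// (ev_nat z 1) => e.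
have Fz := ord0_neq0 F0 h; apply: (mulIf Fz).
by rewrite -e mulVf.
Qed.

Lemma ev_exprz z F (k : int) : F != 0 -> ord z F = 0 -> (F ^ k) z = F z ^ k.
Proof.
move=> F0 h; case: k => n; first exact: evX (ord0_vge h).
have -> : F ^ Negz n = (F ^+ n.+1)^-1 by [].
rewrite evV ?evX//; [exact: ord0_vge|by rewrite expf_neq0|].
by rewrite ordX// h mul0rn.
Qed.

Lemma ord_exprz z F (k : int) : F != 0 -> ord z (F ^ k) = ord z F * k.
Proof.
move=> F0; case: k => n; first by rewrite -[F ^ _]/(F ^+ n) ordX// -mulr_natr natz.
have -> : F ^ Negz n = (F ^+ n.+1)^-1 by [].
by rewrite ordVE ordX// NegzE mulrN -mulr_natr natz.
Qed.

Definition fprod s (k : C -> int) : M := \prod_(a <- s) tm a ^ k a.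

Lemma fprod_neq0 s k : fprod s k != 0.
Proof. by rewrite prodf_seq_neq0; apply/allP => a _; rewrite /= expfz_neq0// tm_neq0. Qed.

Lemma ord_fprod s k z : uniq s -> ord z (fprod s k) = if z \in s then k z else 0.
Proof.
elim: s => [|a s ih] /=; first by rewrite /fprod big_nil ord1.
move=> /andP[na us]; rewrite /fprod big_cons ordM ?expfz_neq0 ?tm_neq0//; last exact: fprod_neq0.
rewrite -/(fprod s k) ih// ord_exprz ?tm_neq0// inE.
have [->|za] := eqVneq z a; first by rewrite ord_tm mul1r (negbTE na) addr0.
by rewrite ord_tm_ne// mul0r add0r.
Qed.

Lemma modC_exprz z (k : int) : modC (z ^ k) = modC z ^ k.
Proof.
case: k => n; first exact: modCX.
by rewrite -[z ^ _]/((z ^+ n.+1)^-1) modCV modCX.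
Qed.

Lemma ln_exprz (x : R) (k : int) : 0 < x -> ln (x ^ k) = k%:~R * ln x.
Proof.
move=> x0; case: k => n; first by rewrite -[x ^ _]/(x ^+ n) lnXn// -mulr_natl pmulrn.
rewrite -[x ^ _]/((x ^+ n.+1)^-1) lnV ?posrE ?exprn_gt0// lnXn// NegzE mulrNz -pmulrn.
by rewrite mulNr mulr_natl.
Qed.

Lemma fprod_ev s k z : z \notin s -> fprod s k z = \prod_(a <- s) (z - a) ^ k a /\ vge z 0 (fprod s k).
Proof.
elim: s => [|a s ih]; first by move=> _; rewrite /fprod !big_nil (ev_nat z 1); split => //; exact: vge1_0.
rewrite inE negb_or => /andP[za /ih[e v]]; rewrite /fprod !big_cons -/(fprod s k).
have o : ord z (tm a ^ k a) = 0 by rewrite ord_exprz ?tm_neq0// ord_tm_ne// mul0r.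
have v' := ord0_vge o; split; last by rewrite -[0]addr0; exact: vgeM.
have e2 := ev_exprz (k a) (tm_neq0 a) (ord_tm_ne za).
by rewrite (evM v' v) e e2 tm_pt.
Qed.

Lemma ln_fprod s k z : z \notin s ->
  ln (modC (fprod s k z)) = \sum_(a <- s) (k a)%:~R * ln (modC (z - a)).
Proof.
move=> zs; rewrite (fprod_ev k zs).1.
elim: s zs => [|a s ih]; first by rewrite !big_nil modC1 ln1.
rewrite inE negb_or => /andP[za zs]; rewrite !big_cons modCM.
have za0 : 0 < modC (z - a) by rewrite modC_gt0 subr_eq0.
rewrite lnM ?posrE ?ih// ?modC_exprz ?ln_exprz//; first by rewrite exprz_gt0.
rewrite modC_gt0 prodf_seq_neq0; apply/allP => b bs /=.
by rewrite expfz_neq0// subr_eq0; apply: contraNneq zs => ->.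
Qed.

(** Only finitely many zeros and poles have modulus at most [r + 1], which leaves a margin beyond
    [r]. The mean value theorems need such a larger open disc. *)
Lemma ord_enlarge F r : F != 0 -> (forall z, modC z <= r -> ord z F = 0) ->
  exists2 r', r < r' & forall z, modC z < r' -> ord z F = 0.
Proof.
move=> F0 h; have /finite_seqP[s hs] := fin_ord (r + 1) F0.
have [r' [rr r1 hr]] : exists r', [/\ r < r', r' <= r + 1 & forall a, a \in s -> r' <= modC a].
  have hs' a : a \in s -> r < modC a.
    move=> sa; have : [set` s] a by []; rewrite -hs => -[_ oa].
    by rewrite ltNge; apply: contraNN oa => /h ->.
  elim: s hs' {hs} => [_|a s ih hs]; first by exists (r + 1); split => //; lra.
  have [|r' [h1 h2 h3]] := ih; first by move=> b bs; apply: hs; rewrite inE bs orbT.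
  exists (Num.min r' (modC a)); split; first by rewrite lt_min h1 hs ?inE ?eqxx.
    by rewrite ge_min h2.
  by move=> b; rewrite inE => /orP[/eqP ->|/h3 hb]; rewrite ge_min ?lexx ?orbT// hb.
exists r' => // z zr; apply/eqP/negPn/negP => oz.
have : [set` s] z by rewrite -hs; split => //; lra.
by move=> /hr; lra.
Qed.

Lemma factor F r : F != 0 -> 0 < r -> gen r F -> exists s (e : M),
  [/\ uniq s, (forall a, a \in s -> modC a < r), (forall a, modC a <= r -> a \notin s -> ord a F = 0),
      [/\ F = e * fprod s (fun a => ord a F), e != 0 & forall a, a \in s -> ord a F != 0] &
      exists2 r', r < r' & forall z, modC z < r' -> ord z e = 0].
Proof.
move=> F0 r0 gF; have [s [us hs hz]] := locfin2 r (locfin_ord F0) (locfin_ord F0).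
pose s' := [seq a <- s | (modC a < r) && (ord a F != 0)].
have us' : uniq s' by exact: filter_uniq.
have hz' a : modC a <= r -> a \notin s' -> ord a F = 0.
  rewrite le_eqVlt => /predU1P[ar _|ar]; first exact: gF.
  rewrite mem_filter ar /= negb_and negbK => /orP[/eqP //|/(hz a (ltW ar))[/eqP]].
  by rewrite intr_eq0 => /eqP.
have f0 := fprod_neq0 s' (fun a => ord a F).
pose e := F / fprod s' (fun a => ord a F).
have e0 : e != 0 by rewrite mulf_neq0// invr_neq0.
exists s', e; split => //.
- by move=> a; rewrite mem_filter => /andP[/andP[]].
- by split => //; [rewrite /e divfK|move=> a; rewrite mem_filter => /andP[/andP[]]].
- apply: ord_enlarge => // z zr; rewrite /e ordM ?invr_neq0// ordV// ord_fprod//.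
  by case: ifPn => [_|/hz' ->//]; rewrite ?subrr ?subr0.
Qed.

Lemma hol_ord0 (e : M) r : (forall z, modC z < r -> ord z e = 0) -> hol_on r e.
Proof.
move=> h z zr; have [d d0 hd] := vge_hol (ord0_vge (h z zr)).
by apply: hd; rewrite subrr modC0.
Qed.

(* The denominator of a Blaschke factor for the disc of radius r. *)
Definition bl r a z : C := toC r - conjc a / toC r * z.

Lemma bl_mod r a z : 0 < r -> modC z = r -> modC (bl r a z) = modC (z - a).
Proof.
move=> r0 zr; rewrite /bl.
have r0' : toC r != 0 :> C by rewrite -modC_gt0 modC_toC gtr0_norm.
have -> : toC r - conjc a / toC r * z = (z / toC r) * conjc (z - a : C).
  have cz : z * conjc z = toC r * toC r by rewrite (conj_circ zr) expr2 toCM.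
  rewrite conjCB; transitivity ((z * conjc z) / toC r - conjc a / toC r * z); last by ring.
  by rewrite cz; field.
by rewrite modCM modCM modCV modC_conj zr modC_toC gtr0_norm// divff ?mul1r// gt_eqF.
Qed.

Lemma cder_bl r a z : exists l, cder (bl r a) z l.
Proof.
eexists; apply: cderB; first exact: cder_cst.
by apply: cderM; [exact: cder_cst|exact: cder_id].
Qed.

Lemma bl_ge r a z : 0 < r -> modC a < r -> modC z < r -> modC (z - a) <= modC (bl r a z).
Proof.
move=> r0 ar zr; rewrite -(@ler_pXn2r _ 2)// ?nnegrE ?modC_ge0//.
have r0' := gt_eqF r0.
have -> : modC (bl r a z) ^+ 2 = modC (z - a) ^+ 2 + (r ^+ 2 - modC a ^+ 2) * (r ^+ 2 - modC z ^+ 2) / r ^+ 2.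
  rewrite !modC_sqr /bl -toCV; case: a z {ar zr} => [x y] [x' y'] /=.
  by field; rewrite r0'.
rewrite lerDl divr_ge0 ?sqr_ge0// mulr_ge0// subr_ge0;
  apply: lerXn2r; rewrite ?nnegrE ?modC_ge0//; exact: ltW.
Qed.

Lemma bl_enlarge r s : 0 < r -> (forall a, a \in s -> modC a < r) ->
  exists2 r', r < r' & forall a z, a \in s -> modC z < r' -> bl r a z != 0.
Proof.
move=> r0; elim: s => [_|a s ih hs]; first by exists (r + 1) => //; lra.
have [|r' rr h] := ih; first by move=> b bs; apply: hs; rewrite inE bs orbT.
have ar : modC a < r by apply: hs; rewrite inE eqxx.
have a1 : 0 < modC a + r by have := modC_ge0 a; lra.
(* Lies between [r] and the modulus [r ^+ 2 / modC a] of the zero of [bl r a]. *)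
pose q := 2 * r ^+ 2 / (modC a + r).
have rq : r < q by rewrite /q ltr_pdivlMr// mulrDr mulr2n mulrDl mul1r expr2 ltrD2r ltr_pM2l.
exists (Num.min r' q); first by rewrite lt_min rr.
move=> b z; rewrite lt_min inE => /orP[/eqP ->|bs] /andP[z1 z2]; last exact: h.
rewrite /bl subr_eq0; apply/eqP => /(congr1 (@modC R)).
rewrite !modCM modCV modC_conj modC_toC gtr0_norm// mulrAC => hh.
have {hh} : modC a * modC z = r ^+ 2.
  by rewrite expr2 {1}hh divfK// gt_eqF.
move: z2; rewrite /q ltr_pdivlMr// => z2.
have : modC a * modC z <= r * modC z by rewrite ler_wpM2r ?modC_ge0// ltW.
by move: z2; clear; lra.
Qed.

End Factorization.

(** * Jensen's formula and the first main theorem *)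

Section Jensen.
Variable R : realType.
Local Notation C := (CC R).
Local Notation M := (mer R).
Implicit Types (F G : M) (a z : C) (r x y : R) (s : seq C).

Lemma circ_contD r (u v : C -> R) : circ_cont r u -> circ_cont r v ->
  circ_cont r (fun z => u z + v z).
Proof. by move=> hu hv z zr; apply: continuousD; [exact: hu|exact: hv]. Qed.

Lemma circ_cont_sum r (I : eqType) (s : seq I) (u : I -> C -> R) :
  (forall i, i \in s -> circ_cont r (u i)) -> circ_cont r (fun z => \sum_(a <- s) u a z).
Proof.
elim: s => [_|a s ih h].
  rewrite (_ : (fun z => _) = (fun=> 0)); first exact: circ_cont_cst.
  by apply/funext => z; rewrite big_nil.
rewrite (_ : (fun z => _) = (fun z => u a z + \sum_(b <- s) u b z)); last first.
  by apply/funext => z; rewrite big_cons.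
apply: circ_contD; first by apply: h; rewrite inE eqxx.
by apply: ih => b bs; apply: h; rewrite inE bs orbT.
Qed.

Lemma rmean_sum r (I : eqType) (s : seq I) (u : I -> C -> R) : 0 <= r ->
  (forall i, i \in s -> circ_cont r (u i)) ->
  rmean r (fun z => \sum_(a <- s) u a z) = \sum_(a <- s) rmean r (u a).
Proof.
move=> r0; elim: s => [_|a s ih h].
  by rewrite big_nil -[RHS](rmean_cst r); apply: eq_rmean => // z _; rewrite big_nil.
have ha : circ_cont r (u a) by apply: h; rewrite inE eqxx.
have hs b : b \in s -> circ_cont r (u b) by move=> bs; apply: h; rewrite inE bs orbT.
rewrite big_cons -ih// -(rmeanD r0 ha (circ_cont_sum hs)).
by apply: eq_rmean => // z _; rewrite big_cons.
Qed.

Lemma circ_cont_sub r a : modC a != r -> circ_cont r (fun z => ln (modC (z - a))).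
Proof.
move=> ar; apply: circ_cont_ln.
  by move=> z _; apply: cont_cderE; exists 1; exact: cder_subz.
by move=> z zr; rewrite subr_eq0; apply: contraNneq ar => <-; rewrite zr.
Qed.

(** For [modC a < r] the factor [z - a] is replaced on the circle by [bl r a z], which has the same
    modulus there, is zero-free inside and has modulus [r] at 0. *)
Lemma mean_ln_sub r a : 0 < r -> modC a != r ->
  rmean r (fun z => ln (modC (z - a))) = ln (Num.max r (modC a)).
Proof.
move=> r0 ar; have [ar'|ra|ar'] := ltgtP (modC a) r; last by rewrite ar' eqxx in ar.
  have [|r' rr h] := @bl_enlarge R r [:: a] r0; first by move=> b; rewrite inE => /eqP ->.
  have e : rmean r (fun z => ln (modC (z - a))) = rmean r (fun z => ln (modC (bl r a z))).
    by apply: eq_rmean => [|z zr]; [exact: ltW|rewrite bl_mod].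
  rewrite e (@mean_log _ _ r r'); first 1 last.
  - exact: ltW.
  - exact: rr.
  - by move=> z _; exact: cder_bl.
  - by move=> z zr; apply: h => //; rewrite inE.
  by rewrite /bl mulr0 subr0 modC_toC gtr0_norm//; congr ln; apply/esym/max_idPl; exact: ltW.
rewrite (@mean_log _ (fun z => z - a) r (modC a))//; first 1 last.
- exact: ltW.
- by move=> z _; exists 1; exact: cder_subz.
- by move=> z zr; rewrite subr_eq0; apply: contraTneq zr => ->; rewrite ltxx.
by rewrite sub0r modCN; congr ln; apply/esym/max_idPr; exact: ltW.
Qed.

(** Logarithm of the modulus of the leading Laurent coefficient at 0: the constant in Jensen's
    formula. *)
Definition lnlc F : R := ln (modC ((F / tm 0 ^ ord 0 F) 0)).

Lemma ord0_pos z F : F != 0 -> ord z F = 0 -> 0 < modC (F z).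
Proof. by move=> F0 o; rewrite modC_gt0 ord0_neq0. Qed.

Lemma gen_circ_cont r F : gen r F -> circ_cont r F.
Proof. by move=> h z zr; apply: vge_cont; apply: ord0_vge; exact: h. Qed.

Lemma factor_pt F s (e : M) k z : F != 0 -> F = e * fprod s k -> e != 0 ->
  ord z e = 0 -> z \notin s ->
  modC (F z) = modC (e z) * modC (fprod s k z) /\
  ln (modC (F z)) = ln (modC (e z)) + \sum_(a <- s) (k a)%:~R * ln (modC (z - a)).
Proof.
move=> F0 E e0 oe zs; have [_ v] := fprod_ev k zs.
have eF : modC (F z) = modC (e z) * modC (fprod s k z).
  by rewrite {1}E (evM (ord0_vge oe) v) modCM.
split => //; rewrite eF lnM ?posrE; first by rewrite ln_fprod.
  exact: ord0_pos.
rewrite modC_gt0 (fprod_ev k zs).1 prodf_seq_neq0; apply/allP => b bs /=.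
by rewrite expfz_neq0// subr_eq0; apply: contraNneq zs => ->.
Qed.

(** After [factor], the zero-free part contributes its value at 0, and each [z - a] contributes
    [ln r], which is [lw r a] plus, for [a != 0], the term [ln (modC a)] belonging to [lnlc F]. *)
Lemma jensen F r : F != 0 -> 0 < r -> gen r F ->
  rmean r (fun z => ln (modC (F z))) = lnlc F + Nc r (ordR F).
Proof.
move=> F0 r0 gF; have [s [e [us hs hz [E e0 _] [r' rr he]]]] := factor F0 r0 gF.
set k := fun a => ord a F in E.
have r0' := ltW r0.
have ns z : modC z = r -> z \notin s.
  by move=> zr; apply/negP => /hs; rewrite zr ltxx.
have oe z : modC z <= r -> ord z e = 0 by move=> zr; apply: he; lra.
have as_ a : a \in s -> modC a != r by move=> /hs /lt_eqF ->.
have cs a : a \in s -> circ_cont r (fun z => (k a)%:~R * ln (modC (z - a))).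
  by move=> sa; apply: circ_contMr; [exact: circ_cont_cst|exact: circ_cont_sub (as_ a sa)].
have he' := hol_ord0 he.
have en z : modC z < r' -> e z != 0 by move=> /he oz; exact: ord0_neq0.
have ce : circ_cont r (fun z => ln (modC (e z))).
  by apply: circ_cont_ln; [exact: hol_circ_cont rr he'|move=> z zr; apply: en; rewrite zr].
have -> : rmean r (fun z => ln (modC (F z))) =
   rmean r (fun z => ln (modC (e z)) + \sum_(a <- s) (k a)%:~R * ln (modC (z - a))).
  apply: eq_rmean => // z zr.
  by have [|_ ->] := factor_pt F0 E e0 _ (ns z zr); first by apply: oe; rewrite zr.
rewrite (rmeanD r0' ce (circ_cont_sum cs)) (rmean_sum r0' cs) (mean_log r0' rr he' en).
have -> : \sum_(a <- s) rmean r (fun z => (k a)%:~R * ln (modC (z - a))) =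
   \sum_(a <- s) (k a)%:~R * ln r.
  rewrite big_seq [RHS]big_seq; apply: eq_bigr => a sa.
  rewrite (rmeanZ _ r0' (circ_cont_sub (as_ a sa))) mean_ln_sub ?as_//.
  by congr (_ * ln _); apply/max_idPl; apply: ltW; exact: hs.
have NE : Nc r (ordR F) = \sum_(a <- s) (k a)%:~R * lw r a.
  apply: NcE => //; first by move=> a /hs /ltW.
  by move=> a ar /(hz a ar); rewrite /ordR => ->.
pose s0 := [seq a <- s | a != 0].
have o0 : 0 \notin s0 by rewrite mem_filter eqxx.
have EG : F / tm 0 ^ ord 0 F = e * fprod s0 k.
  have t0 : tm (0 : C) ^ ord 0 F != 0 by rewrite expfz_neq0// tm_neq0.
  apply: (mulIf t0); rewrite divfK// {1}E -mulrA; congr (_ * _).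
  rewrite /fprod big_filter; have [s0'|s0'] := boolP (0 \in s).
    rewrite (bigD1_seq 0)//= mulrC; congr (_ * _).
  rewrite (hz 0 _ s0') ?modC0// expr0z mulr1.
  rewrite big_seq [RHS]big_mkcond [RHS]big_seq; apply: eq_bigr => a sa.
  by case: ifPn => // /negPn/eqP a0; rewrite -a0 sa in s0'.
have G0 : F / tm 0 ^ ord 0 F != 0.
  by rewrite mulf_neq0// invr_neq0// expfz_neq0// tm_neq0.
have lc : lnlc F = ln (modC (e 0)) + \sum_(a <- s0) (k a)%:~R * ln (modC a).
  rewrite /lnlc; have [|_ ->] := factor_pt G0 EG e0 _ o0; first by apply: oe; rewrite modC0.
  by congr (_ + _); apply: eq_bigr => a _; rewrite sub0r modCN.
rewrite lc NE -addrA; congr (_ + _); rewrite /s0 big_filter [in RHS]big_mkcond -big_split.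
apply: eq_bigr => a _ /=; rewrite /lw; case: eqP => [->|_] /=; first by rewrite add0r.
by ring.
Qed.

Lemma logpE x : logp x = ln (Num.max 1 x).
Proof.
by rewrite /logp; case: leP => h; rewrite ?ln1.
Qed.

Lemma logp_ge0 x : 0 <= logp x.
Proof. by rewrite logpE ln_ge0// le_max lexx. Qed.

Lemma logp_mono x y : x <= y -> logp x <= logp y.
Proof.
move=> xy; have p (t : R) : 0 < Num.max 1 t by rewrite lt_max ltr01.
by rewrite !logpE ler_ln ?posrE// ge_max !le_max lexx xy orbT.
Qed.

Lemma logp_max x : 0 < x -> logp x = Num.max (ln x) 0.
Proof.
move=> x0; rewrite /logp; case: leP => h; apply/esym.
  by apply/max_idPr; rewrite ln_le0.
by apply/max_idPl; rewrite ln_ge0// ltW.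
Qed.

Lemma logpM x y : 0 <= x -> 0 <= y -> logp (x * y) <= logp x + logp y.
Proof.
move=> x0 y0; have p (t : R) : 0 < Num.max 1 t by rewrite lt_max ltr01.
rewrite !logpE -lnM ?posrE// ler_ln ?posrE// ?mulr_gt0//.
have hx : 1 <= Num.max 1 x by rewrite le_max lexx.
have hy : 1 <= Num.max 1 y by rewrite le_max lexx.
rewrite ge_max; apply/andP; split.
  exact: mulr_ege1.
by apply: ler_pM => //; rewrite le_max lexx orbT.
Qed.

Lemma logpD x y : 0 <= x -> 0 <= y -> logp (x + y) <= logp x + logp y + ln 2.
Proof.
move=> x0 y0; apply: le_trans (_ : logp (2 * Num.max x y) <= _).
  apply: logp_mono; have : x <= Num.max x y by rewrite le_max lexx.
  have : y <= Num.max x y by rewrite le_max lexx orbT.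
  by lra.
apply: le_trans (logpM _ _) _; rewrite ?le_max ?x0//.
have -> : logp 2 = ln 2 :> R by rewrite /logp; case: leP => //; lra.
rewrite addrC lerD2r; have := logp_ge0 x; have := logp_ge0 y.
by rewrite /Num.max; case: ifP => _; lra.
Qed.

Lemma logp_inv x : 0 < x -> logp x - logp x^-1 = ln x.
Proof.
move=> x0; rewrite !logp_max ?invr_gt0// lnV ?posrE//.
case: (boolP (0 <= ln x)) => [h|]; last rewrite -ltNge => /ltW h.
  have /max_idPr -> : - ln x <= 0 by rewrite oppr_le0.
  by rewrite (max_idPl h) subr0.
have /max_idPl -> : 0 <= - ln x by rewrite oppr_ge0.
by rewrite (max_idPr h) opprK add0r.
Qed.

Lemma logp_abs x : 0 < x -> `|ln x| = logp x + logp x^-1.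
Proof.
move=> x0; have [h|h] := leP 0 (ln x).
  rewrite ger0_norm// -(logp_inv x0).
  have -> : logp x^-1 = 0; last by rewrite subr0 addr0.
  by rewrite logp_max ?invr_gt0// lnV ?posrE//; apply/max_idPr; rewrite oppr_le0.
rewrite ltr0_norm// -(logp_inv x0).
have -> : logp x = 0; last by rewrite !add0r opprK.
by rewrite logp_max//; apply/max_idPr; exact: ltW.
Qed.

Lemma continuous_logp : continuous (@logp R).
Proof.
move=> x; have p : 0 < Num.max 1 x by rewrite lt_max ltr01.
rewrite (_ : @logp R = (@ln R) \o (fun x => Num.max 1 x)); last first.
  by apply/funext => t; rewrite logpE.
apply: continuous_comp; last exact: continuous_ln.
by apply: continuous_max; [exact: cst_continuous|exact: cvg_id].
Qed.

Lemma circ_cont_logp r (f : C -> C) : circ_cont r f -> circ_cont r (fun z => logp (modC (f z))).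
Proof.
move=> h z zr; apply: (@continuous_comp _ _ _ (fun z => modC (f z)) (@logp R)).
  exact: (circ_cont_modC h zr).
exact: continuous_logp.
Qed.

Definition mm r F : R := rmean r (fun z => logp (modC (F z))).
Definition reg r F := forall z, modC z = r -> vge z 0 F.

Lemma reg_cont r F : reg r F -> circ_cont r (fun z => logp (modC (F z))).
Proof. by move=> h; apply: circ_cont_logp => z /h; exact: vge_cont. Qed.

Lemma gen_reg r F : gen r F -> reg r F.
Proof. by move=> h z /h; exact: ord0_vge. Qed.

Lemma rmean_ge0 r (u : C -> R) : (forall z, 0 <= u z) -> 0 <= rmean r u.
Proof.
move=> h; rewrite /rmean mulr_ge0 ?invr_ge0 ?(ltW (@twopi_gt0 R))//.
by apply: Rintegral_ge0 => t _; exact: h.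
Qed.

Lemma mm_ge0 r F : 0 <= mm r F.
Proof. by apply: rmean_ge0 => z; exact: logp_ge0. Qed.

Lemma mmM r F G : 0 <= r -> reg r F -> reg r G -> mm r (F * G) <= mm r F + mm r G.
Proof.
move=> r0 hF hG; rewrite /mm -(rmeanD r0 (reg_cont hF) (reg_cont hG)).
apply: (rmean_le r0).
- by apply: reg_cont => z zr; rewrite -[0]addr0; apply: vgeM; [exact: hF|exact: hG].
- by apply: circ_contD; exact: reg_cont.
- by move=> z zr; rewrite (evM (hF z zr) (hG z zr)) modCM; apply: logpM; exact: modC_ge0.
Qed.

Lemma mmD r F G : 0 <= r -> reg r F -> reg r G -> mm r (F + G) <= mm r F + mm r G + ln 2.
Proof.
move=> r0 hF hG; rewrite /mm -(rmeanD r0 (reg_cont hF) (reg_cont hG)).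
rewrite -[ln 2](rmean_cst r) -rmeanD//; first 1 last.
- by apply: circ_contD; exact: reg_cont.
- exact: circ_cont_cst.
apply: (rmean_le r0).
- by apply: reg_cont => z zr; apply: vgeD; [exact: hF|exact: hG].
- by apply: circ_contD; [apply: circ_contD; exact: reg_cont|exact: circ_cont_cst].
- move=> z zr; rewrite (evD (hF z zr) (hG z zr)).
  by apply: le_trans (logp_mono (modCD _ _)) _; apply: logpD; exact: modC_ge0.
Qed.

Lemma mm_le r F K : 0 <= r -> reg r F -> (forall z, modC z = r -> modC (F z) <= K) ->
  mm r F <= logp K.
Proof.
move=> r0 hF h; rewrite -[leRHS](rmean_cst r); apply: (rmean_le r0 (reg_cont hF)).
  exact: circ_cont_cst.
by move=> z /h; exact: logp_mono.
Qed.

Lemma mm_cst r c : 0 <= r -> mm r (cstm c) <= logp (modC c).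
Proof.
move=> r0; apply: mm_le => //; first by move=> z _; exact: vge_cst.
by move=> z _; rewrite cstm_pt.
Qed.

Lemma mm_inv r F : F != 0 -> 0 < r -> gen r F ->
  mm r F - mm r F^-1 = lnlc F + Nc r (ordR F).
Proof.
move=> F0 r0 gF; rewrite -jensen//; have r0' := ltW r0.
have gV : gen r F^-1 by move=> z /gF h; rewrite ordV// h.
apply/eqP; rewrite subr_eq; apply/eqP.
have cl : circ_cont r (fun z => ln (modC (F z))).
  apply: circ_cont_ln; first exact: gen_circ_cont.
  by move=> z /gF /(ord0_neq0 F0).
rewrite /mm -(rmeanD r0' cl (reg_cont (gen_reg gV))); apply: eq_rmean => // z zr.
have o := gF z zr; rewrite (evV F0 o) modCV -logp_inv; first by rewrite subrK.
exact: ord0_pos.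
Qed.

Definition T r F : R := mm r F + Nc r (pol F).

Lemma T_ge0 r F : 1 <= r -> 0 <= T r F.
Proof. by move=> r1; rewrite addr_ge0 ?mm_ge0 ?Nc_ge0// => a; exact: pol_ge0. Qed.

Lemma Nc_ord r F : F != 0 -> Nc r (ordR F) = Nc r (zer F) - Nc r (pol F).
Proof.
move=> F0; rewrite -[- _]mulN1r -NcZ -NcD; [|exact: locfin_zer|by apply: locfinZ; exact: locfin_pol].
by apply: eq_fsbigr => a _; rewrite mulN1r -ordR_split.
Qed.

Lemma T_inv r F : F != 0 -> 0 < r -> gen r F -> T r F^-1 = T r F - lnlc F.
Proof.
move=> F0 r0 gF; have := mm_inv F0 r0 gF; rewrite Nc_ord// /T -/(zer F) => h.
by move: (mm r F) (mm r F^-1) (Nc r (zer F)) (Nc r (pol F)) (lnlc F) h; clear => *; lra.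
Qed.

Lemma T_M r F G : 1 <= r -> reg r F -> reg r G -> T r (F * G) <= T r F + T r G.
Proof.
move=> r1 hF hG; have r0 : 0 <= r by lra.
have h1 := mmM r0 hF hG.
have h2 : Nc r (pol (F * G)) <= Nc r (pol F) + Nc r (pol G).
  rewrite -NcD; try exact: locfin_pol.
  apply: Nc_le => //; [exact: locfin_pol|by apply: locfinD; exact: locfin_pol|].
  by move=> a _; rewrite /pol -natrD ler_nat polnM.
by rewrite /T addrACA lerD.
Qed.

Lemma T_D r F G : 1 <= r -> reg r F -> reg r G -> T r (F + G) <= T r F + T r G + ln 2.
Proof.
move=> r1 hF hG; have r0 : 0 <= r by lra.
have h1 := mmD r0 hF hG.
have h2 : Nc r (pol (F + G)) <= Nc r (pol F) + Nc r (pol G).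
  rewrite -NcD; try exact: locfin_pol.
  apply: Nc_le => //; [exact: locfin_pol|by apply: locfinD; exact: locfin_pol|].
  move=> a _; rewrite /pol -natrD ler_nat; apply: leq_trans (polnD _ _ _) _.
  by rewrite geq_max leq_addr leq_addl.
apply: le_trans (lerD h1 h2) _; rewrite /T le_eqVlt; apply/orP; left; apply/eqP.
by rewrite addrAC addrACA.
Qed.

End Jensen.

(** * Monotonicity of the characteristic *)

Section Characteristic.
Variable R : realType.
Local Notation C := (CC R).
Local Notation M := (mer R).
Implicit Types (F G : M) (a z : C) (r x y : R) (s : seq C).

Lemma ln_prodX s (k : C -> nat) (b : C -> C) : (forall a, a \in s -> b a != 0) ->
  ln (modC (\prod_(a <- s) b a ^+ k a)) = \sum_(a <- s) (k a)%:R * ln (modC (b a)).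
Proof.
elim: s => [_|a s ih h]; first by rewrite !big_nil modC1 ln1.
have h1 : b a != 0 by apply: h; rewrite inE eqxx.
have h2 c : c \in s -> b c != 0 by move=> cs; apply: h; rewrite inE cs orbT.
rewrite !big_cons modCM lnM ?posrE ?modC_gt0 ?expf_neq0//.
  by rewrite ih// modCX lnXn ?modC_gt0// mulr_natl.
by rewrite prodf_seq_neq0; apply/allP => c cs /=; rewrite expf_neq0// h2.
Qed.

Lemma hol_prod r s (k : C -> nat) (b : C -> C -> C) : (forall a z, exists l, cder (b a) z l) ->
  hol_on r (fun z => \prod_(a <- s) b a z ^+ k a).
Proof.
move=> hb z zr; elim: s => [|a s [l hl]].
  rewrite (_ : (fun z => _) = (fun=> 1)); first by exists 0; exact: cder_cst.
  by apply/funext => w; rewrite big_nil.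
rewrite (_ : (fun z => _) = (fun z => b a z ^+ k a * \prod_(a <- s) b a z ^+ k a)).
  have [l' hl'] := hb a z; eexists; apply: cderM; last exact: hl.
  by apply: cderX; exact: hl'.
by apply/funext => w; rewrite big_cons.
Qed.

(** The right-hand side is independent of [r], so the same constant [cst0] occurs at both radii in
    [T_mono]. *)
Lemma ln_lw r a : 0 < r -> modC a != r ->
  - ln (Num.max r (modC a)) + (if modC a <= r then lw r a else 0) =
  - (if a == 0 then 0 else ln (modC a)).
Proof.
move=> r0 ar; rewrite /lw; have [->|a0] := eqVneq a 0.
  rewrite modC0 (ltW r0) (max_idPl (ltW r0)); ring.
by case: leP => h; rewrite ?addr0//; ring.
Qed.

(** Replacing each [z - a] by [bl R1 a z] gives zero-free [qh] and [ph] with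
    [modC (F z) = modC (qh z / ph z)] on the circle of radius [R1]. There [T R1 F] is the mean of
    the larger of the two logarithms, minus a constant of the divisor. The Poisson extension of that
    maximum dominates both logarithms inside, in particular on the circle of radius [r]. *)
Lemma T_mono F r R1 : F != 0 -> 0 < r -> r < R1 -> gen r F -> gen R1 F -> T r F <= T R1 F.
Proof.
move=> F0 r0 rR gr gR; have R10 : 0 < R1 by lra.
have r0' := ltW r0; have R10' := ltW R10.
have [s [e [us hs hz [E e0 hn] [R' rr he]]]] := factor F0 R10 gR.
set k := fun a => ord a F in E.
have [R2 rR2 hbl] := bl_enlarge R10 hs.
pose zn a := poln a F^-1; pose pn a := poln a F.
have kE a : (k a)%:~R = (zn a)%:R - (pn a)%:R :> R by exact: ordR_split.
pose R3 := Num.min R' R2.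
have RR3 : R1 < R3 by rewrite lt_min rr.
pose qh z := e z * \prod_(a <- s) bl R1 a z ^+ zn a.
pose ph z := \prod_(a <- s) bl R1 a z ^+ pn a.
have en z : modC z < R' -> e z != 0 by move=> /he oz; exact: ord0_neq0.
have R3' z : modC z < R3 -> modC z < R' /\ modC z < R2 by rewrite lt_min => /andP[].
have hph : hol_on R3 ph by apply: hol_prod => a z; exact: cder_bl.
have hqh : hol_on R3 qh.
  move=> z /[dup] zR3 /R3'[zR _]; have [l hl] := hol_ord0 he zR.
  have [l' hl'] := @hol_prod R3 s zn (bl R1) (fun a z => cder_bl R1 a z) z zR3.
  by eexists; exact: cderM hl hl'.
have nph z : modC z < R3 -> ph z != 0.
  move=> /R3'[_ zR]; rewrite prodf_seq_neq0; apply/allP => a sa /=.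
  by rewrite expf_neq0// hbl.
have nqh z : modC z < R3 -> qh z != 0.
  move=> /R3'[zR' zR]; rewrite mulf_neq0 ?en// prodf_seq_neq0; apply/allP => a sa /=.
  by rewrite expf_neq0// hbl.
have lqh z : modC z < R3 -> ln (modC (qh z)) =
    ln (modC (e z)) + \sum_(a <- s) (zn a)%:R * ln (modC (bl R1 a z)).
  move=> zR3; have := nqh z zR3; rewrite /qh mulf_eq0 negb_or => /andP[n1 n2].
  rewrite modCM lnM ?posrE ?modC_gt0// ln_prodX// => a sa.
  by apply: hbl => //; case: (R3' z zR3).
have lph z : modC z < R3 -> ln (modC (ph z)) = \sum_(a <- s) (pn a)%:R * ln (modC (bl R1 a z)).
  by move=> zR3; rewrite ln_prodX// => a sa; apply: hbl => //; case: (R3' z zR3).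
have lF z : modC z < R' -> z \notin s ->  ln (modC (F z)) = ln (modC (e z)) +
   \sum_(a <- s) (zn a)%:R * ln (modC (z - a)) - \sum_(a <- s) (pn a)%:R * ln (modC (z - a)).
  move=> zR zs; have [_ ->] := factor_pt F0 E e0 (he z zR) zs.
  rewrite -addrA -sumrB; congr (_ + _); apply: eq_bigr => a _.
  by rewrite kE mulrBl.
pose U z := Num.max (ln (modC (qh z))) (ln (modC (ph z))).
have cqh : circ_cont R1 (fun z => ln (modC (qh z))).
  by apply: circ_cont_ln; [exact: hol_circ_cont hqh|move=> z zr; apply: nqh; rewrite zr].
have cph : circ_cont R1 (fun z => ln (modC (ph z))).
  by apply: circ_cont_ln; [exact: hol_circ_cont hph|move=> z zr; apply: nph; rewrite zr].
have cU : circ_cont R1 U.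
  by move=> z zr; apply: continuous_max; [exact: cqh|exact: cph].
pose cst0 := \sum_(a <- s) (pn a)%:R * (if a == 0 then 0 else ln (modC a)).
have NE rho : 0 < rho -> rho <= R1 -> Nc rho (pol F) =
    \sum_(a <- s) (pn a)%:R * (if modC a <= rho then lw rho a else 0).
  move=> rho0 rhoR; rewrite (@NcE _ _ _ [seq a <- s | modC a <= rho]).
  - by rewrite big_filter big_mkcond; apply: eq_bigr => a _ /=; case: ifP; rewrite ?mulr0.
  - exact: filter_uniq.
  - by move=> a; rewrite mem_filter => /andP[].
  - move=> a ar; rewrite mem_filter ar /= => ns.
    have o : ord a F = 0 by apply: hz => //; lra.
    by rewrite /pol /poln o minxx absz0.
have TR : T R1 F = rmean R1 U - cst0.
  rewrite /T; have -> : mm R1 F = rmean R1 U - ln (modC (ph 0)).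
    have := mean_log R10' RR3 hph nph => <-.
    apply/eqP; rewrite eq_sym subr_eq; apply/eqP.
    rewrite /mm -(rmeanD R10' (reg_cont (gen_reg gR)) cph); apply: eq_rmean => // z zR.
    have zR3 : modC z < R3 by rewrite zR.
    have zs : z \notin s by apply/negP => /hs; rewrite zR ltxx.
    have zR' : modC z < R' by case: (R3' z zR3).
    have Fz : 0 < modC (F z) by apply: ord0_pos => //; exact: gR.
    rewrite (logp_max Fz) /U.
    have -> : ln (modC (F z)) = ln (modC (qh z)) - ln (modC (ph z)).
      rewrite lF// lqh// lph//; congr (_ + _ - _); apply: eq_bigr => a sa; by rewrite bl_mod.
    by rewrite addr_maxl subrK add0r.
  have -> : ln (modC (ph 0)) = \sum_(a <- s) (pn a)%:R * ln R1.
    rewrite lph ?modC0//; last by lra.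
    by apply: eq_bigr => a _; rewrite /bl mulr0 subr0 modC_toC gtr0_norm.
  rewrite NE// -addrA; congr (_ + _); rewrite /cst0 -!sumrN -big_split big_seq [RHS]big_seq.
  apply: eq_bigr => a sa /=.
  have ar : modC a < R1 by exact: hs.
  have := @ln_lw R1 a R10; rewrite lt_eqF// (max_idPl (ltW ar)) => /(_ isT).
  by move=> /(congr1 (fun t => (pn a)%:R * t)); rewrite mulrDr !mulrN.
have sr a : a \in s -> modC a != r.
  by move=> /hn oa; apply: contraNneq oa => /gr ->.
have cs a : a \in s -> circ_cont r (fun z => (pn a)%:R * ln (modC (z - a))).
  by move=> sa; apply: circ_contMr; [exact: circ_cont_cst|exact: circ_cont_sub (sr a sa)].
have hP := poisson_hol R10 cU.
have cP : circ_cont r (fun z => complex.Re (poisson R1 U z)).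
  by apply: circ_cont_Re; exact: hol_circ_cont hP.
(* The Poisson extension of [U] has the same mean over the circle of radius [r] as [U] has over that
   of radius [R1]: both are its value at 0. *)
have h : mm r F <= rmean R1 U - \sum_(a <- s) (pn a)%:R * ln (Num.max r (modC a)).
  have -> : \sum_(a <- s) (pn a)%:R * ln (Num.max r (modC a)) =
      rmean r (fun z => \sum_(a <- s) (pn a)%:R * ln (modC (z - a))).
    rewrite (rmean_sum r0' cs) big_seq [RHS]big_seq; apply: eq_bigr => a sa.
    by rewrite (rmeanZ _ r0' (circ_cont_sub (sr a sa))) mean_ln_sub ?sr.
  rewrite lerBrDr /mm -(rmeanD r0' (reg_cont (gen_reg gr)) (circ_cont_sum cs)).
  rewrite -(poisson0 R10 cU) -(mean_hol r0' rR hP) (Re_cmean r0' (hol_circ_cont rR hP)).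
  apply: (rmean_le r0' _ cP).
    by apply: circ_contD; [exact: reg_cont (gen_reg gr)|exact: circ_cont_sum].
  move=> z zr; have zR1 : modC z < R1 by rewrite zr.
  have zR3 : modC z < R3 by lra.
  have [zR' _] := R3' z zR3.
  have zs : z \notin s by apply/negP => /sr; rewrite zr eqxx.
  have Fz : 0 < modC (F z) by apply: ord0_pos => //; exact: gr.
  rewrite (logp_max Fz) lF// addr_maxl subrK add0r ge_max.
  have bk (kk : C -> nat) : \sum_(a <- s) (kk a)%:R * ln (modC (z - a)) <=
      \sum_(a <- s) (kk a)%:R * ln (modC (bl R1 a z)).
    rewrite big_seq [leRHS]big_seq; apply: ler_sum => a sa; rewrite ler_wpM2l//.
    have za : 0 < modC (z - a).
      by rewrite modC_gt0 subr_eq0; apply: contraNneq zs => ->.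
    have hb := bl_ge R10 (hs a sa) zR1.
    by rewrite ler_ln ?posrE//; exact: lt_le_trans hb.
  apply/andP; split.
    apply: le_trans (poisson_le R10 RR3 zR1 hqh nqh cU _).
      by rewrite lqh// lerD2l.
    by move=> w _; rewrite /U le_max lexx.
  apply: le_trans (poisson_le R10 RR3 zR1 hph nph cU _).
    by rewrite lph.
  by move=> w _; rewrite /U le_max lexx orbT.
rewrite TR /T NE//; last exact: ltW.
apply: le_trans (lerD h (lexx _)) _; rewrite -addrA lerD2l.
rewrite /cst0 -!sumrN -big_split big_seq [leRHS]big_seq; apply: ler_sum => a sa /=.
have := ln_lw r0 (sr a sa) => /(congr1 (fun t => (pn a)%:R * t)).
by rewrite mulrDr !mulrN => ->.
Qed.

End Characteristic.

(** * Pointwise bounds for the logarithmic derivative *)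

Section LogDerivative.
Variable R : realType.
Local Notation C := (CC R).
Local Notation M := (mer R).
Implicit Types (F G : M) (a z : C) (r x y : R) (s : seq C).

Definition dlog F : M := derm F / F.

Lemma dlogM F G : F != 0 -> G != 0 -> dlog (F * G) = dlog F + dlog G.
Proof. by move=> F0 G0; rewrite /dlog dermM; field; rewrite F0 G0. Qed.

Lemma dlogV F : F != 0 -> dlog F^-1 = - dlog F.
Proof. by move=> F0; rewrite /dlog dermV// invrK mulNr expr2 invfM mulrA divfK. Qed.

Lemma dlogX F n : F != 0 -> dlog (F ^+ n) = n%:R * dlog F.
Proof.
move=> F0; elim: n => [|n ih]; first by rewrite /dlog expr0 derm1 mul0r mul0r.
by rewrite exprS dlogM ?expf_neq0// ih -addn1 natrD; ring.
Qed.

Lemma dlog_exprz F (k : int) : F != 0 -> dlog (F ^ k) = k%:~R * dlog F.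
Proof.
move=> F0; case: k => n; first by rewrite -[F ^ _]/(F ^+ n) dlogX// pmulrn.
rewrite -[F ^ _]/((F ^+ n.+1)^-1) dlogV ?expf_neq0// dlogX// NegzE mulrNz -pmulrn.
by rewrite mulNr.
Qed.

Lemma dlog_fprod s k : dlog (fprod s k) = \sum_(a <- s) (k a)%:~R / tm a.
Proof.
elim: s => [|a s ih]; first by rewrite /fprod !big_nil /dlog derm1 mul0r.
rewrite /fprod !big_cons -/(fprod s k) dlogM ?fprod_neq0 ?expfz_neq0 ?tm_neq0//.
by rewrite ih dlog_exprz ?tm_neq0// {1}/dlog derm_tm div1r.
Qed.

Lemma ev_int a (k : int) : (k%:~R : M) a = k%:~R /\ vge a 0 (k%:~R : M).
Proof.
have e : (k%:~R : M) = cstm k%:~R.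
  case: k => n; first by rewrite -!pmulrn cstm_nat.
  rewrite NegzE !mulrNz -!pmulrn -mulN1r cstmN1 -cstm_nat -cstmM mulN1r //.
by rewrite e cstm_pt; split => //; exact: vge_cst.
Qed.

Lemma ev_sum_tm s (k : C -> int) z : z \notin s ->
  (\sum_(a <- s) (k a)%:~R / tm a) z = \sum_(a <- s) (k a)%:~R / (z - a) /\
  vge z 0 (\sum_(a <- s) (k a)%:~R / tm a).
Proof.
elim: s => [|a s ih]; first by rewrite !big_nil (ev_nat z 0); split => //; exact: vge0.
rewrite inE negb_or => /andP[za /ih[e v]]; rewrite !big_cons.
have o : ord z (tm a)^-1 = 0 by rewrite ordV ?tm_neq0// ord_tm_ne// oppr0.
have [ek vk] := ev_int z (k a).
have vm : vge z 0 ((k a)%:~R / tm a) by rewrite -[0]addr0; apply: vgeM => //; exact: ord0_vge.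
split; last exact: vgeD.
rewrite (evD vm v) e (evM vk (ord0_vge o)) ek.
by rewrite (evV (tm_neq0 a) (ord_tm_ne za)) tm_pt.
Qed.

Lemma ln_ge1V x : 0 < x -> 1 - x^-1 <= ln x.
Proof.
move=> x0; have xv : 0 < x^-1 by rewrite invr_gt0.
have := @le_ln1Dx R (x^-1 - 1); rewrite subrKC lnV ?posrE// => h.
by have : - ln x <= x^-1 - 1 by [apply: h; lra]; lra.
Qed.

Lemma count_ln F s rho r : F != 0 -> 1 <= rho -> rho < r -> gen r F ->
  uniq s -> (forall a, a \in s -> modC a <= rho) ->
  (\sum_(a <- s) `|(ord a F)%:~R : R|) * ln (r / rho) <= 2 * T r F + `|lnlc F|.
Proof.
move=> F0 rho1 rr gr us hs; have r0 : 0 < r by lra.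
have E a : `|(ord a F)%:~R : R| = pol F a + zer F a.
  rewrite /pol /zer /poln ordVE; case: (ord a F) => n.
    have -> : Num.min 0 (Posz n) = 0 by apply/min_idPl.
    have -> : Num.min 0 (- Posz n) = - Posz n by apply/min_idPr; rewrite oppr_le0.
    by rewrite abszN !absz_nat add0r -pmulrn normr_nat.
  rewrite NegzE opprK.
  have -> : Num.min 0 (Posz n.+1) = 0 by apply/min_idPl.
  have -> : Num.min 0 (- Posz n.+1) = - Posz n.+1 by apply/min_idPr; rewrite oppr_le0.
  by rewrite abszN !absz_nat addr0 mulrNz -pmulrn normrN normr_nat.
under eq_bigr do rewrite E.
have lf : locfin (fun a => pol F a + zer F a).
  by apply: locfinD; [exact: locfin_pol|exact: locfin_zer].
have nn a : 0 <= pol F a + zer F a by rewrite addr_ge0 ?ler0n.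
have := Nc_count rho1 rr lf nn us hs.
rewrite NcD; [|exact: locfin_pol|exact: locfin_zer].
have h1 : Nc r (pol F) <= T r F by rewrite /T lerDr mm_ge0.
have h2 : Nc r (zer F) <= T r F - lnlc F.
  by rewrite -T_inv// /T -/(zer F) lerDr mm_ge0.
set S := _ * _ => hS.
have := ler_norm (- lnlc F); rewrite normrN => h4.
by clear -h1 h2 h4 hS; lra.
Qed.

Lemma count_le F s rho r : F != 0 -> 1 <= rho -> rho < r -> gen r F ->
  uniq s -> (forall a, a \in s -> modC a <= rho) ->
  \sum_(a <- s) `|(ord a F)%:~R : R| <= (2 * T r F + `|lnlc F|) * r / (r - rho).
Proof.
move=> F0 rho1 rr gr us hs; have := count_ln F0 rho1 rr gr us hs.
have r0 : 0 < r by lra.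
have d0 : 0 < r - rho by lra.
set S := \sum_(a <- s) _ => hS.
have S0 : 0 <= S by apply: sumr_ge0.
have hl : (r - rho) / r <= ln (r / rho).
  apply: le_trans (ln_ge1V _); last by rewrite divr_gt0//; lra.
  by rewrite invf_div mulrBl divff ?gt_eqF.
rewrite ler_pdivlMr// -ler_pdivrMr// -mulrA; apply: le_trans hS.
by rewrite ler_wpM2l.
Qed.

Lemma mean_abs_ln r F : F != 0 -> 0 < r -> gen r F ->
  rmean r (fun z => `|ln (modC (F z))|) = mm r F + mm r F^-1.
Proof.
move=> F0 r0 gF; have gV : gen r F^-1 by move=> z /gF h; rewrite ordV// h.
rewrite /mm -(rmeanD (ltW r0) (reg_cont (gen_reg gF)) (reg_cont (gen_reg gV))).
apply: eq_rmean => [|z zr]; first exact: ltW.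
by rewrite (evV F0 (gF z zr)) modCV logp_abs//; exact: ord0_pos (gF z zr).
Qed.

(** The absolute value is [2 * logp (modC (z - a)) - ln (modC (z - a))], and the subtracted term has
    mean [ln r >= 0]. *)
Lemma mean_abs_sub r a : 1 <= r -> modC a < r ->
  rmean r (fun z => `|ln (modC (z - a))|) <= 2 * ln (2 * r).
Proof.
move=> r1 ar; have r0 : 0 < r by lra.
have r0' := ltW r0; have an : modC a != r by rewrite lt_eqF.
have cl := circ_cont_sub an.
have cN : circ_cont r (fun z => -1 * ln (modC (z - a))).
  by apply: circ_contMr; [exact: circ_cont_cst|exact: cl].
have c2 : circ_cont r (fun=> 2 * ln (2 * r)) by exact: circ_cont_cst.
apply: le_trans (_ : rmean r (fun z => 2 * ln (2 * r) + -1 * ln (modC (z - a))) <= _).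
  apply: (rmean_le r0' (circ_cont_abs cl) (circ_contD c2 cN)) => z zr.
  have za : 0 < modC (z - a).
    by rewrite modC_gt0 subr_eq0; apply: contraTneq ar => <-; rewrite zr ltxx.
  have h1 : logp (modC (z - a)) <= ln (2 * r).
    apply: le_trans (_ : logp (2 * r) <= _); last first.
      by rewrite /logp; case: ifP => h; [lra|exact: lexx].
    by apply: logp_mono; have := modCD z (- a); rewrite modCN zr; lra.
  rewrite logp_abs// mulN1r -(logp_inv za).
  by clear -h1; lra.
rewrite (rmeanD r0' c2 cN) rmean_cst (rmeanZ _ r0' cl) mean_ln_sub// mulN1r.
by rewrite lerBlDr lerDl ln_ge0// le_max r1.
Qed.

Lemma dlog_reg r F : F != 0 -> gen r F -> reg r (dlog F).
Proof.
move=> F0 gF z zr; have o := gF z zr; rewrite -[0]addr0; apply: vgeM.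
  by apply: vge_der0; exact: ord0_vge.
by apply: ord0_vge; rewrite ordV// o oppr0.
Qed.

(** The first main theorem bounds the mean for [F]; each factor [z - a] removed from [F] costs at
    most [2 * ln (2 * R1)] times its multiplicity. *)
Lemma mean_factor F s (e : M) n R1 R' : F != 0 -> 1 <= R1 -> gen R1 F ->
  (forall a, a \in s -> modC a < R1) -> F = e * fprod s (fun a => ord a F) -> e != 0 ->
  R1 < R' -> (forall z, modC z < R' -> ord z e = 0) ->
  \sum_(a <- s) `|(ord a F)%:~R : R| <= n ->
  rmean R1 (fun z => `|ln (modC (e z))|) <=
    2 * T R1 F + `|lnlc F| + n * (2 * ln (2 * R1)).
Proof.
move=> F0 R11 gR hs E e0 rr he hnk; have R10 : 0 < R1 by lra.
have R10' := ltW R10.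
set k := fun a => ord a F in E.
have he' := hol_ord0 he.
have en z : modC z < R' -> e z != 0 by move=> /he oz; exact: ord0_neq0.
have sR a : a \in s -> modC a != R1 by move=> /hs /lt_eqF ->.
have cs a : a \in s -> circ_cont R1 (fun z => `|(k a)%:~R| * `|ln (modC (z - a))|).
  move=> sa; apply: circ_contMr; first exact: circ_cont_cst.
  by apply: circ_cont_abs; exact: circ_cont_sub (sR a sa).
have Rs z : modC z = R1 -> z \notin s by move=> zr; apply/negP => /hs; rewrite zr ltxx.
have cF : circ_cont R1 (fun z => `|ln (modC (F z))|).
  apply: circ_cont_abs; apply: circ_cont_ln; first exact: gen_circ_cont.
  by move=> z /gR /(ord0_neq0 F0).
have ce : circ_cont R1 (fun z => `|ln (modC (e z))|).
  apply: circ_cont_abs; apply: circ_cont_ln; first exact: hol_circ_cont rr he'.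
  by move=> z zr; apply: en; rewrite zr.
apply: le_trans (_ : rmean R1 (fun z => `|ln (modC (F z))| +
    \sum_(a <- s) `|(k a)%:~R| * `|ln (modC (z - a))|) <= _).
  apply: (rmean_le R10' ce (circ_contD cF (circ_cont_sum cs))) => z zr.
  have [|_ ->] := factor_pt F0 E e0 _ (Rs z zr); first by apply: he; rewrite zr.
  set A := ln _; set S := \sum_(a <- s) _; set S' := \sum_(a <- s) _.
  have h : `|S| <= S'.
    by apply: le_trans (ler_norm_sum _ _ _) _; apply: ler_sum => a _; rewrite normrM.
  have := ler_normB (A + S) S; rewrite addrK => h2.
  by clear -h h2; lra.
rewrite (rmeanD R10' cF (circ_cont_sum cs)) (rmean_sum R10' cs); apply: lerD.
  rewrite mean_abs_ln//.
  have h1 : mm R1 F <= T R1 F.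
    by rewrite /T lerDl; apply: Nc_ge0 => // a; exact: pol_ge0.
  have h2 : mm R1 F^-1 <= T R1 F - lnlc F.
    by rewrite -T_inv// /T lerDl; apply: Nc_ge0 => // a; exact: pol_ge0.
  have := ler_norm (- lnlc F); rewrite normrN => h4.
  by move: (mm R1 F) (mm R1 F^-1) (T R1 F) (lnlc F) h1 h2 h4; clear => *; lra.
have l0 : 0 <= 2 * ln (2 * R1) by rewrite mulr_ge0// ln_ge0//; lra.
apply: le_trans (_ : (\sum_(a <- s) `|(k a)%:~R|) * (2 * ln (2 * R1)) <= _); last first.
  by rewrite ler_wpM2r.
rewrite mulr_suml big_seq [leRHS]big_seq; apply: ler_sum => a sa.
have ca := circ_cont_abs (circ_cont_sub (sR a sa)).
by rewrite (rmeanZ _ R10' ca) ler_wpM2l// mean_abs_sub// hs.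
Qed.

(** [dlog F] is [dlog e] plus the sum of the [ord a F / (z - a)]. The zero-free part is bounded by
    [logderiv_le]. The sum is bounded at every point of the circle, since the zeros and poles keep
    distance [del] from it. *)
Lemma dlog_pt F r R1 (del n B : R) : F != 0 -> 1 <= r -> r < R1 -> gen r F -> gen R1 F ->
  0 < del -> (forall a, modC a <= R1 -> ord a F != 0 -> del <= `|modC a - r|) ->
  (forall s, uniq s -> (forall a, a \in s -> modC a <= R1) ->
     \sum_(a <- s) `|(ord a F)%:~R : R| <= n) ->
  mm r (dlog F) <= logp (4 * R1 / (R1 - r) ^+ 2 *
     (2 * T R1 F + `|lnlc F| + n * (2 * ln (2 * R1))) + n / del).
Proof.
move=> F0 r1 rR gr gR del0 hdel hn; have R10 : 0 < R1 by lra.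
have R10' := ltW R10; have R11 : 1 <= R1 by lra.
have [s [e [us hs hz [E e0 hns] [R' rr he]]]] := factor F0 R10 gR.
set k := fun a => ord a F in E.
have he' := hol_ord0 he.
have en z : modC z < R' -> e z != 0 by move=> /he oz; exact: ord0_neq0.
have hnk : \sum_(a <- s) `|(k a)%:~R : R| <= n.
  by apply: hn => // a /hs /ltW.
have hm := mean_factor F0 R11 gR hs E e0 rr he hnk.
have r0 : 0 <= r by lra.
apply: (mm_le r0 (dlog_reg F0 gr)) => z zr.
have zR : modC z < R1 by rewrite zr.
have zR' : modC z < R' by lra.
have zs : z \notin s by apply/negP => /hns; rewrite (gr z zr).
have oe := he z zR'.
have [eS vS] := ev_sum_tm k zs.
have DE : dlog F = dlog e + \sum_(a <- s) (k a)%:~R / tm a.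
  by rewrite {1}E dlogM ?fprod_neq0// dlog_fprod.
have oV : ord z e^-1 = 0 by rewrite ordV// oe oppr0.
have vd := vge_der0 (ord0_vge oe).
have ve : vge z 0 (dlog e) by rewrite -[0]addr0; apply: vgeM vd (ord0_vge oV).
have -> : dlog F z = derive1 e z / e z + \sum_(a <- s) (k a)%:~R / (z - a).
  rewrite DE (evD ve vS) eS; congr (_ + _).
  rewrite /dlog (evM vd (ord0_vge oV)) (evV e0 oe).
  by rewrite (cder_derive1 (ev_der (ord0_vge oe))).
apply: le_trans (modCD _ _) _; apply: lerD.
  have := logderiv_le R10 rr zR he' en; rewrite zr => h; apply: le_trans h _.
  rewrite ler_wpM2l// divr_ge0 ?sqr_ge0// mulr_ge0//.
have modC_sum (I : Type) (t : seq I) (f : I -> C) : modC (\sum_(a <- t) f a) <= \sum_(a <- t) modC (f a).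
  elim: t => [|a t ih]; first by rewrite !big_nil modC0.
  by rewrite !big_cons; apply: le_trans (modCD _ _) _; rewrite lerD2l.
have modC_int (j : int) : modC (j%:~R : C) = `|j%:~R : R|.
  case: j => m; first by rewrite -!pmulrn modC_nat normr_nat.
  by rewrite NegzE !mulrNz modCN normrN -!pmulrn modC_nat normr_nat.
apply: le_trans (modC_sum _ _ _) _.
apply: le_trans (_ : (\sum_(a <- s) `|(k a)%:~R : R|) / del <= _); last first.
  by rewrite ler_wpM2r// invr_ge0 ltW.
rewrite mulr_suml big_seq [leRHS]big_seq; apply: ler_sum => a sa.
rewrite modCM modC_int modCV ler_wpM2l//.
have za : del <= modC (z - a).
  apply: le_trans (hdel a (ltW (hs a sa)) (hns a sa)) _.
  have := modC_triB a z; have := modC_triB z a; rewrite (modCB a z) zr => h1 h2.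
  by clear -h1 h2; rewrite ler_norml; apply/andP; split; lra.
by rewrite lef_pV2 ?posrE//; exact: lt_le_trans za.
Qed.

End LogDerivative.

(** * Exceptional sets and the lemma on the logarithmic derivative *)

Section GoodRadii.
Variable R : realType.
Local Notation C := (CC R).
Local Notation M := (mer R).
Local Notation mu := (@lebesgue_measure R).
Implicit Types (F G : M) (a z : C) (r x y : R) (s : seq C) (P Q : R -> Prop).

(** The exceptional sets of [small_function], packaged as a filter of properties of the radius;
    [good_ex] says that it is proper. *)
Definition good P := exists E : set R, [/\ measurable E, (mu E < +oo)%E &
  exists r0, forall r, r0 < r -> ~ E r -> P r].

Lemma goodI P Q : good P -> good Q -> good (fun r => P r /\ Q r).
Proof.
move=> [E [mE fE [r0 h]]] [E' [mE' fE' [r0' h']]]; exists (E `|` E'); split.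
- exact: measurableU.
- by apply: (le_lt_trans (measureU2 mu mE mE')); rewrite lte_add_pinfty.
- exists (Num.max r0 r0') => r; rewrite gt_max => /andP[h1 h2] nE.
  by split; [apply: h => // Er|apply: h' => // Er]; apply: nE; [left|right].
Qed.

Lemma goodS P Q : (forall r, P r -> Q r) -> good P -> good Q.
Proof.
move=> h [E [mE fE [r0 hE]]]; exists E; split => //; exists r0 => r rr nE.
by apply: h; exact: hE.
Qed.

Lemma good_gt x : good (fun r => x < r).
Proof. by exists set0; split => //; [rewrite measure0|exists x]. Qed.

Lemma good_ex P : good P -> exists r, P r.
Proof.
move=> [E [mE fE [r0 h]]]; apply: contrapT => np.
have sub : `]r0, +oo[%classic `<=` E.
  move=> r; rewrite /= in_itv/= andbT => rr; apply: contrapT => nE.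
  by apply: np; exists r; exact: h.
have : (mu `]r0, +oo[%classic <= mu E)%E by apply: (le_measure mu) => //; rewrite inE.
by rewrite lebesgue_measure_itv /= ltry /= addye// leye_eq => /eqP e; rewrite e in fE.
Qed.

Lemma gen_ex F (a b : R) : F != 0 -> a < b -> exists r, [/\ a < r, r < b & gen r F].
Proof.
move=> F0 ab; have /finite_seqP[s hs] := fin_ord b F0.
have [x [y [ax xy yb h]]] : exists x y, [/\ a <= x, x < y, y <= b & forall c, c \in s ->
    ~ (x < modC c < y)].
  elim: s {hs} => [|c s [x [y [ax xy yb h]]]]; first by exists a, b; split.
  have [cx|cx] := boolP (x < modC c < y); last first.
    exists x, y; split => // d; rewrite inE => /orP[/eqP ->|/h//]; exact/negP.
  have /andP[c1 c2] := cx; exists x, (modC c); split => //; [lra|].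
  move=> d; rewrite inE => /orP[/eqP ->|/h hd]; first by rewrite ltxx andbF.
  by move=> /andP[d1 d2]; apply: hd; rewrite d1 (lt_trans d2).
exists ((x + y) / 2); split; [lra|lra|] => z zr; apply/eqP/negPn/negP => oz.
have : [set` s] z by rewrite -hs; split => //; lra.
by move/h; apply; rewrite zr; apply/andP; split; lra.
Qed.

Lemma good_gen F : F != 0 -> good (fun r => gen r F).
Proof.
move=> F0; pose A n := [set r | exists2 z, modC z <= n%:R /\ ord z F != 0 & modC z = r].
have fA n : finite_set (A n).
  have -> : A n = (@modC R) @` [set z : C | modC z <= n%:R /\ ord z F != 0].
    by apply/seteqP; split => r [z h e]; exists z.
  by apply: finite_image; exact: fin_ord.
have cE : countable (\bigcup_n A n).
  by apply: bigcup_countable => // n _; apply: finite_set_countable; exact: fA.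
exists (\bigcup_n A n); split.
- apply: bigcup_measurable => n _; have /finite_seqP[s ->] := fA n.
  have -> : [set` s] = \bigcup_(x in [set` s]) [set x].
    by apply/seteqP; split => [x sx|x [y sy ->]//]; exists x.
  by apply: fin_bigcup_measurable => [|x _]; [exact: finite_seq|exact: measurable_set1].
- by rewrite countable_lebesgue_measure0.
- exists 0 => r r0 nE z zr; apply/eqP/negPn/negP => oz; apply: nE.
  exists (Num.truncn r).+1 => //; exists z => //; split => //.
  by rewrite zr ltW// truncnS_gt.
Qed.

Lemma ex_level x : 1 <= x -> exists k, 2 ^+ k <= x < 2 ^+ k.+1.
Proof.
move=> x1; have ex : exists k, x < 2 ^+ k.+1.
  exists (Num.truncn x); apply: lt_trans (truncnS_gt x) _.
  by rewrite -natrX ltr_nat ltn_expl.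
exists (ex_minn ex); case: ex_minnP => k hk hm; rewrite hk andbT.
case: k hk hm => [|k] hk hm; first by rewrite expr0.
by rewrite leNgt; apply/negP => /hm; rewrite ltnn.
Qed.

Definition annu (d : R) a : set R := `[modC a - d, modC a + d]%classic.

Lemma mu_seq s (d : R) : 0 <= d ->
  measurable (\big[setU/set0]_(a <- s) annu d a) /\
  (mu (\big[setU/set0]_(a <- s) annu d a) <= ((size s)%:R * (2 * d))%:E)%E.
Proof.
move=> d0; elim: s => [|a s [m ih]]; first by rewrite big_nil measure0 mul0r.
rewrite big_cons; split; first by apply: measurableU => //; exact: measurable_itv.
have ma : measurable (annu d a) by exact: measurable_itv.
apply: (le_trans (measureU2 mu ma m)).
rewrite /= -addn1 natrD mulrDl mul1r addrC EFinD; apply: leeD => //.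
rewrite /annu lebesgue_measure_itv /= lte_fin; case: ifP => _; last by rewrite lee_fin mulr_ge0.
by rewrite -EFinB lee_fin; lra.
Qed.

Lemma in_bigsetU s (I : C -> set R) x : (\big[setU/set0]_(a <- s) I a) x <->
  exists2 a, a \in s & I a x.
Proof.
elim: s => [|a s ih]; first by rewrite big_nil; split => // -[].
rewrite big_cons; split => [[h|/ih[b bs h]]|[b]].
- by exists a => //; rewrite inE eqxx.
- by exists b => //; rewrite inE bs orbT.
- by rewrite inE => /orP[/eqP -> h|bs h]; [left|right; apply/ih; exists b].
Qed.

Lemma count_numeric (Q K T2 R2 d : R) : 1 <= Q -> 0 <= K -> 0 <= T2 -> T2 <= 2 * Q ->
  0 <= R2 -> R2 <= 2 * Q -> Q^-1 / 8 <= d ->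
  (2 * T2 + K) * R2 / d <= 16 * (4 + K) * Q ^+ 3.
Proof.
move=> Q1 K0 T0 T2Q R0 R2Q hd; have Q0 : 0 < Q by lra.
have h0 : 0 < Q^-1 / 8 by rewrite divr_gt0// invr_gt0.
have i1 : d^-1 <= 8 * Q.
  by rewrite -[8 * Q]invrK lef_pV2 ?posrE ?invr_gt0 ?mulr_gt0//; [rewrite invfM mulrC|lra].
have h : 2 * T2 + K <= (4 + K) * Q.
  by have : K * 1 <= K * Q by [rewrite ler_wpM2l]; lra.
apply: le_trans (_ : (4 + K) * Q * (2 * Q) * (8 * Q) <= _).
  apply: ler_pM => //; [by rewrite mulr_ge0//; lra|by rewrite invr_ge0; lra|].
  by apply: ler_pM => //; lra.
by rewrite !exprS expr0; lra.
Qed.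

(** With [Q] the dyadic size of [r + T r F], all quantities are polynomial in [Q]. The kernel gives
    [Q ^+ 3] and the mean [Q ^+ 4]; in the sum over zeros and poles the count gives [Q ^+ 3] and the
    inverse distance [Q ^+ 4]. *)
Lemma ldl_numeric (Q K c1 r R1 T1 sz : R) : 1 <= Q -> 0 <= K -> 0 <= c1 -> 0 <= sz ->
  1 <= R1 -> R1 <= 2 * Q -> Q^-1 / 2 <= R1 - r -> 0 <= T1 -> T1 <= 2 * Q -> sz <= c1 * Q ^+ 3 ->
  4 * R1 / (R1 - r) ^+ 2 * (2 * T1 + K + c1 * Q ^+ 3 * (2 * ln (2 * R1)))
    + c1 * Q ^+ 3 / (Q^-1 / (sz + 1))
  <= (32 * (4 + K + 8 * c1) + c1 * (c1 + 1)) * Q ^+ 7.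
Proof.
move=> Q1 K0 c10 sz0 R11 R1Q hd T0 TQ hs; have Q0 : 0 < Q by lra.
have Q3 (n : nat) : 1 <= Q ^+ n by rewrite exprn_ege1.
have q3 := Q3 3%N; have n0 : 0 <= c1 * Q ^+ 3 by rewrite mulr_ge0//; lra.
have h0 : 0 < Q^-1 / 2 by rewrite divr_gt0// invr_gt0.
have i1 : (R1 - r)^-1 <= 2 * Q.
  by rewrite -[2 * Q]invrK lef_pV2 ?posrE ?invr_gt0 ?mulr_gt0//; [rewrite invfM mulrC|lra].
have i0 : 0 <= (R1 - r)^-1 by rewrite invr_ge0; lra.
have b1 : 4 * R1 / (R1 - r) ^+ 2 <= 32 * Q ^+ 3.
  rewrite -exprVn; apply: le_trans (_ : 4 * (2 * Q) * (2 * Q) ^+ 2 <= _).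
    apply: ler_pM; rewrite ?sqr_ge0//; [lra|lra|].
    by apply: lerXn2r; rewrite ?nnegrE//; lra.
  by clear; rewrite !exprS !expr0; lra.
have l1 : 2 * ln (2 * R1) <= 8 * Q.
  by have := @ln_sublinear R (2 * R1) ltac:(lra); lra.
have l0 : 0 <= 2 * ln (2 * R1) by rewrite mulr_ge0// ln_ge0//; lra.
have b2 : 2 * T1 + K + c1 * Q ^+ 3 * (2 * ln (2 * R1)) <= (4 + K + 8 * c1) * Q ^+ 4.
  have h1 : c1 * Q ^+ 3 * (2 * ln (2 * R1)) <= 8 * c1 * Q ^+ 4.
    apply: le_trans (_ : c1 * Q ^+ 3 * (8 * Q) <= _); first by rewrite (ler_wpM2l n0).
    by clear; rewrite !exprS expr0; lra.
  have h2 : K <= K * Q ^+ 4 by rewrite ler_peMr.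
  have h3 : Q <= Q ^+ 4 by rewrite exprS ler_peMr// ltW.
  by clear -h1 h2 h3 TQ; lra.
have b3 : c1 * Q ^+ 3 / (Q^-1 / (sz + 1)) <= c1 * (c1 + 1) * Q ^+ 7.
  rewrite invf_div invrK.
  have h1 : sz + 1 <= (c1 + 1) * Q ^+ 3 by clear -q3 hs; lra.
  apply: le_trans (_ : c1 * Q ^+ 3 * ((c1 + 1) * Q ^+ 3 * Q) <= _).
    by rewrite (ler_wpM2l n0)// (ler_wpM2r (ltW Q0)).
  by clear; rewrite !exprS !expr0; lra.
have h1 : 4 * R1 / (R1 - r) ^+ 2 * (2 * T1 + K + c1 * Q ^+ 3 * (2 * ln (2 * R1))) <=
  32 * Q ^+ 3 * ((4 + K + 8 * c1) * Q ^+ 4).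
  apply: ler_pM => //; first by rewrite divr_ge0 ?sqr_ge0//; lra.
  by rewrite !addr_ge0// mulr_ge0.
apply: le_trans (lerD h1 b3) _.
by clear; rewrite !exprS !expr0; lra.
Qed.

(** Radii are sorted by the dyadic level of [r + T r F]. At level [k] one discards the last [eta k]
    below the supremum [sk k] and thin annuli through the zeros and poles. A remaining radius has
    larger radii of the same level at distance comparable to [1 / Q], and there monotonicity of [T]
    gives control. The coefficient 7 is the exponent in [ldl_numeric]. *)
Theorem log_derivative F : F != 0 -> exists D, good (fun r =>
  mm r (dlog F) <= D + 7 * ln (r + T r F)).
Proof.
move=> F0; pose K := `|lnlc F|; have K0 : 0 <= K by exact: normr_ge0.
pose S k := [set r | [/\ 1 <= r, gen r F & r + T r F < 2 ^+ k.+1]].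
pose sk k := sup (S k); pose eta k : R := (2 ^+ k)^-1.
have eta0 k : 0 < eta k by rewrite invr_gt0 exprn_gt0.
have /choice[l hl] : forall k, exists s, uniq s /\
    forall a, (a \in s) <-> (modC a <= sk k - eta k / 4 /\ ord a F != 0).
  move=> k; have /finite_seqP[s hs] := fin_ord (sk k - eta k / 4) F0.
  exists (undup s); split; first exact: undup_uniq.
  move=> a; rewrite mem_undup.
  by have -> : (a \in s) = ([set` s] a) :> Prop by []; rewrite -hs.
(* Dividing by the number of annuli keeps their total length below [2 * eta k]; the added 1 covers
   an empty list. *)
pose del k : R := eta k / ((size (l k))%:R + 1).
have sz k : 0 < (size (l k))%:R + 1 :> R by rewrite ltr_wpDl.
have del0 k : 0 < del k by rewrite divr_gt0.
pose E1 k := `[sk k - eta k, sk k]%classic.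
pose E2 k := \big[setU/set0]_(a <- l k) annu (del k) a.
pose E := \bigcup_k (E1 k `|` E2 k).
have mE2 k := mu_seq (l k) (ltW (del0 k)).
have mE12 k : measurable (E1 k `|` E2 k) by apply: measurableU; [exact: measurable_itv|exact: (mE2 k).1].
have mE : measurable E by apply: bigcup_measurable.
have fE : (mu E < +oo)%E.
  apply: le_lt_trans (_ : (6%:E < +oo)%E); last by rewrite ltry.
  apply: (le_trans (measure_sigma_subadditive mu mE12 mE (@subset_refl _ _))).
  (* The share of level [k] is [6 / 2 ^+ k.+1 = 3 * eta k]: one [eta k] for the interval, two for
     the annuli. *)
  apply: le_trans (epsilon_trick0 xpredT (_ : 0 <= 6)); last by [].
  apply: lee_nneseries => // k _.
  have mE1 : measurable (E1 k) by exact: measurable_itv.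
  apply: (le_trans (measureU2 mu mE1 (mE2 k).1)).
  have -> : 6 / (2 ^ k.+1)%:R = eta k + 2 * eta k :> R.
    by rewrite /eta natrX exprS invfM; field; rewrite expf_neq0.
  have e1 : (mu (E1 k) <= (eta k)%:E)%E.
    rewrite /E1 lebesgue_measure_itv /= lte_fin; case: ifP => _; last by rewrite lee_fin ltW.
    by rewrite -EFinB lee_fin; lra.
  rewrite EFinD; apply: leeD; first exact: e1.
  apply: le_trans (mE2 k).2 _; rewrite lee_fin /del mulrCA ler_wpM2l// mulrA ler_pdivrMr//.
  by rewrite mulrC ler_wpM2l ?(ltW (eta0 k))//; lra.
pose c1 := 16 * (4 + K); pose D0 := 32 * (4 + K + 8 * c1) + c1 * (c1 + 1).
have c10 : 0 <= c1 by rewrite /c1; lra.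
have D00 : 0 <= D0 by rewrite /D0 addr_ge0// mulr_ge0//; clear -K0 c10; lra.
exists (logp D0); apply: goodS (goodI (good_gen F0) (goodI (good_gt 1) _)); last first.
  by exists E; split => //; exists 0 => r _ nE; exact: nE.
move=> r [gr [r1 nE]]; have r1' := ltW r1.
have T0 := T_ge0 F r1'.
have [k /andP[k1 k2]] := @ex_level (r + T r F) ltac:(lra).
set Q : R := 2 ^+ k in k1; have Q1 : 1 <= Q by rewrite exprn_ege1// ler1n.
have Q0 : 0 < Q by exact: lt_le_trans ltr01 Q1.
have Q2 : 2 ^+ k.+1 = 2 * Q by rewrite exprS.
have etaQ : eta k = Q^-1 by [].
have Sr : S k r by [].
have hub : has_sup (S k).
  split; first by exists r.
  exists (2 * Q) => x [x1 _]; rewrite Q2 => hx; have := T_ge0 F x1; clear -hx; lra.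
have rs : r <= sk k by exact: sup_upper_bound.
have rs' : r < sk k - eta k.
  rewrite ltNge; apply/negP => h; apply: nE; exists k => //; left.
  by rewrite /E1 /= in_itv/= h.
(* The radii are placed as [r < sk - eta], [sk - eta / 2 < R1 < sk - eta / 4] and
   [sk - eta / 8 < R2]. [R1] serves for the factorization, and [R2], still of level [k], for
   counting zeros and poles below [R1]. *)
have e8 : 0 < eta k / 8 by rewrite divr_gt0.
have [R2 [R21 gR2 TR2] R2s] := sup_adherent e8 hub; rewrite -/(sk k) in R2s.
have eta0k := eta0 k.
have [R1 [R11 R12 gR1]] := @gen_ex F (sk k - eta k / 2) (sk k - eta k / 4) F0 ltac:(clear -eta0k; lra).
have TR1 : T R1 F <= T R2 F by apply: T_mono => //; clear -R11 R12 R2s rs' r1 eta0k; lra.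
rewrite Q2 in TR2.
have T20 := T_ge0 F R21.
have R2Q : R2 <= 2 * Q by clear -TR2 T20; lra.
have R1Q : R1 <= 2 * Q by clear -R12 R2s R2Q eta0k; lra.
have T2Q : T R2 F <= 2 * Q by clear -TR2 R21; lra.
have cnt rho s : 1 <= rho -> rho <= sk k - eta k / 4 -> uniq s ->
    (forall a, a \in s -> modC a <= rho) ->
    \sum_(a <- s) `|(ord a F)%:~R : R| <= c1 * Q ^+ 3.
  move=> rho1 rhos us hs.
  apply: le_trans (@count_le R F s rho R2 F0 rho1 _ gR2 us hs) _; first by clear -rhos R2s e8; lra.
  by rewrite /c1; apply: count_numeric => //; rewrite -?etaQ; clear -rhos R2s R21 T20; lra.
have hdel a : modC a <= R1 -> ord a F != 0 -> del k <= `|modC a - r|.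
  move=> ar oa; rewrite leNgt; apply/negP => h; apply: nE; exists k => //; right.
  apply/in_bigsetU; exists a; first by apply/(hl k).2; split => //; clear -ar R12; lra.
  move: h; rewrite ltr_norml /annu /= in_itv/= => /andP[h1 h2].
  by apply/andP; split; clear -h1 h2; lra.
have hn s : uniq s -> (forall a, a \in s -> modC a <= R1) ->
    \sum_(a <- s) `|(ord a F)%:~R : R| <= c1 * Q ^+ 3.
  by apply: cnt; clear -R11 R12 rs' r1 eta0k; lra.
apply: le_trans (dlog_pt 0 F0 r1' _ gr gR1 (del0 k) hdel hn) _; first by clear -R11 rs' eta0k; lra.
have szl : (size (l k))%:R <= c1 * Q ^+ 3.
  apply: le_trans (_ : \sum_(a <- l k) `|(ord a F)%:~R : R| <= _); last first.
    apply: (cnt (sk k - eta k / 4)) => //; [by clear -rs' r1 eta0k; lra|by case: (hl k)|].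
    by move=> a /(hl k).2[].
  rewrite -sum1_size natr_sum big_seq [leRHS]big_seq; apply: ler_sum => a.
  move=> /(hl k).2[_ oa]; rewrite -intr_norm ler1z.
  by rewrite -[1]add0r lezD1 normr_gt0.
have T10 : 0 <= T R1 F by apply: T_ge0; clear -R11 rs' r1 eta0k; lra.
apply: le_trans (_ : logp (D0 * Q ^+ 7) <= _).
  apply: logp_mono; rewrite -/K /D0 /del etaQ; apply: ldl_numeric => //; rewrite -?etaQ.
  - by clear -R11 rs' r1 eta0k; lra.
  - by clear -R11 rs' eta0k; lra.
  - by clear -TR1 T2Q; lra.
apply: le_trans (logpM _ _) _; [by []|by rewrite exprn_ge0// ltW|].
rewrite lerD2l /logp; case: ifP => _.
  by rewrite mulr_ge0// ln_ge0//; clear -r1' T0; lra.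
have hQ : ln Q <= ln (r + T r F) by rewrite ler_ln ?posrE//; clear -Q0 k1; lra.
by rewrite lnXn// -[ln Q *+ 7]mulr_natl; clear -hQ; lra.
Qed.

End GoodRadii.

(** * Functions of logarithmic growth *)

Section Growth.
Variable R : realType.
Local Notation C := (CC R).
Local Notation M := (mer R).
Implicit Types (F G : M) (a z : C) (r x y : R) (s : seq C).

Lemma ln_le_sqrt x : 1 <= x -> ln x <= 2 * Num.sqrt x.
Proof.
move=> x1; have s0 : 0 < Num.sqrt x by rewrite sqrtr_gt0; lra.
rewrite -{1}[x]sqr_sqrtr; last by lra.
by rewrite lnXn// mulr2n; have := ln_sublinear s0; lra.
Qed.

Lemma small_bound (A B x eps : R) : 0 <= A -> 0 <= B -> 0 <= x -> 0 < eps ->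
  exists r0, forall r, r0 <= r -> 1 <= r /\ (x < r /\
    4 * r / (r - x) ^+ 2 * (A * ln r + B) <= eps).
Proof.
move=> A0 B0 x0 e0; pose c := 16 * (2 * A + B); have c0 : 0 <= c by rewrite /c; lra.
exists (1 + 2 * x + (c / eps) ^+ 2) => r hr.
have sq : 0 <= (c / eps) ^+ 2 by exact: sqr_ge0.
have r1 : 1 <= r by lra.
have r2 : 2 * x < r by lra.
split => //; split; first by lra.
pose q := Num.sqrt r; have qq : q ^+ 2 = r by rewrite /q sqr_sqrtr//; lra.
have q0 : 0 <= q by exact: sqrtr_ge0.
have q1 : 1 <= q by rewrite -(@ler_pXn2r _ 2)// ?nnegrE// expr1n qq.
have cq : c <= eps * q.
  rewrite mulrC -ler_pdivrMr// -(@ler_pXn2r _ 2)// ?nnegrE// ?qq; last by rewrite divr_ge0// ltW.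
  by lra.
have h1 : A * ln r + B <= (2 * A + B) * q.
  have := ler_wpM2l A0 (ln_le_sqrt r1); rewrite -/q => h.
  have : B * 1 <= B * q by rewrite ler_wpM2l.
  by lra.
have d0 : 0 < r - x by lra.
have h2 : 4 * r / (r - x) ^+ 2 <= 16 / r.
  rewrite ler_pdivrMr ?exprn_gt0// mulrAC ler_pdivlMr; last by lra.
  have : 0 <= r - 2 * x by lra.
  move=> t; have := mulr_ge0 t (ltW d0); have := mulr_ge0 t x0.
  have := mulr_ge0 t (_ : 0 <= r); rewrite !expr2 => /(_ _) h3 h4 h5.
  by have {h3} := h3 ltac:(lra); lra.
apply: le_trans (_ : 16 / r * ((2 * A + B) * q) <= _).
  apply: ler_pM => //; first by rewrite divr_ge0 ?sqr_ge0//; lra.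
  by rewrite addr_ge0// mulr_ge0// ln_ge0.
rewrite -qq; have qn : q != 0 by rewrite gt_eqF//; lra.
have -> : 16 / q ^+ 2 * ((2 * A + B) * q) = c / q by rewrite /c; field.
by rewrite ler_pdivrMr//; lra.
Qed.

(** Logarithmic growth on an unbounded set of radii bounds the number of zeros and poles. For the
    zero-free cofactor [e], letting [r] grow in [logderiv_le] shows that [e'] vanishes at every
    point. Asking only for an unbounded set of radii makes the negation a lower bound at all large
    generic radii. *)
Theorem slow_growth F K : F != 0 ->
  (forall r0, exists r, [/\ r0 < r, gen r F & T r F < K * ln r]) ->
  exists s c, F = cstm c * fprod s (fun a => ord a F).
Proof.
move=> F0 hslow; pose L := `|lnlc F|; have L0 : 0 <= L by exact: normr_ge0.
pose B := 4 * `|K| + 2 * L.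
have K0 := normr_ge0 K.
have cnt s : uniq s -> \sum_(a <- s) `|(ord a F)%:~R : R| <= B.
  move=> us.
  have [rho rho1 hrho] : exists2 rho : R, 1 <= rho & forall a, a \in s -> modC a <= rho.
    elim: s {us} => [|a s [rho r1 h]]; first by exists 1.
    exists (Num.max rho (modC a)); first by rewrite le_max r1.
    by move=> b; rewrite inE => /orP[/eqP ->|/h hb]; rewrite le_max ?lexx ?orbT// hb.
  (* Beyond [rho ^+ 2] one has [ln (r / rho) >= ln r / 2], and beyond [expR 1] one has [ln r >= 1],
     which absorbs the constant [L]. *)
  have [r [rr gr Tr]] := hslow (Num.max (rho ^+ 2) (expR 1)).
  move: rr; rewrite gt_max => /andP[rr re].
  have rho0 : 0 < rho by lra.
  have rhor : rho < r by apply: le_lt_trans rr; rewrite expr2 ler_peMr//; lra.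
  have r0 : 0 < r by lra.
  have := count_ln F0 rho1 rhor gr us hrho.
  set S := \sum_(a <- s) _; have S0 : 0 <= S by apply: sumr_ge0.
  have l1 : 1 <= ln r by rewrite -[1]expRK ler_ln ?posrE ?expR_gt0// ltW.
  have l2 : ln r / 2 <= ln (r / rho).
    rewrite ln_div ?posrE//; have : ln (rho ^+ 2) <= ln r by rewrite ler_ln ?posrE ?exprn_gt0// ltW.
    by rewrite lnXn// mulr2n; lra.
  have l3 : S * (ln r / 2) <= S * ln (r / rho) by rewrite ler_wpM2l.
  have l4 : K * ln r <= `|K| * ln r by rewrite ler_wpM2r ?ler_norm//; lra.
  have l5 : L * 1 <= L * ln r by rewrite ler_wpM2l.
  rewrite -/L => l6; rewrite -(@ler_pM2r _ (ln r)); last by lra.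
  rewrite /B; clear -l3 l4 l5 l6 Tr; lra.
have szb s : uniq s -> (forall a, a \in s -> ord a F != 0) -> (size s <= Num.truncn B)%N.
  move=> us hs; rewrite -ltnS -(ltr_nat R); apply: le_lt_trans (truncnS_gt B).
  apply: le_trans (cnt s us); rewrite -sum1_size natr_sum big_seq [leRHS]big_seq.
  apply: ler_sum => a /hs oa; rewrite -intr_norm ler1z.
  by rewrite -[1]add0r lezD1 normr_gt0.
(* A list of maximal size among those of distinct zeros and poles must contain all of them. *)
pose P n := `[< exists s, [/\ uniq s, (forall a, a \in s -> ord a F != 0) & size s = n] >].
have exP : exists n, P n by exists 0%N; apply/asboolP; exists [::]; split.
have ubP n : P n -> (n <= Num.truncn B)%N by move=> /asboolP[s [us hs <-]]; exact: szb.
have [n /asboolP[s [us hs sn]] hmax] := ex_maxnP exP ubP.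
have hz a : a \notin s -> ord a F = 0.
  move=> na; apply/eqP/negPn/negP => oa.
  have : P n.+1.
    apply/asboolP; exists (a :: s); split; [by rewrite /= na|  |by rewrite /= sn].
    by move=> b; rewrite inE => /orP[/eqP ->//|/hs].
  by move/hmax; rewrite ltnn.
have f0 := fprod_neq0 s (fun a => ord a F).
have [e [e0 E oe]] : exists e : M, [/\ e != 0, F = e * fprod s (fun a => ord a F) &
    forall z, ord z e = 0].
  exists (F / fprod s (fun a => ord a F)); split.
  - by rewrite mulf_neq0// invr_neq0.
  - by rewrite divfK.
  - move=> z; rewrite ordM ?invr_neq0// ordV// ord_fprod//.
    by case: ifPn => [_|/hz ->//]; rewrite ?subrr ?subr0.
have [rho hrho] : exists rho : R, forall a, a \in s -> modC a < rho.
  elim: s {us hs sn hz f0 e0 E} => [|a s [rho h]]; first by exists 1.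
  exists (Num.max rho (modC a + 1)) => b; rewrite inE => /orP[/eqP ->|/h hb].
    by rewrite lt_max; apply/orP; right; lra.
  by rewrite lt_max hb.
have B0 : 0 <= B by rewrite /B; clear -K0 L0; lra.
have de z : derive1 e z / e z = 0.
  apply/eqP; rewrite -modC_eq0; apply/eqP/le_anti; rewrite modC_ge0 andbT.
  apply/ler_addgt0Pl => eps eps0; rewrite addr0.
  have A0 : 0 <= 2 * `|K| + 2 * B by clear -K0 B0; lra.
  have B20 : 0 <= L + 2 * B * ln 2 by rewrite addr_ge0// !mulr_ge0// ln_ge0//; clear -B0; lra.
  have [r0 hr0] := small_bound A0 B20 (modC_ge0 z) eps0.
  have [r [rr gr Tr]] := hslow (Num.max r0 rho).
  move: rr; rewrite gt_max => /andP[rr0 rrho].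
  have [r1 [zr hle]] := hr0 r (ltW rr0).
  have rp : 0 < r by clear -r1; lra.
  have r1' : r < r + 1 by rewrite ltrDl.
  have hol := @hol_ord0 R e (r + 1) (fun z _ => oe z).
  have en w : modC w < r + 1 -> e w != 0 by move=> _; exact: ord0_neq0.
  apply: le_trans (logderiv_le rp r1' zr hol en) _; apply: le_trans hle.
  rewrite ler_wpM2l ?divr_ge0 ?sqr_ge0 ?mulr_ge0 ?(ltW rp)//.
  have hs' a : a \in s -> modC a < r by move=> /hrho h; exact: lt_trans h rrho.
  apply: le_trans (mean_factor F0 r1 gr hs' E e0 r1' (fun z _ => oe z) (cnt s us)) _.
  have l0 : 0 <= ln r by rewrite ln_ge0.
  have l4 : K * ln r <= `|K| * ln r by rewrite ler_wpM2r ?ler_norm.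
  rewrite lnM ?posrE// -/L; clear -l4 Tr; lra.
have dz : derm e = 0.
  apply: mer_near => b; apply: filterS (filterI (dermE e b) (mer0 b)) => z [-> ->].
  have := de z; move/eqP; rewrite mulf_eq0 invr_eq0 (negbTE (ord0_neq0 e0 (oe z))) orbF.
  by move/eqP.
have [c hc] := derm0_cst dz.
by exists s, c; rewrite -hc.
Qed.

End Growth.

(** * Polynomials along a Riccati equation *)

Section RiccatiNumeric.
Variable F : numClosedFieldType.
Implicit Types (p Q : {poly F}) (s : seq F) (z : F).

Lemma coef01_prod s : (forall z, z \in s -> z != 0) ->
  (\prod_(z <- s) ('X - z%:P))`_0 = \prod_(z <- s) - z /\
  (\prod_(z <- s) ('X - z%:P))`_1 = - (\prod_(z <- s) - z) * \sum_(z <- s) z^-1.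
Proof.
elim: s => [_|z s IH sn]; first by rewrite !big_nil !coefC /= mulr0.
have [i0 i1] : _ := IH (fun w ws => sn w (@mem_behead _ (z :: s) w ws)).
have z0 : z != 0 by apply: sn; rewrite mem_head.
rewrite !big_cons mulrBl !coefB !coefXM !coefCM /= i0 i1; split; first by rewrite sub0r mulNr.
by field.
Qed.

(** In characteristic 0 the multiplicity of [z] drops by exactly one from [Q] to its derivative, so
    [p] has to supply the missing factor. *)
Lemma ode_root p Q z (k : {poly F}) : Q != 0 -> Q^`() * p = k * Q -> root Q z -> root p z.
Proof.
move=> Q0 ode Qz; have [e [G]] := multiplicity_XsubC Q z.
rewrite Q0 /= => Gz QE.
have e0 : (0 < e)%N.
  by rewrite lt0n; apply: contraTN Qz => /eqP ez; rewrite QE ez expr0 mulr1.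
have Xn : ('X - z%:P) ^+ e.-1 != 0 by rewrite expf_neq0 // polyXsubC_eq0.
have ES : ('X - z%:P) ^+ e = ('X - z%:P) * ('X - z%:P) ^+ e.-1 by rewrite -exprS prednK.
have : (G^`() * ('X - z%:P) + G *+ e) * p = k * G * ('X - z%:P).
  apply: (mulIf Xn); move: ode; rewrite QE derivM deriv_exp derivXsubC mul1r => ode.
  rewrite -[RHS]mulrA -ES -[RHS]mulrA -ode ES -[G *+ e]mulr_natr -[_ ^+ e.-1 *+ e]mulr_natr; ring.
move=> /(congr1 (fun q => q.[z])); rewrite !hornerM hornerD hornerM hornerMn hornerXsubC subrr !mulr0 add0r => /eqP.
rewrite mulf_eq0 mulrn_eq0 -leqn0 leqNgt e0 /= -/(root G z).
by move: Gz; rewrite rootE => /negPf ->; rewrite rootE.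
Qed.

(** Let [r1], [r2] be the roots of the quadratic, with multiplicities [a1], [b1] in [Q]. From
    [Q_1 = 0] one gets [a1 / r1 + b1 / r2 = 0], so [|r1| / |r2| = a1 / b1]; from [|Q_0| = 1] one
    gets [|Q_n| |r1|^a1 |r2|^b1 = 1]. With [c / a = r1 * r2] the left-hand side is
    [(|r1| / |r2|)^(b1 - a1)]. *)
Lemma riccati_numeric Q n a b c : (0 < n)%N -> a != 0 -> c != 0 -> size Q = n.+1 ->
  `|Q`_0| = 1 -> Q`_1 = 0 ->
  Q^`() * (a *: 'X^2 + b *: 'X + c%:P) = (n%:R * a) *: 'X * Q ->
  `|Q`_n| ^+ 2 * `|c / a| ^+ n <= 1.
Proof.
move=> n0 an cn sQ Q0 Q1 ode.
have Qn : Q != 0 by rewrite -size_poly_eq0 sQ.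
have [s sE] := closed_field_poly_normal Q.
set qn := lead_coef Q in sE.
have qE : Q`_n = qn by rewrite /qn lead_coefE sQ.
have qn0 : qn != 0 by rewrite lead_coef_eq0.
have ss : size s = n.
  by move: sQ; rewrite sE size_scale // size_prod_XsubC => -[].
have rts z : z \in s -> a * z ^+ 2 + b * z + c = 0.
  move=> zs; have : root Q z by rewrite sE rootZ // root_prod_XsubC.
  by move=> /(ode_root Qn ode)/rootP; rewrite !hornerE.
have sn z : z \in s -> z != 0.
  by move=> /rts; apply: contra_eqN => /eqP ->; rewrite expr0n /= !mulr0 !add0r.
have [c0 c1] := coef01_prod sn.
have pn0 : \prod_(z <- s) - z != 0.
  rewrite prodf_seq_neq0; apply/allP => z zs /=; rewrite oppr_eq0; exact: sn.
have sum0 : \sum_(z <- s) z^-1 = 0.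
  move: Q1; rewrite sE coefZ c1 => /eqP; rewrite !mulf_eq0 oppr_eq0 (negPf qn0) (negPf pn0) /=.
  by move=> /eqP.
have prod1 : `|qn| * \prod_(z <- s) `|z| = 1.
  rewrite -[RHS]Q0 sE coefZ c0 normrM normr_prod; congr (_ * _).
  by apply: eq_bigr => z _; rewrite normrN.
have [r1 r1s] : exists z, z \in s by case: (s) ss n0 => [<-//|z t _ _]; exists z; rewrite mem_head.
have r1n := sn _ r1s; have r1q := rts _ r1s.
(* The companion root by Vieta. It is not assumed distinct from [r1]; the relation [abr] later rules
   out that all roots of [Q] equal [r1]. *)
pose r2 := c / (a * r1).
have r2n : r2 != 0 by rewrite mulf_neq0 // invr_eq0 mulf_neq0.
have r12 : c / a = r1 * r2 by rewrite /r2; field; rewrite r1n an.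
have dich z : z \in s -> z != r1 -> z = r2.
  move=> /rts zq; rewrite -subr_eq0 => zn; apply: (mulfI (mulf_neq0 an r1n)).
  have -> : a * r1 * r2 = c by rewrite /r2; field; rewrite r1n an.
  apply/eqP; rewrite -subr_eq0 -(mulrI_eq0 _ (mulfI zn)); apply/eqP.
  have -> : (z - r1) * (a * r1 * z - c) =
    r1 * (a * z ^+ 2 + b * z + c) - z * (a * r1 ^+ 2 + b * r1 + c) by ring.
  by rewrite zq r1q !mulr0 subr0.
pose a1 := count (fun z => z == r1) s; pose b1 := count (fun z => z != r1) s.
have ab : (a1 + b1)%N = n by rewrite -ss -(count_predC (fun z => z == r1)).
have sumE : a1%:R / r1 + b1%:R / r2 = 0.
  rewrite -sum0 (bigID (fun z => z == r1)) /=; congr (_ + _).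
    rewrite (eq_bigr (fun=> r1^-1)); last by move=> z /eqP ->.
    by rewrite big_const_seq iter_addr_0 mulr_natl.
  rewrite big_seq_cond (eq_bigr (fun=> r2^-1)); last by move=> z /andP[zs /(dich _ zs) ->].
  by rewrite -big_seq_cond big_const_seq iter_addr_0 mulr_natl.
have prodE : \prod_(z <- s) `|z| = `|r1| ^+ a1 * `|r2| ^+ b1.
  rewrite (bigID (fun z => z == r1)) /=; congr (_ * _).
    rewrite (eq_bigr (fun=> `|r1|)); last by move=> z /eqP ->.
    by rewrite big_const_seq iter_mulr_1.
  rewrite big_seq_cond (eq_bigr (fun=> `|r2|)); last by move=> z /andP[zs /(dich _ zs) ->].
  by rewrite -big_seq_cond big_const_seq iter_mulr_1.
have a10 : (0 < a1)%N by rewrite -has_count; apply/hasP; exists r1.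
have abr : a1%:R * r2 = - (b1%:R * r1).
  apply/eqP; rewrite -addr_eq0; apply/eqP.
  have -> : a1%:R * r2 + b1%:R * r1 = (a1%:R / r1 + b1%:R / r2) * (r1 * r2).
    by field; rewrite r1n r2n.
  by rewrite sumE mul0r.
have b10 : (0 < b1)%N.
  rewrite lt0n; apply/negP => /eqP b0; move: abr; rewrite b0 mul0r oppr0 => /eqP.
  by rewrite mulf_eq0 pnatr_eq0 -leqn0 leqNgt a10 (negPf r2n).
have nabr : a1%:R * `|r2| = b1%:R * `|r1|.
  by rewrite -[a1%:R]normr_nat -normrM abr normrN normrM normr_nat.
have x0 : 0 < `|r1| by rewrite normr_gt0.
have y0 : 0 < `|r2| by rewrite normr_gt0.
move: prod1; rewrite prodE qE r12 (normrM r1 r2).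
move: `|r1| `|r2| `|qn| x0 y0 nabr => x y q x0 y0 nabr pq.
have -> : q = (x ^+ a1 * y ^+ b1)^-1.
  have h0 : x ^+ a1 * y ^+ b1 != 0 by rewrite mulf_neq0 // expf_neq0 // gt_eqF.
  by apply: (mulIf h0); rewrite pq mulVf.
rewrite exprVn mulrC ler_pdivrMr ?exprn_gt0 ?mulr_gt0 ?exprn_gt0 // mul1r.
rewrite exprMn [leRHS]exprMn -!exprM -ab.
have xe e : 0 <= x ^+ e by apply: exprn_ge0; exact: ltW.
have ye e : 0 <= y ^+ e by apply: exprn_ge0; exact: ltW.
have [le|/ltnW le] := leqP a1 b1.
  have xy : x <= y.
    have b1p : (0 : F) < b1%:R by rewrite ltr0n.
    rewrite -(ler_pM2l b1p) -nabr ler_wpM2r ?ler_nat // ltW //.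
  rewrite -(subnKC le); set k := (b1 - a1)%N.
  have -> : x ^+ (a1 + (a1 + k)) = x ^+ (a1 * 2) * x ^+ k by rewrite -exprD muln2 -addnn addnA.
  have -> : y ^+ ((a1 + k) * 2) = y ^+ (a1 + (a1 + k)) * y ^+ k.
    by rewrite -exprD; congr (_ ^+ _); rewrite muln2 -addnn; rewrite addnAC addnA addnAC.
  rewrite -mulrA ler_wpM2l // mulrC ler_wpM2l //.
  by rewrite lerXn2r // nnegrE ltW.
have xy : y <= x.
  have a1p : (0 : F) < a1%:R by rewrite ltr0n.
  rewrite -(ler_pM2l a1p) nabr ler_wpM2r ?ler_nat // ltW //.
rewrite -(subnKC le); set k := (a1 - b1)%N.
have -> : y ^+ (b1 + k + b1) = y ^+ (b1 * 2) * y ^+ k by rewrite -exprD muln2 -addnn addnAC.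
have -> : x ^+ ((b1 + k) * 2) = x ^+ (b1 + k + b1) * x ^+ k.
  by rewrite -exprD; congr (_ ^+ _); rewrite muln2 -addnn addnA.
rewrite [leRHS]mulrAC -[leRHS]mulrA ler_wpM2l // ler_wpM2l //.
by rewrite lerXn2r // nnegrE ltW.
Qed.

End RiccatiNumeric.

Section Quadratic.
Variable K : comNzRingType.
Implicit Types (p : {poly K}).

Definition quad (A B C : K) : {poly K} := A *: 'X^2 + B *: 'X + C%:P.

Lemma coef_quad p A B C j : (p^`() * quad A B C)`_j =
  A * (j.-1)%:R * p`_j.-1 *+ (j != 0%N) + B * j%:R * p`_j + C * j.+1%:R * p`_j.+1.
Proof.
rewrite /quad !mulrDr !coefD -!scalerAr !coefZ coefMC coefMX coefMXn !coef_deriv.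
by case: j => [|[|j]] /=; rewrite ?subSS ?subn0; ring.
Qed.

Lemma coef_XM p (c : K) j : (c *: 'X * p)`_j = c * p`_j.-1 *+ (j != 0%N).
Proof. by rewrite -scalerAl coefZ coefXM; case: j => [|j]; rewrite ?mulr0 ?mulr1n. Qed.

End Quadratic.

(** * The derivation of K[X] attached to a Riccati equation *)

Section PolyDerivation.
Variables (K : fieldType) (d : K -> K).
Hypotheses (dD : forall x y, d (x + y) = d x + d y) (dM : forall x y, d (x * y) = d x * y + x * d y).
Variables (A B C : K).
Implicit Types (p q : {poly K}) (f : K).

Lemma der0 : d 0 = 0.
Proof. by have := dM 0 0; rewrite mulr0 !mul0r mulr0 addr0. Qed.

Lemma der1 : d 1 = 0.
Proof. by have := dM 1 1; rewrite mulr1 mulr1 mul1r => /eqP; rewrite -subr_eq subrr eq_sym => /eqP. Qed.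

Lemma derN x : d (- x) = - d x.
Proof. by apply/eqP; rewrite -addr_eq0 -dD addNr der0. Qed.

Lemma der_nat n : d n%:R = 0.
Proof. by elim: n => [|n IH]; [exact: der0 | rewrite -natr1 dD IH der1 addr0]. Qed.

Lemma derX x n : d (x ^+ n) = n%:R * x ^+ n.-1 * d x.
Proof.
elim: n => [|n IH]; first by rewrite expr0 der1 !mul0r.
rewrite exprS dM IH /= -natr1; case: n {IH} => [|n] /=; first by rewrite expr0; ring.
by rewrite exprS; ring.
Qed.

Lemma derV x : x != 0 -> d x^-1 = - d x / x ^+ 2.
Proof.
move=> x0; have : d (x * x^-1) = 0 by rewrite mulfV // der1.
rewrite dM => /eqP; rewrite addrC addr_eq0 => /eqP h.
by apply: (mulfI x0); rewrite h; field.
Qed.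

(** The derivation of [K[X]] that extends [d] and sends [X] to [A X^2 + B X + C]. At a solution [f]
    of the Riccati equation, evaluation turns it into [d]. *)
Definition pD p := map_poly d p + p^`() * quad A B C.

Lemma coef_pD p j : (pD p)`_j = d p`_j +
  (A * (j.-1)%:R * p`_j.-1 *+ (j != 0%N) + B * j%:R * p`_j + C * j.+1%:R * p`_j.+1).
Proof. by rewrite coefD coef_map_id0 ?der0 // coef_quad. Qed.

Lemma pDD p q : pD (p + q) = pD p + pD q.
Proof.
apply/polyP => j; rewrite coefD !coef_pD !coefD dD.
by case: j => [|j]; rewrite ?mulr0n ?mulr1n /=; ring.
Qed.

Lemma d_sum I (r : seq I) (P : pred I) (F : I -> K) :
  d (\sum_(i <- r | P i) F i) = \sum_(i <- r | P i) d (F i).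
Proof. by apply: (big_morph d dD der0). Qed.

Lemma pDM p q : pD (p * q) = pD p * q + p * pD q.
Proof.
rewrite /pD derivM.
have -> : map_poly d (p * q) = map_poly d p * q + p * map_poly d q.
  apply/polyP => j; rewrite coefD !coef_map_id0 ?der0 // !coefM d_sum -big_split /=.
  by apply: eq_bigr => i _; rewrite dM !coef_map_id0 ?der0.
by ring.
Qed.

Lemma pDC c : pD c%:P = (d c)%:P.
Proof.
rewrite /pD derivC mul0r addr0; apply/polyP => j; rewrite coef_map_id0 ?der0 // !coefC.
by case: ifP => // _; exact: der0.
Qed.

Lemma pD_eval p f : d f = A * f ^+ 2 + B * f + C -> (pD p).[f] = d p.[f].
Proof.
move=> df; elim/poly_ind: p => [|p c IH].
  by rewrite -polyC0 pDC !hornerC.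
rewrite pDD pDM pDC (hornerD (pD p * 'X + _)) (hornerD (pD p * 'X)) (hornerM (pD p)) IH.
rewrite (hornerM p) /pD derivX mul1r.
have -> : map_poly d 'X = 0 :> {poly K}.
  apply/polyP => j; rewrite coef_map_id0 ?der0 // coefX coef0.
  by case: eqP => _; [exact: der1 | exact: der0].
rewrite add0r /quad !(hornerD, hornerM, hornerZ, hornerXn, hornerX, hornerC) dD dM df; ring.
Qed.

(** The commutator of [pD] with the formal derivative; it yields the equations satisfied by the
    derivatives of [Q] and, later, of the Hessian. *)
Lemma pD_deriv p : (pD p)^`() = pD p^`() + p^`() * ((2 * A) *: 'X + B%:P).
Proof.
rewrite /pD derivD derivM /quad !derivD !derivZ derivXn derivX derivC addr0.
have -> : (map_poly d p)^`() = map_poly d p^`().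
  apply/polyP => j; rewrite coef_deriv !coef_map_id0 ?der0 // coef_deriv -[p`_j.+1 *+ _]mulr_natr -[d _ *+ _]mulr_natr dM der_nat.
  by rewrite mulr0 addr0.
rewrite /= expr1 -!mul_polyC polyCM polyC_natr; ring.
Qed.

Lemma pD_top p e : (size p <= e.+1)%N -> (size (pD p) <= e.+2)%N /\ (pD p)`_e.+1 = A * e%:R * p`_e.
Proof.
move=> sp; have z j : (e.+1 <= j)%N -> p`_j = 0 by move=> h; apply: nth_default; exact: leq_trans h.
split; last by rewrite coef_pD /= mulr1n (z e.+1) // (z e.+2) // der0; ring.
apply/leq_sizeP => -[//|j] h; rewrite coef_pD /= mulr1n (z j.+1) ?(z j) ?(z j.+2) ?der0 //; first by ring.
all: by [exact: ltnW | exact: leqW (ltnW h)].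
Qed.

Lemma pD_low p e : (forall i, (i < e)%N -> p`_i = 0) -> (forall i, (i < e.-1)%N -> (pD p)`_i = 0) /\
  ((0 < e)%N -> (pD p)`_e.-1 = C * e%:R * p`_e).
Proof.
move=> z; split=> [i ie|e0].
  have ie' : (i.+1 < e)%N by case: (e) ie => // e' /=.
  rewrite coef_pD (z i) ?(z i.-1) ?(z i.+1) ?der0 //; first by rewrite !mulr0 mul0rn !addr0.
  - by rewrite (leq_ltn_trans (leq_pred i)) // ltnW.
  - exact: ltnW.
case: e z e0 => // e z _ /=; rewrite coef_pD (z e) // (z e.-1) ?der0; last by rewrite ltnS leq_pred.
by rewrite !mulr0 mul0rn !add0r.
Qed.

(** The rising factorial: it is the factor acquired by the top coefficient of ['X^l] under [m]
    derivations, while the bottom coefficient acquires the falling factorial [l ^_ m]. The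
    comparison of the two decides the end of the proof. *)
Definition rf (l m : nat) : nat := \prod_(i < m) (l + i).

Lemma rfS l m : rf l m.+1 = (rf l m * (l + m))%N.
Proof. by rewrite /rf big_ord_recr. Qed.

Lemma iter_pD_top l m : (size (iter m pD 'X^l) <= (l + m).+1)%N /\
  (iter m pD 'X^l)`_(l + m) = (rf l m)%:R * A ^+ m.
Proof.
elim: m => [|m [s1 c1]]; first by rewrite addn0 /= size_polyXn coefXn eqxx /rf big_ord0 expr0 mulr1.
have [s2 c2] := pD_top s1; rewrite addnS iterS; split=> //.
by rewrite c2 c1 rfS natrM exprS; ring.
Qed.

Lemma iter_pD_low l m : (m <= l)%N -> (forall i, (i < l - m)%N -> (iter m pD 'X^l)`_i = 0) /\
  (iter m pD 'X^l)`_(l - m) = (l ^_ m)%:R * C ^+ m.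
Proof.
elim: m => [_|m IH lm].
  rewrite subn0 /=; split; last by rewrite coefXn eqxx ffactn0 expr0 mulr1.
  by move=> i il; rewrite coefXn ltn_eqF.
have [s1 c1] := IH (ltnW lm); have [s2 c2] := pD_low s1.
rewrite iterS subnS; split=> //.
rewrite c2 ?subn_gt0 // c1 ffactnSr natrM exprS; ring.
Qed.

Lemma iter_pD_eval p f m : d f = A * f ^+ 2 + B * f + C -> (iter m pD p).[f] = iter m d p.[f].
Proof. by move=> df; elim: m => //= m IH; rewrite pD_eval // IH. Qed.

Lemma top_mul p q a b : (size p <= a.+1)%N -> (size q <= b.+1)%N ->
  (size (p * q)%R <= (a + b).+1)%N /\ (p * q)`_(a + b) = p`_a * q`_b.
Proof.
move=> sp sq; split.
  have [->|p0] := eqVneq p 0; first by rewrite mul0r size_poly0.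
  have [->|q0] := eqVneq q 0; first by rewrite mulr0 size_poly0.
  rewrite size_mul //; move: (leq_add sp sq); rewrite addSn addnS.
  by case: (size p + size q)%N.
have ab : (a < (a + b).+1)%N by rewrite ltnS leq_addr.
rewrite coefM (bigD1 (Ordinal ab)) //= addKn big1 ?addr0 // => i ia.
have [lt|le] := ltnP a i; first by rewrite nth_default ?mul0r // (leq_trans sp).
have lt : (i < a)%N by rewrite ltn_neqAle le andbT.
by rewrite [q`__]nth_default ?mulr0 // (leq_trans sq) // ltn_subRL ltn_add2r.
Qed.

Lemma low_mul p q a b : (forall i, (i < a)%N -> p`_i = 0) -> (forall i, (i < b)%N -> q`_i = 0) ->
  (forall i, (i < a + b)%N -> (p * q)`_i = 0) /\ (p * q)`_(a + b) = p`_a * q`_b.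
Proof.
move=> zp zq; split=> [i iab|].
  rewrite coefM big1 // => j _; have [/zp ->|le] := ltnP j a; first by rewrite mul0r.
  rewrite (zq (i - j)%N) ?mulr0 // ltn_subLR; last by rewrite -ltnS.
  by rewrite (leq_trans iab) // leq_add2r.
have ab : (a < (a + b).+1)%N by rewrite ltnS leq_addr.
rewrite coefM (bigD1 (Ordinal ab)) //= addKn big1 ?addr0 // => i ia.
have [lt|le] := ltnP i a; first by rewrite zp ?mul0r.
have lt : (a < i)%N by rewrite ltn_neqAle le andbT eq_sym.
rewrite (zq (a + b - i)%N) ?mulr0 // ltn_subLR; last by rewrite -ltnS.
by rewrite ltn_add2r.
Qed.

Lemma top_prod k (p : 'I_k -> {poly K}) (a : 'I_k -> nat) : (forall i, size (p i) <= (a i).+1)%N ->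
  (size (\prod_(i < k) p i)%R <= (\sum_(i < k) a i).+1)%N /\
  (\prod_(i < k) p i)`_(\sum_(i < k) a i)%N = \prod_(i < k) (p i)`_(a i).
Proof.
elim: k p a => [|k IH] p a h; first by rewrite !big_ord0 size_poly1 coefC.
have [s1 c1] := IH (fun i => p (widen_ord (leqnSn k) i)) (fun i => a (widen_ord (leqnSn k) i)) (fun i => h _).
by rewrite !big_ord_recr /= -c1; apply: top_mul.
Qed.

Lemma low_prod k (p : 'I_k -> {poly K}) (a : 'I_k -> nat) : (forall i j, (j < a i)%N -> (p i)`_j = 0) ->
  (forall j, (j < \sum_(i < k) a i)%N -> (\prod_(i < k) p i)`_j = 0) /\
  (\prod_(i < k) p i)`_(\sum_(i < k) a i)%N = \prod_(i < k) (p i)`_(a i).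
Proof.
elim: k p a => [|k IH] p a h; first by rewrite !big_ord0; split=> //; rewrite coefC.
have [s1 c1] := IH (fun i => p (widen_ord (leqnSn k) i)) (fun i => a (widen_ord (leqnSn k) i)) (fun i => h _).
by rewrite !big_ord_recr /= -c1; apply: low_mul => //; exact: h.
Qed.

End PolyDerivation.

(** * Reduction to an equation without derivatives of coefficients *)

Section RiccatiInvariant.
Variables (K : fieldType) (d : K -> K) (S : K -> Prop) (f A B C : K) (n : nat) (Q : {poly K}).
Hypotheses (dD : forall x y, d (x + y) = d x + d y) (dM : forall x y, d (x * y) = d x * y + x * d y).
Hypothesis char0 : forall i, (i.+1)%:R != 0 :> K.
Hypotheses (SD : forall x y, S x -> S y -> S (x + y)) (SM : forall x y, S x -> S y -> S (x * y)).
Hypothesis Sconst : forall x, d x = 0 -> S x.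
Hypothesis transc : forall p : {poly K}, (forall i, S p`_i) -> p.[f] = 0 -> p = 0.
Implicit Types (p q : {poly K}).

Definition pS p := forall i, S p`_i.

Lemma S0 : S 0. Proof. exact: Sconst (der0 dM). Qed.
Lemma S_nat i : S i%:R. Proof. exact: Sconst (der_nat dD dM i). Qed.

Lemma SN x : S x -> S (- x).
Proof. by rewrite -mulN1r; apply: SM; apply: Sconst; rewrite (derN dD dM) (der1 dM) oppr0. Qed.

Lemma pSC c : S c -> pS c%:P.
Proof. by move=> Sc i; rewrite coefC; case: ifP => // _; exact: S0. Qed.

Lemma pSD p q : pS p -> pS q -> pS (p + q).
Proof. by move=> hp hq i; rewrite coefD; exact: SD. Qed.

Lemma pSN p : pS p -> pS (- p).
Proof. by move=> hp i; rewrite coefN; exact: SN. Qed.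

Lemma pSM p q : pS p -> pS q -> pS (p * q).
Proof. move=> hp hq i; rewrite coefM; apply: big_ind => //; [exact: S0 | by move=> j _; exact: SM]. Qed.

Lemma pSX p i : pS p -> pS (p ^+ i).
Proof.
move=> hp; elim: i => [|i IH]; last by rewrite exprS; exact: pSM.
by rewrite expr0 -polyC1; apply: pSC; exact: (S_nat 1).
Qed.

Lemma pS_deriv p : pS p -> pS p^`().
Proof. by move=> hp i; rewrite coef_deriv -mulr_natr; apply: SM => //; exact: S_nat. Qed.

Lemma pS_nat i : pS i%:R.
Proof. by rewrite -polyC_natr; apply: pSC; exact: S_nat. Qed.

Hypotheses (df : d f = A * f ^+ 2 + B * f + C) (A0 : A != 0) (C0 : C != 0) (n0 : (0 < n)%N).
Hypotheses (pSQ : pS Q) (ode : pD d A B C Q = (n%:R * A) *: 'X * Q) (Q0 : Q`_0 = -1) (Q1 : Q`_1 = 0).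

Local Notation D := (pD d A B C).
Local Notation N := (n%:R : {poly K}).

(** The common multiplier: [D Hs = 2 * e * Hs] and [D Tt = 3 * e * Tt], so it cancels in
    [Tt ^ 2 / Hs ^ 3]. *)
Let e : {poly K} := (N - 2) * A%:P * 'X - B%:P.
(* Viewed as a binary form of degree n, Q has Hessian Hs, and Tt is the Jacobian of Q
   and Hs; hence Tt ^ 2 / Hs ^ 3 is an absolute invariant, constant along the flow. *)
Let Hs := N * Q * Q^`(2) - (N - 1) * Q^`() ^+ 2.
Let Tt := N * Q * Hs^`() - 2 * (N - 2) * Q^`() * Hs.

Let pDN p : D (- p) = - D p.
Proof. by apply/eqP; rewrite -addr_eq0 -(pDD dD dM) addNr -polyC0 (pDC dM) (der0 dM). Qed.

Let pD_nat i : D i%:R = 0.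
Proof. by rewrite -polyC_natr (pDC dM) (der_nat dD dM). Qed.

Let odeQ : D Q = N * A%:P * 'X * Q.
Proof. by rewrite ode -mul_polyC polyCM polyC_natr. Qed.

Let odeQ1 : D Q^`() = N * A%:P * Q + (N - 2) * A%:P * 'X * Q^`() - B%:P * Q^`().
Proof.
have := pD_deriv dD dM A B C Q; rewrite odeQ -mul_polyC polyCM polyC_natr.
have -> : (N * A%:P * 'X * Q)^`() = N * A%:P * Q + N * A%:P * 'X * Q^`().
  by rewrite !derivM -polyC_natr !derivC derivX; ring.
by move=> /esym/(canRL (addrK _)) ->; ring.
Qed.

Let odeQ2 : D Q^`(2) = 2 * (N - 1) * A%:P * Q^`() + (N - 4%:R) * A%:P * 'X * Q^`(2) - 2 * B%:P * Q^`(2).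
Proof.
have := pD_deriv dD dM A B C Q^`(); rewrite odeQ1 -mul_polyC polyCM polyC_natr.
have -> : (N * A%:P * Q + (N - 2) * A%:P * 'X * Q^`() - B%:P * Q^`())^`() =
   N * A%:P * Q^`() + (N - 2) * A%:P * Q^`() + (N - 2) * A%:P * 'X * Q^`(2) - B%:P * Q^`(2).
  rewrite derivB derivD !derivM derivB -!polyC_natr !derivC derivX -[Q^`(2)]/(Q^`()^`()); ring.
by move=> /esym/(canRL (addrK _)) ->; rewrite -[Q^`(2)]/(Q^`()^`()); ring.
Qed.

Let odeH : D Hs = 2 * e * Hs.
Proof.
rewrite /Hs (pDD dD dM) pDN !(pDM dD dM) (pDD dD dM) !pDN !pD_nat.
rewrite -polyC1 (pDC dM) (der1 dM) odeQ odeQ1 odeQ2 /e; ring.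
Qed.

Let odeH1 : D Hs^`() = 2 * (N - 2) * A%:P * Hs + (2 * e - 2 * A%:P * 'X - B%:P) * Hs^`().
Proof.
have := pD_deriv dD dM A B C Hs; rewrite odeH -mul_polyC polyCM polyC_natr.
have -> : (2 * e * Hs)^`() = 2 * (N - 2) * A%:P * Hs + 2 * e * Hs^`().
  rewrite derivM; congr (_ * _ + _).
  rewrite /e derivM derivB !derivM derivB -!polyC_natr !derivC derivX; ring.
by move=> /esym/(canRL (addrK _)) ->; ring.
Qed.

Let odeT : D Tt = 3 * e * Tt.
Proof.
rewrite /Tt (pDD dD dM) pDN !(pDM dD dM) (pDD dD dM) !pDN !pD_nat odeQ odeQ1 odeH odeH1 /e; ring.
Qed.

(** The coefficients are homogeneous: [d Q_j = j * lam * Q_j], where [2 * lam] is the logarithmic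
    derivative of [A / C]. Then the action of [d] on coefficients is [lam * X * Q'] and is absorbed
    into [b = B + lam]. [Q_0], [Q_1] and [Q_2] have the right weight by direct computation; the
    recurrence needs [Q_3] as well, and only the invariant provides it. *)
Lemma riccati_autonomous : exists b, Q^`() * quad A b C = (n%:R * A) *: 'X * Q.
Proof.
have rec j : (j.+2)%:R * C * Q`_j.+2 = (n%:R - j%:R) * A * Q`_j - j.+1%:R * B * Q`_j.+1 - d Q`_j.+1.
  move: (congr1 (fun p => p`_j.+1) ode); rewrite coef_pD // coef_XM /= !mulr1n => h.
  have -> : (n%:R - j%:R) * A * Q`_j = n%:R * A * Q`_j - j%:R * A * Q`_j by ring.
  by rewrite -h; ring.
have two := char0 1; have three := char0 2.
have nn : n%:R != 0 :> K by rewrite -(prednK n0) char0.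
have [x xE] : exists x, A = x * C by exists (A / C); rewrite mulfVK.
have x0 : x != 0 by apply: contraNneq A0 => z; rewrite xE z mul0r.
have [lam dx] : exists lam, d x = 2 * lam * x.
  by exists (d x / (2 * x)); field; rewrite two x0.
have q2 : 2 * Q`_2 = - n%:R * x.
  apply: (mulIf C0); have := rec 0%N; rewrite Q1 Q0 (der0 dM) subr0 mulr0 subr0.
  by rewrite xE mulrAC => ->; ring.
have q20 : Q`_2 != 0.
  apply/eqP => z; move: q2; rewrite z mulr0 => /esym/eqP; rewrite mulf_eq0 oppr_eq0.
  by rewrite (negPf nn) (negPf x0).
have dq2 : d Q`_2 = 2 * lam * Q`_2.
  apply: (mulfI two); have : d (2 * Q`_2) = d (- n%:R * x) by rewrite q2.
  rewrite !dM (derN dD dM) !(der_nat dD dM) dx oppr0 !mul0r !add0r => ->.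
  have -> : 2 * (2 * lam * Q`_2) = 2 * lam * (2 * Q`_2) by ring.
  by rewrite q2; ring.
(* At [X = 0] the invariant compares [Q_3 ^ 2] with [Q_2 ^ 3], so its constancy passes the weight
   from [Q_2] on to [Q_3]. *)
have dq3 : d Q`_3 = 3 * lam * Q`_3.
  have H0 : Hs`_0 = - (2 * n%:R * Q`_2).
    rewrite -horner_coef0 /Hs -[Q^`(2)]/(Q^`()^`()) -polyC1 -!polyC_natr.
    rewrite !(hornerD, hornerN, hornerM, horner_exp, hornerC) !horner_coef0 !coef_deriv Q0 Q1; ring.
  have T0 : Tt`_0 = 6 * n%:R ^+ 2 * Q`_3.
    have H1 : Hs^`().[0] = - (6 * n%:R * Q`_3).
      rewrite /Hs -[Q^`(2)]/(Q^`()^`()) -polyC1 -!polyC_natr derivB !derivM derivB !derivC.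
      rewrite !(hornerD, hornerN, hornerM, horner_exp, hornerC) !horner_coef0 !coef_deriv Q0 Q1; ring.
    rewrite -horner_coef0 /Tt; move: (Hs^`()) (Hs) H1 => h1 h2 H1.
    rewrite -!polyC_natr !(hornerD, hornerN, hornerM, hornerC) H1.
    by rewrite !horner_coef0 Q0 coef_deriv Q1; ring.
  have pSH : pS Hs.
    have h1 := pS_deriv pSQ; have h2 := pS_deriv h1.
    apply: pSD; first by apply: pSM => //; apply: pSM => //; exact: pS_nat.
    apply: pSN; apply: pSM; last exact: pSX.
    by apply: pSD; [exact: pS_nat | apply: pSN; exact: (pS_nat 1)].
  have pST : pS Tt.
    apply: pSD; first by apply: pSM; [apply: pSM => //; exact: pS_nat | exact: pS_deriv].
    apply: pSN; apply: pSM => //; apply: pSM; last exact: pS_deriv.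
    apply: pSM; first exact: pS_nat.
    by apply: pSD; [exact: pS_nat | apply: pSN; exact: pS_nat].
  have Hn : Hs != 0.
    apply/eqP => z; move: H0; rewrite z coef0 => /esym/eqP; rewrite oppr_eq0 !mulf_eq0.
    by rewrite (negPf two) (negPf nn) (negPf q20).
  have Hf : Hs.[f] != 0 by apply: contraNN Hn => /eqP /(transc pSH) ->.
  have dT : d Tt.[f] = 3 * e.[f] * Tt.[f].
    by rewrite -(pD_eval dD dM Tt df) odeT !hornerM -polyC_natr hornerC.
  have dH : d Hs.[f] = 2 * e.[f] * Hs.[f].
    by rewrite -(pD_eval dD dM Hs df) odeH !hornerM -polyC_natr hornerC.
  have [c cE dc] : exists2 c, Tt.[f] ^+ 2 = c * Hs.[f] ^+ 3 & d c = 0.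
    exists (Tt.[f] ^+ 2 * (Hs.[f] ^+ 3)^-1); first by rewrite mulfVK // expf_neq0.
    rewrite dM (derV dM) ?expf_neq0 // !(derX dM) /= dT dH; field; exact: Hf.
  (* The relation holds at [f] and has coefficients in [S], hence holds between polynomials by
     transcendence. *)
  have : Tt ^+ 2 - c%:P * Hs ^+ 3 = 0.
    apply: transc; last by move: (Tt) (Hs) cE => t h cE; rewrite hornerD hornerN horner_exp (hornerM c%:P) horner_exp hornerC cE subrr.
    apply: pSD; first exact: pSX.
    by apply: pSN; apply: pSM; [apply: pSC; exact: Sconst | exact: pSX].
  move: (Tt) (Hs) H0 T0 => t h H0 T0.
  move=> /(congr1 (fun p => p.[0])) /eqP; rewrite hornerD hornerN horner_exp (hornerM c%:P) horner_exp hornerC horner0.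
  rewrite !horner_coef0 H0 T0 subr_eq0 => /eqP rel.
  have : d ((6 * n%:R ^+ 2 * Q`_3) ^+ 2) = d (c * (- (2 * n%:R * Q`_2)) ^+ 3) by rewrite rel.
  rewrite !(dM, derX dM, derN dD dM) !(der_nat dD dM) dc dq2 /= => dr.
  have : 72%:R * n%:R ^+ 4 * (Q`_3 * (d Q`_3 - 3 * lam * Q`_3)) = 0.
    transitivity (d ((6 * n%:R ^+ 2 * Q`_3) ^+ 2) - 6 * lam * (6 * n%:R ^+ 2 * Q`_3) ^+ 2).
      by rewrite !(dM, derX dM, derN dD dM) !(der_nat dD dM) /=; ring.
    by rewrite !(dM, derX dM, derN dD dM) !(der_nat dD dM) /= dr rel; ring.
  have nz : 72%:R * n%:R ^+ 4 != 0 :> K by apply: mulf_neq0 (char0 71) (expf_neq0 4 nn).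
  move=> /eqP; rewrite mulf_eq0 (negPf nz) /= mulf_eq0.
  case/orP => [/eqP -> |]; first by rewrite (der0 dM) mulr0.
  by rewrite subr_eq0 => /eqP.
(* With [A = x * C] and [B = y * C - lam] the recurrence has coefficients [x] of weight 2 and [y] of
   weight 1. The weight of [y] is read off from [Q_3]. *)
have [y yE] : exists y, B = y * C - lam by exists ((B + lam) / C); rewrite mulfVK // addrK.
have q3 : 3 * Q`_3 = - 2 * y * Q`_2.
  apply: (mulIf C0); have := rec 1%N; rewrite Q1 dq2 mulr0 sub0r mulrAC => ->.
  by rewrite yE; ring.
have dy : d y = lam * y.
  have : d (3 * Q`_3) = d (- 2 * y * Q`_2) by rewrite q3.
  rewrite !dM dq2 dq3 (derN dD dM) !(der_nat dD dM) oppr0 !mul0r !add0r => h.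
  have {}h : 2 * Q`_2 * (d y - lam * y) = 0.
    have -> : 2 * Q`_2 * (d y - lam * y) =
      3 * lam * (- 2 * y * Q`_2) - (- 2 * d y * Q`_2 + - 2 * y * (2 * lam * Q`_2)) by ring.
    by rewrite -q3 -h; ring.
  move/eqP: h; rewrite !mulf_eq0 (negPf two) (negPf q20) /= subr_eq0 => /eqP //.
have all j : d Q`_j = j%:R * lam * Q`_j /\ d Q`_j.+1 = j.+1%:R * lam * Q`_j.+1.
  elim: j => [|j [h1 h2]]; first by rewrite Q0 Q1 (derN dD dM) (der1 dM) (der0 dM) mulr0 !mul0r oppr0.
  split=> //; have r : j.+2%:R * Q`_j.+2 = (n%:R - j%:R) * x * Q`_j - j.+1%:R * y * Q`_j.+1.
    apply: (mulIf C0); rewrite mulrAC rec h2 xE yE; ring.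
  have lin a u v : d a = 0 -> d (a * u * v) = a * (d u * v + u * d v).
    by move=> a0; rewrite dM (dM a) a0; ring.
  have da : d (n%:R - j%:R) = 0 by rewrite dD (derN dD dM) !(der_nat dD dM) subr0.
  apply: (mulfI (char0 j.+1)); have := congr1 d r.
  rewrite dM (der_nat dD dM) mul0r add0r => ->.
  rewrite (dD _ (- _)) (derN dD dM) !lin ?(der_nat dD dM) // h1 h2 dx dy.
  transitivity (j.+2%:R * lam * (j.+2%:R * Q`_j.+2)); last by ring.
  by rewrite r; ring.
exists (B + lam); rewrite -ode /pD; apply/polyP => j; rewrite coefD !coef_quad.
rewrite coef_map_id0 ?(der0 dM) // (all j).1; ring.
Qed.

End RiccatiInvariant.

(** * Small functions *)

Section SmallFunctions.
Variable R : realType.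
Local Notation C := (CC R).
Local Notation M := (mer R).
Implicit Types (F G g : M) (r k eps : R) (u v : R -> R) (P Q : R -> Prop).

Lemma good2 P Q (W : R -> Prop) : good P -> good Q -> (forall r, P r -> Q r -> W r) -> good W.
Proof. by move=> p q h; apply: goodS (goodI p q) => r [pr qr]; exact: h. Qed.

Lemma reg0 r : reg r (0 : M).
Proof. by move=> z _; exact: vge0. Qed.

Lemma good_reg F : good (fun r => reg r F).
Proof.
have [->|F0] := eqVneq F 0; first by apply: goodS (good_gt 0) => r _; exact: reg0.
by apply: goodS (good_gen F0) => r; exact: gen_reg.
Qed.

Lemma mm0 r : 0 <= r -> mm r (0 : M) = 0.
Proof.
move=> r0; apply/eqP; rewrite eq_le mm_ge0 andbT.
by have := @mm_cst R r 0 r0; rewrite modC0 /logp ler01.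
Qed.

Lemma good_mmM F G : good (fun r => mm r (F * G) <= mm r F + mm r G).
Proof.
apply: good2 (good_gt 0) (goodI (good_reg F) (good_reg G)) _ => r r0 [rF rG].
exact: mmM (ltW r0) rF rG.
Qed.

Lemma good_mmD F G : good (fun r => mm r (F + G) <= mm r F + mm r G + ln 2).
Proof.
apply: good2 (good_gt 0) (goodI (good_reg F) (good_reg G)) _ => r r0 [rF rG].
exact: mmD (ltW r0) rF rG.
Qed.

Lemma good_TM F G : good (fun r => T r (F * G) <= T r F + T r G).
Proof.
apply: good2 (good_gt 1) (goodI (good_reg F) (good_reg G)) _ => r r0 [rF rG].
exact: T_M (ltW r0) rF rG.
Qed.

Lemma good_TD F G : good (fun r => T r (F + G) <= T r F + T r G + ln 2).
Proof.
apply: good2 (good_gt 1) (goodI (good_reg F) (good_reg G)) _ => r r0 [rF rG].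
exact: T_D (ltW r0) rF rG.
Qed.

Lemma good_TV F : F != 0 -> good (fun r => T r F^-1 = T r F - lnlc F).
Proof. by move=> F0; apply: good2 (good_gt 0) (good_gen F0) _ => r r0 rF; exact: T_inv. Qed.

Lemma Nc_pol_ge0 r F : 1 <= r -> 0 <= Nc r (pol F).
Proof. by move=> r1; apply: Nc_ge0 r1 _ => a; exact: pol_ge0. Qed.

Lemma Nc_pol_le r F : Nc r (pol F) <= T r F.
Proof. by rewrite /T lerDr mm_ge0. Qed.

Lemma good_Tder F : good (fun r => T r (derm F) <= 2 * T r F + mm r (dlog F)).
Proof.
have [->|F0] := eqVneq F 0.
  rewrite derm0; apply: goodS (good_gt 1) => r r1.
  have t0 := T_ge0 (0 : M) (ltW r1); have m0 := mm_ge0 r (dlog (0 : M)); clear r1; lra.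
have dE : derm F = F * dlog F by rewrite /dlog mulrC mulfVK.
apply: good2 (good_gt 1) (good_mmM F (dlog F)) _ => r r1; rewrite -dE => h.
have hN : Nc r (pol (derm F)) <= 2 * Nc r (pol F).
  rewrite -NcZ; apply: (Nc_le (ltW r1) (locfin_pol (derm F)) (locfinZ 2 (locfin_pol F))) => a _.
  rewrite /pol -natrM ler_nat mul2n -addnn; apply: leq_trans (poln_der a F) _.
  by rewrite leq_add2l; case: (poln a F).
have m0 := mm_ge0 r F; rewrite /T; move: (mm r (derm F)) (Nc r (pol (derm F))) (Nc r (pol F)) (mm r F) (mm r (dlog F)) h hN m0; clear; move=> *; lra.
Qed.

Lemma ln_lin (x eps : R) : 0 < x -> 0 < eps -> ln x <= eps * x - ln eps.
Proof.
move=> x0 e0; have := @le_ln1Dx R (eps * x - 1); rewrite [1 + _]addrC subrK.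
rewrite lnM ?posrE // => h.
have : ln eps + ln x <= eps * x - 1 by apply: h; have := mulr_gt0 e0 x0; lra.
lra.
Qed.

Variable f : M.
Hypothesis htr : forall k, good (fun r => k * ln r <= T r f).

(** The one-sided error class of functions at most [o(T r f)]. The exceptional set may depend on
    [eps], so this is weaker than what [small_function] grants with a single set. *)
Definition err u := forall eps, 0 < eps -> good (fun r => u r <= eps * T r f).
Definition small g := err (fun r => T r g).
Definition big g := exists2 k, 0 <= k & good (fun r => T r g <= k * T r f).

Lemma err_le u v : good (fun r => u r <= v r) -> err v -> err u.
Proof.
by move=> h ev eps e0; apply: good2 h (ev _ e0) _ => r; exact: le_trans.
Qed.

Lemma errD u v : err u -> err v -> err (fun r => u r + v r).
Proof.
move=> eu ev eps e0; have e2 : 0 < eps / 2 by rewrite divr_gt0.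
apply: good2 (eu _ e2) (ev _ e2) _ => r h1 h2; clear -h1 h2; lra.
Qed.

Lemma errZ k u : 0 <= k -> err u -> err (fun r => k * u r).
Proof.
rewrite le_eqVlt => /predU1P[<- eu|k0 eu] eps e0.
  apply: good2 (good_gt 1) (good_gt 0) _ => r r1 _; rewrite mul0r.
  by apply: mulr_ge0; [exact: ltW | exact: T_ge0 f (ltW r1)].
apply: goodS (eu (eps / k) (divr_gt0 e0 k0)) => r h.
by rewrite -ler_pdivlMl // mulrA [_^-1 * _]mulrC.
Qed.

Lemma err_ln : err (@ln R).
Proof.
move=> eps e0; apply: goodS (htr eps^-1) => r h.
by rewrite -ler_pdivrMl.
Qed.

Lemma err_cst k : err (fun=> k).
Proof.
apply: err_le err_ln; apply: goodS (good_gt (expR k)) => r h.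
rewrite -ler_expR lnK ?ltW // posrE; exact: lt_trans (expR_gt0 k) h.
Qed.

Lemma not_err_T : ~ err (fun r => T r f).
Proof.
move=> e; have h2 : 0 < 2^-1 :> R by rewrite invr_gt0.
have [r [[h /= l] r1]] := good_ex (goodI (goodI (e _ h2) (htr 1)) (good_gt 1)).
have : 0 < ln r by exact: ln_gt0.
by clear -h l; lra.
Qed.

(** [log_derivative] leaves [ln (r + T r g)]. Its part [ln r] is negligible by [htr], and
    [ln (1 + T r g)] by a tangent line of small slope. *)
Lemma big_dlog g : big g -> err (fun r => mm r (dlog g)).
Proof.
move=> [k k0 hk].
have [->|g0] := eqVneq g 0.
  apply: err_le (err_cst 0); apply: goodS (good_gt 0) => r r0.
  by rewrite /dlog derm0 mul0r mm0 // ltW.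
have [D hD] := log_derivative g0; move=> eps e0.
(* The slope is chosen so that [7 * de * k <= eps / 2]. *)
pose de := eps / 2 / (7 * (k + 1)).
have k1 : 0 < 7 * (k + 1) by clear -k0; lra.
have de0 : 0 < de by rewrite !divr_gt0.
have e2 : 0 < eps / 2 by rewrite divr_gt0.
have : err (fun r => 7 * ln r + (D + 7 * (de - ln de))).
  by apply: errD; [apply: errZ => //; exact: err_ln | exact: err_cst].
move=> /(_ _ e2) he.
apply: good2 (goodI (good_gt 1) he) (goodI hD hk) _ => r [r1 hr] [h1 h2].
apply: le_trans h1 _.
have t0 := T_ge0 g (ltW r1); have tf0 := T_ge0 f (ltW r1).
have r0 : 0 < r by exact: lt_trans r1.
have t1 : 0 < 1 + T r g by clear -t0; lra.
have l1 : ln (r + T r g) <= ln r + ln (1 + T r g).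
  rewrite -lnM ?posrE // ler_ln ?posrE; last exact: mulr_gt0.
    rewrite mulrDr mulr1 lerD2l; apply: ler_peMl => //; exact: ltW.
  by apply: ltr_pwDl.
have l2 := ln_lin t1 de0.
have l3 : 7 * (de * T r g) <= eps / 2 * T r f.
  have : 7 * (de * T r g) <= 7 * (de * (k * T r f)).
    by rewrite ler_pM2l // ler_pM2l.
  move=> /le_trans; apply.
  have -> : 7 * (de * (k * T r f)) = eps / 2 * (k / (k + 1)) * T r f.
    by rewrite /de; field; apply/eqP; clear -k0; lra.
  apply: ler_wpM2r => //; rewrite ger_pMr // ler_pdivrMr; clear -k0; lra.
clear -l1 l2 l3 hr; lra.
Qed.

Lemma small_big g : small g -> big g.
Proof. by move=> s; exists 1 => //; exact: s. Qed.

Lemma big_f : big f.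
Proof. by exists 1 => //; apply: goodS (good_gt 0) => r _; rewrite mul1r. Qed.

Lemma bigM F G : big F -> big G -> big (F * G).
Proof.
move=> [k k0 hk] [k' k'0 hk']; exists (k + k'); first exact: addr_ge0.
apply: good2 (good_TM F G) (goodI hk hk') _ => r h [h1 h2]; clear -h h1 h2; lra.
Qed.

Lemma bigD F G : big F -> big G -> big (F + G).
Proof.
move=> [k k0 hk] [k' k'0 hk']; exists (k + k' + 1); first by rewrite !addr_ge0.
have e := err_cst (ln 2) ltr01.
apply: good2 (goodI (good_TD F G) e) (goodI hk hk') _ => r [h0 h] [h1 h2]; clear -h0 h h1 h2; lra.
Qed.

Lemma big_der F : big F -> big (derm F).
Proof.
move=> bF; have e := big_dlog bF ltr01; move: bF => [k k0 hk].
exists (2 * k + 1); first by rewrite addr_ge0 // mulr_ge0.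
apply: good2 (goodI (good_Tder F) e) hk _ => r [h0 h] h1; clear -h0 h h1; lra.
Qed.

Lemma smallM F G : small F -> small G -> small (F * G).
Proof. by move=> sF sG; apply: err_le (good_TM F G) (errD sF sG). Qed.

Lemma smallD F G : small F -> small G -> small (F + G).
Proof.
by move=> sF sG; apply: err_le (good_TD F G) (errD (errD sF sG) (err_cst _)).
Qed.

Lemma Tcst r c : 0 <= r -> T r (cstm c) <= logp (modC c).
Proof.
move=> r0; rewrite /T (_ : Nc r _ = 0) ?addr0; first exact: mm_cst.
rewrite (@NcE _ _ _ [::]) ?big_nil // => a _ _; rewrite /pol.
by have /poln0 /eqP -> := vge_cst a c.
Qed.

Lemma small_cst c : small (cstm c).
Proof.
apply: err_le (err_cst (logp (modC c))); apply: goodS (good_gt 0) => r r0.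
exact: Tcst (ltW r0).
Qed.

Lemma small0 : small 0. Proof. exact: small_cst. Qed.
Lemma small1 : small 1. Proof. exact: small_cst. Qed.
Lemma small_nat n : small n%:R. Proof. by rewrite -cstm_nat; exact: small_cst. Qed.

Lemma smallN F : small F -> small (- F).
Proof. by move=> sF; rewrite -mulN1r cstmN1; apply: smallM => //; exact: small_cst. Qed.

Lemma smallB F G : small F -> small G -> small (F - G).
Proof. by move=> sF sG; apply: smallD => //; exact: smallN. Qed.

Lemma smallV F : small F -> small F^-1.
Proof.
have [->|F0] := eqVneq F 0; first by rewrite invr0.
move=> sF; apply: err_le (errD sF (err_cst (- lnlc F))).
by apply: goodS (good_TV F0) => r ->.
Qed.

Lemma smallX F n : small F -> small (F ^+ n).
Proof.
by move=> sF; elim: n => [|n IH]; [exact: small1 | rewrite exprS; exact: smallM].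
Qed.

Lemma small_der F : small F -> small (derm F).
Proof.
move=> sF; apply: err_le (good_Tder F) (errD (errZ _ sF) (big_dlog (small_big sF))).
exact: ler0n.
Qed.

Lemma small_dlog F : small F -> small (dlog F).
Proof. by move=> sF; apply: smallM; [exact: small_der | exact: smallV]. Qed.

Lemma bigX F n : big F -> big (F ^+ n).
Proof.
by move=> bF; elim: n => [|n IH]; [exact: small_big small1 | rewrite exprS; exact: bigM].
Qed.

Lemma big_iter_der F n : big F -> big (iter n (@derm R) F).
Proof. by move=> bF; elim: n => [//|n ih]; rewrite iterS; apply: big_der. Qed.

Lemma small_pol g : small g -> err (fun r => Nc r (pol g)).
Proof.
move=> sg; apply: err_le sg; apply: goodS (good_gt 1) => r _; exact: Nc_pol_le.
Qed.

Lemma small_zer g : small g -> err (fun r => Nc r (zer g)).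
Proof. by move=> sg; exact: small_pol (smallV sg). Qed.

Lemma small_mm g : small g -> err (fun r => mm r g).
Proof.
move=> sg; apply: err_le sg; apply: goodS (good_gt 1) => r r1.
by rewrite /T lerDl; exact: Nc_pol_ge0 (ltW r1).
Qed.

Lemma T_poly (p : {poly M}) n : (forall i, small p`_i) -> (size p <= n.+1)%N ->
  exists2 u, err u & good (fun r => T r p.[f] <= n%:R * T r f + u r).
Proof.
elim: n p => [|n IH] p sp szp.
  rewrite (size1_polyC szp) hornerC; exists (fun r => T r p`_0); first exact: sp.
  by apply: goodS (good_gt 0) => r _; rewrite mul0r add0r.
pose q := \poly_(i < n.+1) p`_i.+1.
have pE : p = q * 'X + (p`_0)%:P.
  apply/polyP => -[|i]; rewrite coefD coefMX coefC /= ?add0r // addr0 coef_poly.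
  by case: ltnP => // h; rewrite nth_default // (leq_trans szp).
have [u eu hu] : exists2 u, err u & good (fun r => T r q.[f] <= n%:R * T r f + u r).
  apply: IH; last exact: size_poly.
  by move=> i; rewrite coef_poly; case: ifP => _; [exact: sp | exact: small0].
exists (fun r => u r + T r p`_0 + ln 2); first by apply: errD (errD eu (sp 0%N)) (err_cst _).
have qE : p.[f] = q.[f] * f + p`_0 by rewrite {1}pE !hornerE.
rewrite qE; apply: good2 hu (goodI (good_TD (q.[f] * f) p`_0) (good_TM q.[f] f)) _ => r h0 [h1 h2].
rewrite -natr1; move: (T r (q.[f] * f + p`_0)) (T r (q.[f] * f)) (T r q.[f]) (T r p`_0) (T r f) (u r) h0 h1 h2.
by clear; move=> *; lra.
Qed.

Lemma poln_exp a F n : poln a (F ^+ n) = (n * poln a F)%N.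
Proof.
have [->|F0] := eqVneq F 0.
  case: n => [|n]; first by rewrite expr0 mul0n; apply/eqP/poln0; exact: vge1_0.
  by rewrite expr0n (_ : poln a 0 = 0%N) ?muln0 //; apply/eqP/poln0; exact: vge0.
rewrite /poln ordX //; have [h|h] := leP 0 (ord a F).
  by rewrite !min_l ?muln0 // mulrn_wge0.
by rewrite !min_r ?mulrn_wle0 ?(ltW h) // -mulr_natl abszM natz.
Qed.

Lemma mm_exp r F n : 0 <= r -> reg r F -> mm r (F ^+ n) = n%:R * mm r F.
Proof.
move=> r0 rF; rewrite /mm -rmeanZ //; last exact: reg_cont.
apply: eq_rmean => // z zr; rewrite evX ?modCX; last exact: rF.
elim: n => [|n IH]; first by rewrite expr0 mul0r /logp lexx.
move: (modC (F z)) (modC_ge0 (F z)) IH => x x0; rewrite !logpE => IH.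
have [x1|] := boolP (x <= 1); last rewrite -ltNge => x1.
  by rewrite max_l ?exprn_ile1 // max_l // ln1 mulr0.
have x1' := ltW x1; have xp : 0 < x by exact: lt_trans x1.
by rewrite !max_r ?exprn_ege1 // lnXn // mulr_natl.
Qed.

Lemma T_exp r F n : 0 <= r -> reg r F -> T r (F ^+ n) = n%:R * T r F.
Proof.
move=> r0 rF; rewrite /T mm_exp // mulrDr -NcZ; congr (_ + Nc _ _).
by apply/funext => a; rewrite /pol poln_exp natrM.
Qed.

(** A relation of degree [n.+1] writes [f ^+ n.+1] as a polynomial of degree [n] in [f]. Comparing
    characteristics, [(n + 1) T <= n T + o(T)], which is impossible. *)
Lemma transcendence (p : {poly M}) : (forall i, small p`_i) -> p.[f] = 0 -> p = 0.
Proof.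
move=> sp pf; apply/eqP/negPn/negP => p0.
have [n sz] : exists n, size p = n.+1.
  by exists (size p).-1; rewrite prednK // lt0n size_poly_eq0.
have pn : p`_n != 0 by move: p0; rewrite -lead_coef_eq0 lead_coefE sz.
case: n sz pn => [|n] sz pn.
  by move: pf; rewrite (size1_polyC (_ : (size p <= 1)%N)) ?sz // hornerC => /eqP; rewrite (negPf pn).
pose q := \poly_(i < n.+1) (- (p`_i / p`_n.+1)).
have [u eu hu] : exists2 u, err u & good (fun r => T r q.[f] <= n%:R * T r f + u r).
  apply: T_poly; last exact: size_poly.
  move=> i; rewrite coef_poly; case: ifP => _; last exact: small0.
  by apply: smallN; apply: smallM => //; exact: smallV.
have fE : f ^+ n.+1 = q.[f].
  move: pf; rewrite horner_coef sz big_ord_recr /= => /eqP.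
  rewrite addrC addr_eq0 => /eqP h; apply: (mulfI pn); rewrite h horner_poly mulr_sumr -sumrN.
  by apply: eq_bigr => i _; field.
apply: not_err_T; apply: err_le eu.
apply: good2 (good_gt 0) (goodI (good_reg f) hu) _ => r r0 [rf].
rewrite -fE (T_exp n.+1 (ltW r0) rf) -natr1; move: (T r f) (u r); clear; move=> *; lra.
Qed.

End SmallFunctions.

(** * The main inequality *)

Section LocalOrders.
Variable R : realType.
Local Notation C := (CC R).
Local Notation M := (mer R).
Implicit Types (F G H : M) (a : C).

Lemma ord_poln a F : ord a F = (poln a F^-1)%:Z - (poln a F)%:Z.
Proof. by rewrite /poln ordVE; lia. Qed.

Lemma poln_or a F : poln a F = 0%N \/ poln a F^-1 = 0%N.
Proof. by rewrite /poln ordVE; lia. Qed.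

Lemma vge_ord a F : vge a (ord a F) F.
Proof.
have [->|F0] := eqVneq F 0; first exact: vge0.
by apply/vgeP.
Qed.

Lemma vge_prod a k (G : 'I_k -> M) (e : 'I_k -> int) : (forall i, vge a (e i) (G i)) ->
  vge a (\sum_(i < k) e i) (\prod_(i < k) G i).
Proof.
move=> h; elim: k G e h => [|k IH] G e h; first by rewrite !big_ord0; exact: vge1_0.
by rewrite !big_ord_recr /=; apply: vgeM => //; exact: IH.
Qed.

Lemma ord_prod a k (G : 'I_k -> M) : (forall i, G i != 0) ->
  ord a (\prod_(i < k) G i) = \sum_(i < k) ord a (G i).
Proof.
elim: k G => [|k IH] G h; first by rewrite !big_ord0 ord1.
rewrite !big_ord_recr /= ordM ?IH //.
by apply/prodf_neq0 => i _.
Qed.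

Lemma vge_iter_der0 a F n : vge a 0 F -> vge a 0 (iter n (@derm R) F).
Proof. by move=> h; elim: n => //= n; exact: vge_der0. Qed.

Lemma vge_iter_der a F n (e : int) : vge a e F -> vge a (e - n%:Z) (iter n (@derm R) F).
Proof.
move=> h; elim: n => [|n IH] /=; first by rewrite subr0.
by have := vge_der IH; apply: vgeW; lia.
Qed.

Lemma ord_iter_der a F n : F != 0 -> ord a F < 0 ->
  iter n (@derm R) F != 0 /\ ord a (iter n (@derm R) F) = ord a F - n%:Z.
Proof.
move=> F0 oF; elim: n => [|n [n0 IH]] /=; first by rewrite subr0.
have nz : ord a (iter n (@derm R) F) != 0 by lia.
by have [d0 ->] := ord_der n0 nz; split=> //; lia.
Qed.

Lemma ord_dlog_ge a F : F != 0 -> dlog F != 0 -> (-1 <= ord a (dlog F)) /\ (ord a F = 0 -> 0 <= ord a (dlog F)).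
Proof.
move=> F0 dF; have d0 : derm F != 0 by apply: contraNneq dF => d0; rewrite /dlog d0 mul0r.
rewrite {1 2}/dlog ordM ?invr_eq0 // ordV //; split.
  by have := vge_der (vge_ord a F); move=> /(vgeP _ _ d0); lia.
move=> o0; rewrite o0 subr0; apply/(vgeP _ _ d0); apply: vge_der0; rewrite -o0; exact: vge_ord.
Qed.

Lemma ord_sub1 a G (e : int) : 0 < e -> vge a e G -> ord a (G - 1) = 0 /\ G - 1 != 0.
Proof.
move=> e0 vG; have v0 : vge a 0 G by apply: vgeW vG; lia.
have v1 : vge a 1 G by apply: vgeW vG; lia.
have g0 : G a = 0 by apply/(vge1P v0).
have ev : (G - 1) a = -1 by rewrite evB ?g0 ?sub0r; [rewrite (ev_nat a 1) | | exact: vge1_0].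
have n0 : G - 1 != 0.
  apply/eqP => z; move: ev; rewrite z cstm_pt => /eqP.
  by rewrite eq_sym oppr_eq0 oner_eq0.
split=> //; apply: ord_eq0 => //; first by apply: vgeB => //; exact: vge1_0.
by rewrite ev oppr_eq0 oner_eq0.
Qed.

Lemma ord_dlog_sub1 a G (e : int) : 0 < e -> vge a e G -> dlog (G - 1) != 0 ->
  e - 1 <= ord a (dlog (G - 1)).
Proof.
move=> e0 vG; have [oz n0] := ord_sub1 e0 vG.
have dE : derm (G - 1) = derm G by rewrite dermB derm1 subr0.
rewrite /dlog dE => nz; have d0 : derm G != 0 by apply: contraNneq nz => ->; rewrite mul0r.
rewrite (ordM _ d0 (invr_neq0 n0)) (ordV _ n0) oz subr0; apply/(vgeP _ _ d0).
exact: vge_der vG.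
Qed.

Section DiffMonomial.
Variables (f Om : M) (k l0 : nat) (l m : 'I_k -> nat).
Hypotheses (f0 : f != 0) (Om0 : Om != 0) (ml : forall i, (m i <= l i)%N).

Definition pdm : M := f ^+ l0 * \prod_(i < k) iter (m i) (@derm R) (f ^+ l i).
Local Notation d := (l0 + \sum_(i < k) l i)%N.
Local Notation m' := (\sum_(i < k) m i)%N.

Lemma pdm_zero a (p : nat) : vge a p%:Z f -> vge a ((p * d)%N%:Z - m'%:Z) pdm.
Proof.
move=> vp; have X n : vge a (p * n)%N%:Z (f ^+ n).
  by have := vgeX n vp; rewrite -mulr_natr natz -PoszM.
have := vgeM (X l0) (vge_prod (fun i => vge_iter_der (m i) (X (l i)))).
rewrite sumrB -!(big_morph Posz PoszD (erefl _)); apply: vgeW.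
by rewrite mulnDr big_distrr /=; clear; lia.
Qed.

Lemma pdm_reg a : vge a 0 f -> vge a 0 pdm.
Proof.
move=> v0; have X n : vge a 0 (f ^+ n) by have := vgeX n v0; rewrite mul0rn.
have := vgeM (X l0) (vge_prod (fun i => vge_iter_der0 (m i) (X (l i)))).
by rewrite big1 // addr0.
Qed.

(** The order is exact here: in characteristic 0 a derivation lowers a negative order by exactly
    one, so no cancellation occurs. *)
Lemma pdm_pole a : (0 < poln a f)%N ->
  (forall i, iter (m i) (@derm R) (f ^+ l i) != 0) /\ ord a pdm = - (poln a f * d + m')%N%:Z.
Proof.
move=> q0; have of_ : ord a f = - (poln a f)%:Z by have := ord_poln a f; have := poln_or a f; clear -q0; lia.
have fac i : iter (m i) (@derm R) (f ^+ l i) != 0 /\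
    ord a (iter (m i) (@derm R) (f ^+ l i)) = - (poln a f * l i + m i)%N%:Z.
  have Xn : f ^+ l i != 0 by rewrite expf_neq0.
  (* When [l i = 0], the inequality [m i <= l i] ensures that the constant 1 is not
     differentiated. *)
  have [li|li] := posnP (l i).
    have mi : m i = 0%N by apply/eqP; rewrite -leqn0 -li.
    by rewrite mi li /= expr0 ord1 oner_neq0 muln0.
  have oX : ord a (f ^+ l i) = - (poln a f * l i)%N%:Z.
    by rewrite ordX // of_ mulNrn -mulr_natr natz -PoszM.
  have [|n0 ->] := ord_iter_der (m i) Xn (a := a); first by rewrite oX; clear -q0 li; nia.
  by split=> //; rewrite oX; clear; lia.
split=> [i|]; first exact: (fac i).1.
rewrite /pdm ordM ?expf_neq0 //; last by apply/prodf_neq0 => i _; exact: (fac i).1.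
rewrite ord_prod => [|i]; last exact: (fac i).1.
rewrite (eq_bigr (fun i => - (poln a f * l i + m i)%N%:Z)); last by move=> i _; exact: (fac i).2.
rewrite sumrN -(big_morph Posz PoszD (erefl _)) big_split /= -big_distrr /=.
by rewrite ordX // of_ mulNrn -mulr_natr natz -PoszM mulnDr; clear; lia.
Qed.

Local Notation h := (pdm / Om - 1).
Local Notation aa := (dlog h).
Hypotheses (h0 : h != 0) (aa0 : aa != 0).

Lemma ord_aa_zero a : ord a Om < (poln a f^-1 * d)%N%:Z - m'%:Z -> (0 < poln a f^-1)%N ->
  (poln a f^-1 * d)%N%:Z - m'%:Z - ord a Om - 1 <= ord a aa.
Proof.
move=> lt p0; have vf : vge a (poln a f^-1)%:Z f.
  by have := vge_ord a f; apply: vgeW; have := ord_poln a f; have := poln_or a f; lia.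
apply: ord_dlog_sub1 => //; first by lia.
by apply: vgeM; [exact: pdm_zero | rewrite -ordV //; exact: vge_ord].
Qed.

Lemma ord_aa_reg a : poln a f = 0%N -> ord a Om = 0 -> ord a (pdm - Om) <= 0 -> 0 <= ord a aa.
Proof.
move=> q0 w0 le; apply: (ord_dlog_ge a h0 aa0).2.
have hE : h = (pdm - Om) / Om by rewrite mulrBl divff.
have n0 : pdm - Om != 0 by apply: contraNneq h0 => z; rewrite hE z mul0r.
rewrite hE ordM ?invr_eq0 // ordV // w0 subr0; apply/eqP; rewrite eq_le le /=.
apply/(vgeP _ _ n0); apply: vgeB; first by apply: pdm_reg; apply/poln0/eqP.
by rewrite -w0; exact: vge_ord.
Qed.

(** The main inequality point by point. At a zero of [f] of order [p], [h' / h] vanishes to order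
    about [p * d - m' - 1], so only [m' + 1] of [p * d] survives. Elsewhere [h' / h] has at worst a
    simple pole, charged to a pole of [f], to [Om], or to a zero of [P - Om]. *)
Lemma aa_bound a : (poln a f^-1 * d)%N%:Z - ord a aa <= (0 < poln a f)%N%:Z +
  (m'.+1 * (0 < poln a f^-1))%N%:Z + (poln a Om + poln a Om^-1)%N%:Z + (0 < ord a (pdm - Om))%R%:Z.
Proof.
have [g1 _] := ord_dlog_ge a h0 aa0; have wE := ord_poln a Om.
have [p0|p0] := posnP (poln a f^-1).
  rewrite p0 mul0n muln0 !PoszD.
  have [q0|q0] := posnP (poln a f); last by clear -g1; lia.
  have [w0|w0] := eqVneq (ord a Om) 0; last by clear -g1 wE w0; lia.
  have [e0|e0] := ltP 0 (ord a (pdm - Om)); first by clear -g1; lia.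
  by have := ord_aa_reg q0 w0 e0; clear; lia.
have [lt|le] := ltP (ord a Om) ((poln a f^-1 * d)%N%:Z - m'%:Z).
  by have := ord_aa_zero lt p0; clear -wE; lia.
by clear -g1 wE le; lia.
Qed.

(** A pole of [f] cancels the simple pole of [aa]. At a zero of order [p], up to the order of [Om],
    [aa] vanishes to order at least [p * (m' + 2) - m' - 1 >= p], which compensates the division by
    [f]. *)
Lemma phi_bound a : (m' + 2 <= d)%N ->
  (poln a (aa / f) <= poln a Om + poln a Om^-1 + (0 < ord a (pdm - Om))%R)%N.
Proof.
move=> hd; have [g1 _] := ord_dlog_ge a h0 aa0; have wE := ord_poln a Om.
have fE := ord_poln a f; have fo := poln_or a f.
have oE : ord a (aa / f) = ord a aa - ord a f by rewrite ordM ?invr_eq0 // ordV.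
have pE : poln a (aa / f) = absz (Num.min 0 (ord a aa - ord a f)) by rewrite /poln oE.
suff : - (ord a aa - ord a f) <=
    (poln a Om + poln a Om^-1)%N%:Z + (0 < ord a (pdm - Om))%R%:Z by rewrite pE; clear; lia.
have [p0|p0] := posnP (poln a f^-1).
  have [q0|q0] := posnP (poln a f); last by clear -g1 fE p0 q0; lia.
  have [w0|w0] := eqVneq (ord a Om) 0; last by clear -g1 wE w0 fE q0 p0; lia.
  have [e0|e0] := ltP 0 (ord a (pdm - Om)); first by clear -g1 fE p0 q0; lia.
  by have := ord_aa_reg q0 w0 e0; clear -fE p0 q0; lia.
have pd : (poln a f^-1 * (m' + 2) <= poln a f^-1 * d)%N by rewrite leq_mul2l hd orbT.
have pm : (poln a f^-1 + m'.+1 <= poln a f^-1 * (m' + 2))%N by clear -p0; nia.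
have [lt|le] := ltP (ord a Om) ((poln a f^-1 * d)%N%:Z - m'%:Z).
  by have := ord_aa_zero lt p0; clear -wE fE fo pd pm p0; lia.
by clear -g1 wE le fE fo pd pm p0; lia.
Qed.

End DiffMonomial.
End LocalOrders.

(** * The inequality between characteristic and truncated counting functions *)

Section MainInequality.
Variable R : realType.
Local Notation C := (CC R).
Local Notation M := (mer R).
Implicit Types (F G H : M) (a : C) (r : R).

(** The reduced pole divisor; its integrated counting function is Nbar(r, F). *)
Definition polb F a : R := (0 < poln a F)%N%:R.

Lemma locfin_polb F : locfin (polb F).
Proof.
apply: locfin_bound (locfin_pol F) => a; rewrite /polb /pol => /eqP.
by rewrite pnatr_eq0 => /eqP ->.
Qed.

Lemma polb_le F a : polb F a <= pol F a.
Proof. by rewrite /polb /pol ler_nat; case: (poln a F). Qed.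

Lemma Nc_polb_le r F : 1 <= r -> Nc r (polb F) <= Nc r (pol F).
Proof.
move=> r1; apply: (Nc_le r1 (locfin_polb F) (locfin_pol F)) => a _; exact: polb_le.
Qed.

Lemma iter_dermD n F G : iter n (@derm R) (F + G) = iter n (@derm R) F + iter n (@derm R) G.
Proof. by elim: n => //= n ->; rewrite dermD. Qed.

Lemma iter_derm_id c n j : (j <= n)%N ->
  iter j (@derm R) (cstm c * idm R ^+ n) = cstm (c * (n ^_ j)%:R) * idm R ^+ (n - j).
Proof.
elim: j => [|j IH] h; first by rewrite subn0 ffactn0 mulr1.
rewrite iterS IH 1?ltnW // dermM derm_cst mul0r add0r dermX derm_id mulr1 ffactnSr natrM.
by rewrite mulrA -subnS mulrA -cstm_nat -cstmM.
Qed.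

Lemma main_arith (x1 x2 x3 x4 x5 y1 y2 y3 y4 y5 y6 y7 y8 y9 z1 z2 z3 z4 z5 z6 z7 z8 : R) :
  x1 <= y1 + y2 -> y2 <= y3 + y4 -> y3 <= y5 + z1 + z2 -> z1 <= y6 + z3 -> z3 <= z4 + y7 ->
  y8 - z4 = y9 + x4 -> x2 - x4 <= x5 + z5 + (z6 + z7 + z8) ->
  x1 + x2 + x3 - x5 - z5 <= y1 + y4 + y5 + y6 + y7 + y8 + (z6 + z7 + z8) + (z2 - y9 + x3).
Proof. by move=> *; lra. Qed.

Lemma strict_arith (x t n n' c q : R) : n <= t -> 0 <= t -> (q + 3) * t <= x -> (q + 1) * n' <= (q + 1) * (t - c) ->
  t <= x - n - (q + 1) * n' + (q + 1) * - c.
Proof. by move=> *; lra. Qed.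

Lemma pole_arith (t n n' c q : R) : (q + 1) * n' <= (q + 1) * (t - c) ->
  t - n <= (q + 2) * t - n - (q + 1) * n' + (q + 1) * - c.
Proof. by move=> *; lra. Qed.

Lemma zero_arith (t n n' q : R) : n <= t -> (q + 1) * (t - n') <= (q + 2) * t - n - (q + 1) * n'.
Proof. by move=> *; lra. Qed.

Lemma mm_arith (x y z t c : R) : x + y = t - c -> z <= y -> x <= t - z + - c.
Proof. by move=> *; lra. Qed.

Variable f : M.
Hypothesis htr : forall k : R, good (fun r => k * ln r <= T r f).

Lemma f_neq0 : f != 0.
Proof.
apply/eqP => f0; apply: (not_err_T htr).
by have := small0 htr; rewrite /small f0.
Qed.

Lemma small_id : small f (idm R).
Proof.
apply: err_le (err_ln htr); apply: goodS (good_gt 1) => r r1.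
have r0 : 0 <= r by exact: ltW (lt_trans ltr01 r1).
rewrite /T (_ : Nc r _ = 0) ?addr0.
  have v : reg r (idm R) by move=> z _; exact: vge_id.
  apply: le_trans (mm_le (K := r) r0 v _) _; first by move=> z zr; rewrite idm_pt zr.
  by rewrite /logp ifF //; apply/negbTE; rewrite -ltNge.
rewrite (@NcE _ _ _ [::]) ?big_nil // => a _ _; rewrite /pol.
by have /poln0 /eqP -> := vge_id a.
Qed.

(** Such a [G] is a polynomial: subtracting a monomial [c / n! * z ^+ n] lowers [n]. Together with
    [exp_not_small] it shows that no factor of the differential monomial vanishes identically. *)
Lemma iter_der0_small n G : iter n (@derm R) G = 0 -> small f G.
Proof.
elim: n G => [|n IH] G; first by move=> /= ->; exact: small0.
rewrite iterS => /derm0_cst [c cE].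
pose e := c / n`!%:R.
have : small f (G + cstm (- e) * idm R ^+ n).
  apply: IH; rewrite iter_dermD iter_derm_id // subnn expr0 mulr1 ffactnn cE -cstmD.
  by rewrite /e mulNr divfK ?subrr // pnatr_eq0 -lt0n fact_gt0.
have s2 : small f (cstm e * idm R ^+ n).
  by apply: smallM; [exact: small_cst | apply: smallX => //; exact: small_id].
move=> /(smallD htr) /(_ s2); rewrite -addrA -mulrDl -cstmD addNr mul0r addr0 //.
Qed.

Lemma exp_not_small n : (0 < n)%N -> ~ small f (f ^+ n).
Proof.
move=> n0 s; apply: (not_err_T htr); apply: err_le s.
apply: good2 (good_gt 1) (good_reg f) _ => r r1 rf.
rewrite (T_exp n (ltW (lt_trans ltr01 r1)) rf) ler_peMl //; last by rewrite ler1n.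
exact: T_ge0 (ltW r1).
Qed.

Lemma big_prod k (G : 'I_k -> M) : (forall i, big f (G i)) -> big f (\prod_(i < k) G i).
Proof.
move=> h; apply: (big_ind (big f)); first exact: small_big (small1 htr).
  by move=> F H; exact: bigM.
by move=> i _; exact: h.
Qed.

Lemma err_mm_prod k (G : 'I_k -> M) : (forall i, err f (fun r => mm r (G i))) ->
  err f (fun r => mm r (\prod_(i < k) G i)).
Proof.
move=> h; apply: (big_ind (fun H => err f (fun r => mm r H))); first exact: small_mm (small1 htr).
  by move=> F H eF eH; apply: err_le (good_mmM F H) (errD eF eH).
by move=> i _; exact: h.
Qed.

(** The quotient telescopes into logarithmic derivatives of the successive derivatives of [G]. *)
Lemma err_iter_der G n : G != 0 -> big f G -> err f (fun r => mm r (iter n (@derm R) G / G)).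
Proof.
move=> G0 bG; elim: n => [|n IH]; first by rewrite /= divff //; exact: small_mm (small1 htr).
have [z|n0] := eqVneq (iter n (@derm R) G) 0.
  by rewrite iterS z derm0 mul0r; exact: small_mm (small0 htr).
have -> : iter n.+1 (@derm R) G / G = dlog (iter n (@derm R) G) * (iter n (@derm R) G / G).
  by rewrite iterS /dlog mulrA mulfVK.
apply: err_le (good_mmM _ _) (errD _ IH).
by apply: (big_dlog htr); exact: big_iter_der.
Qed.

Variables (Om : M) (k l0 : nat) (l m : 'I_k -> nat).
Hypotheses (Om0 : Om != 0) (sOm : small f Om) (ml : forall i, (m i <= l i)%N).
Hypotheses (l00 : (0 < l0)%N) (mls : (\sum_(i < k) m i < \sum_(i < k) l i)%N).

Local Notation d := (l0 + \sum_(i < k) l i)%N.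
Local Notation m' := (\sum_(i < k) m i)%N.
Local Notation P := (pdm f l0 l m).

Let f0 := f_neq0.

Lemma fac_neq0 i : iter (m i) (@derm R) (f ^+ l i) != 0.
Proof.
have [li|li] := posnP (l i).
  have mi : m i = 0%N by apply/eqP; rewrite -leqn0 -li.
  by rewrite mi li /= expr0 oner_neq0.
by apply/eqP => /iter_der0_small; exact: exp_not_small.
Qed.

Lemma pdm_neq0 : P != 0.
Proof. by rewrite mulf_neq0 ?expf_neq0 //; apply/prodf_neq0 => i _; exact: fac_neq0. Qed.

Lemma big_pdm : big f P.
Proof.
have bX n : big f (f ^+ n) by apply: bigX => //; exact: big_f.
apply: bigM => //; apply: big_prod => i; exact: big_iter_der.
Qed.

Lemma err_mm_pdm : err f (fun r => mm r (P / f ^+ d)).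
Proof.
have -> : P / f ^+ d = \prod_(i < k) (iter (m i) (@derm R) (f ^+ l i) / f ^+ l i).
  rewrite /pdm exprD -mulf_div divff ?expf_neq0 // mul1r prodf_div; congr (_ / _).
  by rewrite expr_sum.
apply: err_mm_prod => i; apply: err_iter_der; first by rewrite expf_neq0.
by apply: bigX => //; exact: big_f.
Qed.

Lemma good_mm_inv : good (fun r => d%:R * mm r f^-1 <= mm r (P / f ^+ d) + mm r P^-1).
Proof.
apply: good2 (good_gt 0) (goodI (good_reg f^-1) (good_mmM (P / f ^+ d) P^-1)) _ => r r0 [rf].
have -> : P / f ^+ d * P^-1 = f^-1 ^+ d by rewrite mulrAC (divff pdm_neq0) mul1r exprVn.
by rewrite (mm_exp d (ltW r0) rf).
Qed.

Lemma d_ge : (m' + 2 <= d)%N.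
Proof. by move: l00 mls; lia. Qed.

(** A zero of [f] of order [p] is a zero of [P] of order at least [p * (m' + 2) - m' >= p], so N(r,
    1/f) <= N(r, 1/P). If [P] were small, then so would be m(r, 1/f) by [good_mm_inv], hence [f]
    itself. *)
Lemma pdm_not_small : ~ small f P.
Proof.
move=> sP; have P0 := pdm_neq0.
have z a : (poln a f^-1 <= poln a P^-1)%N.
  have vf : vge a (poln a f^-1)%:Z f -> vge a (poln a f^-1)%:Z P.
    move=> vf; have [->|p0] := posnP (poln a f^-1).
      apply: pdm_reg; apply: vgeW vf; lia.
    have := pdm_zero l0 l m vf; apply: vgeW; have := d_ge.
    move: d (\sum_(i < k) m i)%N (poln a f^-1) p0 => x y p p0 h; clear -p0 h; nia.
  have : vge a (poln a f^-1)%:Z P \/ poln a f^-1 = 0%N.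
    have := ord_poln a f; have := poln_or a f; have := vge_ord a f => v o e.
    have [->|p0] := posnP (poln a f^-1); first by right.
    by left; apply: vf; apply: vgeW v; lia.
  case=> [/(vgeP _ _ P0)|->//]; have := ord_poln a P; lia.
apply: (not_err_T htr).
have eP := errD err_mm_pdm (smallV htr sP).
apply: err_le (errD eP (err_cst htr (lnlc f))).
apply: good2 (goodI (good_gt 1) good_mm_inv) (good_TV f0) _ => r [r1 h1] h2.
have hN : Nc r (zer f) <= Nc r (pol P^-1).
  apply: (Nc_le (ltW r1) (locfin_zer f) (locfin_pol P^-1)) => a _.
  by rewrite /pol /zer ler_nat.
have m0 := mm_ge0 r f^-1.
have hd : mm r f^-1 <= d%:R * mm r f^-1.
  by apply: ler_peMl => //; rewrite ler1n; have := d_ge; lia.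
move: h2; rewrite /T -[pol f^-1]/(zer f).
move: (mm r f^-1) (Nc r (zer f)) (mm r P^-1) (Nc r (pol P^-1)) (mm r (P / f ^+ d)) (mm r f) (Nc r (pol f))
  (lnlc f) (d%:R * _) h1 hN hd; clear; move=> *; lra.
Qed.

Local Notation h := (P / Om - 1).
Local Notation aa := (dlog h).
Hypothesis h0 : P != Om.
Hypothesis Efin : finite_set [set a | 0 < ord a (P - Om)].

Lemma h_neq0 : h != 0.
Proof.
apply: contraNneq h0 => /eqP; rewrite subr_eq0 => /eqP hE.
by rewrite -[P](mulfVK Om0) hE mul1r.
Qed.

Lemma aa_neq0 : aa != 0.
Proof.
apply/eqP => /eqP; rewrite mulf_eq0 invr_eq0 (negPf h_neq0) orbF => /eqP /derm0_cst [c cE].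
apply: pdm_not_small; have -> : P = (cstm c + 1) * Om by rewrite -cE subrK mulfVK.
by apply: smallM => //; apply: smallD => //; [exact: small_cst | exact: small1].
Qed.

Let h0' := h_neq0.
Let aa0 := aa_neq0.

Lemma big_h : big f h.
Proof.
apply: bigD => //; last by apply: small_big; apply: smallN => //; exact: small1.
by apply: bigM; [exact: big_pdm | apply: small_big; exact: smallV].
Qed.

(** The supposedly finite zero set of [P - Om] becomes the pole divisor of a rational function, so
    its counting function is an error term like that of [Om]. *)
Lemma small_indicator : exists2 W : M, small f W & forall a, pol W a = (0 < ord a (P - Om))%R%:R.
Proof.
have [s sE] := (finite_seqP _).1 Efin; exists (fprod (undup s) (fun=> -1)).
  apply: (big_ind (small f)); [exact: small1 | by move=> ? ?; exact: smallM |].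
  move=> a _; rewrite exprN1; apply: smallV => //.
  by apply: smallB => //; [exact: small_id | exact: small_cst].
move=> a; rewrite /pol /poln ord_fprod ?undup_uniq // mem_undup.
have -> : (a \in s) = (0 < ord a (P - Om)).
  by apply/idP/idP => [|] h; [have : [set` s] a by []; rewrite -sE | have : [set` s] a by rewrite -sE].
by case: ifP.
Qed.

Lemma err_aa : err f (fun r => mm r aa).
Proof. exact: (big_dlog htr big_h). Qed.

(** The identity [FhE] and good radii reduce [d * m(r, 1/f)] to m(r, 1/aa) plus error terms;
    Jensen's formula then exchanges m(r, 1/aa) for m(r, aa) and a signed count of the orders of
    [aa]. *)
Lemma main_inequality : err f (fun r => d%:R * T r f - Nc r (polb f) - m'.+1%:R * Nc r (polb f^-1)).
Proof.
have [W sW WE] := small_indicator.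
pose Fh := P / Om.
have Fh0 : Fh != 0 by rewrite mulf_neq0 ?pdm_neq0 ?invr_eq0.
have FhE : Fh^-1 = 1 + (-1) * (aa^-1 * dlog Fh).
  have dE : derm h = derm Fh by rewrite dermB derm1 subr0.
  have d0 : derm Fh != 0 by apply: contraNneq aa0 => z; rewrite /dlog dE z mul0r.
  rewrite /dlog dE -/Fh; move: h0'; rewrite -/Fh => h0''.
  by field; rewrite d0 Fh0 h0''.
have PE : P^-1 = Fh^-1 * Om^-1 by rewrite /Fh invf_div mulrAC divff ?mul1r ?invr_eq0.
have e1 : err f (fun r => mm r (P / f ^+ d) + mm r Om^-1 + mm r 1 + mm r (-1) + mm r (dlog Fh) + mm r aa
    + (Nc r (pol Om) + Nc r (zer Om) + Nc r (pol W)) + (ln 2 - lnlc aa + d%:R * lnlc f)).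
  apply: errD (err_cst htr _); apply: errD.
    apply: errD err_aa; apply: errD; last first.
      apply: (big_dlog htr); apply: bigM; first exact: big_pdm.
      by apply: small_big; exact: smallV.
    apply: errD; last by rewrite cstmN1; exact: small_mm (small_cst htr _).
    apply: errD; last exact: small_mm (small1 htr).
    by apply: errD err_mm_pdm _; apply: small_mm; exact: smallV.
  apply: errD; last exact: small_pol.
  by apply: errD; [exact: small_pol | exact: small_zer].
apply: err_le e1.
apply: good2 (goodI (good_gt 1) (goodI good_mm_inv (good_mmM Fh^-1 Om^-1)))
  (goodI (goodI (good_mmD 1 (-1 * (aa^-1 * dlog Fh))) (good_mmM (-1) (aa^-1 * dlog Fh)))
   (goodI (good_mmM aa^-1 (dlog Fh)) (goodI (good_TV f0) (good_gen aa0)))) _.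
move=> r [r1 [g1 g2]] [[g3 g4] [g5 [g6 g7]]].
have {}g7 := mm_inv aa0 (lt_trans ltr01 r1) g7.
rewrite -PE in g2; rewrite -FhE in g3.
have lfz := locfinZ d%:R (locfin_zer f); have lfo := locfinZ (-1) (locfin_ord aa0).
have lfb := locfinZ m'.+1%:R (locfin_polb f^-1).
(* The signed count of [aa] is combined with [d * N(r, 1/f)] before estimating: separately, the
   high-order zeros of [aa] at the zeros of [f] would be lost. *)
have g8 : d%:R * Nc r (zer f) - Nc r (ordR aa) <= Nc r (polb f) + m'.+1%:R * Nc r (polb f^-1)
    + (Nc r (pol Om) + Nc r (zer Om) + Nc r (pol W)).
  rewrite -[- Nc r (ordR aa)]mulN1r -!NcZ -(NcD _ lfz lfo).
  have l1 := locfinD (locfin_polb f) lfb.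
  have l2 := locfinD (locfin_pol Om) (locfin_zer Om).
  have l3 := locfinD l2 (locfin_pol W).
  rewrite -(NcD _ (locfin_polb f) lfb) -(NcD _ (locfin_pol Om) (locfin_zer Om)).
  rewrite -(NcD _ l2 (locfin_pol W)) -(NcD _ l1 l3).
  apply: (Nc_le (ltW r1) (locfinD lfz lfo) (locfinD l1 l3)) => a _.
  rewrite WE mulN1r /zer /ordR /polb /pol.
  have := aa_bound f0 Om0 h0' aa0 a; rewrite -(ler_int R) !(rmorphD, rmorphN, rmorphM) /=.
  rewrite -!pmulrn mulrC => b; apply: le_trans b _.
  by rewrite -natr1 le_eqVlt; apply/orP; left; apply/eqP; ring.
have dT : d%:R * T r f = d%:R * mm r f^-1 + d%:R * Nc r (zer f) + d%:R * lnlc f.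
  by rewrite -!mulrDr (_ : T r f = T r f^-1 + lnlc f) // g6 subrK.
rewrite dT; exact: main_arith g1 g2 g3 g4 g5 g7 g8.
Qed.

Lemma Nc_polb_T r : 1 <= r -> Nc r (polb f) <= T r f.
Proof. by move=> r1; apply: le_trans (Nc_polb_le f r1) (Nc_pol_le r f). Qed.

(** As Nbar <= T + O(1), a strict inequality [d > m' + 2] would leave a full [T] inside an error
    term. In the equality case both Nbar equal T up to o(T), so m(r, 1/f) is an error term; with
    [phi_bound] this makes [aa / f] small. *)
Lemma boundary : [/\ (d = m' + 2)%N, err f (fun r => T r f - Nc r (polb f)),
  err f (fun r => T r f - Nc r (polb f^-1)) & small f (aa / f)].
Proof.
have g : good (fun r => [/\ 1 <= r, 0 <= T r f, Nc r (polb f) <= T r f & Nc r (polb f^-1) <= T r f - lnlc f]).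
  apply: good2 (good_gt 1) (good_TV f0) _ => r /ltW r1 e; split=> //; first exact: T_ge0.
    exact: Nc_polb_T.
  rewrite -e; exact: le_trans (Nc_polb_le _ r1) (Nc_pol_le r _).
have mi := main_inequality.
have dE : d = (m' + 2)%N.
  apply/eqP; rewrite eqn_leq d_ge andbT leqNgt; apply/negP => lt.
  apply: (not_err_T htr).
  apply: err_le (errD mi (err_cst htr (m'.+1%:R * - lnlc f))); apply: goodS g => r [r1 t0 b1 b2].
  have b3 : (m'%:R + 3) * T r f <= d%:R * T r f.
    by apply: ler_wpM2r => //; rewrite -natrD ler_nat addn3 -addn2.
  have b4 : (m'%:R + 1) * Nc r (polb f^-1) <= (m'%:R + 1) * (T r f - lnlc f) by rewrite natr1 ler_pM2l.
  by rewrite -[m'.+1%:R]natr1; exact: strict_arith b1 t0 b3 b4.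
have e1 : err f (fun r => T r f - Nc r (polb f)).
  apply: err_le (errD mi (err_cst htr (m'.+1%:R * - lnlc f))); apply: goodS g => r [r1 t0 b1 b2].
  have b4 : (m'%:R + 1) * Nc r (polb f^-1) <= (m'%:R + 1) * (T r f - lnlc f) by rewrite natr1 ler_pM2l.
  by rewrite dE natrD -[m'.+1%:R]natr1; exact: pole_arith b4.
have e2 : err f (fun r => T r f - Nc r (polb f^-1)).
  have mp : 0 < m'.+1%:R :> R by rewrite ltr0n.
  have : err f (fun r => m'.+1%:R^-1 * (d%:R * T r f - Nc r (polb f) - m'.+1%:R * Nc r (polb f^-1))).
    by apply: errZ => //; rewrite invr_ge0 ltW.
  apply: err_le; apply: goodS g => r [r1 t0 b1 b2].
  rewrite -(ler_pM2l mp) mulVKf ?gt_eqF // dE natrD -[m'.+1%:R]natr1; exact: zero_arith b1.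
have em : err f (fun r => mm r f^-1).
  apply: err_le (errD e2 (err_cst htr (- lnlc f))).
  apply: good2 (good_gt 1) (good_TV f0) _ => r r1 e.
  exact: mm_arith e (Nc_polb_le f^-1 (ltW r1)).
split=> //; have [W sW WE] := small_indicator.
have eN := errD (errD (small_pol sOm) (small_zer htr sOm)) (small_pol sW).
apply: err_le (errD (errD err_aa em) eN).
apply: good2 (good_gt 1) (good_mmM aa f^-1) _ => r r1 g1.
rewrite /T; apply: lerD => //.
have l2 := locfinD (locfin_pol Om) (locfin_zer Om).
rewrite -(NcD _ (locfin_pol Om) (locfin_zer Om)) -(NcD _ l2 (locfin_pol W)).
apply: (Nc_le (ltW r1) (locfin_pol (aa / f)) (locfinD l2 (locfin_pol W))) => a _.
by rewrite WE /pol /zer -!natrD ler_nat; apply: phi_bound => //; exact: d_ge.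
Qed.

End MainInequality.

(** * The Riccati equation at the boundary case *)

Section RiccatiLocal.
Variable R : realType.
Local Notation C := (CC R).
Local Notation M := (mer R).
Implicit Types (F G H : M) (a : C).

Lemma vge0M a F G : vge a 0 F -> vge a 0 G -> vge a 0 (F * G).
Proof. by move=> vF vG; have := vgeM vF vG; rewrite addr0. Qed.

Lemma vge0X a F n : vge a 0 F -> vge a 0 (F ^+ n).
Proof. by move=> vF; have := vgeX n vF; rewrite mul0rn. Qed.

Lemma cstmV (c : C) : c != 0 -> (cstm c)^-1 = cstm c^-1.
Proof.
move=> c0; have n0 : cstm c != 0.
  by apply/eqP => /(congr1 (fun F : M => F 0)); rewrite !cstm_pt; apply/eqP.
by apply: (mulIf n0); rewrite mulVf // -cstmM mulVf.
Qed.

Lemma natmV n : (n.+1%:R : M)^-1 = cstm n.+1%:R^-1.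
Proof. by rewrite -cstm_nat cstmV // pnatr_eq0. Qed.

Lemma vge_dlog a F : F != 0 -> ord a F = 0 -> vge a 0 (dlog F).
Proof.
move=> F0 z; have vF := ord0_vge z.
by apply: vge0M; [exact: vge_der0 | apply: ord0_vge; rewrite ordV // z oppr0].
Qed.

Lemma ev_dlog a F : F != 0 -> ord a F = 0 -> dlog F a = derm F a / F a.
Proof.
move=> F0 z; have vF := ord0_vge z.
have vV : vge a 0 F^-1 by apply: ord0_vge; rewrite ordV // z oppr0.
by rewrite (evM (vge_der0 vF) vV) evV.
Qed.

Lemma dlog_prod k (G : 'I_k -> M) : (forall i, G i != 0) ->
  dlog (\prod_(i < k) G i) = \sum_(i < k) dlog (G i).
Proof.
elim: k G => [|k IH] G h; first by rewrite !big_ord0 /dlog derm1 mul0r.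
by rewrite !big_ord_recr /= dlogM ?IH //; apply/prodf_neq0 => i _.
Qed.

Lemma vge_sum a k (G : 'I_k -> M) : (forall i, vge a 0 (G i)) -> vge a 0 (\sum_(i < k) G i).
Proof. by move=> h; apply: big_ind => //; [exact: vge0 | move=> x y; exact: vgeD]. Qed.

Lemma ev_sum a k (G : 'I_k -> M) : (forall i, vge a 0 (G i)) ->
  (\sum_(i < k) G i) a = \sum_(i < k) G i a.
Proof.
elim: k G => [|k IH] G h; first by rewrite !big_ord0 cstm_pt.
by rewrite !big_ord_recr (evD (vge_sum (fun i => h _)) (h _)) IH.
Qed.

(** The ratio between the logarithmic derivatives at the pole of [scaled l m] and of [u = t * f].
    Its non-negativity makes [kc + n] invertible. *)
Definition kap (l m : nat) : C := l%:R * \prod_(j < m) ((l + j)%:R - 1) / (rf l m)%:R.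

Lemma kap_ge0 l m : 0 <= kap l m.
Proof.
rewrite /kap mulr_ge0 ?invr_ge0 ?ler0n //.
case: l => [|l]; first by rewrite mul0r.
rewrite mulr_ge0 ?ler0n //; apply: prodr_ge0 => j _.
by rewrite addSn -natr1 addrK ler0n.
Qed.

Section FieldIdentities.
Variables (F : fieldType) (n p p1 u u1 : F).
Hypotheses (n0 : n != 0) (u0 : u != 0) (e : - n = p * u).

Let pE : p = - n / u. Proof. by rewrite e mulfK. Qed.

(** In the application [u] and [p] are the values at the pole of [t * f] and of [phi], [u1] and [p1]
    those of their derivatives, and [e] is the leading-coefficient relation. Isolating the
    identities reduces them to arithmetic in a field. *)
Lemma pole_identity k w : k * (u1 / u) - w - (p1 * u + p * u1) = 0 ->
  w = (k + n) * (u1 / u) + n * (p1 / p).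
Proof.
move=> h; rewrite -[w]addr0 -[in LHS]h pE; field; by rewrite ?oppr_eq0 ?u0 ?n0 ?andbT.
Qed.

Lemma riccati_value x b : 0 * x - u - n^-1 * p * u ^+ 2 - b * (0 * u) = 0.
Proof. by rewrite pE; field; rewrite n0 u0. Qed.

Lemma riccati_slope x b1 : 0 * x - (n^-1 * p1 * u ^+ 2 + n^-1 * p * (2 * u * u1))
  - (b1 * (0 * u) + (2 * (u1 / u) + p1 / p) * (u + 0 * u1)) = 0.
Proof. by rewrite pE; field; rewrite ?oppr_eq0 ?u0 ?n0 ?andbT. Qed.

End FieldIdentities.

Section AtSimplePole.
Variables (f : M) (a : C).
Hypothesis (f0 : f != 0) (of1 : ord a f = -1).
Local Notation t := (tm a).
Let u := t * f.

Let t0 : t != 0 := tm_neq0 a.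
Let vt : vge a 0 t := vge_tm a a.

Lemma u_neq0 : u != 0. Proof. by rewrite mulf_neq0. Qed.
Lemma ord_u : ord a u = 0. Proof. by rewrite ordM // ord_tm of1. Qed.

Let vu : vge a 0 u := ord0_vge ord_u.

(** At a simple pole of [f] the power of [t] clears the pole of the derivative exactly; value and
    first derivative at [a] then follow from the recurrence [scaledS]. *)
Definition scaled (l m : nat) : M := t ^+ (l + m) * iter m (@derm R) (f ^+ l).

Lemma scaledS l m : scaled l m.+1 = t * derm (scaled l m) - (l + m)%:R * scaled l m.
Proof.
rewrite /scaled addnS iterS dermM dermX derm_tm mulr1.
case: (l + m)%N => [|e] /=; rewrite ?mul0r ?subr0 exprS; first by rewrite add0r; ring.
by rewrite exprS; ring.
Qed.

Lemma vge_scaled l m : vge a 0 (scaled l m).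
Proof.
elim: m => [|m IH]; first by rewrite /scaled addn0 /= -exprMn; exact: vge0X.
rewrite scaledS; apply: vgeB; apply: vge0M => //; [exact: vge_der0 | exact: vge_nat].
Qed.

Lemma ev_scaled l m : scaled l m a = (-1) ^+ m * (rf l m)%:R * u a ^+ l /\
  derm (scaled l m) a = (-1) ^+ m * (\prod_(j < m) ((l + j)%:R - 1)) * (l%:R * u a ^+ l.-1 * derm u a).
Proof.
have vd F : vge a 0 F -> vge a 0 (derm F) by exact: vge_der0.
elim: m => [|m [v1 v2]].
  have -> : scaled l 0 = u ^+ l by rewrite /scaled addn0 /u exprMn.
  rewrite /rf !big_ord0 expr0 !mul1r; split; first exact: evX.
  rewrite dermX (evM _ (vd _ vu)); last by apply: vge0M; [exact: vge_nat | exact: vge0X].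
  by rewrite (evM (vge_nat _ _) (vge0X _ vu)) ev_nat evX.
have vG := vge_scaled l m; have vG1 := vd _ vG; have vG2 := vd _ vG1.
have vn := vge_nat a (l + m).
rewrite scaledS; split.
  rewrite (evB (vge0M vt vG1) (vge0M vn vG)) (evM vt vG1) (evM vn vG) tm_pt subrr mul0r sub0r ev_nat v1.
  by rewrite rfS natrM exprS; ring.
rewrite dermB dermM derm_tm mul1r dermM derm_nat mul0r add0r.
rewrite (evB (vgeD vG1 (vge0M vt vG2)) (vge0M vn vG1)) (evD vG1 (vge0M vt vG2)) (evM vt vG2) (evM vn vG1).
rewrite tm_pt subrr mul0r addr0 ev_nat v2 big_ord_recr /= exprS; ring.
Qed.

Lemma dlog_scaled l m : (m <= l)%N -> [/\ scaled l m != 0, ord a (scaled l m) = 0 &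
  dlog (scaled l m) a = kap l m * (derm u a / u a)].
Proof.
move=> ml; have [v1 v2] := ev_scaled l m.
have ua : u a != 0 by apply: ord0_neq0; [exact: u_neq0 | exact: ord_u].
have rf0 : (rf l m)%:R != 0 :> C.
  rewrite pnatr_eq0 -lt0n /rf prodn_gt0 // => i.
  by apply: leq_trans (leq_addr _ _); apply: leq_trans ml; apply: leq_ltn_trans (ltn_ord i).
have ga : scaled l m a != 0 by rewrite v1 !mulf_neq0 ?expf_neq0 ?oppr_eq0 ?oner_eq0.
have g0 : scaled l m != 0 by apply: contraNneq ga => ->; rewrite cstm_pt.
have og : ord a (scaled l m) = 0 by apply: ord_eq0 => //; exact: vge_scaled.
split=> //; rewrite ev_dlog // v1 v2 /kap.
have s0 : (-1) ^+ m != 0 :> C by rewrite expf_neq0 ?oppr_eq0 ?oner_eq0.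
case: l {ml v1 v2 ga g0 og} rf0 => [|l] rf0; first by rewrite !mul0r mulr0 mul0r.
by rewrite exprS /=; field; rewrite s0 ua rf0 expf_neq0.
Qed.

Variables (Om phi : M) (k l0 : nat) (l m : 'I_k -> nat).
Hypotheses (Om0 : Om != 0) (oOm : ord a Om = 0) (phi0 : phi != 0) (ophi : ord a phi = 0).
Hypotheses (ml : forall i, (m i <= l i)%N).
Local Notation d := (l0 + \sum_(i < k) l i)%N.
Local Notation m' := (\sum_(i < k) m i)%N.
Local Notation P := (pdm f l0 l m).
Local Notation n := (d + m')%N.
Local Notation h := (P / Om - 1).
Hypotheses (n2 : (2 <= n)%N) (hode : derm h = phi * f * h).

Definition kc : C := l0%:R + \sum_(i < k) kap (l i) (m i).

Lemma kc_neq0 : kc + n%:R != 0.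
Proof.
rewrite gt_eqF // ltr_wpDl ?ltr0n ?(leq_trans _ n2) //.
by rewrite addr_ge0 ?ler0n // sumr_ge0 // => i _; exact: kap_ge0.
Qed.

(* At a simple pole f = u / (z - a), the first two Laurent coefficients of P' / P give
   phi u = - n and u' / u = ric_gam at a; ric_A and ric_B are the coefficients for which
   the polar part of f' - A f ^ 2 - B f vanishes. *)
Definition ric_gam : M := cstm (kc + n%:R)^-1 * (dlog Om - n%:R * dlog phi).
Definition ric_A : M := phi / n%:R.
Definition ric_B : M := 2 * ric_gam + dlog phi.
Definition ric_C : M := derm f - ric_A * f ^+ 2 - ric_B * f.

Let W := u ^+ l0 * \prod_(i < k) scaled (l i) (m i).

Let WE : P = W / t ^+ n.
Proof.
rewrite /W /pdm /scaled big_split /= -expr_sum big_split /= /u exprMn.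
rewrite !exprD; field; rewrite !expf_neq0 ?t0 //.
Qed.

Let vdW : W != 0 /\ vge a 0 (dlog W).
Proof.
have W0 : W != 0.
  rewrite mulf_neq0 ?expf_neq0 ?u_neq0 //; apply/prodf_neq0 => i _.
  by have [] := dlog_scaled (ml i).
split=> //; apply: vge_dlog => //.
rewrite ordM ?expf_neq0 ?u_neq0 //; last by apply/prodf_neq0 => i _; have [] := dlog_scaled (ml i).
rewrite ordX ?u_neq0 // ord_u mul0rn add0r ord_prod => [|i]; last by have [] := dlog_scaled (ml i).
by rewrite big1 // => i _; have [] := dlog_scaled (ml i).
Qed.

Let ev_dlogW : dlog W a = kc * (derm u a / u a).
Proof.
have s0 i : scaled (l i) (m i) != 0 by have [] := dlog_scaled (ml i).
have vs i : vge a 0 (dlog (scaled (l i) (m i))).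
  by have [z1 z2 _] := dlog_scaled (ml i); exact: vge_dlog.
have vdu : vge a 0 (dlog u) by exact: vge_dlog u_neq0 ord_u.
rewrite /W dlogM ?expf_neq0 ?u_neq0 //; last by apply/prodf_neq0 => i _.
rewrite dlogX ?u_neq0 // dlog_prod //.
rewrite (evD (vge0M (vge_nat a l0) vdu) (vge_sum vs)) (evM (vge_nat a l0) vdu) (ev_sum vs) ev_nat.
rewrite (ev_dlog u_neq0 ord_u) /kc mulrDl mulr_suml; congr (_ + _).
by apply: eq_bigr => i _; have [] := dlog_scaled (ml i).
Qed.

(** Dividing [h' = phi f h] by [h + 1 = Fh] gives [t * Fh' / Fh = phi * u * (1 - 1 / Fh)]. As
    [1 / Fh] vanishes to order [n >= 2], this is an equality modulo [t ^ 2], that is, two conditions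
    at [a]. They determine exactly what is needed for the double and the simple pole of [ric_C] to
    cancel. *)
Lemma riccati_at_pole : vge a 0 ric_C.
Proof.
have u0 := u_neq0; have ou := ord_u.
have n0 : n%:R != 0 :> C by rewrite pnatr_eq0 -lt0n (leq_trans _ n2).
have [W0 vdw] := vdW.
have tn0 : t ^+ n != 0 by rewrite expf_neq0.
have P0 : P != 0 by rewrite WE mulf_neq0 ?invr_eq0.
have vdO := vge_dlog Om0 oOm; have vdp := vge_dlog phi0 ophi; have vp := ord0_vge ophi.
(* The regular part of the logarithmic derivative of [P / Om], whose polar part is [- n / t]. *)
have [Y YE] : exists Y, Y = dlog W - dlog Om by eexists.
have vY : vge a 0 Y by rewrite YE; exact: vgeB.
have ua : u a != 0 by exact: ord0_neq0.
have pa : phi a != 0 by exact: ord0_neq0.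
pose Fh := P / Om.
have Fh0 : Fh != 0 by rewrite mulf_neq0 ?invr_eq0.
have ZE : t * Y - n%:R - phi * u = - (phi * u / Fh).
  have d1 : t * dlog Fh = t * Y - n%:R.
    rewrite /Fh dlogM ?invr_eq0 // dlogV // WE dlogM ?invr_eq0 // dlogV // dlogX //.
    have -> : dlog t = t^-1 by rewrite /dlog derm_tm mul1r.
    by rewrite YE; field; exact: t0.
  have d2 : t * dlog Fh = phi * u * (Fh - 1) / Fh.
    have dE : derm h = derm Fh by rewrite dermB derm1 subr0.
    by rewrite /dlog -dE hode /u -/Fh; ring.
  rewrite -d1 d2; field; exact: Fh0.
have oFh : ord a Fh = - n%:Z.
  have q1 : poln a f = 1%N by rewrite /poln of1.
  have [|_ oP] := pdm_pole l0 f0 ml (a := a); first by rewrite q1.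
  by rewrite ordM ?invr_eq0 // ordV // oOm subr0 oP q1 mul1n.
have vZ : vge a 2 (t * Y - n%:R - phi * u).
  rewrite ZE; apply: vgeN; have := vgeM (vge0M vp vu) (vge_ord a Fh^-1).
  by apply: vgeW; rewrite ordV // oFh opprK add0r lez_nat.
have vn := vge_nat a n.
have vY1 := vge_der0 vY; have vp1 := vge_der0 vp; have vu1 := vge_der0 vu; have vu2 := vge_der0 vu1.
have ta : t a = 0 by rewrite tm_pt subrr.
have vZ0 : vge a 0 (t * Y - n%:R - phi * u) by apply: vgeW vZ.
have /(vge1P vZ0) : vge a 1 (t * Y - n%:R - phi * u) by apply: vgeW vZ.
rewrite (evB (vgeB (vge0M vt vY) vn) (vge0M vp vu)) (evB (vge0M vt vY) vn) (evM vt vY) (evM vp vu) ev_nat ta.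
rewrite mul0r sub0r => /eqP; rewrite subr_eq0 => /eqP e1.
have dZ : derm (t * Y - n%:R - phi * u) = Y + t * derm Y - (derm phi * u + phi * derm u).
  by rewrite (dermB (t * Y - _)) (dermB (t * Y)) (dermM t Y) (dermM phi u) derm_tm derm_nat mul1r subr0.
have vdZ : vge a 1 (derm (t * Y - n%:R - phi * u)) by have := vge_der vZ; apply: vgeW.
have /(vge1P (vgeW _ vdZ)) : vge a 1 (derm (t * Y - n%:R - phi * u)) by [].
move=> /(_ isT); rewrite dZ (evB (vgeD vY (vge0M vt vY1)) (vgeD (vge0M vp1 vu) (vge0M vp vu1))).
rewrite (evD vY (vge0M vt vY1)) (evD (vge0M vp1 vu) (vge0M vp vu1)) (evM vt vY1) (evM vp1 vu) (evM vp vu1).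
rewrite ta mul0r addr0 YE (evB vdw vdO) ev_dlogW => e2.
have vg : vge a 0 ric_gam by apply: vge0M (vge_cst _ _) (vgeB vdO (vge0M vn vdp)).
have ga : ric_gam a = derm u a / u a.
  rewrite /ric_gam (evM (vge_cst _ _) (vgeB vdO (vge0M vn vdp))) cstm_pt (evB vdO (vge0M vn vdp)).
  rewrite (evM vn vdp) ev_nat (ev_dlog phi0 ophi).
  have -> : dlog Om a = (kc + n%:R) * (derm u a / u a) + n%:R * (derm phi a / phi a).
    refine (pole_identity n0 ua e1 e2).
  by rewrite addrK mulrA mulVf ?mul1r // kc_neq0.
pose A := ric_A; pose B := ric_B.
have vA : vge a 0 A.
  by rewrite /A /ric_A -(prednK (ltnW n2)) natmV; exact: vge0M vp (vge_cst _ _).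
have vA1 := vge_der0 vA.
have vB : vge a 0 B by apply: vgeD (vge0M (vge_nat a 2) vg) vdp.
have vB1 := vge_der0 vB.
(* This is [t ^ 2 * ric_C]; vanishing of its value and derivative at [a] makes [ric_C] regular. *)
pose V := t * derm u - u - A * u ^+ 2 - B * (t * u).
have VE : ric_C = V / t / t.
  rewrite /V /ric_C -/A -/B /u dermM derm_tm; field; exact: t0.
have AE : A = cstm n%:R^-1 * phi.
  by rewrite mulrC /A /ric_A -(prednK (ltnW n2)) natmV.
have Aa : A a = n%:R^-1 * phi a by rewrite AE (evM (vge_cst _ _) vp) cstm_pt.
have A1a : derm A a = n%:R^-1 * derm phi a.
  by rewrite AE dermM derm_cst mul0r add0r (evM (vge_cst _ _) vp1) cstm_pt.
have Ba : B a = 2 * (derm u a / u a) + derm phi a / phi a.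
  rewrite /B /ric_B (evD (vge0M (vge_nat a 2) vg) vdp) (evM (vge_nat a 2) vg) ev_nat ga.
  by rewrite (ev_dlog phi0 ophi).
have vtu1 := vge0M vt vu1; have vAu := vge0M vA (vge0X 2 vu); have vtu := vge0M vt vu.
have vBt := vge0M vB vtu.
have vV : vge a 0 V by exact: vgeB (vgeB (vgeB vtu1 vu) vAu) vBt.
have Va : V a = 0.
  rewrite /V (evB (vgeB (vgeB vtu1 vu) vAu) vBt) (evB (vgeB vtu1 vu) vAu) (evB vtu1 vu).
  rewrite (evM vt vu1) (evM vA (vge0X 2 vu)) (evM vB vtu) (evM vt vu) (evX 2 vu) ta Aa.
  refine (riccati_value n0 ua e1 _ _).
have V1a : derm V a = 0.
  have dV : derm V = t * derm (derm u) - (derm A * u ^+ 2 + A * (2 * u * derm u))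
     - (derm B * (t * u) + B * (u + t * derm u)).
    rewrite /V (dermB (t * derm u - u - A * u ^+ 2)) (dermB (t * derm u - u)) (dermB (t * derm u)).
    by rewrite (dermM t (derm u)) (dermM A) (dermX u 2) (dermM B) (dermM t u) derm_tm expr1; ring.
  have w1 := vge0M vt vu2; have w2 := vge0M vA1 (vge0X 2 vu).
  have w3 := vge0M (vge_nat a 2) vu; have w4 := vge0M w3 vu1; have w5 := vge0M vA w4.
  have w6 := vge0M vB1 vtu; have w7 := vgeD vu vtu1; have w8 := vge0M vB w7.
  rewrite dV (evB (vgeB w1 (vgeD w2 w5)) (vgeD w6 w8)) (evB w1 (vgeD w2 w5)) (evD w2 w5) (evD w6 w8).
  rewrite (evM vt vu2) (evM vA1 (vge0X 2 vu)) (evM vA w4) (evM w3 vu1) (evM (vge_nat a 2) vu).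
  rewrite (evM vB1 vtu) (evM vB w7) (evD vu vtu1) (evM vt vu) (evM vt vu1) (evX 2 vu) ev_nat ta Aa A1a Ba.
  refine (riccati_slope _ _ n0 ua e1 _ _).
rewrite VE; have := vge_divt (vge_divt (vge2 vV Va V1a)); exact: vgeW.
Qed.

End AtSimplePole.
End RiccatiLocal.

(** * Smallness of the Riccati coefficients *)

Section RiccatiSmall.
Variable R : realType.
Local Notation C := (CC R).
Local Notation M := (mer R).
Implicit Types (F G H : M) (a : C) (r : R).

Lemma polnN a F : (poln a (- F) <= poln a F)%N.
Proof. exact: poln_le (vgeN (vge_poln a F)). Qed.

Lemma polnB2 a F G H : (poln a (F - G - H)%R <= maxn (maxn (poln a F) (poln a G)) (poln a H))%N.
Proof.
apply: leq_trans (polnD a (F - G) (- H)) _; rewrite geq_max; apply/andP; split.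
  apply: leq_trans (polnD a F (- G)) _; rewrite geq_max !leq_max leqnn /=.
  by rewrite (polnN a G) orbT.
by rewrite !leq_max (polnN a H) orbT.
Qed.

Variable f : M.
Hypothesis htr : forall k : R, good (fun r => k * ln r <= T r f).

Definition errm F := err f (fun r => mm r F).

Lemma errmM F G : errm F -> errm G -> errm (F * G).
Proof. by move=> eF eG; exact: err_le (good_mmM F G) (errD eF eG). Qed.

Lemma errmD F G : errm F -> errm G -> errm (F + G).
Proof. by move=> eF eG; exact: err_le (good_mmD F G) (errD (errD eF eG) (err_cst htr _)). Qed.

Lemma errmN F : errm F -> errm (- F).
Proof.
move=> eF; rewrite -mulN1r; apply: errmM (eF); apply: small_mm.
by rewrite cstmN1; exact: small_cst htr _.
Qed.

Variables (Om phi : M) (k l0 : nat) (l m : 'I_k -> nat).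
Hypotheses (Om0 : Om != 0) (sOm : small f Om) (phi0 : phi != 0) (sphi : small f phi).
Hypotheses (ml : forall i, (m i <= l i)%N).
Local Notation d := (l0 + \sum_(i < k) l i)%N.
Local Notation m' := (\sum_(i < k) m i)%N.
Local Notation P := (pdm f l0 l m).
Local Notation n := (d + m')%N.
Local Notation h := (P / Om - 1).
Hypotheses (n2 : (2 <= n)%N) (hode : derm h = phi * f * h).
Hypothesis e1 : err f (fun r => T r f - Nc r (polb f)).
Hypothesis e2 : err f (fun r => T r f - Nc r (polb f^-1)).

Local Notation A := (ric_A phi l0 l m).
Local Notation B := (ric_B Om phi l0 l m).
Local Notation Cc := (ric_C f Om phi l0 l m).

Let f0 : f != 0 := f_neq0 htr.

Lemma small_A : small f A.
Proof. refine (smallM sphi _); refine (smallV htr (small_nat htr _)). Qed.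

Lemma A_neq0 : A != 0.
Proof.
rewrite mulf_neq0 // -(prednK (ltnW n2)) natmV.
apply/eqP => /(congr1 (fun F : M => F 0)); rewrite !cstm_pt; apply/eqP.
by rewrite invr_eq0 pnatr_eq0.
Qed.

Lemma small_B : small f B.
Proof.
have sd : small f (dlog phi) by exact: small_dlog.
have sg := smallB htr (small_dlog htr sOm) (smallM (small_nat htr n) sd).
have sg' : small f (ric_gam Om phi l0 l m) by refine (smallM (small_cst htr _) sg).
refine (smallD htr _ sd); refine (smallM (small_nat htr 2) sg').
Qed.

(** At a simple pole of [f] where [Om] and [phi] are units, [ric_C] is regular. Otherwise its pole
    order is at most [2 * q] plus those of the coefficients, [q] being the pole order of [f]; for
    [q >= 2] one has [2 * q <= 4 * (q - 1)], and for [q = 1] the excess 2 is charged to [Om] or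
    [phi]. *)
Lemma poln_C a : (poln a Cc <= 4 * (poln a f - (0 < poln a f)) +
  2 * (poln a Om + poln a Om^-1 + poln a phi + poln a phi^-1) + poln a A + poln a B)%N.
Proof.
have b1 := poln_der a f.
have b2 : (poln a (A * f ^+ 2)%R <= poln a A + 2 * poln a f)%N.
  by apply: leq_trans (polnM _ _ _) _; rewrite poln_exp.
have b3 := polnM a B f.
have b4 : (poln a Cc <= maxn (maxn (poln a (derm f)) (poln a (A * f ^+ 2)%R)) (poln a (B * f)%R))%N.
  exact: polnB2.
have [e|ne] := boolP ((poln a f == 1%N) && ((ord a Om == 0) && (ord a phi == 0))).
  case/andP: e => /eqP q1 /andP[/eqP w0 /eqP p0].
  have of1 : ord a f = -1 by have := ord_poln a f; have := poln_or a f; rewrite q1; clear; lia.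
  have /poln0 /eqP -> : vge a 0 Cc by exact: (riccati_at_pole f0 of1 Om0 w0 phi0 p0 ml n2 hode).
  by [].
have wE := ord_poln a Om; have pE := ord_poln a phi.
move: (poln a Cc) (poln a (derm f)) (poln a (A * f ^+ 2)%R) (poln a (B * f)%R) (poln a A) (poln a B)
  (poln a f) (poln a Om) (poln a Om^-1) (poln a phi) (poln a phi^-1) (ord a Om) (ord a phi) b1 b2 b3 b4 ne wE pE.
clear; move=> x1 x2 x3 x4 x5 x6 q w w' p p' ow op b1 b2 b3 b4 ne wE pE.
lia.
Qed.

Lemma err_mm_f : errm f.
Proof.
apply: err_le e1; apply: goodS (good_gt 1) => r r1.
by rewrite /T -addrA lerDl subr_ge0; exact: Nc_polb_le (ltW r1).
Qed.

Lemma small_C : small f Cc.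
Proof.
have mC : errm Cc.
  have -> : Cc = f * dlog f - A * (f * f) - B * f by rewrite /dlog mulrC mulfVK // -expr2.
  have ed : errm (dlog f) by apply: (big_dlog htr); exact: big_f.
  have ef := err_mm_f; have eA : errm A := small_mm small_A; have eB : errm B := small_mm small_B.
  refine (errmD (errmD (errmM ef ed) (errmN (errmM eA (errmM ef ef)))) (errmN (errmM eB ef))).
have eN : err f (fun r => 4 * (Nc r (pol f) - Nc r (polb f)) +
   2 * (Nc r (pol Om) + Nc r (zer Om) + Nc r (pol phi) + Nc r (zer phi)) + Nc r (pol A) + Nc r (pol B)).
  have p1 : err f (fun r => Nc r (pol f) - Nc r (polb f)).
    apply: err_le e1; apply: goodS (good_gt 1) => r _.
    by rewrite lerD2r; exact: Nc_pol_le.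
  have z1 := errD (errD (errD (small_pol sOm) (small_zer htr sOm)) (small_pol sphi)) (small_zer htr sphi).
  have z2 := errD (errZ (ler0n R 4) p1) (errZ (ler0n R 2) z1).
  refine (errD (errD z2 (small_pol small_A)) (small_pol small_B)).
apply: err_le (errD mC eN); apply: goodS (good_gt 1) => r r1; rewrite /T lerD2l.
have lf := locfin_pol f; have lb := locfinZ (-1) (locfin_polb f).
have l1 := locfinD lf lb; have l1' := locfinZ 4 l1.
have l2 := locfinD (locfin_pol Om) (locfin_zer Om).
have l3 := locfinD l2 (locfin_pol phi); have l4 := locfinD l3 (locfin_zer phi).
have l4' := locfinZ 2 l4; have l5 := locfinD l1' l4'; have l6 := locfinD l5 (locfin_pol A).
rewrite -[- Nc r (polb f)]mulN1r -(NcZ _ (-1)) -(NcD _ lf lb) -NcZ.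
rewrite -(NcD _ (locfin_pol Om) (locfin_zer Om)) -(NcD _ l2 (locfin_pol phi)) -(NcD _ l3 (locfin_zer phi)).
rewrite -NcZ -(NcD _ l1' l4') -(NcD _ l5 (locfin_pol A)) -(NcD _ l6 (locfin_pol B)).
apply: (Nc_le (ltW r1) (locfin_pol Cc) (locfinD l6 (locfin_pol B))) => a _.
have := poln_C a; rewrite /pol /zer /polb -(ler_nat R).
by rewrite !(natrD, natrM) natrB ?mulN1r //; case: (poln a f).
Qed.

(** Otherwise [f' / f = A f + B]. The left side has a pole at every zero of [f], the right side
    there only if [A] or [B] has one; this contradicts that almost all of [T] is Nbar(r, 1/f). *)
Lemma C_neq0 : Cc != 0.
Proof.
apply/eqP => C0.
have dE : dlog f = A * f + B.
  apply: (mulIf f0); rewrite /dlog mulfVK //; apply/eqP; rewrite -subr_eq0 -C0 /ric_C; apply/eqP; ring.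
apply: (not_err_T htr).
apply: err_le (errD e2 (errD (small_pol small_A) (small_pol small_B))); apply: goodS (good_gt 1) => r r1.
have : Nc r (polb f^-1) <= Nc r (pol A) + Nc r (pol B).
  rewrite -(NcD _ (locfin_pol A) (locfin_pol B)).
  apply: (Nc_le (ltW r1) (locfin_polb _) (locfinD (locfin_pol A) (locfin_pol B))) => a _.
  rewrite /polb /pol -natrD ler_nat; have [_//|p0] := posnP (poln a f^-1).
  have fE := ord_poln a f; have fo := poln_or a f.
  have pf : poln a f = 0%N by clear -fo p0; lia.
  have of0 : ord a f != 0 by clear -fE p0 pf; lia.
  have [df0 odf] := ord_der f0 of0.
  have : poln a (dlog f) = 1%N by rewrite /poln /dlog ordM ?invr_eq0 // ordV // odf; clear; lia.
  rewrite dE => p1; have := polnD a (A * f) B; rewrite p1 leq_max => /orP[|] pp.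
    by have := polnM a A f; rewrite pf addn0 => /(leq_trans pp) ?; rewrite ltn_addr.
  by rewrite ltn_addl.
move: (T r f) (Nc r (polb f^-1)) (Nc r (pol A) + Nc r (pol B)) => x y z yz.
by rewrite -addrA lerDl addrC subr_ge0.
Qed.

End RiccatiSmall.

(** * The differential monomial as a polynomial in f *)

Section MonomialPolynomial.
Variables (K : fieldType) (d : K -> K).
Hypotheses (dD : forall x y, d (x + y) = d x + d y) (dM : forall x y, d (x * y) = d x * y + x * d y).
Variables (A B C : K) (k l0 : nat) (l m : 'I_k -> nat).

Definition pP : {poly K} := 'X^l0 * \prod_(i < k) iter (m i) (pD d A B C) 'X^(l i).

Lemma pP_top : (size pP <= (l0 + \sum_(i < k) l i + \sum_(i < k) m i).+1)%N /\
  pP`_(l0 + \sum_(i < k) l i + \sum_(i < k) m i)%N =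
    (\prod_(i < k) rf (l i) (m i))%N%:R * A ^+ (\sum_(i < k) m i).
Proof.
have [s1 c1] := top_prod (fun i => (iter_pD_top dM A B C (l i) (m i)).1).
have sX : (size ('X^l0 : {poly K})%R <= l0.+1)%N by rewrite size_polyXn.
have [s2 c2] := top_mul sX s1.
rewrite -addnA -big_split; split; first exact: s2.
rewrite c2 coefXn eqxx mul1r c1 natr_prod expr_sum -big_split /=.
by apply: eq_bigr => i _; rewrite (iter_pD_top dM A B C (l i) (m i)).2.
Qed.

(** The lowest degree is d - m', which is 2 in the boundary case. That gives [Q = pP / Om - 1] the
    constant term -1, no linear term and an explicit [Q_2]. *)
Lemma pP_low : (forall i, (m i <= l i)%N) ->
  (forall i, (i < l0 + \sum_(i < k) (l i - m i))%N -> pP`_i = 0) /\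
  pP`_(l0 + \sum_(i < k) (l i - m i))%N = (\prod_(i < k) (l i) ^_ (m i))%N%:R * C ^+ (\sum_(i < k) m i).
Proof.
move=> ml; have [s1 c1] := low_prod (fun i => (iter_pD_low dM A B C (ml i)).1).
have sX i : (i < l0)%N -> ('X^l0 : {poly K})`_i = 0 by move=> h; rewrite coefXn ltn_eqF.
have [s2 c2] := low_mul sX s1.
split; first exact: s2.
rewrite c2 coefXn eqxx mul1r c1 natr_prod expr_sum -big_split /=.
by apply: eq_bigr => i _; rewrite (iter_pD_low dM A B C (ml i)).2.
Qed.

Lemma pP_eval f : d f = A * f ^+ 2 + B * f + C ->
  pP.[f] = f ^+ l0 * \prod_(i < k) iter (m i) d (f ^+ l i).
Proof.
move=> df; rewrite /pP hornerM hornerXn horner_prod; congr (_ * _).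
by apply: eq_bigr => i _; rewrite (iter_pD_eval dD dM _ _ df) hornerXn.
Qed.

Variable S : K -> Prop.
Hypotheses (SD : forall x y, S x -> S y -> S (x + y)) (SM : forall x y, S x -> S y -> S (x * y)).
Hypotheses (Sconst : forall x, d x = 0 -> S x) (Sder : forall x, S x -> S (d x)).
Hypotheses (SA : S A) (SB : S B) (SC : S C).

Lemma pS_pD p : pS S p -> pS S (pD d A B C p).
Proof.
move=> sp i; rewrite (coef_pD dM).
have sn j : S j%:R by apply: Sconst; exact: der_nat.
apply: SD; first exact: Sder; apply: SD; first apply: SD.
- case: (i != 0%N); first by apply: SM (sp _); exact: SM.
  by apply: Sconst; exact: der0.
- by apply: SM (sp _); exact: SM.
- by apply: SM (sp _); exact: SM.
Qed.

Lemma pS_pP : pS S pP.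
Proof.
have psX : pS S 'X by move=> i; rewrite coefX; apply: Sconst; exact: der_nat.
have psXn n : pS S 'X^n by exact: (pSX dD dM SD SM Sconst).
apply: (pSM dM SD SM Sconst) => //; apply: (big_ind (pS S)).
- by rewrite -(expr0 'X); exact: psXn.
- by move=> p q; exact: (pSM dM SD SM Sconst).
- move=> i _; elim: (m i) => [|j IH]; first exact: psXn.
  by rewrite iterS; exact: pS_pD.
Qed.

End MonomialPolynomial.

(** * Specialisation at a point and the contradiction *)

Section FinalContradiction.
Variable R : realType.
Local Notation C := (CC R).
Local Notation M := (mer R).
Implicit Types (F G H : M) (a : C) (r : R).

Lemma near_vge0 F a : \forall z \near a^', vge z 0 F.
Proof.
have [->|F0] := eqVneq F 0; first by apply: nearW => z; exact: vge0.
by apply: filterS (ord_near0 a F0) => z; exact: ord0_vge.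
Qed.

Lemma near_coefs (p : {poly M}) a : \forall z \near a^', forall i, vge z 0 p`_i.
Proof.
have : \forall z \near a^', forall i, (i < size p)%N -> vge z 0 p`_i.
  elim: (size p) => [|n IH]; first by apply: nearW.
  apply: filterS2 IH (near_vge0 p`_n a) => z h hn i.
  by rewrite ltnS leq_eqVlt => /predU1P[->//|]; exact: h.
apply: filterS => z h i; have [|le] := ltnP i (size p); first exact: h.
by rewrite nth_default //; exact: vge0.
Qed.

Lemma charM i : (i.+1%:R : M) != 0.
Proof.
rewrite -cstm_nat; apply/eqP => /(congr1 (fun F : M => F 0)); rewrite !cstm_pt; apply/eqP.
by rewrite pnatr_eq0.
Qed.

(** Evaluation at [z] respects sums and products only of functions regular at [z], so the identity
    is transferred coefficient by coefficient. *)
Lemma ev_quad_ode (Q : {poly M}) (A b Cc : M) (n : nat) z : (forall i, vge z 0 Q`_i) ->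
  vge z 0 A -> vge z 0 b -> vge z 0 Cc -> Q^`() * quad A b Cc = (n%:R * A) *: 'X * Q ->
  let q : {poly C} := \poly_(i < size Q) Q`_i z in
  (forall i, q`_i = Q`_i z) /\
  q^`() * quad (A z) (b z) (Cc z) = (n%:R * A z) *: 'X * q.
Proof.
move=> vQ vA vb vC ode q.
have qE i : q`_i = Q`_i z.
  rewrite coef_poly; case: ltnP => // le; by rewrite nth_default // cstm_pt.
split=> //; apply/polyP => j; rewrite coef_quad coef_XM !qE.
move: (congr1 (fun p : {poly M} => p`_j z) ode); rewrite coef_quad coef_XM.
have vn i : vge z 0 (i%:R : M) by exact: vge_nat.
have w2 := vge0M (vge0M vb (vn j)) (vQ j); have w3 := vge0M (vge0M vC (vn j.+1)) (vQ j.+1).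
case: j w2 w3 => [|j] w2 w3.
  rewrite !mulr0n (evD (vgeD (vge0 _ _) w2) w3) (evD (vge0 _ _) w2).
  rewrite (evM (vge0M vb (vn 0%N)) (vQ 0%N)) (evM vb (vn 0%N)) (evM (vge0M vC (vn 1%N)) (vQ 1%N)) (evM vC (vn 1%N)).
  by rewrite !ev_nat ?cstm_pt.
have w1 := vge0M (vge0M vA (vn j)) (vQ j); rewrite !mulr1n -[j.+1.-1]/j.
rewrite (evD (vgeD w1 w2) w3) (evD w1 w2) (evM (vge0M vA (vn j)) (vQ j)) (evM vA (vn j)).
rewrite (evM (vge0M vb (vn j.+1)) (vQ j.+1)) (evM vb (vn j.+1)).
rewrite (evM (vge0M vC (vn j.+2)) (vQ j.+2)) (evM vC (vn j.+2)).
by rewrite (evM (vge0M (vn n) vA) (vQ j)) (evM (vn n) vA) !ev_nat.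
Qed.

Lemma rf_ge l m : (l ^_ m <= rf l m)%N.
Proof.
rewrite /rf; elim: m => [|m IH]; first by rewrite big_ord0 ffactn0.
rewrite big_ord_recr ffactnSr /= leq_mul //; exact: leq_trans (leq_subr _ _) (leq_addr _ _).
Qed.

(** The relation gives [|q| |c / a|^(e + 1) = (e + 1) koo / k0], which exceeds 1 because [e > 0] and
    [k0 <= koo]. With [e = m'], this is where [m' > 0] enters. *)
Lemma numeric_contradiction (F : numFieldType) (q a c : F) (e k0 koo : nat) :
  (0 < e)%N -> (0 < k0)%N -> (k0 <= koo)%N -> a != 0 ->
  q * k0%:R * c ^+ e.+1 = - (e.+1%:R * koo%:R * a ^+ e.+1) ->
  `|q| ^+ 2 * `|c / a| ^+ (e.+1 * 2) <= 1 -> False.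
Proof.
move=> e0 k00 kk a0 h; rewrite exprM -exprMn => le1.
suff : 1 < (`|q| * `|c / a| ^+ e.+1) ^+ 2 by move=> /lt_geF; rewrite le1.
have hk : 0 < k0%:R :> F by rewrite ltr0n.
have hE : `|q| * `|c / a| ^+ e.+1 = e.+1%:R * koo%:R / k0%:R.
  apply: (mulIf (lt0r_neq0 hk)); rewrite mulfVK ?lt0r_neq0 //.
  have aa : 0 < `|a| by rewrite normr_gt0.
  have := congr1 Num.norm h; rewrite normrN !normrM !normr_nat !normrX => h'.
  rewrite normrV ?unitfE // expr_div_n; apply: (mulIf (lt0r_neq0 (exprn_gt0 e.+1 aa))).
  rewrite -h'; field; exact: lt0r_neq0 (exprn_gt0 _ aa).
rewrite hE exprn_egt1 // ltr_pdivlMr // mul1r -natrM ltr_nat.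
by apply: (leq_ltn_trans kk); rewrite ltn_Pmull //; exact: leq_trans k00 kk.
Qed.

Variable f : M.
Hypothesis htr : forall k : R, good (fun r => k * ln r <= T r f).
Variables (Om : M) (k l0 : nat) (l m : 'I_k -> nat).
Hypotheses (Om0 : Om != 0) (sOm : small f Om) (ml : forall i, (m i <= l i)%N).
Hypotheses (l00 : (0 < l0)%N) (mls : (\sum_(i < k) m i < \sum_(i < k) l i)%N).
Hypothesis (m0 : (0 < \sum_(i < k) m i)%N).
Local Notation d := (l0 + \sum_(i < k) l i)%N.
Local Notation m' := (\sum_(i < k) m i)%N.
Local Notation P := (pdm f l0 l m).

Theorem pdm_zeros : P != Om -> ~ finite_set [set a | 0 < ord a (P - Om)].
Proof.
move=> PO Efin.
have [dE e1 e2 sphi] := boundary htr Om0 sOm ml l00 mls PO Efin.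
have f0 := f_neq0 htr; have h0 := h_neq0 Om0 PO.
have aa0 := aa_neq0 htr Om0 sOm ml l00 mls PO.
have [phi phE] : exists phi, phi = dlog (P / Om - 1) / f by eexists.
have phi0 : phi != 0 by rewrite phE mulf_neq0 ?invr_eq0.
rewrite -phE in sphi.
have hode : derm (P / Om - 1) = phi * f * (P / Om - 1).
  by rewrite phE (mulfVK f0) /dlog (mulfVK h0).
have nE : (d + m')%N = (m'.+1 * 2)%N by rewrite dE; clear; lia.
have n2 : (2 <= d + m')%N by rewrite nE; clear; lia.
have sA := small_A htr l0 l m sphi; have A0 := A_neq0 phi0 n2.
have sB := small_B htr l0 l m sOm sphi.
have sC := small_C htr Om0 sOm phi0 sphi ml n2 hode e1.
have C0 := C_neq0 htr l0 l m sOm sphi e2.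
have AE : phi = (d + m')%:R * ric_A phi l0 l m.
  by rewrite /ric_A mulrC mulfVK // -(prednK (ltnW n2)) charM.
have df : derm f = ric_A phi l0 l m * f ^+ 2 + ric_B Om phi l0 l m * f + ric_C f Om phi l0 l m.
  by rewrite /ric_C; ring.
move: (ric_A phi l0 l m) (ric_B Om phi l0 l m) (ric_C f Om phi l0 l m) sA A0 sB sC C0 AE df.
move=> A B Cc sA A0 sB sC C0 AE df.
have dD : forall x y : M, derm (x + y) = derm x + derm y := @dermD R.
have dM : forall x y : M, derm (x * y) = derm x * y + x * derm y := @dermM R.
have SD : forall x y, small f x -> small f y -> small f (x + y) by move=> x y; exact: smallD.
have SM : forall x y, small f x -> small f y -> small f (x * y) by move=> x y; exact: smallM.
have Sc : forall x : M, derm x = 0 -> small f x by move=> x /derm0_cst [c ->]; exact: small_cst.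
have tr : forall p : {poly M}, (forall i, small f p`_i) -> p.[f] = 0 -> p = 0 := @transcendence R f htr.
have Sd : forall x, small f x -> small f (derm x) by move=> x; exact: small_der.
have psP := pS_pP dD dM l0 l m SD SM Sc Sd sA sB sC.
have Pf := pP_eval dD dM l0 l m df.
have [szP topP] := pP_top dM A B Cc l0 l m.
have [lowP cP] := pP_low dM A B Cc l0 ml.
have lowE : (l0 + \sum_(i < k) (l i - m i))%N = 2.
  rewrite sumnB //; move: (\sum_(i < k) l i)%N (\sum_(i < k) m i)%N dE mls; clear; move=> x y h1 h2; lia.
rewrite lowE in lowP cP.
have koo_ge : (\prod_(i < k) (l i) ^_ (m i) <= \prod_(i < k) rf (l i) (m i))%N.
  by apply: leq_prod => i _; exact: rf_ge.
have k0_gt : (0 < \prod_(i < k) (l i) ^_ (m i))%N.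
  by rewrite prodn_gt0 // => i; rewrite ffact_gt0.
have psD p : pS (small f) p -> pS (small f) (pD (@derm R) A B Cc p).
  exact: (pS_pD dD dM SD SM Sc Sd sA sB sC).
move: (pP _ A B Cc l0 l m) psP Pf szP topP lowP cP => pP psP Pf szP topP lowP cP.
move: (\prod_(i < k) (l i) ^_ (m i))%N (\prod_(i < k) rf (l i) (m i))%N koo_ge k0_gt topP cP.
move=> k0 koo koo_ge k0_gt topP cP.
have n0 := ltnW n2.
move: (d + m')%N nE n2 n0 AE szP topP => n nE n2 n0 AE szP topP.
pose Q := Om^-1 *: pP - 1%:P.
have Qf : Q.[f] = P / Om - 1 by rewrite /Q hornerD hornerN hornerZ hornerC Pf mulrC.
have psQ : pS (small f) Q.
  move=> i; rewrite coefD coefN coefZ coefC.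
  refine (SD _ _ (SM _ _ (smallV htr sOm) (psP i)) (smallN htr _)).
  by case: ifP => _; [exact: (small1 htr) | exact: (small0 htr)].
have Q0 : Q`_0 = -1 by rewrite coefD coefN coefZ lowP // mulr0 coefC /= add0r.
have Q1 : Q`_1 = 0 by rewrite coefD coefN coefZ lowP // mulr0 coefC /= subr0.
have Q2 : Q`_2 = k0%:R * Cc ^+ m' / Om by rewrite coefD coefN coefZ cP coefC /= subr0 mulrC.
have Qn : Q`_n = koo%:R * A ^+ m' / Om.
  by rewrite coefD coefN coefZ topP coefC /= gtn_eqF ?subr0 1?mulrC //.
(* At [f] both sides equal [h'] by the equation for [phi]; the coefficients are small, so
   transcendence lifts the equality to polynomials. *)
have ode : pD (@derm R) A B Cc Q = (n%:R * A) *: 'X * Q.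
  apply/eqP; rewrite -subr_eq0; apply/eqP; apply: tr.
    move=> i; rewrite coefD coefN coef_XM; refine (SD _ _ (psD _ psQ i) (smallN htr _)).
    case: (i != 0%N); last exact: (small0 htr).
    refine (SM _ _ (SM _ _ (small_nat htr _) sA) (psQ _)).
  rewrite hornerD hornerN (pD_eval dD dM _ df) Qf -scalerAl hornerZ hornerM hornerX Qf hode -AE.
  by rewrite mulrA subrr.
have [b odeb] := riccati_autonomous dD dM charM SD SM Sc tr df A0 C0 n0 psQ ode Q0 Q1.
(* The coefficient of [X] in [odeb] reads [2 C Q_2 = - n A] with [n = 2 (m' + 1)]. Together with the
   explicit [Q_2] and [Q_n] it eliminates [Om]. *)
have rel : Q`_n * k0%:R * Cc ^+ m'.+1 = - (m'.+1%:R * koo%:R * A ^+ m'.+1).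
  move: (congr1 (fun p : {poly M} => p`_1) odeb); rewrite coef_quad coef_XM /= !mulr1n Q1 Q0 Q2.
  rewrite mulr0 mul0r mulr0 !add0r => h.
  have h2 : m'.+1%:R * (A * Om) = - (k0%:R * Cc ^+ m'.+1).
    apply: (mulIf (charM 1)); apply: (mulIf (invr_neq0 Om0)).
    rewrite mulrN1 in h.
    have -> : m'.+1%:R * (A * Om) * 2 / Om = n%:R * A by rewrite nE natrM; field.
    by rewrite -[LHS]opprK -h exprS; field.
  by rewrite Qn -mulrA -[_ * Cc ^+ _]opprK -h2 exprS; field.
(* Near any point, all but that point itself are regular for the finitely many functions involved
   and neither a zero nor a pole of [A] and [Cc]. *)
have [z [vQ vb oA oC]] : exists z, [/\ forall i, vge z 0 Q`_i, vge z 0 b, ord z A = 0 & ord z Cc = 0].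
  have h1 := near_coefs Q 0; have h2 := near_vge0 b 0; have h3 := ord_near0 0 A0; have h4 := ord_near0 0 C0.
  have : \forall z \near 0^', [/\ forall i, vge z 0 Q`_i, vge z 0 b, ord z A = 0 & ord z Cc = 0].
    by apply: filterS2 (filterI h1 h2) (filterI h3 h4) => z [? ?] [? ?]; split.
  by move=> /dnbhs_ex [z hz _]; exists z.
have vA := ord0_vge oA; have vC := ord0_vge oC.
have [qE qode] := ev_quad_ode vQ vA vb vC odeb.
have Az : A z != 0 by exact: ord0_neq0.
have Cz : Cc z != 0 by exact: ord0_neq0.
have relz : Q`_n z * k0%:R * Cc z ^+ m'.+1 = - (m'.+1%:R * koo%:R * A z ^+ m'.+1).
  have vk j : vge z 0 (j%:R : M) by exact: vge_nat.
  have vCX := vge0X m'.+1 vC; have vAX := vge0X m'.+1 vA.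
  move: (congr1 (fun F : M => F z) rel).
  rewrite (evM (vge0M (vQ n) (vk k0)) vCX) (evM (vQ n) (vk k0)) (evX _ vC).
  rewrite (evN (vge0M (vge0M (vk m'.+1) (vk koo)) vAX)) (evM (vge0M (vk m'.+1) (vk koo)) vAX).
  by rewrite (evM (vk m'.+1) (vk koo)) (evX _ vA) !ev_nat.
have qn0 : Q`_n z != 0.
  apply/eqP => h; move: relz; rewrite h !mul0r => /esym/eqP; rewrite oppr_eq0 !mulf_eq0 !pnatr_eq0 /=.
  by rewrite -leqn0 leqNgt (leq_trans k0_gt koo_ge) expf_eq0 (negPf Az) andbF.
have szQ : (size Q <= n.+1)%N.
  apply/leq_sizeP => j hj; rewrite coefD coefN coefZ coefC (nth_default 0 (leq_trans szP hj)) mulr0.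
  by rewrite (gtn_eqF (leq_trans (ltn0Sn _) hj)) subr0.
move: qE qode; set q := \poly_(i < _) _ => qE qode.
have szq : size q = n.+1.
  apply/eqP; rewrite eqn_leq (leq_trans (size_poly _ _) szQ) /= ltnNge; apply/negP => le.
  by move: qn0; rewrite -qE nth_default ?eqxx.
have q0 : `|q`_0| = 1 by rewrite qE Q0 cstmN1 cstm_pt normrN1.
have q1 : q`_1 = 0 by rewrite qE Q1 cstm_pt.
have := @riccati_numeric R[i] q n (A z) (b z) (Cc z) n0 Az Cz szq q0 q1 qode.
by move=> le; apply: (numeric_contradiction m0 k0_gt koo_ge Az relz); rewrite -nE -qE.
Qed.

End FinalContradiction.

(** * Comparison with the analytic definitions *)

Section Bridge.
Variable R : realType.
Local Notation C := (CC R).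
Local Notation M := (mer R).
Implicit Types (f g : C -> C) (F G : M) (a z w : C) (r : R).

Lemma is_poleP f a : is_pole f a <-> forall K : R, \forall z \near a^', K <= modC (f z).
Proof. by rewrite /is_pole; split => [/cvgryPge|h]; [| apply/cvgryPge]. Qed.

Lemma seq_gap (s : seq C) a : exists2 e : R, 0 < e & forall z, z \in s -> z != a -> e <= modC (z - a).
Proof.
elim: s => [|b s [e e0 he]]; first by exists 1.
have [->|ba] := eqVneq b a.
  exists e => // z; rewrite inE => /orP[/eqP ->|]; [by rewrite eqxx | exact: he].
exists (Num.min e (modC (b - a))); first by rewrite lt_min e0 modC_gt0 subr_eq0.
move=> z; rewrite inE ge_min => /orP[/eqP -> _|zs za]; first by rewrite lexx orbT.
by rewrite he.
Qed.

Lemma meromorphic_near f a : meromorphic f -> \forall z \near a^', ~ is_pole f z.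
Proof.
move=> [_ /(_ a)[r r0 /finite_seqP[s sE]]]; have [e e0 he] := seq_gap s a.
apply/dnbhsC; exists (Num.min r e); first by rewrite lt_min r0.
move=> z; rewrite lt_min => /andP[zr ze] za pz.
have zs : z \in s by have : [set` s] z by rewrite -sE.
by have := he z zs za; rewrite leNgt ze.
Qed.

Lemma meromorphic_cder f z : meromorphic f -> ~ is_pole f z -> exists l, cder f z l.
Proof. by move=> [h _] /h /derivable_cder ?; exists (derive1 f z). Qed.

Lemma meromorphic_near_cder f a : meromorphic f -> \forall z \near a^', exists l, cder f z l.
Proof.
by move=> mf; apply: filterS (meromorphic_near a mf) => z; exact: meromorphic_cder.
Qed.

(** At a pole [1 / f] is bounded near the point, so its singularity is removable; inverting its
    local form gives that of [f]. *)
Lemma meromorphic_merom f : meromorphic f -> merom f.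
Proof.
move=> mf; apply: form_merom => a; have near := meromorphic_near_cder a mf.
have [pa|npa] := pselect (is_pole f a); last first.
  exists 0, f; split; last by apply: filterS (near_neq a) => z _; rewrite expr0z mul1r.
  move/dnbhsC: near => [r r0 h]; exists r => // z zr.
  by have [->|za] := eqVneq z a; [exact: meromorphic_cder | exact: h].
have big := (is_poleP f a).1 pa 1.
have [g hg fg] : exists2 g, hol_at g a & \forall z \near a^', (f z)^-1 = g z.
  apply: (@hol_at_removable _ _ _ 1); apply: filterS2 near big => z [l hl] h1.
  have f0 : f z != 0 by rewrite -modC_gt0; exact: lt_le_trans h1.
  split; first by eexists; exact: cderV f0 hl.
  by rewrite modCV invf_le1 //; exact: lt_le_trans h1.
have fm : form (fun z => (f z)^-1) a 0 g by split=> //; apply: filterS fg => z ->; rewrite expr0z mul1r.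
have [z0|[k [g' [fm' g'a]]]] := form_dich fm.
  have [z [h1 h2] _] := dnbhs_ex (filterI z0 big).
  by move: h2; rewrite -[f z]invrK h1 invr0 modC0 ler10.
have [h1 h2] := formV fm' g'a; exists (- k), (fun z => (g' z)^-1); split=> //.
by apply: filterS h2 => z <-; rewrite invrK.
Qed.

Lemma vge0_bounded F a : vge a 0 F <-> exists K : R, \forall z \near a^', modC (F z) <= K.
Proof.
split=> [/vge_cont /ccontP /(_ 1 ltr01) [e e0 he]|[K hK]].
  exists (modC (F a) + 1); apply/dnbhsC; exists e => // z /he h _.
  by have := modC_tri (F z) 0 (F a); rewrite !subr0; lra.
have [|g hg Fg] := @hol_at_removable _ F a K.
  by apply: filterS2 (mer_near_hol F a) hK.
by exists g; split=> //; apply: filterS Fg => z ->; rewrite expr0z mul1r.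
Qed.

Lemma ord_pole F a : ord a F < 0 -> forall K : R, \forall z \near a^', K <= modC (F z).
Proof.
move=> neg K; have F0 : F != 0 by apply: contraTneq neg => ->; rewrite ord0E.
have v1 : vge a 1 F^-1 by apply/(vgeP _ _ (invr_neq0 F0)); rewrite ordV //; move: neg; clear; lia.
have v0 : vge a 0 F^-1 by apply: vgeW v1.
have i0 := (vge1P v0).1 v1.
have K0 : 0 < (`|K| + 1)^-1 by rewrite invr_gt0 ltr_wpDl.
have /ccontP /(_ _ K0) [e e0 he] := vge_cont v0.
have near1 : \forall z \near a^', modC (F^-1 z) < (`|K| + 1)^-1.
  by apply/dnbhsC; exists e => // z /he; rewrite i0 subr0.
apply: filterS2 (filterI (merV F a) (mer_neq0 a F0)) near1 => z [-> Fz].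
rewrite modCV ltf_pV2 ?posrE ?modC_gt0 ?ltr_wpDl // => h.
by apply: le_trans (ler_norm K) _; apply: ltW; apply: le_lt_trans h; rewrite lerDl.
Qed.

Section Normalized.
Variables (f : C -> C) (F : M).
Hypotheses (mf : meromorphic f) (fF : forall a, \forall z \near a^', F z = f z).

Lemma pole_ord a : is_pole f a <-> ord a F < 0.
Proof.
split=> [/is_poleP pa|neg]; last first.
  apply/is_poleP => K; apply: filterS2 (ord_pole neg K) (fF a) => z h <-; exact: h.
rewrite ltNge; apply/negP => ge.
have /vge0_bounded[K hK] : vge a 0 F by apply: vgeW (vge_ord a F).
have [z [[h1 h2] h3] _] := dnbhs_ex (filterI (filterI hK (fF a)) (pa (K + 1))).
by move: h3; rewrite -h2; lra.
Qed.

Lemma nonpole_eq z : ~ is_pole f z -> F z = f z.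
Proof.
move=> np; have [l /cder_cont fc] := meromorphic_cder mf np.
have vF : vge z 0 F.
  apply: vgeW (vge_ord z F); rewrite leNgt; apply/negP => /pole_ord //.
exact: cont_eq_dnbhs (vge_cont vF) fc (fF z).
Qed.

Lemma pole_boundedP a n : pole_bounded f a n <-> vge a (- n%:Z) F.
Proof.
have t0 := tm_neq0 a.
have tn0 : tm a ^+ n != 0 by rewrite expf_neq0.
have E : \forall z \near a^', (tm a ^+ n * F) z = (z - a) ^+ n * f z.
  apply: filterS2 (merM (tm a ^+ n) F a) (fF a) => z -> ->.
  by rewrite evX ?tm_pt //; exact: vge_tm.
have -> : pole_bounded f a n <-> vge a 0 (tm a ^+ n * F).
  rewrite vge0_bounded; split=> -[K hK]; exists K; apply: filterS2 hK E => z h e.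
    by rewrite e.
  by rewrite -e.
have vt : vge a n%:Z (tm a ^+ n).
  by apply/(vgeP _ _ tn0); rewrite ordX // ord_tm natz.
have vt' : vge a (- n%:Z) (tm a ^+ n)^-1.
  by apply/(vgeP _ _ (invr_neq0 tn0)); rewrite ordV // ordX // ord_tm natz lerN2.
split=> h; last by have := vgeM vt h; rewrite subrr.
by have := vgeM vt' h; rewrite addr0 mulKf.
Qed.

Lemma pole_multE a : pole_mult f a = poln a F.
Proof.
rewrite /pole_mult; case: asboolP => [/pole_ord neg|np].
  have F0 : F != 0 by apply: contraTneq neg => ->; rewrite ord0E.
  apply: xget_unique.
    by split=> [|p /pole_boundedP /poln_le //]; apply/pole_boundedP; exact: vge_poln.
  move=> y [/pole_boundedP /poln_le h1 h2].
  by apply/eqP; rewrite eqn_leq h1 andbT; apply: h2; apply/pole_boundedP; exact: vge_poln.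
have ge : 0 <= ord a F by rewrite leNgt; apply/negP => /(pole_ord a).2.
by rewrite /poln min_l.
Qed.

End Normalized.
End Bridge.

(** * Agreement of the two definitions of the characteristic *)

Section CharacteristicE.
Variable R : realType.
Local Notation C := (CC R).
Local Notation M := (mer R).
Local Notation mu := (@lebesgue_measure R).
Implicit Types (a z w : C) (r t x : R).

(** The integrand contributed to [Ncount] by one pole of modulus [x > 0]; its integral over []0, r]]
    is [ln r - ln x], the weight [lw]. *)
Definition cutinv x t : R := if x <= t then t^-1 else 0.

Lemma cutinv_int x r : 0 < x -> x <= r ->
  mu.-integrable `]0, r] (EFin \o cutinv x) /\ Rintegral mu `]0, r] (cutinv x) = ln r - ln x.
Proof.
move=> x0 xr.
have ci : contI x r (fun t : R => t^-1).
  by move=> t /andP[xt _]; apply: inv_continuous; rewrite gt_eqF // (lt_le_trans x0).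
have E : (cutinv x) \_ `]0, r] = (fun t : R => t^-1) \_ `[x, r].
  apply/funext => t; rewrite !patchE /cutinv.
  have -> : (t \in `[x, r]%classic) = (x <= t) && (t <= r) by apply/idP/idP; rewrite inE /= in_itv.
  have -> : (t \in `]0, r]%classic) = (0 < t) && (t <= r) by apply/idP/idP; rewrite inE /= in_itv.
  case: ifP => [/andP[t0 tr]|]; first by rewrite tr andbT.
  case: ifP => // /andP[xt tr]; by rewrite tr (lt_le_trans x0 xt).
split.
  apply/integrable_mkcond => //.
  have -> : (EFin \o cutinv x) \_ `]0, r] = (EFin \o (fun t : R => t^-1)) \_ `[x, r].
    apply/funext => t; move/(congr1 (fun h => (h t)%:E)): E; rewrite !patchE.
    by case: ifP => _; case: ifP.
  by have /integrable_mkcond := contI_integrable ci; apply; exact: measurable_itv.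
rewrite Rintegral_mkcond E -Rintegral_mkcond.
apply: (rint_FTC (U := @ln R)) => // t /andP[xt _].
by apply: is_derive1_ln; exact: lt_le_trans xt.
Qed.

Lemma cutinv_sum r (s : seq C) (c : C -> R) : (forall a, a \in s -> 0 < modC a /\ modC a <= r) ->
  mu.-integrable `]0, r] (EFin \o (fun t => \sum_(a <- s) c a * cutinv (modC a) t)) /\
  Rintegral mu `]0, r] (fun t => \sum_(a <- s) c a * cutinv (modC a) t) =
    \sum_(a <- s) c a * (ln r - ln (modC a)).
Proof.
elim: s => [_|b s IH h].
  have -> : (fun t => \sum_(a <- [::]) c a * cutinv (modC a) t) = cst 0.
    by apply/funext => t; rewrite big_nil.
  rewrite big_nil; split; first exact: integrable0.
  by rewrite Rintegral_cst // mul0r.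
have [i1 v1] := IH (fun a as_ => h a (@mem_behead _ (b :: s) a as_)).
have [b0 br] := h b (mem_head _ _).
have [i2 v2] := cutinv_int b0 br.
have i3 : mu.-integrable `]0, r] (EFin \o (fun t => c b * cutinv (modC b) t)).
  by have := integrableZl _ (c b) i2; apply; exact: measurable_itv.
have -> : (fun t => \sum_(a <- b :: s) c a * cutinv (modC a) t) =
    (fun t => c b * cutinv (modC b) t + \sum_(a <- s) c a * cutinv (modC a) t).
  by apply/funext => t; rewrite big_cons.
rewrite big_cons; split.
  by have := integrableD _ i3 i1; apply; exact: measurable_itv.
by rewrite RintegralD // v1 -v2; congr (_ + _); rewrite RintegralZl.
Qed.

Section Chars.
Variables (f : C -> C) (F : M).
Hypotheses (mf : meromorphic f) (fF : forall a, \forall z \near a^', F z = f z).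

Lemma npolesE r (s : seq C) t : uniq s -> (forall a, modC a <= r -> a \notin s -> poln a F = 0%N) ->
  t <= r -> npoles f t = (\sum_(a <- s | (modC a <= t)%R) poln a F)%N.
Proof.
move=> us hs tr; rewrite /npoles (@fsbig_widen _ _ _ _ _ [set z | modC z <= t]).
- rewrite (@fsbigE _ _ _ _ _ [seq a <- s | modC a <= t]) ?filter_uniq //.
  + rewrite big_filter_cond; apply: eq_big => [a|a _]; last exact: pole_multE.
    by case: (boolP (modC a <= t)) => //= ha; rewrite mem_set.
  + by move=> a /=; rewrite mem_filter => /andP[].
  + move=> a at_; rewrite mem_filter at_ /= => /hs h.
    by rewrite (pole_multE fF) h // (le_trans at_).
- by move=> z [].
- move=> z [/= zt nz]; rewrite (pole_multE fF); apply/eqP/poln0.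
  apply: vgeW (vge_ord z F); rewrite leNgt; apply/negP => h; apply: nz; split=> //.
  by apply/(pole_ord fF).
Qed.

Lemma NcountE r : 1 <= r -> Ncount f r = Nc r (pol F).
Proof.
move=> r1; have r0 : 0 < r by exact: lt_le_trans r1.
have [s [us hs hz]] := locfin2 r (locfin_pol F) (locfin_pol F).
have hp a : modC a <= r -> a \notin s -> poln a F = 0%N.
  by move=> ar /(hz _ ar)[/eqP]; rewrite pnatr_eq0 => /eqP.
rewrite (@NcE _ _ _ s) //; last by move=> a ar /(hz _ ar)[].
have n0 : npoles f 0 = (\sum_(a <- s | (a == 0)%R) poln a F)%N.
  rewrite (npolesE us hp (ltW r0)); apply: eq_bigl => a.
  by rewrite -modC_eq0 eq_le modC_ge0 andbT.
pose s' := [seq a <- s | a != 0].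
have hs' a : a \in s' -> 0 < modC a /\ modC a <= r.
  by rewrite mem_filter modC_gt0 => /andP[a0 /hs].
have [_ val] := cutinv_sum (pol F) hs'.
rewrite /Ncount.
have -> : Rintegral mu `]0, r] (fun t => ((npoles f t)%:R - (npoles f 0)%:R) / t) =
   Rintegral mu `]0, r] (fun t => \sum_(a <- s') pol F a * cutinv (modC a) t).
  apply: eq_Rintegral => t; rewrite inE /= in_itv /= => /andP[t0 tr].
  rewrite (npolesE us hp tr) n0 !natr_sum (bigID (fun a => a == 0)) /=.
  rewrite (eq_bigl (fun a => a == 0)) => [|a]; last first.
    by case: eqP => [->|_]; rewrite ?andbF // modC0 (ltW t0).
  rewrite addrAC subrr add0r /s' big_filter big_mkcondl /= mulr_suml.
  by apply: eq_bigr => a _; rewrite /cutinv /pol; case: ifP => _; rewrite ?mul0r ?mulr0.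
rewrite val /s' big_filter n0 natr_sum mulr_suml addrC [RHS](bigID (fun a => a == 0)) /=.
by congr (_ + _); apply: eq_bigr => a; rewrite /lw /pol; [move=> -> | move=> /negPf ->].
Qed.

Lemma mproxE r : 0 <= r -> reg r F -> mprox f r = mm r F.
Proof.
move=> r0 rF; rewrite /mprox /mm /rmean /rint; congr (_ * _); apply: eq_Rintegral => t _.
have -> : Complex (r * cos t) (r * sin t) = pt r t :> C.
  by apply: Ceq; rewrite /pt ?ReMul ?ImMul /= mul0r ?subr0 ?addr0.
rewrite (nonpole_eq mf fF) // => /(pole_ord fF) neg.
have := rF _ (modC_pt t r0); have F0 : F != 0 by apply: contraTneq neg => ->; rewrite ord0E.
by move=> /(vgeP _ _ F0); rewrite leNgt neg.
Qed.

Lemma TcharE r : 1 <= r -> reg r F -> Tchar f r = T r F.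
Proof. by move=> r1 rF; rewrite /Tchar mproxE ?NcountE //; exact: le_trans r1. Qed.

End Chars.
End CharacteristicE.

(** * Transfer of the hypotheses and conclusion *)

Section Assembly.
Variable R : realType.
Local Notation C := (CC R).
Local Notation M := (mer R).
Implicit Types (a z w : C) (r t x : R).

Lemma rational_of_fprod (f : C -> C) (F : M) s c (e : C -> int) : meromorphic f ->
  (forall a, \forall z \near a^', F z = f z) -> F = cstm c * fprod s e -> rational_fun f.
Proof.
move=> mf fF FE.
(* The additional 1 in both exponents makes [q] vanish at all points of [s], so the quotient formula
   is only claimed off [s], where [fprod_ev] evaluates the product. *)
pose e1 a := (absz (Num.max 0 (e a))).+1; pose e2 a := (absz (Num.min 0 (e a))).+1.
pose p : {poly R[i]} := c *: \prod_(a <- s) ('X - a%:P) ^+ e1 a.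
pose q : {poly R[i]} := \prod_(a <- s) ('X - a%:P) ^+ e2 a.
exists p, q; split.
  by rewrite prodf_seq_neq0; apply/allP => a _ /=; rewrite expf_neq0 // polyXsubC_eq0.
move=> z np qz.
have ev (g : C -> nat) : (\prod_(a <- s) ('X - a%:P) ^+ g a : {poly R[i]}).[z] = \prod_(a <- s) (z - a) ^+ g a.
  by rewrite horner_prod; apply: eq_bigr => a _; rewrite horner_exp hornerXsubC.
rewrite /p hornerZ ev; move: qz; rewrite /q ev => qz.
have zs : z \notin s.
  apply/negP => zs; move: qz; rewrite prodf_seq_neq0 => /allP /(_ z zs) /=.
  by rewrite subrr expr0n eqxx.
rewrite -(nonpole_eq mf fF np) FE; have [fv vf] := fprod_ev e zs.
rewrite (evM (vge_cst _ _) vf) cstm_pt fv -mulrA; congr (_ * _).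
rewrite -prodf_div [LHS]big_seq [RHS]big_seq; apply: eq_bigr => a as_.
have za : z - a != 0 by rewrite subr_eq0; apply: contraNneq zs => ->.
have -> : e a = (e1 a)%:Z - (e2 a)%:Z by rewrite /e1 /e2; clear; lia.
by rewrite expfzDr // -exprnN.
Qed.

(** By [slow_growth], growth below [K * ln r] on an unbounded set of generic radii would make [f]
    rational. *)
Lemma transcendental_growth (f : C -> C) (F : M) : transcendental f ->
  (forall a, \forall z \near a^', F z = f z) -> forall K : R, good (fun r => K * ln r <= T r F).
Proof.
move=> [mf nr] fF K.
have [F0|F0] := eqVneq F 0.
  exfalso; apply: nr; apply: (@rational_of_fprod f F [::] 0 (fun=> 0) mf fF).
  by rewrite F0 mul0r.
have [h|h] := pselect (forall r0, exists r, [/\ r0 < r, gen r F & T r F < K * ln r]).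
  have [s [c FE]] := slow_growth F0 h.
  by exfalso; apply: nr; exact: rational_of_fprod mf fF FE.
have [r0 hr0] : exists r0, forall r, r0 < r -> gen r F -> K * ln r <= T r F.
  move/existsNP: h => [r0 hr0]; exists r0 => r r0r g.
  by rewrite leNgt; apply/negP => lt; apply: hr0; exists r.
by apply: good2 (good_gt r0) (good_gen F0) _ => r; exact: hr0.
Qed.

Lemma small_function_small (f om : C -> C) (F Om : M) : meromorphic f -> small_function om f ->
  (forall a, \forall z \near a^', F z = f z) -> (forall a, \forall z \near a^', Om z = om z) ->
  small F Om.
Proof.
move=> mf [mom [E [mE [fE h]]]] fF omO eps e0.
have g : good (fun r => Tchar om r <= eps * Tchar f r).
  by have [r0 hr0] := h _ e0; exists E; split=> //; exists r0.
apply: good2 (goodI (good_gt 1) g) (goodI (good_reg F) (good_reg Om)) _ => r [/ltW r1 hr] [rF rO].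
by rewrite -(TcharE mom omO r1 rO) -(TcharE mf fF r1 rF).
Qed.

Lemma near_exp (f : C -> C) (F : M) n a : (\forall z \near a^', F z = f z) ->
  \forall z \near a^', (F ^+ n) z = f z ^+ n.
Proof.
move=> h; elim: n => [|n IH]; first by apply: filterS (mer1 a) => z ->.
apply: filterS2 (filterI h IH) (merM F (F ^+ n) a) => z [e1 e2] e3.
by rewrite !exprS e3 e1 e2.
Qed.

Lemma near_derive1n (g : C -> C) (G : M) n : (forall a, \forall z \near a^', G z = g z) ->
  forall a, \forall z \near a^', (iter n (@derm R) G) z = derive1n n g z.
Proof.
move=> h; elim: n => [|n IH] a; first exact: h.
have := dnbhs_dnbhs (IH a) => near2.
apply: filterS2 near2 (mer_near_cder (iter n (@derm R) G) a) => z e1 e2.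
by rewrite iterS derive1nS -(cder_derive1 (cder_near e1 e2)).
Qed.

Lemma near_Pdiff k l0 (l m : 'I_k -> nat) (f : C -> C) (F : M) :
  (forall a, \forall z \near a^', F z = f z) ->
  forall a, \forall z \near a^', pdm F l0 l m z = Pdiff l0 l m f z.
Proof.
move=> h a; rewrite /pdm /Pdiff.
have hp : \forall z \near a^', (\prod_(i < k) iter (m i) (@derm R) (F ^+ l i)) z =
    \prod_(i < k) derive1n (m i) (fun w => f w ^+ l i) z.
  elim: k l m => [|k IH] l m.
    by apply: filterS (mer1 a) => z; rewrite !big_ord0.
  pose G := \prod_(i < k) iter (m (widen_ord (leqnSn k) i)) (@derm R) (F ^+ l (widen_ord (leqnSn k) i)).
  have h1 := IH (fun i => l (widen_ord (leqnSn k) i)) (fun i => m (widen_ord (leqnSn k) i)).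
  have h2 := near_derive1n (m ord_max) (fun a => near_exp (l ord_max) (h a)) a.
  apply: filterS2 (filterI h1 h2) (merM G (iter (m ord_max) (@derm R) (F ^+ l ord_max)) a) => z [e1 e2] e3.
  by rewrite !big_ord_recr e3 e1 e2.
apply: filterS2 (filterI (near_exp l0 (h a)) hp) 
  (merM (F ^+ l0) (\prod_(i < k) iter (m i) (@derm R) (F ^+ l i)) a) => z [e1 e2] ->.
by rewrite e1 e2.
Qed.

(** Membership in [zeros] is a limit condition, so it ignores the value of [g] at the point. In the
    degenerate case [G = 0] every point satisfies it, which disposes of P[f] = omega. *)
Lemma zerosP (g : C -> C) (G : M) : (forall a, \forall z \near a^', G z = g z) ->
  [set a | 0 < ord a G] `<=` zeros g /\ (G = 0 -> zeros g = setT).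
Proof.
move=> h; split=> [a /= oa|G0].
  have v1 : vge a 1 G by apply: vgeW (vge_ord a G); move: oa; clear; lia.
  have v0 : vge a 0 G by apply: vgeW v1.
  have Ga := (vge1P v0).1 v1.
  move=> A /nbhsC[e e0 hA]; have /ccontP /(_ _ e0) [d d0 hd] := vge_cont v0.
  have near1 : \forall z \near a^', modC (G z) < e.
    by apply/dnbhsC; exists d => // z /hd; rewrite Ga subr0.
  have near2 : \forall z \near a^', A (g z).
    by apply: filterS2 near1 (h a) => z lt <-; apply: hA; rewrite subr0.
  exact: near2.
apply/seteqP; split=> // a _ A /nbhs_singleton A0.
have near2 : \forall z \near a^', A (g z) by apply: filterS (h a) => z <-; rewrite G0 cstm_pt.
exact: near2.
Qed.

Lemma C_infinite : ~ finite_set [set: C].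
Proof.
move=> /finite_seqP [s sE]; pose x : R := 1 + \sum_(a <- s) modC a.
have s0 (s' : seq C) : 0 <= \sum_(a <- s') modC a by apply: sumr_ge0 => a _; exact: modC_ge0.
have : toC x \in s by have : [set` s] (toC x) by rewrite -sE.
move=> xs; have : modC (toC x) <= \sum_(a <- s) modC a.
  by rewrite (big_rem _ xs) /= lerDl s0.
rewrite modC_toC ger0_norm /x; last by rewrite addr_ge0.
by rewrite gerDr ler10.
Qed.

End Assembly.

Theorem theorem2p1 (R : realType) (k l0 : nat) (l m : 'I_k -> nat)
    (f omega : CC R -> CC R) :
  (1 <= k)%N -> (0 < l0)%N ->
  (forall i, m i <= l i)%N ->
  (\sum_(i < k) m i < \sum_(i < k) l i)%N ->
  (0 < \sum_(i < k) m i)%N ->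
  transcendental f ->
  small_function omega f ->
  not_ident_zero omega ->
  ~ finite_set (zeros (fun z => Pdiff l0 l m f z - omega z)).
Proof.
move=> _ l00 ml mls m0 tf sf nz fin.
have mf := tf.1; have mom := sf.1.
pose F := mk (meromorphic_merom mf); pose Om := mk (meromorphic_merom mom).
have fF a : \forall z \near a^', F z = f z by exact: mkE.
have omO a : \forall z \near a^', Om z = omega z by exact: mkE.
have htr := transcendental_growth tf fF.
have sOm := small_function_small mf sf fF omO.
have Om0 : Om != 0.
  move: nz => [z [np oz]]; apply: contraNneq oz => Oz.
  by rewrite -(nonpole_eq mom omO np) Oz cstm_pt.
have near a : \forall z \near a^', (pdm F l0 l m - Om) z = Pdiff l0 l m f z - omega z.
  apply: filterS2 (filterI (near_Pdiff l0 l m fF a) (omO a))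
    (filterI (merD (pdm F l0 l m) (- Om) a) (merN Om a)) => z [e1 e2] [-> ->].
  by rewrite e1 e2.
have [sub all] := zerosP near.
have PO : pdm F l0 l m != Om.
  apply/eqP => PO; apply: (@C_infinite R).
  by rewrite -(all _) // PO subrr.
exact: (pdm_zeros htr Om0 sOm ml l00 mls m0 PO) (sub_finite_set sub fin).
Qed.
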